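(* Let $n,m\in\mathbb{N}$ with either $1\le n<m$ or $4\le n=m$. There is no algorithm that, given a finite connected $m$-dimensional simplicial complex $X$, decides whether $H^n_{(\infty)}(X;\mathbb{R})=0$.
   Context: A finite simplicial complex is given as input by its finite vertex set and the list of vertex subsets forming simplices. For a connected space $X$ with fundamental group $G$ and universal cover $\widetilde X$, $H^\bullet_{(\infty)}(X;\mathbb{R})$ is the cohomology of the complex of real singular (equivalently, simplicial/cellular) cochains on $\widetilde X$ that are bounded on orbits: for every simplex $\sigma$, $\{\alpha(g\cdot\sigma):g\in G\}$ is bounded, with $G$ acting by covering transformations; equivalently $H^\bullet(X;\ell^\infty(G,\mathbb{R}))$. *)

(* Defs.v *)
From Stdlib Require Import Reals List Arith Relations.
Import ListNotations.
Open Scope R_scope.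

Inductive Code : Type :=
| CZero : Code
| CSucc : Code
| CProj : nat -> Code
| CComp : Code -> list Code -> Code
| CRec  : Code -> Code -> Code
| CMu   : Code -> Code.

Inductive eval : Code -> list nat -> nat -> Prop :=
| ev_zero : forall args, eval CZero args 0
| ev_succ : forall args, eval CSucc args (S (hd 0%nat args))
| ev_proj : forall i args, eval (CProj i) args (nth i args 0%nat)
| ev_comp : forall f gs args ys y,
    evals gs args ys -> eval f ys y -> eval (CComp f gs) args y
| ev_rec0 : forall f g xs y, eval f xs y -> eval (CRec f g) (0%nat :: xs) y
| ev_recS : forall f g k xs r y,
    eval (CRec f g) (k :: xs) r -> eval g (k :: r :: xs) y ->
    eval (CRec f g) (S k :: xs) y
| ev_mu : forall f xs y,
    eval f (y :: xs) 0%nat ->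
    (forall z, (z < y)%nat -> exists v, v <> 0%nat /\ eval f (z :: xs) v) ->
    eval (CMu f) xs y
with evals : list Code -> list nat -> list nat -> Prop :=
| evs_nil : forall args, evals [] args []
| evs_cons : forall g gs args y ys,
    eval g args y -> evals gs args ys -> evals (g :: gs) args (y :: ys).

Definition cpair (a b : nat) : nat := ((a + b) * S (a + b) / 2 + b)%nat.
Fixpoint code_list (l : list nat) : nat :=
  match l with [] => 0%nat | x :: t => S (cpair x (code_list t)) end.
Fixpoint code_complex (K : list (list nat)) : nat :=
  match K with [] => 0%nat | s :: t => S (cpair (code_list s) (code_complex t)) end.

(* A complex is given by the list of its simplices (vertex subsets, as lists). *)
Definition is_simplex (K : list (list nat)) (s : list nat) : Prop :=
  exists t, In t K /\ (forall v, In v s <-> In v t).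

Definition is_vertex (K : list (list nat)) (v : nat) : Prop := is_simplex K [v].

Definition wf_complex (K : list (list nat)) : Prop :=
  K <> [] /\
  (forall s, In s K -> s <> []) /\
  (forall s t, In s K -> t <> [] -> incl t s -> is_simplex K t).

(* Edge paths (stationary steps allowed), as vertex lists. *)
Fixpoint steps_ok (K : list (list nat)) (u : nat) (l : list nat) : Prop :=
  match l with [] => True | w :: t => is_simplex K [u; w] /\ steps_ok K w t end.

Definition edge_path (K : list (list nat)) (a b : nat) (p : list nat) : Prop :=
  match p with
  | [] => False
  | u :: t => u = a /\ is_vertex K a /\ steps_ok K u t /\ last p a = b
  end.

Definition connected (K : list (list nat)) : Prop :=
  forall a b, is_vertex K a -> is_vertex K b -> exists p, edge_path K a b p.

Definition has_dim (K : list (list nat)) (m : nat) : Prop :=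
  (exists s, is_simplex K s /\ NoDup s /\ length s = S m) /\
  (forall s, is_simplex K s -> NoDup s -> (length s <= S m)%nat).

Inductive htp1 (K : list (list nat)) : list nat -> list nat -> Prop :=
| htp_stutter : forall l1 u l2, htp1 K (l1 ++ u :: l2) (l1 ++ u :: u :: l2)
| htp_tri : forall l1 u v w l2, is_simplex K [u; v; w] ->
    htp1 K (l1 ++ u :: w :: l2) (l1 ++ u :: v :: w :: l2).

Definition htp (K : list (list nat)) : list nat -> list nat -> Prop :=
  clos_refl_sym_trans (list nat) (htp1 K).

(* A vertex of the universal cover over v is a homotopy class of edge paths from
   the base vertex to v; an ordered k-simplex of the cover is a pair (p, s) with s
   an ordered (k+1)-tuple of vertices spanning a simplex of K and p an edge path
   from the base vertex to the first vertex of s (this lifts s uniquely).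
   A k-cochain is represented by a function of (p, s); only its values on such
   pairs matter. *)
Definition base (K : list (list nat)) : nat := hd 0%nat (hd [] K).

Definition ord_simplex (K : list (list nat)) (k : nat) (s : list nat) : Prop :=
  length s = S k /\ is_simplex K s.

Definition lift_ok (K : list (list nat)) (k : nat) (p s : list nat) : Prop :=
  ord_simplex K k s /\ edge_path K (base K) (hd 0%nat s) p.

Definition cochain := list nat -> list nat -> R.

Definition cochain_wd (K : list (list nat)) (k : nat) (a : cochain) : Prop :=
  forall p p' s, lift_ok K k p s -> lift_ok K k p' s -> htp K p p' -> a p s = a p' s.

(* bounded on orbits: the deck group acts transitively on lifts of s *)
Definition cochain_bdd (K : list (list nat)) (k : nat) (a : cochain) : Prop :=
  forall s, ord_simplex K k s ->
    exists M, forall p, lift_ok K k p s -> Rabs (a p s) <= M.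

Definition remove_nth (i : nat) (l : list nat) : list nat := firstn i l ++ skipn (S i) l.

(* coboundary; the 0-th face has first vertex the second vertex of s, reached from
   the end of p along the edge (s_0, s_1) *)
Definition cobdry (a : cochain) : cochain := fun p s =>
  a (p ++ [nth 1 s 0%nat]) (tl s) +
  fold_right Rplus 0
    (map (fun i => (-1) ^ i * a p (remove_nth i s)) (seq 1 (length s - 1))).

Definition bcochain (K : list (list nat)) (k : nat) (a : cochain) : Prop :=
  cochain_wd K k a /\ cochain_bdd K k a.

(* H^n_(infinity)(X; R) = 0, for n >= 1 *)
Definition linf_vanishes (K : list (list nat)) (n : nat) : Prop :=
  forall a, bcochain K n a ->
    (forall p s, lift_ok K (S n) p s -> cobdry a p s = 0) ->
    exists b, bcochain K (n - 1) b /\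
      forall p s, lift_ok K n p s -> cobdry b p s = a p s.

Definition valid_input (m : nat) (K : list (list nat)) : Prop :=
  wf_complex K /\ connected K /\ has_dim K m.

(* Main.v *)
Require Import Defs.
From Stdlib Require Import Reals List Arith.
Import ListNotations.
From Stdlib Require Import Bool Relations Morphisms Sorted Lia Lra ZArith Permutation.
From Stdlib Require Import Classical ClassicalEpsilon FunctionalExtensionality PropExtensionality.

(* A decider [e] is refuted by diagonalisation.  A fixed [Code] [Phi] turns the code [k] of a list of
   simplices into the code of a larger complex, obtained by adding [N = 2 ^ k - 1] stages to that list.
   The computation of [e (Phi k)] is simulated by rules acting affinely on integer registers, and these
   by the relations of a group with letters [X_i] (registers), [T_q] (states), [R_j] (rules), [K]: there
   the relation [K T_acc = T_acc^2 K] and the commutation of [K] with [X_0^N T_0 X_0^-N] make [T_acc]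
   trivial if the rules lead from [(0, N)] to [(acc, 0)].  Otherwise [T_acc] has infinite order, as shown
   by permutations of pairs (configuration or tree of formal preimages, real number).  Additional letters
   kill the whole group as soon as [T_acc = 1], and the letters present with their killing relations
   alone an acyclic complex.  Each remaining relator is set equal to a letter that commutes with everything, which keeps the
   presentation complex [X] free of real cohomology above degree one whether or not the rules halt;
   if they halt, all letters become central, and the group, being perfect, is trivial.  The simplices
   of [X] that depend on [N] come in stages whose vertex numbers are affine in the stage number,
   so that [Phi] can write them down; the rest has a code [k], and [N] is read off from it.

   When [X] is simply connected and acyclic, l^infinity cohomology is ordinary cohomology and
   vanishes.  In the other case a nonzero class is found in each range of [(n, m)]:
   - for [n = 1 < m], in the [m]-skeleton of [X], the word length in an infinite group is an unbounded
     function with bounded coboundary;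
   - for [2 <= n < m], in the [m]-skeleton of [X] times the boundary of an [n]-simplex with one fibre
     filled, the cocycle dual to a single filled fibre of the universal cover is no coboundary, as
     the boundaries of all fibres are homologous;
   - for [4 <= n = m], the 2-skeleton of [X] is thickened along the loop [T_acc] by a tube that
     reverses the orientation of its cross section; on the line covering that loop [1 + t] is not
     onto among bounded functions, [t] being the shift. *)

(** The self-reference needs no recursion theorem: [Phi] depends only on the templates of the
    stages, which are the same for all rule systems, so it is available when the rules simulating
    [e] on its output are made. The number of stages is [2 ^ k - 1] because a register with content
    [k] is encoded in this way; it is the exponent of [X_0] in the initial configuration.

    Killing a fundamental group by many relators usually creates real classes of degree two, whereas
    here the cohomology has to vanish when the rules halt. A new disc is harmless if some real
    assignment of the letters satisfies the earlier relators but not the new one. Commutators never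
    allow this; the central letters repair it, each being the circle factor of a product whose other
    factor is acyclic.

    Fundamental groups are never formed. Labellings of edges by elements of arbitrary groups replace
    them: simple connectedness means that all of them are trivial, and a labelling with a loop of
    infinite order is all that the nonvanishing arguments receive from the other case. *)

Local Open Scope nat_scope.

(** * Register machines *)

(* The automatic induction principle gives no hypothesis for the evaluations hidden under the existential of [ev_mu]. *)
Section EvalInd.
Variable P : Code -> list nat -> nat -> Prop.
Variable Q : list Code -> list nat -> list nat -> Prop.
Hypothesis Hz : forall args, P CZero args 0.
Hypothesis Hs : forall args, P CSucc args (S (hd 0 args)).
Hypothesis Hp : forall i args, P (CProj i) args (nth i args 0).
Hypothesis Hc : forall f gs args ys y,
 Q gs args ys -> P f ys y -> P (CComp f gs) args y.
Hypothesis Hr0 : forall f g xs y, P f xs y -> P (CRec f g) (0 :: xs) y.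
Hypothesis HrS : forall f g k xs r y,
 P (CRec f g) (k :: xs) r -> P g (k :: r :: xs) y -> P (CRec f g) (S k :: xs) y.
Hypothesis Hm : forall f xs y, P f (y :: xs) 0 ->
 (forall z, z < y -> exists v, v <> 0 /\ P f (z :: xs) v) -> P (CMu f) xs y.
Hypothesis Hn : forall args, Q [] args [].
Hypothesis Hcons : forall g gs args y ys,
 P g args y -> Q gs args ys -> Q (g :: gs) args (y :: ys).

Fixpoint eval_nested_ind c args y (H : eval c args y) {struct H} : P c args y :=
 match H in eval c args y return P c args y with
 | ev_zero a => Hz a
 | ev_succ a => Hs a
 | ev_proj i a => Hp i a
 | ev_comp f gs a ys y H1 H2 =>
   Hc f gs a ys y (evals_nested_ind gs a ys H1) (eval_nested_ind f ys y H2)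
 | ev_rec0 f g xs y H1 => Hr0 f g xs y (eval_nested_ind f xs y H1)
 | ev_recS f g k xs r y H1 H2 =>
   HrS f g k xs r y (eval_nested_ind _ _ _ H1) (eval_nested_ind _ _ _ H2)
 | ev_mu f xs y H1 H2 =>
   Hm f xs y (eval_nested_ind _ _ _ H1)
    (fun z l => match H2 z l with
          | ex_intro _ v (conj hv he) =>
            ex_intro _ v (conj hv (eval_nested_ind _ _ _ he))
          end)
 end
with evals_nested_ind gs args ys (H : evals gs args ys) {struct H} : Q gs args ys :=
 match H in evals gs args ys return Q gs args ys with
 | evs_nil a => Hn a
 | evs_cons g gs a y ys H1 H2 =>
   Hcons g gs a y ys (eval_nested_ind _ _ _ H1) (evals_nested_ind _ _ _ H2)
 end.
End EvalInd.

Definition upd {A} (s : nat -> A) (i : nat) (v : A) : nat -> A :=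
 fun j => if j =? i then v else s j.

Lemma upd_eq {A} (s : nat -> A) i v : upd s i v i = v.
Proof. unfold upd; now rewrite Nat.eqb_refl. Qed.
Lemma upd_neq {A} (s : nat -> A) i v j : j <> i -> upd s i v j = s j.
Proof. intros H; unfold upd. destruct (Nat.eqb_spec j i); congruence. Qed.

Ltac ext_upd :=
 apply functional_extensionality; intro; unfold upd;
 repeat match goal with |- context [?a =? ?b] => destruct (Nat.eqb_spec a b) end;
 subst; try lia; try congruence; auto.

Ltac ext_if := apply functional_extensionality; intro; unfold upd;
 repeat match goal with
 | |- context [?a <=? ?b] => destruct (Nat.leb_spec a b)
 | |- context [?a <? ?b] => destruct (Nat.ltb_spec a b)
 | |- context [?a =? ?b] => destruct (Nat.eqb_spec a b) end; cbn [andb]; auto; try lia.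

(** * While programs on registers, and the compilation of codes into them *)

Inductive cmd :=
| Skip | Inc (i : nat) | Dec (i : nat) | Seq (c1 c2 : cmd) | While (i : nat) (c : cmd).

Inductive exec : cmd -> (nat -> nat) -> (nat -> nat) -> Prop :=
| ex_skip s : exec Skip s s
| ex_inc i s : exec (Inc i) s (upd s i (S (s i)))
| ex_dec i s : exec (Dec i) s (upd s i (pred (s i)))
| ex_seq c1 c2 s1 s2 s3 : exec c1 s1 s2 -> exec c2 s2 s3 -> exec (Seq c1 c2) s1 s3
| ex_while0 i c s : s i = 0 -> exec (While i c) s s
| ex_whileS i c s1 s2 s3 : s1 i <> 0 -> exec c s1 s2 -> exec (While i c) s2 s3 ->
  exec (While i c) s1 s3.

Definition Clr r := While r (Dec r).
Definition Mov a b := While a (Seq (Dec a) (Inc b)).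
(** Adds the content of [a] to [b] through the scratch register [t], which must be 0 and is 0 again
    afterwards; it is a copy when [b] is clear. *)
Definition Cpy a b t := Seq (While a (Seq (Dec a) (Seq (Inc b) (Inc t)))) (Mov t a).

Lemma exec_eq c s s1 s2 : exec c s s1 -> s1 = s2 -> exec c s s2.
Proof. congruence. Qed.

Lemma exec_Clr r s : exec (Clr r) s (upd s r 0).
Proof.
remember (s r) as k eqn:E. revert s E. induction k; intros s E.
- eapply exec_eq; [apply ex_while0; auto|]. ext_upd.
- eapply ex_whileS; [lia|apply ex_dec|].
 eapply exec_eq; [apply IHk|].
 + rewrite upd_eq; lia.
 + ext_upd.
Qed.

Lemma exec_Mov a b s : a <> b -> exec (Mov a b) s (upd (upd s b (s a + s b)) a 0).
Proof.
intros N. remember (s a) as k eqn:E. revert s E. induction k; intros s E.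
- eapply exec_eq; [apply ex_while0; auto|]. ext_upd.
- eapply ex_whileS; [lia|eapply ex_seq; [apply ex_dec|apply ex_inc]|].
 eapply exec_eq; [apply IHk|].
 + rewrite upd_neq, upd_eq; lia.
 + rewrite (upd_neq s a _ b), upd_eq by auto. rewrite <- plus_n_Sm. ext_upd.
Qed.

Lemma exec_Cpy a b t s : a <> b -> a <> t -> b <> t -> s t = 0 ->
 exec (Cpy a b t) s (upd s b (s a + s b)).
Proof.
intros N1 N2 N3 H0.
assert (L : forall k s, s a = k ->
 exec (While a (Seq (Dec a) (Seq (Inc b) (Inc t)))) s
  (upd (upd (upd s b (k + s b)) t (k + s t)) a 0)).
{ clear s H0. induction k; intros s E.
 - eapply exec_eq; [apply ex_while0; auto|]. ext_upd.
 - eapply ex_whileS; [lia|eapply ex_seq;[apply ex_dec|eapply ex_seq; apply ex_inc]|].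
  eapply exec_eq; [apply IHk|].
  + rewrite !upd_neq, upd_eq by auto; lia.
  + rewrite !upd_eq.
   rewrite (upd_neq _ t _ b), upd_eq by auto. rewrite (upd_neq _ b _ t) by auto.
   rewrite !(upd_neq _ a) by auto. rewrite <- !plus_n_Sm. ext_upd. }
eapply ex_seq; [apply (L _ _ eq_refl)|].
eapply exec_eq; [apply exec_Mov; auto|].
rewrite upd_eq, upd_neq, upd_eq, H0 by auto. ext_upd.
Qed.

Fixpoint clr_from (f n : nat) : cmd :=
 match n with 0 => Skip | S n => Seq (Clr f) (clr_from (S f) n) end.

Lemma exec_clr_from n : forall f s,
 exec (clr_from f n) s (fun j => if (f <=? j) && (j <? f + n) then 0 else s j).
Proof.
induction n; intros f s; simpl.
- eapply exec_eq; [apply ex_skip|]. ext_if.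
- eapply ex_seq; [apply exec_Clr|]. eapply exec_eq; [apply IHn|].
 ext_if.
Qed.

(* [args] lists the registers holding the arguments, [o] is the output register and
  the registers from [f] on are free. *)
Fixpoint compile (c : Code) (args : list nat) (o f : nat) : cmd :=
 match c with
 | CZero => Skip
 | CSucc => Seq (match args with [] => Skip | a :: _ => Cpy a o f end) (Inc o)
 | CProj i => match nth_error args i with Some a => Cpy a o f | None => Skip end
 | CComp g gs =>
   let F := f + length gs in
   Seq ((fix cl gs k := match gs with
              | [] => Skip
              | g :: gs' => Seq (compile g args k F) (cl gs' (S k))
              end) gs f)
    (Seq (compile g (seq f (length gs)) o F) (clr_from f (length gs)))
 | CRec g h =>
   match args with
   | [] => Skip
   | a :: xs =>
     Seq (Cpy a f (4 + f)) (Seq (compile g xs (2 + f) (4 + f))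
      (Seq (While f (Seq (Dec f) (Seq (compile h ((1 + f) :: (2 + f) :: xs) (3 + f) (4 + f))
        (Seq (Clr (2 + f)) (Seq (Mov (3 + f) (2 + f)) (Inc (1 + f)))))))
       (Seq (Mov (2 + f) o) (Clr (1 + f)))))
   end
 | CMu g =>
   Seq (compile g (f :: args) (1 + f) (2 + f))
    (Seq (While (1 + f) (Seq (Clr (1 + f)) (Seq (Inc f) (compile g (f :: args) (1 + f) (2 + f)))))
     (Mov f o))
 end.

(** The output register starts at 0 because copying adds to it. The registers from [f] on are 0
    before and after a call, so nested calls can reuse them without clean-up. *)
Definition frame_ok (s : nat -> nat) (args : list nat) (o f : nat) (vals : list nat) : Prop :=
 (forall a, In a args -> a < f) /\ o < f /\ ~ In o args /\ s o = 0 /\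
 (forall r, f <= r -> s r = 0) /\ map s args = vals.

Ltac below H1 := let a := fresh in let H := fresh in
 try intros a H; try intros H; simpl in H; repeat (destruct H as [H|H]; [lia|]); specialize (H1 _ H); lia.
Ltac zero H5 := intros; rewrite ?upd_neq by lia; apply H5; lia.
Ltac frame H1 H5 := repeat split; [below H1|lia|below H1|zero H5|zero H5|].

Lemma map_upd_notin (s : nat -> nat) args i v : ~ In i args -> map (upd s i v) args = map s args.
Proof.
intros H. apply map_ext_in. intros a Ha. apply upd_neq. congruence.
Qed.

Definition runs (c : Code) (vals : list nat) (y : nat) : Prop :=
 forall args o f s, frame_ok s args o f vals -> exec (compile c args o f) s (upd s o y).

Definition rec_body (h : Code) (xs : list nat) (f : nat) : cmd :=
 Seq (Dec f) (Seq (compile h ((1 + f) :: (2 + f) :: xs) (3 + f) (4 + f))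
        (Seq (Clr (2 + f)) (Seq (Mov (3 + f) (2 + f)) (Inc (1 + f))))).

(* Running [k] rounds of the loop is phrased through its continuation, so that the
  induction on the evaluation of a recursion can peel off the last round. *)
Definition rec_loop_ok (c : Code) (vals : list nat) (y : nat) : Prop :=
 forall g h k xs, c = CRec g h -> vals = k :: xs ->
 forall args f s m s', (forall a, In a args -> a < f) -> (forall r, f <= r -> s r = 0) ->
  map s args = xs ->
  exec (While f (rec_body h args f)) (upd (upd (upd s f m) (1 + f) k) (2 + f) y) s' ->
  exec (Seq (compile g args (2 + f) (4 + f)) (While f (rec_body h args f))) (upd s f (k + m)) s'.

Lemma rec_loop_compile g h k xs y : rec_loop_ok (CRec g h) (k :: xs) y ->
 runs (CRec g h) (k :: xs) y.
Proof.
intros IH args o f s (H1 & H2 & H3 & H4 & H5 & H6).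
destruct args as [|a args]; [easy|]. simpl in H6. injection H6 as Ha H6.
assert (a < f) by (apply H1; left; auto).
cbn [compile].
eapply ex_seq; [apply exec_Cpy; try lia; apply H5; lia|].
rewrite Ha, (H5 f) by lia.
pose proof (IH g h k xs eq_refl eq_refl args f s 0) as R.
eassert (R' : exec _ _ _).
{ eapply R; auto.
 - intros b Hb; apply H1; right; auto.
 - apply ex_while0. unfold upd.
  replace (f =? 2 + f) with false by (symmetry; apply Nat.eqb_neq; lia).
  replace (f =? 1 + f) with false by (symmetry; apply Nat.eqb_neq; lia).
  now rewrite Nat.eqb_refl. }
inversion R'; subst.
eapply ex_seq; [eassumption|]. eapply ex_seq; [eassumption|].
eapply ex_seq; [apply exec_Mov; lia|].
eapply exec_eq; [apply exec_Clr|].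
pose proof (H5 (2 + f)). pose proof (H5 (1 + f)). pose proof (H5 f).
rewrite upd_eq. rewrite (upd_neq _ (2 + f) _ o), (upd_neq _ (1 + f) _ o), (upd_neq _ f _ o) by lia.
rewrite H4. rewrite Nat.add_0_r. ext_upd; symmetry; auto with arith.
Qed.

(** For a list of codes the invariant says that the values end up in consecutive registers from [k]
    on, everything else being unchanged. For a recursion the statement about the loop is carried
    along, since a derivation for [S k] contains one for [k] but nothing about the rounds of the
    loop. *)
Lemma compile_correct_aux c vals y : eval c vals y -> runs c vals y /\ rec_loop_ok c vals y.
Proof.
revert c vals y.
apply (eval_nested_ind (fun c vals y => runs c vals y /\ rec_loop_ok c vals y)
 (fun gs vals ys => length gs = length ys /\
   forall args F s, (forall a, In a args -> a < F) -> map s args = vals ->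
   forall k, (forall a, In a args -> a < k) -> k + length gs <= F ->
   (forall r, k <= r -> s r = 0) ->
   exec ((fix cl gs k := match gs with
             | [] => Skip
             | g :: gs' => Seq (compile g args k F) (cl gs' (S k))
             end) gs k) s
    (fun j => if (k <=? j) && (j <? k + length gs) then nth (j - k) ys 0 else s j))).
- intros vals; split; [|intros ? ? ? ?; easy].
 intros args o f s (H1 & H2 & H3 & H4 & H5 & H6). simpl.
 eapply exec_eq; [apply ex_skip|]. ext_upd.
- intros vals; split; [|intros ? ? ? ?; easy].
 intros args o f s (H1 & H2 & H3 & H4 & H5 & H6). simpl.
 destruct args as [|a args].
 + simpl in H6; subst vals. simpl.
  eapply ex_seq; [apply ex_skip|]. eapply exec_eq; [apply ex_inc|]. rewrite H4; auto.
 + simpl in H6; subst vals. simpl.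
  assert (a < f) by (apply H1; left; auto).
  eapply ex_seq; [apply exec_Cpy; try lia|].
  * intro; subst; apply H3; left; auto.
  * auto.
  * eapply exec_eq; [apply ex_inc|]. rewrite upd_eq, H4, Nat.add_0_r. ext_upd.
- intros i vals; split; [|intros ? ? ? ?; easy].
 intros args o f s (H1 & H2 & H3 & H4 & H5 & H6). simpl.
 destruct (nth_error args i) as [a|] eqn:E.
 + assert (Ha : In a args) by (eapply nth_error_In; eauto).
  assert (a < f) by auto.
  eapply exec_eq; [apply exec_Cpy; try lia; auto|].
  * congruence.
  * rewrite H4, Nat.add_0_r. f_equal. subst vals.
   symmetry; apply nth_error_nth. rewrite nth_error_map, E. auto.
 + eapply exec_eq; [apply ex_skip|]. subst vals.
  rewrite nth_overflow; [ext_upd|]. rewrite length_map. apply nth_error_None; auto.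
- intros g gs vals ys y (Hl & IH1) (IH2 & _); split; [|intros ? ? ? ?; easy].
 intros args o f s (H1 & H2 & H3 & H4 & H5 & H6). simpl.
 eapply ex_seq.
 { apply IH1; auto. intros a Ha; specialize (H1 a Ha); lia. }
 eapply ex_seq.
 { apply IH2. repeat split.
  - intros a Ha. apply in_seq in Ha. lia.
  - lia.
  - rewrite in_seq. lia.
  - destruct (Nat.leb_spec f o); simpl; auto. lia.
  - intros r Hr. destruct (Nat.leb_spec f r), (Nat.ltb_spec r (f + length gs)); simpl; auto; try lia;
    apply H5; lia.
  - apply nth_ext with (d := 0) (d' := 0).
   + rewrite length_map, length_seq; auto.
   + rewrite length_map, length_seq. intros n Hn.
    match goal with |- nth n (map ?h _) 0 = _ =>
     rewrite nth_indep with (d' := h 0) by (rewrite length_map, length_seq; auto);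
     rewrite (map_nth h) end.
    rewrite seq_nth by auto.
    destruct (Nat.leb_spec f (f + n)), (Nat.ltb_spec (f + n) (f + length gs)); simpl; try lia.
    f_equal; lia. }
 eapply exec_eq; [apply exec_clr_from|].
 ext_if. symmetry; auto.
- intros g h xs y (IH & _).
 assert (L : rec_loop_ok (CRec g h) (0 :: xs) y).
 { intros g' h' k' xs' E E' args f s m s' H1 H5 H6 HW. injection E as <- <-. injection E' as <- <-.
  eapply ex_seq.
  { apply IH. frame H1 H5. rewrite map_upd_notin; auto. below H1. }
  match goal with H : exec _ ?a ?b |- exec _ ?a' ?b => replace a' with a; auto end.
  pose proof (H5 (1 + f)). ext_upd. }
 split; auto. apply rec_loop_compile; auto.
- intros g h k xs r y (_ & IH1) (IH2 & _).
 assert (L : rec_loop_ok (CRec g h) (S k :: xs) y).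
 { intros g' h' k' xs' E E' args f s m s' H1 H5 H6 HW. injection E as <- <-. injection E' as <- <-.
  replace (S k + m) with (k + S m) by lia.
  apply (IH1 g h k xs eq_refl eq_refl); auto.
  eapply ex_whileS with (s2 := upd (upd (upd s f m) (1 + f) (S k)) (2 + f) y); auto.
  { rewrite !upd_neq, upd_eq by lia. lia. }
  eapply ex_seq; [apply ex_dec|]. eapply ex_seq.
  { apply IH2. frame H1 H5. simpl map. rewrite upd_neq, upd_neq, upd_eq by lia.
   rewrite upd_neq, upd_eq by lia. rewrite !map_upd_notin; [congruence| | | |]; below H1. }
  eapply ex_seq; [apply exec_Clr|]. eapply ex_seq; [apply exec_Mov; lia|].
  eapply exec_eq; [apply ex_inc|].
  pose proof (H5 (3 + f)).
  ext_upd; try (symmetry; apply H5; lia). }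
 split; auto. apply rec_loop_compile; auto.
- intros g xs y (IH1 & _) IH2; split; [|intros ? ? ? ?; easy].
 intros args o f s (H1 & H2 & H3 & H4 & H5 & H6). cbn [compile].
 assert (G : forall z v, runs g (z :: xs) v ->
    exec (compile g (f :: args) (1 + f) (2 + f)) (upd s f z) (upd (upd s f z) (1 + f) v)).
 { intros z v HC. apply HC. frame H1 H5. simpl. rewrite upd_eq, map_upd_notin; [congruence|below H1]. }
 assert (E0 : upd s f 0 = s) by (pose proof (H5 f (le_n f)); ext_upd).
 assert (Hn : forall z, z <= y -> exists v, (v = 0 <-> z = y) /\ runs g (z :: xs) v).
 { intros z Hz. destruct (Nat.eq_dec z y) as [->|]; [exists 0; tauto|].
  destruct (IH2 z) as (v & hv & hC & _); [lia|]. exists v. split; auto; lia. }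
 assert (Loop : forall j z v, z + j = y -> runs g (z :: xs) v -> (v = 0 <-> z = y) ->
  exec (While (1 + f) (Seq (Clr (1 + f)) (Seq (Inc f) (compile g (f :: args) (1 + f) (2 + f)))))
   (upd (upd s f z) (1 + f) v) (upd s f y)).
 { induction j; intros z v Ej HC Hv.
  - eapply exec_eq; [apply ex_while0; rewrite upd_eq; lia|].
   assert (z = y) by lia. assert (v = 0) by lia. subst. pose proof (H5 (1 + f)). ext_upd.
  - destruct (Hn (S z) ltac:(lia)) as (v' & Hv' & HC').
   eapply ex_whileS; [rewrite upd_eq; lia| |apply (IHj (S z) v'); auto; lia].
   eapply ex_seq; [apply exec_Clr|]. eapply ex_seq; [apply ex_inc|].
   rewrite !(upd_neq _ _ _ f) by lia. rewrite upd_eq.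
   match goal with |- exec _ ?a _ => replace a with (upd s f (S z)) end; auto.
   pose proof (H5 (1 + f)). ext_upd. }
 destruct (Hn 0 ltac:(lia)) as (v' & Hv' & HC').
 eapply ex_seq; [rewrite <- E0 at 1; apply (G 0 v'); auto|].
 eapply ex_seq; [apply (Loop y 0 v'); auto|]. eapply exec_eq; [apply exec_Mov; lia|].
 rewrite upd_eq, upd_neq, H4, Nat.add_0_r by lia. pose proof (H5 f (le_n f)). ext_upd.
- intros vals; split; auto. intros args F s _ _ k _ _ _. eapply exec_eq; [apply ex_skip|]. simpl. ext_if.
- intros g gs vals y ys (IH1 & _) (Hl & IH2). split; [simpl; auto|].
 intros args F s H1 H2 k H3 H4 H5. simpl in H4.
 eapply ex_seq.
 { apply IH1. repeat split; auto; try lia.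
  - intro Hb; specialize (H3 _ Hb); lia.
  - intros r Hr; apply H5; lia. }
 eapply exec_eq; [apply IH2|]; auto.
 + rewrite map_upd_notin; auto. intro Hb; specialize (H3 _ Hb); lia.
 + intros a Ha; specialize (H3 a Ha); lia.
 + lia.
 + intros r Hr. rewrite upd_neq by lia. apply H5; lia.
 + cbn [length]. ext_if; [replace (x - k) with (S (x - S k)) by lia|subst; rewrite Nat.sub_diag]; auto.
Qed.

Lemma compile_correct c vals y args o f s : eval c vals y -> frame_ok s args o f vals ->
 exec (compile c args o f) s (upd s o y).
Proof. intros H. apply (compile_correct_aux _ _ _ H). Qed.

(** * Flat programs, and affine rules on integer vectors *)

Inductive instr := IInc (i : nat) | IDec (i : nat) | ITest (i z : nat) | IJmp (z : nat).

Inductive fstep (P : list instr) : nat * (nat -> nat) -> nat * (nat -> nat) -> Prop :=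
| fs_inc pc s i : nth_error P pc = Some (IInc i) -> fstep P (pc, s) (S pc, upd s i (S (s i)))
| fs_dec pc s i : nth_error P pc = Some (IDec i) -> fstep P (pc, s) (S pc, upd s i (pred (s i)))
| fs_test0 pc s i z : nth_error P pc = Some (ITest i z) -> s i = 0 -> fstep P (pc, s) (z, s)
| fs_testS pc s i z : nth_error P pc = Some (ITest i z) -> s i <> 0 -> fstep P (pc, s) (S pc, s)
| fs_jmp pc s z : nth_error P pc = Some (IJmp z) -> fstep P (pc, s) (z, s).

Fixpoint flen (c : cmd) : nat :=
 match c with
 | Skip => 0 | Inc _ | Dec _ => 1
 | Seq c1 c2 => flen c1 + flen c2
 | While _ c => 2 + flen c
 end.

Fixpoint flat (c : cmd) (pc : nat) : list instr :=
 match c with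
 | Skip => []
 | Inc i => [IInc i]
 | Dec i => [IDec i]
 | Seq c1 c2 => flat c1 pc ++ flat c2 (pc + flen c1)
 | While i c => ITest i (pc + 2 + flen c) :: flat c (S pc) ++ [IJmp pc]
 end.

Lemma length_flat c : forall pc, length (flat c pc) = flen c.
Proof.
induction c; intros pc; simpl; auto.
- rewrite length_app. auto.
- rewrite length_app, IHc. simpl. lia.
Qed.

Lemma flat_correct P c s s' : exec c s s' -> forall l1 l2, P = l1 ++ flat c (length l1) ++ l2 ->
 clos_refl_trans _ (fstep P) (length l1, s) (length l1 + flen c, s').
Proof.
assert (Nth : forall l1 l2 (x : instr), nth_error (l1 ++ x :: l2) (length l1) = Some x).
{ intros l1 l2 x. rewrite nth_error_app2, Nat.sub_diag; auto. }
induction 1; intros l1 l2 E; simpl in *.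
- rewrite Nat.add_0_r. apply rt_refl.
- rewrite Nat.add_1_r. apply rt_step, fs_inc. subst. apply Nth.
- rewrite Nat.add_1_r. apply rt_step, fs_dec. subst. apply Nth.
- eapply rt_trans.
 + apply (IHexec1 l1 (flat c2 (length l1 + flen c1) ++ l2)). rewrite E, <- app_assoc. auto.
 + specialize (IHexec2 (l1 ++ flat c1 (length l1)) l2).
  rewrite length_app, length_flat in IHexec2. rewrite Nat.add_assoc. apply IHexec2.
  rewrite E, <- !app_assoc. auto.
- apply rt_step. replace (length l1 + S (S (flen c))) with (length l1 + 2 + flen c) by lia.
 eapply fs_test0; eauto. rewrite E. apply Nth.
- eapply rt_trans; [apply rt_step; eapply fs_testS; eauto; rewrite E; apply Nth|].
 eapply rt_trans.
 { specialize (IHexec1 (l1 ++ [ITest i (length l1 + 2 + flen c)]) (IJmp (length l1) :: l2)).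
  rewrite length_app in IHexec1. simpl in IHexec1. rewrite Nat.add_1_r in IHexec1.
  apply IHexec1. rewrite E, <- !app_assoc. simpl. auto. }
 eapply rt_trans; [apply rt_step; eapply fs_jmp with (z := length l1)|apply (IHexec2 l1 l2); auto].
 specialize (Nth (l1 ++ ITest i (length l1 + 2 + flen c) :: flat c (S (length l1))) l2 (IJmp (length l1))).
 rewrite length_app in Nth. simpl in Nth. rewrite length_flat in Nth.
 replace (S (length l1) + flen c) with (length l1 + S (flen c)) by lia. rewrite <- Nth, E.
 f_equal. rewrite <- app_assoc. simpl. rewrite <- app_assoc. auto.
Qed.

(* The rule rewrites the configuration [(r_src, v)] with [v r_reg = r_m u + r_a] to
  [(r_dst, v')] where [v' r_reg = r_p u + r_c], for every integer [u]. *)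
Record rule := { r_src : nat; r_reg : nat; r_m : nat; r_a : nat; r_dst : nat; r_p : nat; r_c : nat }.

Definition config : Type := nat * (nat -> Z).

Definition applies (r : rule) (x y : config) : Prop :=
 fst x = r_src r /\ fst y = r_dst r /\
 exists u : Z, (snd x (r_reg r) = Z.of_nat (r_m r) * u + Z.of_nat (r_a r) /\
  snd y = upd (snd x) (r_reg r) (Z.of_nat (r_p r) * u + Z.of_nat (r_c r)))%Z.

Definition zstep (R : list rule) (x y : config) : Prop := exists r, In r R /\ applies r x y.

(** With [x = 2^r - 1], adding 1 to [r] is [x -> 2 x + 1]; a positive [r] gives an odd
    [x = 2 u + 1], whose predecessor is encoded by [u], and [r = 0] is the only even case. A jump is
    an identity rule on register 0, with modulus 1 so that it always applies. *)
Definition rules_of_instr (pc : nat) (x : instr) : list rule :=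
 match x with
 | IInc i => [Build_rule pc i 1 0 (S pc) 2 1]
 | IDec i => [Build_rule pc i 2 1 (S pc) 1 0; Build_rule pc i 2 0 (S pc) 2 0]
 | ITest i z => [Build_rule pc i 2 1 (S pc) 2 1; Build_rule pc i 2 0 z 2 0]
 | IJmp z => [Build_rule pc 0 1 0 z 1 0]
 end.

Fixpoint rules_of (P : list instr) (pc : nat) : list rule :=
 match P with [] => [] | x :: P => rules_of_instr pc x ++ rules_of P (S pc) end.

Lemma in_rules_of P r : forall pc, In r (rules_of P pc) <->
 exists k x, nth_error P k = Some x /\ In r (rules_of_instr (pc + k) x).
Proof.
induction P as [|x P IH]; intros pc; simpl.
- split; [tauto|]. intros (k & x & H & _). destruct k; easy.
- rewrite in_app_iff, IH. split.
 + intros [H|(k & y & H1 & H2)].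
  * exists 0, x. rewrite Nat.add_0_r. auto.
  * exists (S k), y. rewrite <- plus_n_Sm. auto.
 + intros ([|k] & y & H1 & H2).
  * injection H1 as <-. rewrite Nat.add_0_r in H2. auto.
  * right. exists k, y. rewrite <- plus_n_Sm in H2. auto.
Qed.

(* The register content [r] is encoded as [2^r - 1], so that parity tests for zero. *)
Definition enc_reg (s : nat -> nat) : nat -> Z := fun i => (2 ^ Z.of_nat (s i) - 1)%Z.

Lemma enc_reg_upd s i k : enc_reg (upd s i k) = upd (enc_reg s) i (2 ^ Z.of_nat k - 1)%Z.
Proof.
apply functional_extensionality; intro j. unfold enc_reg, upd. destruct (j =? i); auto.
Qed.

Lemma pow2_S k : (2 ^ Z.of_nat (S k) = 2 * 2 ^ Z.of_nat k)%Z.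
Proof. rewrite Nat2Z.inj_succ, Z.pow_succ_r; lia. Qed.

Lemma upd_same {A} (s : nat -> A) i v : v = s i -> upd s i v = s.
Proof. intros ->. ext_upd. Qed.

Lemma fstep_zstep P x y : fstep P x y ->
 zstep (rules_of P 0) (fst x, enc_reg (snd x)) (fst y, enc_reg (snd y)).
Proof.
intros H.
assert (I : forall pc ins r, nth_error P pc = Some ins -> In r (rules_of_instr pc ins) ->
 In r (rules_of P 0)) by (intros pc ins r H1 H2; apply in_rules_of; exists pc, ins; auto).
destruct H as [pc s i E|pc s i E|pc s i z E E0|pc s i z E E0|pc s z E]; simpl;
 specialize (fun r => I pc _ r E).
- eexists; split; [apply I; left; reflexivity|]. split; [|split]; auto.
 exists (enc_reg s i). cbn -[Z.mul Z.add Z.pow Z.of_nat]. split; [lia|].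
 rewrite enc_reg_upd, pow2_S. f_equal. unfold enc_reg. lia.
- assert (Es : enc_reg s i = (2 ^ Z.of_nat (s i) - 1)%Z) by reflexivity.
 destruct (s i) as [|k] eqn:Ei.
 + eexists; split; [apply I; right; left; reflexivity|]. split; [|split]; auto.
  exists 0%Z. cbn -[Z.mul Z.add Z.pow Z.of_nat enc_reg]. rewrite Es. split; auto.
  rewrite enc_reg_upd. auto.
 + eexists; split; [apply I; left; reflexivity|]. split; [|split]; auto.
  exists (2 ^ Z.of_nat k - 1)%Z. cbn -[Z.mul Z.add Z.pow Z.of_nat enc_reg]. rewrite Es, pow2_S.
  split; [lia|]. rewrite enc_reg_upd. f_equal. lia.
- assert (Es : enc_reg s i = (2 ^ Z.of_nat (s i) - 1)%Z) by reflexivity. rewrite E0 in Es.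
 eexists; split; [apply I; right; left; reflexivity|]. split; [|split]; auto.
 exists 0%Z. cbn -[Z.mul Z.add Z.pow Z.of_nat enc_reg]. split; [rewrite Es; auto|].
 rewrite upd_same; auto.
- assert (Es : enc_reg s i = (2 ^ Z.of_nat (s i) - 1)%Z) by reflexivity.
 eexists; split; [apply I; left; reflexivity|]. split; [|split]; auto.
 destruct (s i) as [|k] eqn:Ei; [lia|]. rewrite pow2_S in Es.
 exists (2 ^ Z.of_nat k - 1)%Z. cbn -[Z.mul Z.add Z.pow Z.of_nat enc_reg].
 split; [lia|]. rewrite upd_same; auto. lia.
- eexists; split; [apply I; left; reflexivity|]. split; [|split]; auto.
 exists (enc_reg s 0). cbn -[Z.mul Z.add Z.pow Z.of_nat enc_reg]. split; [lia|].
 rewrite upd_same; auto. lia.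
Qed.

Definition deterministic (R : list rule) : Prop :=
 forall r r' x y y', In r R -> In r' R -> applies r x y -> applies r' x y' -> r = r' /\ y = y'.

Lemma applies_det r x y y' : 0 < r_m r -> applies r x y -> applies r x y' -> y = y'.
Proof.
destruct x, y, y'. intros Hm (E1 & E2 & u & E3 & E4) (E1' & E2' & u' & E3' & E4'). simpl in *.
assert (u = u') by (apply (Z.mul_reg_l _ _ (Z.of_nat (r_m r))); lia). subst. auto.
Qed.

(** Two rules of one instruction have modulus 2 and different residues. So determinism holds for all
    integer vectors, also for those that encode no register contents, which do occur in the group
    model. *)
Lemma rules_of_deterministic P : deterministic (rules_of P 0).
Proof.
intros r r' x y y' Hr Hr' A A'.
enough (r = r').
{ subst r'. split; auto. eapply applies_det; eauto.
 apply in_rules_of in Hr. destruct Hr as (k & ins & _ & Hr).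
 destruct ins; simpl in Hr; repeat destruct Hr as [<-|Hr]; simpl; try lia; destruct Hr. }
apply in_rules_of in Hr, Hr'. destruct Hr as (k & ins & E & Hr), Hr' as (k' & ins' & E' & Hr').
destruct A as (A1 & _ & u & A2 & _), A' as (A1' & _ & u' & A2' & _).
assert (S1 : forall pc ins r, In r (rules_of_instr pc ins) -> r_src r = pc).
{ intros pc i0 r0 H0. destruct i0; simpl in H0; repeat destruct H0 as [<-|H0]; simpl; auto; destruct H0. }
apply S1 in Hr as Hk. apply S1 in Hr' as Hk'.
assert (k = k') by (simpl in *; congruence). subst k'. assert (ins' = ins) by congruence. subst ins'.
destruct ins; simpl in Hr, Hr'; repeat destruct Hr as [<-|Hr]; repeat destruct Hr' as [<-|Hr'];
 cbn -[Z.mul Z.add Z.of_nat] in *; auto; try tauto; lia.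
Qed.

Definition rule_wf (d : nat) (r : rule) : Prop :=
 0 < r_m r /\ r_a r < r_m r /\ 0 < r_p r /\ r_c r < r_p r /\ r_reg r < d.

Lemma terminal_rt {A} (S : A -> A -> Prop) x y :
 (forall z, ~ S x z) -> clos_refl_trans A S x y -> y = x.
Proof.
intros T H. apply clos_rt_rt1n in H. destruct H; auto. destruct (T _ H).
Qed.

Lemma det_terminal {A} (S : A -> A -> Prop) x y z :
 (forall a b c, S a b -> S a c -> b = c) -> (forall w, ~ S z w) -> (forall w, ~ S y w) ->
 clos_refl_trans A S x y -> clos_refl_trans A S x z -> y = z.
Proof.
intros D Tz Ty H. apply clos_rt_rt1n in H. induction H as [x|x x' y H1 H2 IH]; intros Hz.
- symmetry. eapply terminal_rt; eauto.
- apply clos_rt_rt1n in Hz. destruct Hz as [|x'' z H3 H4]; [destruct (Tz _ H1)|].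
 apply IH; auto. rewrite (D _ _ _ H1 H3). apply clos_rt1n_rt; auto.
Qed.

Definition start (k : nat) : config := (0, upd (fun _ => 0%Z) 0 (2 ^ Z.of_nat k - 1)%Z).

(** The compiled program clears its input register and then tests the output register 1. The value 0
    leads to [acc] with all registers 0; the value 1 leads to another state without rules, and
    determinism then excludes a run to [acc]. *)
Theorem affine_system (g : Code) : exists (R : list rule) (d acc : nat),
 1 <= d /\ (forall r, In r R -> rule_wf d r /\ r_src r <> acc) /\ deterministic R /\
 (forall k, eval g [k] 0 -> clos_refl_trans _ (zstep R) (start k) (acc, fun _ => 0%Z)) /\
 (forall k, eval g [k] 1 -> ~ clos_refl_trans _ (zstep R) (start k) (acc, fun _ => 0%Z)).
Proof.
set (c := Seq (compile g [0] 1 2) (Clr 0)).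
set (P := flat c 0 ++ [ITest 1 (flen c + 2)]).
set (R := rules_of P 0).
assert (Len : length P = flen c + 1) by (unfold P; rewrite length_app, length_flat; auto).
assert (Term : forall q v, flen c + 1 <= q -> forall y, ~ zstep R (q, v) y).
{ intros q v Hq y (r & Hr & E & _). apply in_rules_of in Hr. destruct Hr as (k & ins & H1 & H2).
 assert (k < length P) by (apply nth_error_Some; congruence).
 assert (r_src r = k) by (destruct ins; simpl in H2; repeat destruct H2 as [<-|H2]; simpl; auto; destruct H2).
 simpl in E. lia. }
assert (Run : forall k y, eval g [k] y ->
 clos_refl_trans _ (zstep R) (start k) (flen c, enc_reg (upd (fun _ => 0) 1 y))).
{ intros k y H.
 assert (X : exec c (upd (fun _ => 0) 0 k) (upd (fun _ => 0) 1 y)).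
 { eapply ex_seq.
  - eapply compile_correct; eauto. repeat split; auto.
   + intros a [<-|[]]. lia.
   + simpl. lia.
   + intros r Hr. rewrite upd_neq; auto; lia.
  - eapply exec_eq; [apply exec_Clr|]. ext_upd. }
 apply (flat_correct P) with (l1 := []) (l2 := [ITest 1 (flen c + 2)]) in X; auto.
 simpl in X.
 assert (St : start k = (0, enc_reg (upd (fun _ => 0) 0 k))).
 { unfold start. f_equal. rewrite enc_reg_upd. auto. }
 rewrite St.
 assert (G : forall x y, clos_refl_trans _ (fstep P) x y ->
  clos_refl_trans _ (zstep R) (fst x, enc_reg (snd x)) (fst y, enc_reg (snd y))).
 { induction 1; [apply rt_step, fstep_zstep; auto|apply rt_refl|eapply rt_trans; eauto]. }
 apply (G _ _ X). }
assert (Tst : forall s, exists y, nth_error P (flen c) = Some (ITest 1 (flen c + 2)) /\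
  fstep P (flen c, s) y /\ y = (if s 1 =? 0 then flen c + 2 else S (flen c), s)).
{ intros s. assert (E : nth_error P (flen c) = Some (ITest 1 (flen c + 2))).
 { unfold P. rewrite nth_error_app2, length_flat, Nat.sub_diag; auto. rewrite length_flat; auto. }
 destruct (Nat.eqb_spec (s 1) 0); eexists; split; auto; split; auto.
 - eapply fs_test0; eauto.
 - eapply fs_testS; eauto. }
exists R, (S (list_max (map r_reg R))), (flen c + 2).
split; [lia|]. split; [|split; [|split]].
- intros r Hr. split.
 + assert (r_reg r <= list_max (map r_reg R)).
  { pose proof (proj1 (list_max_le (map r_reg R) _) (le_n _)) as F.
   rewrite Forall_forall in F. apply F, in_map; auto. }
  unfold rule_wf. apply in_rules_of in Hr. destruct Hr as (k & ins & _ & Hr).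
  destruct ins; simpl in Hr; repeat destruct Hr as [<-|Hr]; simpl in *; repeat split; try lia; destruct Hr.
 + intros E. apply in_rules_of in Hr. destruct Hr as (k & ins & H1 & H2).
  assert (k < length P) by (apply nth_error_Some; congruence).
  assert (r_src r = k) by (destruct ins; simpl in H2; repeat destruct H2 as [<-|H2]; simpl; auto; destruct H2).
  lia.
- apply rules_of_deterministic.
- intros k H. eapply rt_trans; [apply (Run _ _ H)|].
 destruct (Tst (upd (fun _ => 0) 1 0)) as (y & _ & F & Ey). apply fstep_zstep in F. subst y.
 apply rt_step. simpl in F. replace (fun _ : nat => 0%Z) with (enc_reg (upd (fun _ => 0) 1 0)); auto.
 rewrite enc_reg_upd. apply functional_extensionality; intro j. unfold upd, enc_reg.
 destruct (j =? 1); auto.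
- intros k H Hacc.
 assert (Hrej : clos_refl_trans _ (zstep R) (start k) (S (flen c), enc_reg (upd (fun _ => 0) 1 1))).
 { eapply rt_trans; [apply (Run _ _ H)|].
  destruct (Tst (upd (fun _ => 0) 1 1)) as (y & _ & F & Ey). apply fstep_zstep in F. subst y.
  apply rt_step. auto. }
 assert (E : (S (flen c), enc_reg (upd (fun _ => 0) 1 1)) = (flen c + 2, fun _ => 0%Z)).
 { eapply (det_terminal (zstep R)); [| | |exact Hrej|exact Hacc].
  - intros x y y' (r & Hr & A) (r' & Hr' & A').
   exact (proj2 (rules_of_deterministic P _ _ _ _ _ Hr Hr' A A')).
  - apply Term. lia.
  - apply Term. lia. }
 injection E. lia.
Qed.

(** * Groups *)

Notation em := excluded_middle_informative.
Record group := Group {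
 gcar :> Type; gop : gcar -> gcar -> gcar; gone : gcar; ginv : gcar -> gcar;
 gassoc : forall x y z, gop (gop x y) z = gop x (gop y z);
 gone_l : forall x, gop gone x = x;
 ginv_l : forall x, gop (ginv x) x = gone }.
Arguments gop {g}. Arguments gone {g}. Arguments ginv {g}.

Declare Scope grp_scope.
Delimit Scope grp_scope with grp.
Infix "**" := gop (at level 40, left associativity) : grp_scope.
Notation "1" := gone : grp_scope.
Notation "x ^-1" := (ginv x) (at level 3, left associativity, format "x ^-1") : grp_scope.
Local Open Scope grp_scope.

Section GroupTheory.
Context {G : group}.
Implicit Types x y z : G.
Lemma ginv_r x : x ** x^-1 = 1.
Proof.
rewrite <- (gone_l _ (x ** x^-1)), <- (ginv_l _ x^-1), gassoc, <- (gassoc _ x^-1 x).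
rewrite ginv_l, gone_l. reflexivity.
Qed.
Lemma gone_r x : x ** 1 = x.
Proof. rewrite <- (ginv_l _ x), <- gassoc, ginv_r. apply gone_l. Qed.
Lemma gcancel_l x y z : x ** y = x ** z -> y = z.
Proof.
intros H. rewrite <- (gone_l _ y), <- (gone_l _ z), <- (ginv_l _ x), !gassoc, H. auto.
Qed.
Lemma gcancel_r x y z : y ** x = z ** x -> y = z.
Proof.
intros H. rewrite <- (gone_r y), <- (gone_r z), <- (ginv_r x), <- !gassoc, H. auto.
Qed.
Lemma ginv_unique x y : x ** y = 1 -> y = x^-1.
Proof. intros H. apply (gcancel_l x). rewrite H, ginv_r. auto. Qed.
Lemma ginvK x : x^-1^-1 = x.
Proof. symmetry; apply ginv_unique, ginv_l. Qed.
Lemma ginv1 : (1 : G)^-1 = 1.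
Proof. symmetry; apply ginv_unique, gone_l. Qed.
Lemma ginvM x y : (x ** y)^-1 = y^-1 ** x^-1.
Proof.
symmetry; apply ginv_unique. rewrite gassoc, <- (gassoc _ y), ginv_r, gone_l. apply ginv_r.
Qed.
Lemma gmulKl x y : x^-1 ** (x ** y) = y.
Proof. rewrite <- gassoc, ginv_l, gone_l. auto. Qed.
Lemma gmulKr x y : x ** (x^-1 ** y) = y.
Proof. rewrite <- gassoc, ginv_r, gone_l. auto. Qed.
Lemma geq_of_div x y : x ** y^-1 = 1 -> x = y.
Proof. intros H. apply (gcancel_r y^-1). rewrite H, ginv_r. auto. Qed.
End GroupTheory.

Ltac gsimp :=
 repeat rewrite ?gassoc, ?gone_l, ?gone_r, ?ginv_l, ?ginv_r, ?ginvM, ?ginvK, ?ginv1,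
  ?gmulKl, ?gmulKr.
Ltac gsimp_in H :=
 repeat rewrite ?gassoc, ?gone_l, ?gone_r, ?ginv_l, ?ginv_r, ?ginvM, ?ginvK, ?ginv1,
  ?gmulKl, ?gmulKr in H.

Definition hom {G H : group} (f : G -> H) : Prop := forall x y, f (x ** y) = f x ** f y.

Section Hom.
Context {G H : group} (f : G -> H) (Hf : hom f).
Lemma hom1 : f 1 = 1.
Proof. apply (gcancel_l (f 1)). rewrite <- Hf, gone_l, gone_r. auto. Qed.
Lemma homV x : f x^-1 = (f x)^-1.
Proof. apply ginv_unique. rewrite <- Hf, ginv_r, hom1. auto. Qed.
Lemma hom_inj : (forall x, f x = 1 -> x = 1) -> forall x y, f x = f y -> x = y.
Proof.
intros K x y E. apply geq_of_div, K. rewrite Hf, homV, E, ginv_r. auto.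
Qed.
End Hom.

Lemma hom_comp {G H K : group} (f : G -> H) (g : H -> K) : hom f -> hom g -> hom (fun x => g (f x)).
Proof. intros Hf Hg x y. rewrite Hf, Hg. auto. Qed.

Definition gpow {G : group} (x : G) (n : nat) : G := Nat.iter n (gop x) 1.
Definition zpow {G : group} (x : G) (n : Z) : G :=
 if Z.leb 0 n then gpow x (Z.to_nat n) else gpow x^-1 (Z.to_nat (- n)).

Lemma zpow_succ {G : group} (x : G) n : zpow x (Z.succ n) = x ** zpow x n.
Proof.
unfold zpow. destruct (Z.leb_spec 0 n).
- replace (0 <=? Z.succ n)%Z with true by (symmetry; apply Z.leb_le; lia).
 rewrite Z2Nat.inj_succ by lia. reflexivity.
- replace (Z.to_nat (- n)) with (S (Z.to_nat (- Z.succ n))) by lia. simpl.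
 rewrite gmulKr. destruct (Z.leb_spec 0 (Z.succ n)); auto.
 replace n with (-1)%Z by lia. reflexivity.
Qed.
Lemma zpow_0 {G : group} (x : G) : zpow x 0 = 1.
Proof. reflexivity. Qed.
Lemma zpow_1 {G : group} (x : G) : zpow x 1 = x.
Proof. apply gone_r. Qed.
Lemma zpow_add {G : group} (x : G) m n : zpow x (m + n) = zpow x m ** zpow x n.
Proof.
revert m. apply Z.bi_induction.
- intros a b ->; tauto.
- rewrite zpow_0, gone_l. auto.
- intros m. replace (Z.succ m + n)%Z with (Z.succ (m + n)) by lia. rewrite !zpow_succ, gassoc.
 split; [intros ->; auto|apply gcancel_l].
Qed.
Lemma zpow_opp {G : group} (x : G) n : zpow x (- n) = (zpow x n)^-1.
Proof. apply ginv_unique. rewrite <- zpow_add, Z.add_opp_diag_r. auto. Qed.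
Lemma zpow_nat {G : group} (x : G) n : zpow x (Z.of_nat n) = gpow x n.
Proof.
unfold zpow. replace (0 <=? Z.of_nat n)%Z with true by (symmetry; apply Z.leb_le; lia).
rewrite Nat2Z.id. auto.
Qed.
Lemma zpow_hom {G H : group} (f : G -> H) (Hf : hom f) x n : f (zpow x n) = zpow (f x) n.
Proof.
revert n. apply Z.bi_induction.
- intros a b ->; tauto.
- apply (hom1 f Hf).
- intros n. rewrite !zpow_succ, Hf. split; [intros ->; auto|apply gcancel_l].
Qed.
Lemma zpow_mul {G : group} (x : G) m n : zpow x (m * n) = zpow (zpow x m) n.
Proof.
revert n. apply Z.bi_induction.
- intros a b ->; tauto.
- rewrite Z.mul_0_r. auto.
- intros n. replace (m * Z.succ n)%Z with (m + m * n)%Z by lia. rewrite zpow_add, zpow_succ.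
 split; [intros ->; auto|apply gcancel_l].
Qed.
Lemma zpow_conj {G : group} (u a b : G) n : u ** a = b ** u -> u ** zpow a n = zpow b n ** u.
Proof.
intros E. revert n. apply Z.bi_induction.
- intros m n ->; tauto.
- rewrite !zpow_0, gone_l, gone_r. auto.
- intros n. rewrite !zpow_succ. split; intros H.
 + rewrite <- gassoc, E, !gassoc, H. auto.
 + apply (gcancel_l b). rewrite <- gassoc, <- E, gassoc, H, gassoc. auto.
Qed.

(** * Permutation groups, products and subgroups *)

Section Perm.
Variable A : Type.
Record perm := Perm { pf : A -> A; pg : A -> A; pfg : forall x, pf (pg x) = x; pgf : forall x, pg (pf x) = x }.
Lemma perm_ext (p q : perm) : (forall x, pf p x = pf q x) -> p = q.
Proof.
destruct p as [f g H1 H2], q as [f' g' H1' H2']; simpl. intros E.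
assert (f = f') by (apply functional_extensionality; auto). subst f'.
assert (g = g') by (apply functional_extensionality; intro x; rewrite <- (H1' x), H2, H1'; auto).
subst g'. f_equal; apply proof_irrelevance.
Qed.
Definition perm_op (p q : perm) : perm.
Proof.
refine (Perm (fun x => pf p (pf q x)) (fun x => pg q (pg p x)) _ _);
 intro x; rewrite ?pfg, ?pgf, ?pfg, ?pgf; auto.
Defined.
Definition perm_one : perm := Perm (fun x => x) (fun x => x) (fun _ => eq_refl) (fun _ => eq_refl).
Definition perm_inv (p : perm) : perm := Perm (pg p) (pf p) (pgf p) (pfg p).
Definition Sym : group.
Proof.
refine (Group perm perm_op perm_one perm_inv _ _ _); intros; apply perm_ext; intro; simpl; auto.
apply pgf.
Defined.
End Perm.
Arguments pf {A}. Arguments pg {A}. Arguments Perm {A}.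

Definition prodG (G H : group) : group.
Proof.
refine (Group (G * H) (fun x y => (fst x ** fst y, snd x ** snd y)) (1, 1)
     (fun x => ((fst x)^-1, (snd x)^-1)) _ _ _).
- intros x y z; simpl. rewrite !gassoc. auto.
- intros [x y]; simpl. rewrite !gone_l. auto.
- intros [x y]; simpl. rewrite !ginv_l. auto.
Defined.

Definition ZG : group := Group Z Z.add 0%Z Z.opp (fun x y z => eq_sym (Z.add_assoc x y z)) Z.add_0_l Z.add_opp_diag_l.

Definition trivG : group.
Proof. refine (Group unit (fun _ _ => tt) tt (fun _ => tt) _ _ _); auto. intros []; auto. Defined.

Section Subgroup.
Variables (G : group) (P : G -> Prop).
Hypotheses (P1 : P 1) (PM : forall x y, P x -> P y -> P (x ** y)) (PV : forall x, P x -> P x^-1).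
Lemma sub_ext (x y : {g : G | P g}) : proj1_sig x = proj1_sig y -> x = y.
Proof. destruct x, y; simpl; intros ->. f_equal. apply proof_irrelevance. Qed.
Definition subG : group.
Proof.
refine (Group {g : G | P g}
 (fun x y => exist P (proj1_sig x ** proj1_sig y) (PM _ _ (proj2_sig x) (proj2_sig y)))
 (exist P 1 P1) (fun x => exist P (proj1_sig x)^-1 (PV _ (proj2_sig x))) _ _ _);
 intros; apply sub_ext; simpl.
- apply gassoc.
- apply gone_l.
- apply ginv_l.
Defined.
End Subgroup.

(** * Amalgamated products *)

Section Amalgam.
Variables (C : group) (H : bool -> group) (io : forall b, C -> H b).
Hypotheses (io_hom : forall b, hom (io b)) (io_inj : forall b c, io b c = 1 -> c = 1).

Definition inC b (h : H b) : Prop := exists c, h = io b c.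
Definition coset b (h h' : H b) : Prop := exists c, h = io b c ** h'.

Lemma io1 b : io b 1 = 1.
Proof. apply hom1, io_hom. Qed.
Lemma io_eq b c c' : io b c = io b c' -> c = c'.
Proof. apply hom_inj; [apply io_hom|apply io_inj]. Qed.

Lemma coset_refl b h : coset b h h.
Proof. exists 1. rewrite io1, gone_l. auto. Qed.
Lemma coset_shift b c (h h' : H b) : coset b (io b c ** h) h' <-> coset b h h'.
Proof.
split; intros [d E].
- exists (c^-1 ** d). rewrite io_hom, gassoc, <- E, (homV _ (io_hom b)), gmulKl. auto.
- exists (c ** d). rewrite io_hom, gassoc, <- E. auto.
Qed.

(* The element of [C] represents its own coset by [1]; other representatives are chosen. *)
Definition rep b (h : H b) : H b :=
 if em (inC b h) then 1 else epsilon (inhabits h) (coset b h).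

Lemma rep_coset b h : coset b h (rep b h).
Proof.
unfold rep. destruct (em _) as [[c ->]|N].
- exists c. rewrite gone_r. auto.
- apply epsilon_spec. exists h. apply coset_refl.
Qed.
Lemma inC_shift b c h : inC b (io b c ** h) <-> inC b h.
Proof.
split; intros [d E].
- exists (c^-1 ** d). rewrite io_hom, <- E, (homV _ (io_hom b)), gmulKl. auto.
- exists (c ** d). rewrite io_hom, <- E. auto.
Qed.
Lemma rep_shift b c h : rep b (io b c ** h) = rep b h.
Proof.
unfold rep. destruct (em _) as [I|N], (em _) as [I'|N'];
 auto; try (apply inC_shift in I; tauto); try (apply (inC_shift b c) in I'; tauto).
replace (coset b (io b c ** h)) with (coset b h).
- f_equal. apply proof_irrelevance.
- apply functional_extensionality; intro h'. apply propositional_extensionality.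
 symmetry; apply coset_shift.
Qed.
Lemma rep_1 b h : rep b h = 1 <-> inC b h.
Proof.
split.
- intros E. destruct (rep_coset b h) as [c Hc]. exists c. rewrite Hc, E, gone_r. auto.
- intros I. unfold rep. destruct (em _); tauto.
Qed.
Lemma rep_rep b h : rep b (rep b h) = rep b h.
Proof.
destruct (rep_coset b h) as [c Hc]. rewrite Hc at 2. rewrite rep_shift. auto.
Qed.
Definition cpart b (h : H b) : C := epsilon (inhabits 1) (fun c => h = io b c ** rep b h).
Lemma cpart_spec b h : h = io b (cpart b h) ** rep b h.
Proof. apply (epsilon_spec (inhabits 1) (fun c => h = io b c ** rep b h)), rep_coset. Qed.
Lemma cpart_unique b h c : h = io b c ** rep b h -> cpart b h = c.
Proof.
intros E. apply (io_eq b), (gcancel_r (rep b h)). rewrite <- E. symmetry; apply cpart_spec.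
Qed.
Lemma cpart_shift b c h : cpart b (io b c ** h) = c ** cpart b h.
Proof. apply cpart_unique. rewrite rep_shift, io_hom, gassoc, <- cpart_spec. auto. Qed.

Definition letters := list {b : bool & H b}.
Definition starts_off b (s : letters) : Prop := match s with [] => True | x :: _ => projT1 x <> b end.
Fixpoint valid (s : letters) : Prop :=
 match s with
 | [] => True
 | existT _ b r :: s => rep b r = r /\ ~ inC b r /\ starts_off b s /\ valid s
 end.

(* van der Waerden's set of normal forms [c r_1 ... r_k] *)
Definition nf := {x : C * letters | valid (snd x)}.

(** Rewrites a normal form as an element of [H b] followed by a normal form not starting in [H b].
    [join] is the inverse, and [H b] acts by left multiplication in between. *)
Definition split b (x : C * letters) : H b * letters :=
 match snd x with
 | existT _ b' r :: s =>
   match bool_dec b' b with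
   | left E => (io b (fst x) ** eq_rect b' (fun b => gcar (H b)) r b E, s)
   | right _ => (io b (fst x), snd x)
   end
 | [] => (io b (fst x), [])
 end.
Definition join b (y : H b * letters) : C * letters :=
 if em (inC b (fst y)) then (cpart b (fst y), snd y)
 else (cpart b (fst y), existT _ b (rep b (fst y)) :: snd y).

Lemma split_off b x : starts_off b (snd x) -> split b x = (io b (fst x), snd x).
Proof.
destruct x as [c [|[b' r] s]]; simpl; auto. intros N. unfold split; simpl.
destruct (bool_dec b' b); congruence.
Qed.
Lemma split_on b c r s : split b (c, existT _ b r :: s) = (io b c ** r, s).
Proof.
unfold split; simpl. destruct (bool_dec b b) as [E|N]; [|congruence].
rewrite (proof_irrelevance _ E eq_refl). auto.
Qed.

Lemma split_valid b x : valid (snd x) -> starts_off b (snd (split b x)) /\ valid (snd (split b x)).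
Proof.
destruct x as [c [|[b' r] s]]; [simpl; auto|]. intros V.
destruct (bool_dec b' b) as [<-|N].
- rewrite split_on. destruct V as (_ & _ & V2 & V3). auto.
- rewrite split_off; auto.
Qed.
Lemma join_valid b y : starts_off b (snd y) -> valid (snd y) -> valid (snd (join b y)).
Proof.
intros O V. unfold join. destruct (em _) as [I|I]; simpl; auto.
repeat split; auto; [apply rep_rep|]. intros I'. apply I, rep_1. rewrite <- rep_rep. apply rep_1; auto.
Qed.
Lemma join_split b x : valid (snd x) -> join b (split b x) = x.
Proof.
destruct x as [c [|[b' r] s]]; intros V; [|destruct (bool_dec b' b) as [<-|N]].
- rewrite split_off by (simpl; auto). unfold join; simpl.
 destruct (em _) as [I|I]; [|destruct I; exists c; auto].
 f_equal. apply cpart_unique. rewrite (proj2 (rep_1 b _) I), gone_r. auto.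
- rewrite split_on. destruct V as (V1 & V2 & _). unfold join; cbn [fst snd].
 rewrite rep_shift, V1, cpart_shift.
 destruct (em _) as [I|I]; [apply inC_shift in I; tauto|].
 f_equal. rewrite (cpart_unique b' r 1); [apply gone_r|]. rewrite io1, gone_l; auto.
- rewrite split_off by (simpl; auto). unfold join; simpl.
 destruct (em _) as [I|I]; [|destruct I; exists c; auto].
 f_equal. apply cpart_unique. rewrite (proj2 (rep_1 b _) I), gone_r. auto.
Qed.
Lemma split_join b y : starts_off b (snd y) -> split b (join b y) = y.
Proof.
destruct y as [h s]; simpl; intros O. unfold join; cbn [fst snd].
destruct (em _) as [I|I].
- rewrite split_off by auto. simpl. f_equal. rewrite (cpart_spec b h) at 2.
 rewrite (proj2 (rep_1 b h) I), gone_r. auto.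
- rewrite split_on, <- cpart_spec. auto.
Qed.

Definition act b (h : H b) (x : C * letters) : C * letters :=
 join b (h ** fst (split b x), snd (split b x)).

Lemma act_valid b h x : valid (snd x) -> valid (snd (act b h x)).
Proof. intros V. apply (split_valid b) in V as []. apply join_valid; auto. Qed.
Lemma act_act b h h' x : valid (snd x) -> act b h (act b h' x) = act b (h ** h') x.
Proof.
intros V. apply (split_valid b) in V as []. unfold act. rewrite split_join by auto.
simpl. rewrite gassoc. auto.
Qed.
Lemma act_1 b x : valid (snd x) -> act b 1 x = x.
Proof.
intros V. unfold act. rewrite gone_l, <- surjective_pairing. apply join_split; auto.
Qed.
Lemma act_C b c x : valid (snd x) -> act b (io b c) x = (c ** fst x, snd x).
Proof.
intros V. rewrite <- (join_split b x) at 2 3 by auto. unfold act, join; cbn [fst snd].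
rewrite rep_shift, cpart_shift.
destruct (em _) as [I|I], (em _) as [I'|I']; auto.
- apply inC_shift in I; tauto.
- apply (inC_shift b c) in I'; tauto.
Qed.

Lemma nf_ext (x y : nf) : proj1_sig x = proj1_sig y -> x = y.
Proof. destruct x, y; simpl; intros ->. f_equal. apply proof_irrelevance. Qed.

Definition act_nf b h (x : nf) : nf := exist _ (act b h (proj1_sig x)) (act_valid b h _ (proj2_sig x)).

(** All permutations of the normal forms, not only the subgroup generated by the factors: what is
    used is that the factors embed, agree on [C], and have no nonempty alternating product equal to
    1. *)
Definition amalgam : group := Sym nf.
Definition inj b (h : H b) : amalgam.
Proof.
refine (Perm (act_nf b h) (act_nf b h^-1) _ _); intros [x V]; apply nf_ext; simpl;
 rewrite act_act by auto.
- rewrite ginv_r. apply act_1; auto.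
- rewrite ginv_l. apply act_1; auto.
Defined.

Lemma inj_hom b : hom (inj b).
Proof. intros h h'. apply perm_ext. intros [x V]. apply nf_ext. simpl. symmetry; apply act_act; auto. Qed.
Lemma inj_agree b b' c : inj b (io b c) = inj b' (io b' c).
Proof. apply perm_ext. intros [x V]. apply nf_ext. simpl. rewrite !act_C; auto. Qed.

Fixpoint alternating (l : letters) : Prop :=
 match l with
 | [] => True
 | existT _ b h :: l => ~ inC b h /\ starts_off b l /\ alternating l
 end.
Fixpoint aprod (l : letters) : amalgam :=
 match l with [] => 1 | existT _ b h :: l => inj b h ** aprod l end.

Definition nf1 : nf := exist _ (1, []) I.

(** An element outside [C], applied to a normal form that starts in the other factor or is trivial,
    puts a new letter in front. So the normal form remembers the factor of the first entry, and
    cannot be trivial. *)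
Lemma alternating_head l b h : alternating (existT _ b h :: l) ->
 exists r s, snd (proj1_sig (pf (aprod (existT _ b h :: l)) nf1)) = existT _ b r :: s.
Proof.
revert b h. induction l as [|[b' h'] l IH]; intros b h (N & O & A).
- simpl. unfold act. rewrite split_off by (simpl; auto). simpl. rewrite io1, gone_r.
 unfold join; simpl. destruct (em _); [tauto|]. eexists; eexists; reflexivity.
- destruct (IH b' h' A) as (r & s & E).
 change (exists r s, snd (act b h (proj1_sig (pf (aprod (existT _ b' h' :: l)) nf1))) = existT _ b r :: s).
 revert E. generalize (proj1_sig (pf (aprod (existT _ b' h' :: l)) nf1)). intros x E. simpl in O.
 unfold act. rewrite split_off by (rewrite E; simpl; auto). cbn [fst snd].
 unfold join; cbn [fst snd]. destruct (em _) as [I|I].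
 + destruct N. destruct I as [c E']. exists (c ** (fst x)^-1).
  rewrite io_hom, <- E', gassoc, <- io_hom, ginv_r, io1, gone_r. auto.
 + eexists; eexists; reflexivity.
Qed.

Lemma alternating_neq1 l : l <> [] -> alternating l -> aprod l <> 1.
Proof.
destruct l as [|[b h] l]; [congruence|]. intros _ A E.
destruct (alternating_head l b h A) as (r & s & E'). rewrite E in E'. easy.
Qed.

Lemma inj_inj b h : inj b h = 1 -> h = 1.
Proof.
intros E. destruct (classic (inC b h)) as [[c ->]|N].
- apply (f_equal (fun p : perm nf => proj1_sig (pf p nf1))) in E. simpl in E.
 rewrite act_C in E by exact I. injection E. rewrite gone_r. intros ->. apply io1.
- exfalso. apply (alternating_neq1 [existT _ b h]); [congruence|simpl; auto|].
 change (inj b h ** (1 : amalgam) = 1). rewrite E. apply gone_l.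
Qed.
End Amalgam.

Definition injective_hom {G H : group} (f : G -> H) : Prop := hom f /\ forall x, f x = 1 -> x = 1.

Lemma injective_hom_comp {G H K : group} (f : G -> H) (g : H -> K) :
 injective_hom f -> injective_hom g -> injective_hom (fun x => g (f x)).
Proof. intros [F1 F2] [G1 G2]. split; auto. apply hom_comp; auto. Qed.

(** * Pairs of elements that generate a free group freely *)

Fixpoint pprod {G : group} (u v : G) (l : list (bool * Z)) : G :=
 match l with [] => 1 | (b, k) :: l => zpow (if b then u else v) k ** pprod u v l end.

Fixpoint reduced (l : list (bool * Z)) : Prop :=
 match l with
 | [] => True
 | (b, k) :: l => k <> 0%Z /\ match l with [] => True | (b', _) :: _ => b' <> b end /\ reduced l
 end.

Definition free_pair {G : group} (u v : G) : Prop :=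
 forall l, l <> [] -> reduced l -> pprod u v l <> 1.

Definition infinite_order {G : group} (u : G) : Prop := forall k, k <> 0%Z -> zpow u k <> 1.

Definition push (x : bool * Z) (l : list (bool * Z)) : list (bool * Z) :=
 if (snd x =? 0)%Z then l else
 match l with
 | [] => [x]
 | (b, k) :: l' => if Bool.eqb (fst x) b then
           (if (snd x + k =? 0)%Z then l' else (b, (snd x + k)%Z) :: l')
          else x :: l
 end.
Definition reduce (l : list (bool * Z)) : list (bool * Z) := fold_right push [] l.

Lemma push_reduced x l : reduced l -> reduced (push x l).
Proof.
destruct x as [b k]. unfold push; simpl. destruct (Z.eqb_spec k 0); auto.
destruct l as [|[b' k'] l]; simpl; [auto|]. intros (H1 & H2 & H3).
destruct (Bool.eqb_spec b b').
- destruct (Z.eqb_spec (k + k') 0); simpl; auto.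
- simpl; auto.
Qed.
Lemma reduce_reduced l : reduced (reduce l).
Proof. induction l; simpl; auto. apply push_reduced; auto. Qed.
Lemma pprod_push {G : group} (u v : G) b k l :
 pprod u v (push (b, k) l) = zpow (if b then u else v) k ** pprod u v l.
Proof.
unfold push; simpl. destruct (Z.eqb_spec k 0) as [->|N]; [rewrite zpow_0, gone_l; auto|].
destruct l as [|[b' k'] l]; simpl; auto. destruct (Bool.eqb_spec b b') as [->|]; auto.
rewrite <- gassoc, <- zpow_add. destruct (Z.eqb_spec (k + k') 0) as [E|]; auto.
rewrite E, zpow_0, gone_l; auto.
Qed.
Lemma pprod_reduce {G : group} (u v : G) l : pprod u v (reduce l) = pprod u v l.
Proof. induction l as [|[b k] l IH]; simpl; auto. rewrite pprod_push, IH. auto. Qed.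
Lemma pprod_app {G : group} (u v : G) l l' : pprod u v (l ++ l') = pprod u v l ** pprod u v l'.
Proof. induction l as [|[b k] l IH]; simpl; [rewrite gone_l|rewrite IH, gassoc]; auto. Qed.
Definition pinv (l : list (bool * Z)) := rev (map (fun x => (fst x, (- snd x)%Z)) l).
Lemma pprod_inv {G : group} (u v : G) l : pprod u v (pinv l) = (pprod u v l)^-1.
Proof.
unfold pinv. induction l as [|[b k] l IH]; simpl; [symmetry; apply ginv1|].
rewrite pprod_app, IH, ginvM. simpl. rewrite gone_r, zpow_opp. auto.
Qed.
Lemma free_pair_reduce {G : group} (u v : G) l : free_pair u v -> pprod u v l = 1 -> reduce l = [].
Proof.
intros F E. destruct (reduce l) eqn:R; auto. exfalso. apply (F (reduce l)).
- congruence.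
- apply reduce_reduced.
- rewrite pprod_reduce; auto.
Qed.
Lemma pprod_hom {G H : group} (f : G -> H) u v l : hom f -> f (pprod u v l) = pprod (f u) (f v) l.
Proof.
intros Hf. induction l as [|[b k] l IH]; simpl; [apply (hom1 f Hf)|].
rewrite Hf, IH, (zpow_hom f Hf). destruct b; auto.
Qed.
Lemma free_pair_hom {G H : group} (f : G -> H) u v : injective_hom f -> free_pair u v -> free_pair (f u) (f v).
Proof.
intros [F1 F2] FP l N R E. apply (FP l N R). apply F2. rewrite pprod_hom; auto.
Qed.

Lemma amalgam_free_pair (C : group) (H : bool -> group) (io : forall b, C -> H b)
 (io_hom : forall b, hom (io b)) (io_inj : forall b c, io b c = 1 -> c = 1) b (u : H b) (v : H (negb b)) :
 (forall k, k <> 0%Z -> ~ inC C H io b (zpow u k)) ->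
 (forall k, k <> 0%Z -> ~ inC C H io (negb b) (zpow v k)) ->
 free_pair (inj C H io io_hom io_inj b u) (inj C H io io_hom io_inj (negb b) v).
Proof.
intros Hu Hv l N R E.
set (tr := fun x : bool * Z => if fst x then existT (fun b => gcar (H b)) b (zpow u (snd x))
       else existT (fun b => gcar (H b)) (negb b) (zpow v (snd x))).
apply (alternating_neq1 C H io io_hom io_inj (map tr l)).
- destruct l; simpl; congruence.
- clear N E. induction l as [|[c k] l IH]; simpl in *; auto. destruct R as (K & O & R).
 assert (St : starts_off H (if c then b else negb b) (map tr l)).
 { destruct l as [|[c' k'] l]; simpl; auto. destruct c, c'; simpl; try congruence; destruct b; simpl; congruence. }
 unfold tr at 1. destruct c; simpl; auto.
- rewrite <- E. clear. induction l as [|[c k] l IH]; simpl; auto. rewrite <- IH.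
 unfold tr at 1; destruct c; simpl; rewrite (zpow_hom _ (inj_hom C H io io_hom io_inj _)); auto.
Qed.

(** The amalgamated subgroup is the one generated by [(u1, u2)] and [(v1, v2)] in the product.
    Freeness of both pairs makes both projections injective on it, so it is the graph of an
    isomorphism of free groups. *)
Lemma pair_amalgam (G1 G2 : group) (u1 v1 : G1) (u2 v2 : G2) : free_pair u1 v1 -> free_pair u2 v2 ->
 exists (A : group) (j1 : G1 -> A) (j2 : G2 -> A), injective_hom j1 /\ injective_hom j2 /\
  j1 u1 = j2 u2 /\ j1 v1 = j2 v2.
Proof.
intros F1 F2.
set (P := fun x : prodG G1 G2 => exists l, x = (pprod u1 v1 l, pprod u2 v2 l)).
assert (P1 : P 1) by (exists []; auto).
assert (PM : forall x y, P x -> P y -> P (x ** y)).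
{ intros x y [l ->] [l' ->]. exists (l ++ l'). rewrite !pprod_app. auto. }
assert (PV : forall x, P x -> P x^-1).
{ intros x [l ->]. exists (pinv l). rewrite !pprod_inv. auto. }
set (C := subG _ P P1 PM PV).
set (H := fun b : bool => if b then G1 else G2).
set (io := fun b : bool => if b return C -> H b then fun c => fst (proj1_sig c) else fun c => snd (proj1_sig c)).
assert (io_hom : forall b, hom (io b)) by (intros [] x y; auto).
assert (io_inj : forall b c, io b c = 1 -> c = 1).
{ intros b [x [l E]]; subst x. intros Hb. apply sub_ext; simpl.
 assert (R : reduce l = []).
 { destruct b; [apply (free_pair_reduce u1 v1)|apply (free_pair_reduce u2 v2)]; auto. }
 rewrite <- (pprod_reduce u1 v1 l), <- (pprod_reduce u2 v2 l), R. auto. }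
set (cu := exist P (u1, u2) (ex_intro _ [(true, 1%Z)] (f_equal2 pair
  (eq_sym (eq_trans (gone_r _) (zpow_1 u1))) (eq_sym (eq_trans (gone_r _) (zpow_1 u2))))) : C).
set (cv := exist P (v1, v2) (ex_intro _ [(false, 1%Z)] (f_equal2 pair
  (eq_sym (eq_trans (gone_r _) (zpow_1 v1))) (eq_sym (eq_trans (gone_r _) (zpow_1 v2))))) : C).
exists (amalgam C H io), (inj C H io io_hom io_inj true), (inj C H io io_hom io_inj false).
repeat split.
- exact (inj_hom C H io io_hom io_inj true).
- exact (inj_inj C H io io_hom io_inj true).
- exact (inj_hom C H io io_hom io_inj false).
- exact (inj_inj C H io io_hom io_inj false).
- apply (inj_agree C H io io_hom io_inj true false cu).
- apply (inj_agree C H io io_hom io_inj true false cv).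
Qed.

(** * Letters that kill other letters *)

Definition affop (x y : Z * R) : Z * R := ((fst x + fst y)%Z, (snd x + powerRZ 2 (fst x) * snd y)%R).
(** The maps [t -> 2^k t + x] of the real line, written [(k, x)]. Scaling by 2 and translation by 1
    satisfy the relation of BS(1,2). *)
Definition Aff : group.
Proof.
refine (Group (Z * R) affop (0%Z, 0%R) (fun x => ((- fst x)%Z, (- (powerRZ 2 (- fst x) * snd x))%R)) _ _ _).
- intros [k x] [l y] [m z]. unfold affop; simpl. f_equal; [lia|]. rewrite powerRZ_add by lra. ring.
- intros [k x]. unfold affop; simpl. f_equal. ring.
- intros [k x]. unfold affop; simpl. f_equal; [lia|]. ring.
Defined.

Lemma zpow_aff_trans k : zpow ((0%Z, 1%R) : Aff) k = (0%Z, IZR k).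
Proof.
revert k. apply Z.bi_induction.
- intros a b ->; tauto.
- reflexivity.
- intros n. rewrite zpow_succ, succ_IZR. split; intros E.
 + rewrite E. simpl. unfold affop; simpl. f_equal. ring.
 + apply (gcancel_l ((0%Z, 1%R) : Aff)). rewrite E. simpl. unfold affop; simpl. f_equal. ring.
Qed.
Lemma zpow_aff_scale k : zpow ((1%Z, 0%R) : Aff) k = (k, 0%R).
Proof.
revert k. apply Z.bi_induction.
- intros a b ->; tauto.
- reflexivity.
- intros n. rewrite zpow_succ. split; intros E.
 + rewrite E. simpl. unfold affop; cbn [fst snd]. f_equal; [lia|ring].
 + apply (gcancel_l ((1%Z, 0%R) : Aff)). rewrite E. simpl. unfold affop; cbn [fst snd]. f_equal; [lia|ring].
Qed.

(* [a] acts on [e], and [e] on [g], as in the Baumslag-Solitar group BS(1,2); so [a = 1] forces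
  [e = 1] and then [g = 1], although [a] and [g] are independent. *)
Definition kills {G : group} (a e g : G) : Prop := a ** e = e ** (e ** a) /\ e ** g = g ** (g ** e).

Lemma kills_1 {G : group} (a e g : G) : kills a e g -> a = 1 -> e = 1 /\ g = 1.
Proof.
intros [H1 H2] ->. rewrite gone_l, gone_r in H1.
assert (E : e = 1) by (apply (gcancel_l e); rewrite gone_r; auto). split; auto.
rewrite E, gone_l, gone_r in H2. apply (gcancel_l g). rewrite gone_r; auto.
Qed.

(** Two copies of the affine group, amalgamated along the integral translations of one and the
    scalings of the other; the common generator is [e]. No nontrivial power of the scaling [a] is a
    translation and none of the translation [g] is a scaling, so both stay outside the amalgamated
    subgroup and form a free pair. *)
Lemma kill_group : exists (B : group) (a e g : B), kills a e g /\ free_pair a g.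
Proof.
set (H := fun _ : bool => Aff).
set (io := fun (b : bool) (n : ZG) => (if b then (0%Z, IZR n) else (n : Z, 0%R)) : H b).
assert (io_hom : forall b, hom (io b)).
{ intros [] m n; unfold io; simpl; unfold affop; simpl.
 - rewrite plus_IZR. f_equal. ring.
 - f_equal. ring. }
assert (io_inj : forall b c, io b c = 1 -> c = 1).
{ intros [] c E; injection E; auto. intros E'. apply eq_IZR in E'. auto. }
set (J := inj ZG H io io_hom io_inj).
exists (amalgam ZG H io), (J true (1%Z, 0%R)), (J true (0%Z, 1%R)), (J false (0%Z, 1%R)).
assert (E : J true (0%Z, 1%R) = J false (1%Z, 0%R)).
{ exact (inj_agree ZG H io io_hom io_inj true false 1%Z). }
assert (R : forall b, J b (1%Z, 0%R) ** J b (0%Z, 1%R) = J b (0%Z, 1%R) ** (J b (0%Z, 1%R) ** J b (1%Z, 0%R))).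
{ intros b. unfold J. rewrite <- !(inj_hom ZG H io io_hom io_inj b). f_equal.
 simpl. unfold affop; simpl. f_equal. ring. }
split; [split|].
- apply R.
- rewrite E. apply R.
- apply (amalgam_free_pair ZG H io io_hom io_inj true); intros k Hk [n E']; simpl in E'.
 + rewrite zpow_aff_scale in E'. injection E'. auto.
 + rewrite zpow_aff_trans in E'. injection E' as _ E'. apply eq_IZR in E'. auto.
Qed.

Lemma add_killer (G : group) (z g : G) : free_pair z g ->
 exists (G' : group) (j : G -> G') (e : G'), injective_hom j /\ kills (j z) e (j g).
Proof.
intros F. destruct kill_group as (B & a & e & g' & K & FB).
destruct (pair_amalgam G B z g a g' F FB) as (A & j1 & j2 & I1 & [h2 _] & E1 & E2).
exists A, j1, (j2 e). split; auto. rewrite E1, E2. destruct K as [K1 K2].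
split; rewrite <- !h2; congruence.
Qed.

Lemma add_killers (T : Type) (l : list T) : forall (G : group) (z g : T -> G),
 (forall t, In t l -> free_pair (z t) (g t)) ->
 exists (G' : group) (j : G -> G'), injective_hom j /\
  forall t, In t l -> exists e, kills (j (z t)) e (j (g t)).
Proof.
induction l as [|t l IH]; intros G z g F.
- exists G, (fun x => x). split; [split; [intros x y|]; auto|]. intros t [].
- destruct (add_killer G (z t) (g t)) as (G1 & j1 & e & I1 & K1); [apply F; left; auto|].
 destruct (IH G1 (fun t => j1 (z t)) (fun t => j1 (g t))) as (G2 & j2 & I2 & K2).
 { intros t' Ht'. apply free_pair_hom; auto. apply F; right; auto. }
 exists G2, (fun x => j2 (j1 x)). split; [apply injective_hom_comp; auto|].
 intros t' [<-|Ht']; [|auto]. exists (j2 e). destruct I2 as [h2 _], K1 as [K1 K1'].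
 split; rewrite <- !h2; congruence.
Qed.

(* [G] is enlarged to [(G x Z) * Z]; the generator [y] of the first factor [Z] gives every
  [j s ** y] infinite order, the generator [z] of the second is free from all of them. *)
Lemma add_letters (G : group) : exists (G' : group) (j : G -> G') (y z : G'),
 injective_hom j /\ (forall u, infinite_order u -> free_pair (j u) z) /\
 free_pair z y /\ (forall s, free_pair z (j s ** y)).
Proof.
set (G1 := prodG G ZG).
set (H := fun b : bool => if b then G1 else ZG).
set (io := fun (b : bool) (_ : trivG) => (1 : H b)).
assert (io_hom : forall b, hom (io b)).
{ intros b x y. unfold io. rewrite gone_l. auto. }
assert (io_inj : forall b c, io b c = 1 -> c = 1) by (intros b [] _; auto).
set (J := inj trivG H io io_hom io_inj).
assert (Z1 : forall k, zpow (1%Z : ZG) k = k).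
{ apply Z.bi_induction; [intros a b ->; tauto|auto|]. intros n. rewrite zpow_succ.
 generalize (zpow (1%Z : ZG) n). intros w. change (w = n <-> (1 + w)%Z = Z.succ n).
 change (gcar ZG) with Z in w. lia. }
assert (FP : forall u : G1, infinite_order u -> free_pair (J true u) (J false (1%Z : ZG)) /\
 free_pair (J false (1%Z : ZG)) (J true u)).
{ intros u Hu.
 assert (A1 : forall k, k <> 0%Z -> ~ inC trivG H io true (zpow u k)).
 { intros k Hk [c E]. apply (Hu k Hk E). }
 assert (A2 : forall k, k <> 0%Z -> ~ inC trivG H io false (zpow (1%Z : ZG) k)).
 { intros k Hk [c E]. rewrite Z1 in E. apply Hk, E. }
 split.
 - apply (amalgam_free_pair trivG H io io_hom io_inj true); auto.
 - apply (amalgam_free_pair trivG H io io_hom io_inj false); auto. }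
assert (Sn : forall (u : G1) k, snd (zpow u k) = zpow (snd u : ZG) k).
{ intros u k. apply (zpow_hom (fun x : G1 => snd x : ZG)). intros x y; auto. }
assert (Fs : forall (u : G1) k, fst (zpow u k) = zpow (fst u) k).
{ intros u k. apply (zpow_hom (fun x : G1 => fst x)). intros x y; auto. }
assert (I1 : injective_hom (fun g : G => (g, 0%Z) : G1)).
{ split; [intros x y; auto|]. intros x E. injection E. auto. }
exists (amalgam trivG H io), (fun g => J true (g, 0%Z)), (J true (1, 1%Z)), (J false (1%Z : ZG)).
split; [|split; [|split]].
- apply (injective_hom_comp (fun g : G => (g, 0%Z) : G1) (J true)); auto.
 split; [exact (inj_hom trivG H io io_hom io_inj true)|exact (inj_inj trivG H io io_hom io_inj true)].
- intros u Hu. apply FP. intros k Hk E. apply (Hu k Hk).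
 apply (f_equal fst) in E. rewrite Fs in E. auto.
- apply FP. intros k Hk E. apply Hk. apply (f_equal snd) in E. rewrite Sn, Z1 in E. auto.
- intros s. unfold J. rewrite <- (inj_hom trivG H io io_hom io_inj true). apply FP.
 intros k Hk E. apply Hk. apply (f_equal snd) in E. rewrite Sn in E. simpl snd in E.
 rewrite (Z1 k) in E. auto.
Qed.

(** * The group of a rule system *)

Definition gconj {G : group} (u t : G) : G := u ** (t ** u^-1).

(** A configuration [(q, v)] is represented by the conjugate of [T q] by the product of the powers
    [X i ^ v i]. The relations of [Rj j] make conjugation by it perform rule [j] on such conjugates,
    and [K] makes [T acc] conjugate to its square. *)
Definition machine_rel {G : group} (Rs : list rule) (d acc : nat) (X T Rj : nat -> G) (K : G) : Prop :=
 (forall i k, i < d -> k < d -> X i ** X k = X k ** X i) /\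
 (forall j r, nth_error Rs j = Some r ->
  Rj j ** gpow (X (r_reg r)) (r_m r) = gpow (X (r_reg r)) (r_p r) ** Rj j /\
  (forall k, k < d -> k <> r_reg r -> Rj j ** X k = X k ** Rj j) /\
  Rj j ** gconj (gpow (X (r_reg r)) (r_a r)) (T (r_src r)) =
   gconj (gpow (X (r_reg r)) (r_c r)) (T (r_dst r)) ** Rj j /\
  K ** Rj j = Rj j ** K) /\
 K ** T acc = T acc ** (T acc ** K).

Section Halting.
Variables (G : group) (Rs : list rule) (d acc : nat) (X T Rj : nat -> G) (K : G).
Hypotheses (Rel : machine_rel Rs d acc X T Rj K) (Wf : forall r, In r Rs -> rule_wf d r).

Fixpoint Xv (v : nat -> Z) (n : nat) : G :=
 match n with 0 => 1 | S n => Xv v n ** zpow (X n) (v n) end.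
Definition conf (x : config) : G := gconj (Xv (snd x) d) (T (fst x)).

Lemma commute_zpow (a b : G) k : a ** b = b ** a -> a ** zpow b k = zpow b k ** a.
Proof. apply zpow_conj. Qed.
Lemma commute_mul (a b c : G) : a ** b = b ** a -> a ** c = c ** a -> a ** (b ** c) = (b ** c) ** a.
Proof. intros H1 H2. rewrite <- gassoc, H1, gassoc, H2, gassoc. auto. Qed.

Lemma X_Xv i v n k : i < d -> n <= d -> zpow (X i) k ** Xv v n = Xv v n ** zpow (X i) k.
Proof.
intros Hi. induction n; intros Hn; simpl; [rewrite gone_l, gone_r; auto|].
apply commute_mul; [apply IHn; lia|].
apply commute_zpow. symmetry. apply commute_zpow. destruct Rel as (C & _). apply C; lia.
Qed.

Lemma Xv_upd i v n k : n <= d -> i < n -> Xv v n = zpow (X i) (v i - k) ** Xv (upd v i k) n.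
Proof.
induction n; intros Hn Hi; [lia|]. simpl.
destruct (Nat.eq_dec n i) as [->|N].
- rewrite upd_eq. rewrite <- gassoc, (X_Xv i _ i) by lia.
 rewrite gassoc, <- zpow_add. replace (v i - k + k)%Z with (v i) by lia. f_equal.
 assert (E : forall l, l <= i -> Xv v l = Xv (upd v i k) l).
 { clear. induction l; intros H; simpl; auto. rewrite IHl, upd_neq by lia. auto. }
 apply E; lia.
- rewrite IHn by lia. rewrite (upd_neq v i k n) by auto. rewrite gassoc. auto.
Qed.

(** The power of the register concerned is split as [(X^m)^u X^a]: the first factor goes to
    [(X^p)^u], the other registers are fixed, and the conjugate of the source letter by [X^a] goes
    to that of the target letter by [X^c]. *)
Lemma conf_step j r x y : nth_error Rs j = Some r -> applies r x y -> Rj j ** conf x = conf y ** Rj j.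
Proof.
destruct x as [q v], y as [q' v']. intros Hj (E1 & E2 & u & E3 & E4). simpl in *. subst q q' v'.
destruct Rel as (C & H & _). destruct (H j r Hj) as (H1 & H2 & H3 & _). clear H.
assert (W : rule_wf d r) by (apply Wf; eapply nth_error_In; eauto).
destruct W as (_ & _ & _ & _ & Hd). set (i := r_reg r) in *.
set (v0 := upd v i 0%Z).
assert (F : forall a w, w i = a -> upd w i 0%Z = v0 -> Xv w d = zpow (X i) a ** Xv v0 d).
{ intros a w <- <-. rewrite (Xv_upd i w d 0) by auto. rewrite Z.sub_0_r. auto. }
assert (R0 : forall n, n <= d -> Rj j ** Xv v0 n = Xv v0 n ** Rj j).
{ induction n; intros Hn; simpl; [rewrite gone_l, gone_r; auto|].
 apply commute_mul; [apply IHn; lia|].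
 unfold v0. destruct (Nat.eq_dec n i) as [->|N].
 - rewrite upd_eq, zpow_0, gone_l, gone_r. auto.
 - apply commute_zpow, H2; auto. }
assert (Split : forall m a, Xv v0 d ** zpow (X i) (Z.of_nat a) = zpow (X i) (Z.of_nat a) ** Xv v0 d ->
 zpow (X i) (Z.of_nat m * u + Z.of_nat a) ** Xv v0 d = zpow (gpow (X i) m) u ** (Xv v0 d ** gpow (X i) a)).
{ intros m a E. rewrite zpow_add, zpow_mul, zpow_nat, gassoc, <- E, zpow_nat. auto. }
unfold conf. cbn [fst snd].
rewrite (F (Z.of_nat (r_m r) * u + Z.of_nat (r_a r))%Z v E3 eq_refl).
rewrite (F (Z.of_nat (r_p r) * u + Z.of_nat (r_c r))%Z
 (upd v i (Z.of_nat (r_p r) * u + Z.of_nat (r_c r))%Z)); [|apply upd_eq|unfold v0; ext_upd].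
rewrite !Split by (symmetry; apply X_Xv; auto).
set (A := zpow (gpow (X i) (r_m r)) u). set (B := zpow (gpow (X i) (r_p r)) u).
assert (AB : Rj j ** A = B ** Rj j) by (apply zpow_conj; auto).
specialize (R0 d (le_n d)).
assert (E : forall (P Q c t : G), gconj (P ** (Q ** c)) t = gconj P (gconj Q (gconj c t))).
{ intros. unfold gconj. gsimp. auto. }
assert (E' : forall (r P Q t s : G), r ** P = Q ** r -> r ** t = s ** r -> r ** gconj P t = gconj Q s ** r).
{ intros r0 P Q t s HP Ht. unfold gconj.
 assert (HP' : r0 ** P^-1 = Q^-1 ** r0).
 { apply (gcancel_l Q). apply (gcancel_r P). gsimp. auto. }
 rewrite <- gassoc, HP, gassoc, <- (gassoc _ r0 t), Ht, gassoc, HP'. gsimp. auto. }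
rewrite !E. apply E'; auto.
Qed.

(** A product of rule letters conjugates the initial configuration to [T acc]. Since [K] commutes
    with that product and with the initial configuration, it commutes with [T acc], and the last
    relation becomes [T acc = T acc ^ 2]. *)
Theorem halting_collapse N :
 clos_refl_trans _ (zstep Rs) (0, upd (fun _ => 0%Z) 0 (Z.of_nat N)) (acc, fun _ => 0%Z) -> 0 < d ->
 K ** gconj (gpow (X 0) N) (T 0) = gconj (gpow (X 0) N) (T 0) ** K ->
 T acc = 1.
Proof.
intros Run Hd E.
assert (Base : forall v, v = (fun _ => 0%Z) -> Xv v d = 1).
{ intros v ->. generalize d. induction d0; simpl; auto. rewrite IHd0, zpow_0, gone_l. auto. }
assert (C0 : conf (acc, fun _ => 0%Z) = T acc).
{ unfold conf, gconj; simpl. rewrite Base by auto. gsimp. auto. }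
assert (C1 : conf (0, upd (fun _ => 0%Z) 0 (Z.of_nat N)) = gconj (gpow (X 0) N) (T 0)).
{ unfold conf; simpl. f_equal. rewrite (Xv_upd 0 _ d 0) by lia.
 rewrite upd_eq, Z.sub_0_r, zpow_nat, Base; [apply gone_r|]. ext_upd. }
assert (Hs : forall x y, zstep Rs x y -> exists s, s ** conf x = conf y ** s /\ K ** s = s ** K).
{ intros x y (r & Hr & A). apply In_nth_error in Hr as [j Hj]. exists (Rj j). split.
 - apply (conf_step j r); auto.
 - destruct Rel as (_ & H & _). apply (H j r Hj). }
assert (H : exists s, s ** conf (0, upd (fun _ => 0%Z) 0 (Z.of_nat N)) = T acc ** s /\ K ** s = s ** K).
{ rewrite <- C0. clear C0 C1. revert Run. generalize (0, upd (fun _ => 0%Z) 0 (Z.of_nat N)).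
 generalize (acc, fun _ : nat => 0%Z).
 intros x0 y0 Run. induction Run as [x y H|x|x y z H1 IH1 H2 IH2]; auto.
 - exists 1. gsimp. auto.
 - destruct IH1 as (s1 & A1 & B1), IH2 as (s2 & A2 & B2). exists (s2 ** s1). split.
  + rewrite gassoc, A1, <- gassoc, A2, gassoc. auto.
  + apply commute_mul; auto. }
clear Hs. destruct H as (s & A & B). rewrite C1 in A. set (c := gconj (gpow (X 0) N) (T 0)) in *.
destruct Rel as (_ & _ & D).
assert (E2 : K ** T acc = T acc ** K).
{ apply (gcancel_r s). rewrite gassoc, <- A, <- gassoc, B, gassoc, E, <- gassoc, A, !gassoc, B. auto. }
rewrite E2 in D. apply gcancel_l in D. apply (gcancel_r K). rewrite gone_l. auto.
Qed.
End Halting.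

Lemma Zmod_unique_pos a m q r : (0 <= r < m -> a = m * q + r -> a / m = q /\ a mod m = r)%Z.
Proof.
intros H E. split; [symmetry; eapply Z.div_unique_pos|symmetry; eapply Z.mod_unique_pos]; eauto.
Qed.

(** * A model of the relations in which [T acc] has infinite order *)

Section Model.
Variables (Rs : list rule) (d acc : nat) (N : nat).
Hypotheses (Wf : forall r, In r Rs -> rule_wf d r /\ r_src r <> acc) (Det : deterministic Rs).
Hypothesis NoRun :
 ~ clos_refl_trans _ (zstep Rs) (0, upd (fun _ => 0%Z) 0 (Z.of_nat N)) (acc, fun _ => 0%Z).

(* Rule [j] acts on pairs (line, vector) and maps the residue class [r_a] of the base line of
  its source to the class [r_c] of the base line of its target.  On every other residue class
  it is made bijective by growing a tree of new lines: [LN j s a l] is glued along its class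
  [0] to the class [a] of [l], by rule [j] if [s = true] and by its inverse otherwise. *)
Inductive line := LB (q : nat) | LN (j : nat) (s : bool) (a : nat) (l : line).

Definition dflt : rule := Build_rule 0 0 1 0 0 1 0.
Definition rl (j : nat) : rule := nth j Rs dflt.
Definition sm (j : nat) (s : bool) : nat := if s then r_m (rl j) else r_p (rl j).
Definition sa (j : nat) (s : bool) : nat := if s then r_a (rl j) else r_c (rl j).
Definition sb (j : nat) (s : bool) : nat := if s then r_src (rl j) else r_dst (rl j).
Definition sr (j : nat) : nat := r_reg (rl j).

Lemma sm_pos j s : 0 < sm j s /\ sa j s < sm j s.
Proof.
assert (H : 0 < r_m (rl j) /\ r_a (rl j) < r_m (rl j) /\ 0 < r_p (rl j) /\ r_c (rl j) < r_p (rl j)).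
{ unfold rl. destruct (nth_in_or_default j Rs dflt) as [I|E].
 - apply Wf in I as [(? & ? & ? & ? & ?) _]. auto.
 - rewrite E. simpl. lia. }
unfold sm, sa. destruct s; lia.
Qed.

(** The class [a] of [l] has no partner yet: it is neither the class on which the rule acts nor
    class 0 of a line grown by the inverse move. The recursive call excludes formal lines that no
    move creates. *)
Fixpoint fresh_ok (j : nat) (s : bool) (a : nat) (l : line) : bool :=
 (a <? sm j s) && negb
  match l with
  | LB q => (q =? sb j s) && (a =? sa j s)
  | LN j' s' b l' => (j' =? j) && (Bool.eqb s' (negb s)) && (a =? 0) && fresh_ok j (negb s) b l'
  end.

Definition pt : Type := line * (nat -> Z).

Definition move_to (j : nat) (s : bool) (a : nat) (u : Z) (x : pt) : pt :=
 let set w := upd (snd x) (sr j) w in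
 let m' := Z.of_nat (sm j (negb s)) in
 let new := (LN j s a (fst x), set (m' * u)%Z) in
 match fst x with
 | LB q => if (q =? sb j s) && (a =? sa j s)
      then (LB (sb j (negb s)), set (m' * u + Z.of_nat (sa j (negb s)))%Z) else new
 | LN j' s' b l' => if (j' =? j) && (Bool.eqb s' (negb s)) && (a =? 0) && fresh_ok j (negb s) b l'
           then (l', set (m' * u + Z.of_nat b)%Z) else new
 end.
Definition move (j : nat) (s : bool) (x : pt) : pt :=
 let k := snd x (sr j) in
 move_to j s (Z.to_nat (k mod Z.of_nat (sm j s))) (k / Z.of_nat (sm j s)) x.
Ltac unfold_move := unfold move_to; cbn [fst snd]; cbv zeta.

Lemma residue (v : nat -> Z) j s : exists a u, a < sm j s /\
 (v (sr j) = Z.of_nat (sm j s) * u + Z.of_nat a)%Z.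
Proof.
pose proof (sm_pos j s) as [H _].
exists (Z.to_nat (v (sr j) mod Z.of_nat (sm j s))), (v (sr j) / Z.of_nat (sm j s))%Z.
pose proof (Z.mod_pos_bound (v (sr j)) (Z.of_nat (sm j s))).
split; [lia|]. rewrite Z2Nat.id by lia. apply Z.div_mod. lia.
Qed.

Lemma move_eq j s l v a u : a < sm j s -> (v (sr j) = Z.of_nat (sm j s) * u + Z.of_nat a)%Z ->
 move j s (l, v) = move_to j s a u (l, v).
Proof.
intros H E. destruct (Zmod_unique_pos (v (sr j)) (Z.of_nat (sm j s)) u (Z.of_nat a)) as [E1 E2]; [lia|lia|].
unfold move. cbn [fst snd]. rewrite E1, E2, Nat2Z.id. auto.
Qed.

Lemma move_fresh j s l v a u : fresh_ok j s a l = true ->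
 (v (sr j) = Z.of_nat (sm j s) * u + Z.of_nat a)%Z ->
 move j s (l, v) = (LN j s a l, upd v (sr j) (Z.of_nat (sm j (negb s)) * u)%Z).
Proof.
intros F E. assert (H : a < sm j s).
{ destruct l; simpl in F; apply andb_true_iff in F as [F _]; apply Nat.ltb_lt; auto. }
rewrite (move_eq j s l v a u) by auto. unfold_move.
destruct l; simpl in F; apply andb_true_iff in F as [_ F]; apply negb_true_iff in F; rewrite F; auto.
Qed.

Lemma upd_upd {A} (v : nat -> A) i x y : upd (upd v i x) i y = upd v i y.
Proof. ext_upd. Qed.

Lemma move_K j s x : move j (negb s) (move j s x) = x.
Proof.
destruct x as [l v]. destruct (residue v j s) as (a & u & Ha & E).
pose proof (sm_pos j (negb s)) as [P1 P2].
assert (Back : upd v (sr j) (Z.of_nat (sm j s) * u + Z.of_nat a)%Z = v) by (apply upd_same; auto).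
assert (New : fresh_ok j s a l = true ->
 move j (negb s) (LN j s a l, upd v (sr j) (Z.of_nat (sm j (negb s)) * u)%Z) = (l, v)).
{ intros F. rewrite (move_eq j (negb s) _ _ 0 u) by (rewrite ?upd_eq; auto; lia). unfold_move.
 rewrite negb_involutive, Nat.eqb_refl, Bool.eqb_reflx, F. simpl. rewrite upd_upd, Back. auto. }
assert (Hlt : (a <? sm j s) = true) by (apply Nat.ltb_lt; auto).
destruct l as [q|j' s' b l'].
- rewrite (move_eq j s _ v a u) by auto. unfold_move.
 destruct ((q =? sb j s) && (a =? sa j s)) eqn:B.
 + apply andb_true_iff in B as [B1 B2]. apply Nat.eqb_eq in B1, B2. subst q a.
  rewrite (move_eq j (negb s) _ _ (sa j (negb s)) u) by (rewrite ?upd_eq; auto). unfold_move.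
  rewrite !Nat.eqb_refl, negb_involutive. simpl. rewrite upd_upd, Back. auto.
 + apply New. simpl. rewrite B, Hlt. auto.
- rewrite (move_eq j s _ v a u) by auto. unfold_move.
 destruct ((j' =? j) && Bool.eqb s' (negb s) && (a =? 0) && fresh_ok j (negb s) b l') eqn:B.
 + rewrite !andb_true_iff in B. destruct B as [[[B1 B2] B3] B4]. apply Nat.eqb_eq in B1, B3. apply Bool.eqb_prop in B2. subst.
  rewrite (move_fresh j (negb s) l' _ b u) by (rewrite ?upd_eq; auto).
  rewrite negb_involutive, upd_upd. rewrite Nat2Z.inj_0, Z.add_0_r in Back. rewrite Back. auto.
 + apply New. simpl. rewrite B, Hlt. auto.
Qed.

Definition terminates (x : config) : Prop := clos_refl_trans _ (zstep Rs) x (acc, fun _ => 0%Z).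

(** In the forward direction the run from [x] cannot be empty, because [acc] has no rules, and by
    determinism its first step is the one to [y]. *)
Lemma halts_step j r x y : nth_error Rs j = Some r -> applies r x y -> (terminates x <-> terminates y).
Proof.
intros Hj A. assert (Hr : In r Rs) by (eapply nth_error_In; eauto).
split; intros H.
- apply clos_rt_rt1n in H. remember (acc, fun _ : nat => 0%Z) as z eqn:Ez. destruct H as [|y' z (r' & Hr' & A') H].
 + exfalso. subst x. destruct A as (E & _). apply (Wf r Hr). auto.
 + destruct (Det r r' x y y') as [_ ->]; auto. subst z. apply clos_rt1n_rt; auto.
- eapply rt_trans; [apply rt_step; exists r; eauto|auto].
Qed.

(** Termination, carried over to the grown lines: a point of [LN j s a l] can be coloured only in
    class 0, where it is glued, and then it has the colour of its partner on [l]. This choice makes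
    colours invariant under all moves. *)
Fixpoint colour (l : line) (v : nat -> Z) : Prop :=
 match l with
 | LB q => terminates (q, v)
 | LN j s a l => exists u, v (sr j) = (Z.of_nat (sm j (negb s)) * u)%Z /\
          colour l (upd v (sr j) (Z.of_nat (sm j s) * u + Z.of_nat a)%Z)
 end.

Lemma colour_move j s l v : j < length Rs -> colour (fst (move j s (l, v))) (snd (move j s (l, v))) <-> colour l v.
Proof.
intros Hj. destruct (residue v j s) as (a & u & Ha & E).
pose proof (sm_pos j (negb s)) as [P1 P2]. pose proof (sm_pos j s) as [P3 P4].
assert (Back : upd v (sr j) (Z.of_nat (sm j s) * u + Z.of_nat a)%Z = v) by (apply upd_same; auto).
assert (New : colour (LN j s a l) (upd v (sr j) (Z.of_nat (sm j (negb s)) * u)%Z) <-> colour l v).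
{ simpl. split.
 - intros (u' & E' & H). rewrite upd_eq in E'. assert (u' = u) by nia. subst u'.
  rewrite upd_upd, Back in H. auto.
 - intros H. exists u. rewrite upd_eq, upd_upd, Back. auto. }
rewrite (move_eq j s _ v a u) by auto. unfold_move.
destruct l as [q|j' s' b l'].
- destruct ((q =? sb j s) && (a =? sa j s)) eqn:B; [|apply New].
 apply andb_true_iff in B as [B1 B2]. apply Nat.eqb_eq in B1, B2. subst q a. cbn [fst snd colour].
 assert (Hn : nth_error Rs j = Some (rl j)) by (apply nth_error_nth'; auto).
 destruct s.
 + symmetry. apply (halts_step j (rl j)); auto. split; [|split]; auto. exists u. split; auto.
 + apply (halts_step j (rl j)); auto. split; [|split]; auto. exists u. simpl. rewrite upd_eq, upd_upd.
  split; auto.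
- destruct ((j' =? j) && Bool.eqb s' (negb s) && (a =? 0) && fresh_ok j (negb s) b l') eqn:B; [|apply New].
 rewrite !andb_true_iff in B. destruct B as [[[B1 B2] B3] B4]. apply Nat.eqb_eq in B1, B3. apply Bool.eqb_prop in B2. subst.
 cbn [fst snd colour]. rewrite negb_involutive. rewrite Nat2Z.inj_0, Z.add_0_r in E. split.
 + intros H. exists u. auto.
 + intros (u' & E' & H). assert (u' = u) by nia. subst. auto.
Qed.

Definition space : Type := pt * R.

Definition pX (i : nat) : Sym space.
Proof.
refine (Perm (fun x => ((fst (fst x), upd (snd (fst x)) i (snd (fst x) i + 1)%Z), snd x))
 (fun x => ((fst (fst x), upd (snd (fst x)) i (snd (fst x) i - 1)%Z), snd x)) _ _);
 intros [[l v] f]; simpl; rewrite upd_eq, upd_upd, upd_same; auto; lia.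
Defined.
Definition at_base (q : nat) (a : Z) (i : nat) (x : pt) : Prop := x = (LB q, upd (fun _ => 0%Z) i a).
Definition bump (P : pt -> Prop) (t : R) (x : space) : space :=
 (fst x, if em (P (fst x)) then (snd x + t)%R else snd x).
Definition pT (q : nat) : Sym space.
Proof.
refine (Perm (bump (at_base q 0 0) 1) (bump (at_base q 0 0) (-1)) _ _);
 intros [x f]; unfold bump; simpl; destruct (em _); f_equal; ring.
Defined.
Definition pR (j : nat) : Sym space.
Proof.
refine (Perm (fun x => (move j true (fst x), snd x)) (fun x => (move j false (fst x), snd x)) _ _);
 intros [x f]; simpl; f_equal; [apply (move_K j false)|apply (move_K j true)].
Defined.
Definition pK : Sym space.
Proof.
refine (Perm
 (fun x => (fst x, if em (colour (fst (fst x)) (snd (fst x))) then (2 * snd x)%R else snd x))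
 (fun x => (fst x, if em (colour (fst (fst x)) (snd (fst x))) then (/ 2 * snd x)%R else snd x))
 _ _);
 intros [x f]; simpl; destruct (em _); f_equal; field.
Defined.

Lemma gpow_pX i n l v f : pf (gpow (pX i) n) ((l, v), f) = ((l, upd v i (v i + Z.of_nat n)%Z), f).
Proof.
induction n.
- simpl. rewrite upd_same; auto. lia.
- change (pf (gpow (pX i) (S n)) ((l, v), f)) with (pf (pX i) (pf (gpow (pX i) n) ((l, v), f))).
 rewrite IHn. simpl pf. cbn -[Z.of_nat Z.add upd]. rewrite upd_eq, upd_upd. do 3 f_equal. lia.
Qed.
Lemma gpow_pX_inv i n l v f : pf (gpow (pX i) n)^-1 ((l, v), f) = ((l, upd v i (v i - Z.of_nat n)%Z), f).
Proof.
change (pf (gpow (pX i) n)^-1 ((l, v), f)) with (pg (gpow (pX i) n) ((l, v), f)).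
rewrite <- (pgf _ (gpow (pX i) n) ((l, upd v i (v i - Z.of_nat n)%Z), f)), gpow_pX.
rewrite upd_eq, upd_upd. do 3 f_equal. symmetry. apply upd_same. lia.
Qed.

Lemma gconj_pT i a q x : pf (gconj (gpow (pX i) a) (pT q)) x = bump (at_base q (Z.of_nat a) i) 1 x.
Proof.
destruct x as [[l v] f].
change (pf (gconj (gpow (pX i) a) (pT q)) ((l, v), f)) with
 (pf (gpow (pX i) a) (pf (pT q) (pf (gpow (pX i) a)^-1 ((l, v), f)))).
rewrite gpow_pX_inv. simpl. unfold bump at 1; simpl. rewrite gpow_pX, upd_eq, upd_upd.
unfold bump; simpl.
assert (E : at_base q 0 0 (l, upd v i (v i - Z.of_nat a)%Z) <-> at_base q (Z.of_nat a) i (l, v)).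
{ unfold at_base. rewrite (upd_same (fun _ => 0%Z) 0 0%Z eq_refl). split; intros E; injection E as -> E; f_equal.
 - rewrite <- (upd_same v i (v i) eq_refl), <- (upd_upd v i (v i - Z.of_nat a)%Z), E. f_equal.
  apply (f_equal (fun g => g i)) in E. rewrite upd_eq in E. lia.
 - rewrite E, upd_eq, upd_upd. apply upd_same. lia. }
rewrite (upd_same v i) by lia.
destruct (em _), (em _); tauto.
Qed.

Lemma bump_move j s q a q' c t x :
 (forall y, at_base q a (sr j) y <-> at_base q' c (sr j) (move j s y)) ->
 (move j s (fst (bump (at_base q a (sr j)) t x)), snd (bump (at_base q a (sr j)) t x)) =
 bump (at_base q' c (sr j)) t (move j s (fst x), snd x).
Proof.
intros H. unfold bump; simpl. f_equal. specialize (H (fst x)).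
destruct (em _), (em _); tauto.
Qed.

Lemma move_base j s : move j s (LB (sb j s), upd (fun _ => 0%Z) (sr j) (Z.of_nat (sa j s))) =
 (LB (sb j (negb s)), upd (fun _ => 0%Z) (sr j) (Z.of_nat (sa j (negb s)))).
Proof.
pose proof (sm_pos j s) as [H1 H2].
rewrite (move_eq j s _ _ (sa j s) 0) by (rewrite ?upd_eq; auto; lia). unfold_move.
rewrite !Nat.eqb_refl, upd_upd. simpl andb. cbv iota. do 2 f_equal. lia.
Qed.

(** [T q] adds 1 to the real coordinate over the origin of the base line of [q], and [K] doubles it
    over coloured points. Over the origin of [acc], which is coloured, this gives the last relation
    of [K]. The initial configuration is not coloured, as its run does not reach [acc], so [K] is
    the identity there. Invariance of colours makes [K] commute with the rules. *)
Theorem machine_model : exists (M : group) (X T Rj : nat -> M) (K : M),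
 machine_rel Rs d acc X T Rj K /\
 K ** gconj (gpow (X 0) N) (T 0) = gconj (gpow (X 0) N) (T 0) ** K /\
 infinite_order (T acc).
Proof.
exists (Sym space), pX, pT, pR, pK. split; [split; [|split]|split].
- intros i k _ _. apply perm_ext. intros [[l v] f]. simpl.
 destruct (Nat.eq_dec i k) as [->|Nik]; auto.
 rewrite !(upd_neq _ _ _ _ Nik), !upd_neq by auto. do 2 f_equal. ext_upd.
- intros j r Hr. assert (Er : rl j = r) by (apply nth_error_nth; auto). subst r.
 assert (Hlt : j < length Rs) by (apply nth_error_Some; congruence).
 split; [|split; [|split]].
 + apply perm_ext. intros [[l v] f].
  change (pf (pR j) (pf (gpow (pX (sr j)) (sm j true)) ((l, v), f)) =
   pf (gpow (pX (sr j)) (sm j false)) (pf (pR j) ((l, v), f))).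
  rewrite gpow_pX. destruct (residue v j true) as (a & u & Ha & E).
  change ((move j true (l, upd v (sr j) (v (sr j) + Z.of_nat (sm j true))%Z), f) =
   pf (gpow (pX (sr j)) (sm j false)) (move j true (l, v), f)).
  rewrite (move_eq j true l v a u) by auto.
  rewrite (move_eq j true l _ a (u + 1)) by (rewrite ?upd_eq; auto; rewrite E; ring). unfold_move.
  change (negb true) with false.
  destruct l as [q|j' s' b l']; match goal with |- context [if ?b then _ else _] => destruct b end;
   rewrite gpow_pX, upd_eq, !upd_upd; do 3 f_equal; lia.
 + intros k _ Hk. apply perm_ext. intros [[l v] f]. simpl.
  destruct (residue v j true) as (a & u & Ha & E). change (r_reg (rl j)) with (sr j) in Hk.
  rewrite (move_eq j true l v a u) by auto.
  rewrite (move_eq j true l _ a u) by (rewrite ?upd_neq; auto). unfold_move. simpl negb.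
  destruct l as [q|j' s' b l']; match goal with |- context [if ?b then _ else _] => destruct b end;
   cbn [fst snd]; rewrite upd_neq by auto; do 2 f_equal; ext_upd.
 + apply perm_ext. intros x.
  change (pf (pR j) (pf (gconj (gpow (pX (sr j)) (sa j true)) (pT (sb j true))) x) =
   pf (gconj (gpow (pX (sr j)) (sa j false)) (pT (sb j false))) (pf (pR j) x)).
  rewrite !gconj_pT. apply bump_move. intros y. unfold at_base. split.
  * intros ->. apply (move_base j true).
  * intros E. rewrite <- (move_K j true y), E. apply (move_base j false).
 + apply perm_ext. intros [[l v] f]. simpl. f_equal.
  pose proof (colour_move j true l v Hlt).
  destruct (em _), (em _); tauto.
- apply perm_ext. intros [[l v] f]. simpl. unfold bump; simpl. f_equal.
 destruct (em (at_base acc 0 0 (l, v))) as [B|B];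
  destruct (em (colour l v)) as [H|H];
  try (match goal with |- (_, ?a) = (_, ?b) => replace a with b by ring end; reflexivity).
 destruct H. unfold at_base in B. injection B as -> ->. simpl. rewrite upd_same by auto. apply rt_refl.
- apply perm_ext. intros [[l v] f].
 change (pf pK (pf (gconj (gpow (pX 0) N) (pT 0)) ((l, v), f)) =
  pf (gconj (gpow (pX 0) N) (pT 0)) (pf pK ((l, v), f))).
 rewrite !gconj_pT. simpl. unfold bump; simpl. f_equal.
 destruct (em (at_base 0 (Z.of_nat N) 0 (l, v))) as [B|B];
  destruct (em (colour l v)) as [H|H]; auto.
 unfold at_base in B. injection B as -> ->. destruct (NoRun H).
- set (o := (LB acc, fun _ => 0%Z) : pt).
 assert (Ho : at_base acc 0 0 o) by (unfold at_base, o; rewrite upd_same; auto).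
 assert (E : forall k f, pf (zpow (pT acc) k) (o, f) = (o, (f + IZR k)%R)).
 { apply (Z.bi_induction (fun k => forall f, pf (zpow (pT acc) k) (o, f) = (o, (f + IZR k)%R))).
  - intros a b ->; tauto.
  - intros f. simpl. f_equal. ring.
  - intros n. rewrite zpow_succ, succ_IZR. split; intros H f; specialize (H f).
   + change (pf (pT acc) (pf (zpow (pT acc) n) (o, f)) = (o, (f + (IZR n + 1))%R)).
    rewrite H. simpl. unfold bump; simpl. destruct (em _); [|tauto].
    f_equal. ring.
   + change (pf (pT acc) (pf (zpow (pT acc) n) (o, f)) = (o, (f + (IZR n + 1))%R)) in H.
    apply (f_equal (pg (pT acc))) in H. rewrite pgf in H. rewrite H. simpl. unfold bump; simpl.
    destruct (em _); [|tauto]. f_equal. ring. }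
 intros k Hk E1. specialize (E k 0%R). rewrite E1 in E. injection E as E.
 rewrite Rplus_0_l in E. apply Hk, eq_IZR. auto.
Qed.
End Model.

(* [GX], [GT], [GR], [GK] generate the group of the rule system, [GE s] is the letter that kills
  [s], [GC i] stands for the conjugate of [GT 0] by the [i]-th power of [GX 0], and [GG j] for
  the central value of the [j]-th relator. *)
Inductive gen :=
| GX (i : nat) | GT (q : nat) | GR (j : nat) | GK | GY | GZ | GE (s : gen) | GC (i : nat) | GG (j : nat).

Definition word := list (gen * bool).

Fixpoint weval {G : group} (x : gen -> G) (w : word) : G :=
 match w with
 | [] => 1
 | (g, b) :: w => (if b then x g else (x g)^-1) ** weval x w
 end.

Definition winv (w : word) : word := rev (map (fun l => (fst l, negb (snd l))) w).

Lemma in_winv w g b : In (g, b) (winv w) -> exists b', In (g, b') w.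
Proof.
unfold winv. intros H. apply in_rev, in_map_iff in H as ((g' & b') & E & H). injection E as -> _. eauto.
Qed.

Section Words.
Context {G : group} (x : gen -> G).
Lemma weval_app w w' : weval x (w ++ w') = weval x w ** weval x w'.
Proof. induction w as [|[g b] w IH]; simpl; [rewrite gone_l|rewrite IH, gassoc]; auto. Qed.
Lemma weval_inv w : weval x (winv w) = (weval x w)^-1.
Proof.
unfold winv. induction w as [|[g b] w IH]; simpl; [symmetry; apply ginv1|].
rewrite weval_app, IH, ginvM. simpl. rewrite gone_r. destruct b; simpl; rewrite ?ginvK; auto.
Qed.
Lemma weval_repeat g n : weval x (repeat (g, true) n) = gpow (x g) n.
Proof. induction n; simpl; [|rewrite IHn]; auto. Qed.
Lemma weval_ext (y : gen -> G) w : (forall g b, In (g, b) w -> x g = y g) -> weval x w = weval y w.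
Proof.
induction w as [|[g b] w IH]; intros H; simpl; auto.
rewrite IH by (intros; eapply H; right; eauto). rewrite (H g b) by (left; auto). auto.
Qed.
End Words.

Lemma weval_hom {G H : group} (f : G -> H) x w : hom f -> f (weval x w) = weval (fun g => f (x g)) w.
Proof.
intros Hf. induction w as [|[g b] w IH]; simpl; [apply (hom1 f Hf)|].
rewrite Hf, IH. destruct b; auto. rewrite (homV f Hf). auto.
Qed.

Definition conjw (g : gen) (n : nat) (t : gen) : word :=
 repeat (g, true) n ++ (t, true) :: winv (repeat (g, true) n).

Lemma weval_conjw {G : group} (x : gen -> G) g n t : weval x (conjw g n t) = gconj (gpow (x g) n) (x t).
Proof. unfold conjw. rewrite weval_app. simpl. rewrite weval_inv, weval_repeat. auto. Qed.

Section Presentation.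
Variables (Rs : list rule) (d acc : nat).

Definition rule_words (j : nat) (r : rule) : list (word * word) :=
 [ ((GR j, true) :: repeat (GX (r_reg r), true) (r_m r), repeat (GX (r_reg r), true) (r_p r) ++ [(GR j, true)]);
  ((GR j, true) :: conjw (GX (r_reg r)) (r_a r) (GT (r_src r)),
   conjw (GX (r_reg r)) (r_c r) (GT (r_dst r)) ++ [(GR j, true)]);
  ([(GK, true); (GR j, true)], [(GR j, true); (GK, true)]) ] ++
 flat_map (fun k => if k =? r_reg r then []
           else [([(GR j, true); (GX k, true)], [(GX k, true); (GR j, true)])]) (seq 0 d).

Definition machine_words : list (word * word) :=
 ([(GK, true); (GT acc, true)], [(GT acc, true); (GT acc, true); (GK, true)]) ::
 flat_map (fun i => map (fun k => ([(GX i, true); (GX k, true)], [(GX k, true); (GX i, true)])) (seq 0 d)) (seq 0 d)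
 ++ flat_map (fun j => match nth_error Rs j with Some r => rule_words j r | None => [] end) (seq 0 (length Rs)).

Definition states : list nat := 0 :: acc :: map r_src Rs ++ map r_dst Rs.
Definition base_gens : list gen :=
 map GX (seq 0 d) ++ map GT states ++ map GR (seq 0 (length Rs)) ++ [GK].
Definition targets : list gen := GZ :: GY :: base_gens.
(** [T acc] kills [GZ], and [GZ] kills everything else. A base letter is killed in its product with
    [GY], which has infinite order and is free from [GZ] in the model whatever the order of that
    letter is; [GY] itself is also a target. *)
Definition killer (s : gen) : gen := match s with GZ => GT acc | _ => GZ end.
Definition target_word (s : gen) : word :=
 match s with GZ | GY => [(s, true)] | _ => [(s, true); (GY, true)] end.
Definition fixed_gens : list gen := targets ++ map GE targets.

Section Eval.
Context {G : group} (x : gen -> G).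
Definition kills_all : Prop :=
 forall s, In s targets -> kills (x (killer s)) (x (GE s)) (weval x (target_word s)).
(** The conjugate by a power of [GX 0] is built up one step at a time, so that the relators have
    bounded length and the same shape at every stage. *)
Definition chain : Prop :=
 x (GC 0) = x (GT 0) /\ forall i, x (GC (S i)) = gconj (x (GX 0)) (x (GC i)).

Lemma machine_words_rel : (forall u v, In (u, v) machine_words -> weval x u = weval x v) <->
 machine_rel Rs d acc (fun i => x (GX i)) (fun q => x (GT q)) (fun j => x (GR j)) (x GK).
Proof.
unfold machine_rel, machine_words. split.
- intros H. split; [|split].
 + intros i k Hi Hk. specialize (H [(GX i, true); (GX k, true)] [(GX k, true); (GX i, true)]).
  simpl weval in H. rewrite !gone_r in H. apply H. right. apply in_or_app; left.
  apply in_flat_map. exists i. rewrite in_seq. split; [lia|].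
  apply in_map_iff. exists k. rewrite in_seq. split; auto; lia.
 + intros j r Hr.
  assert (H' : forall u v, In (u, v) (rule_words j r) -> weval x u = weval x v).
  { intros u v I. apply H. right. apply in_or_app; right. apply in_flat_map. exists j.
   rewrite Hr. split; auto. apply in_seq.
   assert (j < length Rs) by (apply nth_error_Some; congruence). lia. }
  clear H. unfold rule_words in H'.
  pose proof (H' _ _ (or_introl eq_refl)) as H1.
  pose proof (H' _ _ (or_intror (or_introl eq_refl))) as H2.
  pose proof (H' _ _ (or_intror (or_intror (or_introl eq_refl)))) as H3.
  simpl weval in H1, H2, H3. rewrite weval_app, !weval_repeat in H1.
  rewrite weval_app, !weval_conjw in H2. simpl in H1, H2. rewrite !gone_r in *.
  split; [|split; [|split]]; auto.
  intros k Hk Nk. specialize (H' [(GR j, true); (GX k, true)] [(GX k, true); (GR j, true)]).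
  simpl weval in H'. rewrite !gone_r in H'. apply H'. do 3 right. apply in_flat_map. exists k.
  rewrite in_seq. split; [lia|]. rewrite (proj2 (Nat.eqb_neq _ _) Nk). left; auto.
 + specialize (H _ _ (or_introl eq_refl)). simpl in H. rewrite !gone_r in H. auto.
- intros (H1 & H2 & H3) u v [E|I].
 + injection E as <- <-. simpl. rewrite !gone_r. auto.
 + apply in_app_or in I as [I|I]; apply in_flat_map in I as (j & Hj & I).
  * apply in_map_iff in I as (k & E & Hk). injection E as <- <-. simpl. rewrite !gone_r.
   apply in_seq in Hj, Hk. apply H1; lia.
  * destruct (nth_error Rs j) as [r|] eqn:Hr; [|destruct I].
   destruct (H2 j r Hr) as (R1 & R2 & R3 & R4).
   apply in_app_or in I as [[E|[E|[E|[]]]]|I].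
   -- injection E as <- <-. simpl weval. rewrite weval_app, !weval_repeat. simpl. rewrite gone_r. auto.
   -- injection E as <- <-. simpl weval. rewrite weval_app, !weval_conjw. simpl. rewrite gone_r. auto.
   -- injection E as <- <-. simpl. rewrite !gone_r. auto.
   -- apply in_flat_map in I as (k & Hk & I). apply in_seq in Hk.
     destruct (Nat.eqb_spec k (r_reg r)); [destruct I|]. destruct I as [E|[]].
     injection E as <- <-. simpl. rewrite !gone_r. apply R2; auto; lia.
Qed.

Lemma chain_pow : chain -> forall i, x (GC i) = gconj (gpow (x (GX 0)) i) (x (GT 0)).
Proof.
intros [H0 HS] i. induction i.
- rewrite H0. unfold gconj; simpl. gsimp. auto.
- rewrite HS, IHi. unfold gconj; simpl. gsimp. auto.
Qed.

Lemma target_trivial : kills_all -> x (GT acc) = 1 -> forall s, In s targets -> x s = 1 /\ x (GE s) = 1.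
Proof.
intros Kl E.
assert (Ez : x GZ = 1 /\ x (GE GZ) = 1).
{ destruct (kills_1 _ _ _ (Kl GZ (or_introl eq_refl)) E) as [H1 H2].
 simpl in H2. rewrite gone_r in H2. auto. }
destruct Ez as [Ez Ez'].
assert (Ey : x GY = 1 /\ x (GE GY) = 1).
{ destruct (kills_1 _ _ _ (Kl GY (or_intror (or_introl eq_refl))) Ez) as [H1 H2].
 simpl in H2. rewrite gone_r in H2. auto. }
intros s Hs. destruct (Kl s Hs) as [K1 K2].
assert (s = GZ \/ s = GY \/ (x (killer s) = 1 /\ weval x (target_word s) = x s ** x GY)) as [->|[->|[H1 H2]]].
{ destruct s; simpl; rewrite ?gone_r; auto. }
- auto.
- auto.
- destruct (kills_1 _ _ _ (Kl s Hs) H1) as [H3 H4]. rewrite H2 in H4.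
 destruct Ey as [Ey _]. rewrite Ey, gone_r in H4. auto.
Qed.
End Eval.

Lemma in_base g : In g base_gens <->
 match g with GX i => i < d | GT q => In q states | GR j => j < length Rs | GK => True | _ => False end.
Proof.
unfold base_gens. rewrite !in_app_iff, !in_map_iff. split.
- intros [(i & <- & H)|[(i & <- & H)|[(i & <- & H)|[<-|[]]]]]; auto; apply in_seq in H; lia.
- destruct g; try tauto; intros H; [left|right; left|do 2 right; left|simpl; auto];
  eexists; split; auto; apply in_seq; lia.
Qed.
Lemma base_fixed s : In s base_gens -> In s fixed_gens.
Proof. intros H. apply in_or_app; left. right; right; auto. Qed.

Lemma killer_fixed s : In (killer s) fixed_gens.
Proof.
assert (H : In GZ fixed_gens) by (left; auto).
destruct s; try exact H. apply base_fixed, in_base. right; left; auto.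
Qed.

Lemma machine_words_gens u v g b : In (u, v) machine_words -> In (g, b) u \/ In (g, b) v ->
 (forall r, In r Rs -> rule_wf d r) -> In g base_gens.
Proof.
intros I H Wf.
assert (HX : forall i, i < d -> In (GX i) base_gens) by (intros; apply in_base; auto).
assert (HT : forall q, In q states -> In (GT q) base_gens) by (intros; apply in_base; auto).
assert (HK : In GK base_gens) by (apply in_base; auto).
destruct I as [E|I].
- assert (HA : In (GT acc) base_gens) by (apply HT; right; left; auto).
 injection E as <- <-. simpl in H. intuition congruence.
- apply in_app_or in I as [I|I]; apply in_flat_map in I as (j & Hj & I).
 + apply in_map_iff in I as (k & E & Hk). injection E as <- <-. apply in_seq in Hj, Hk.
  assert (In (GX j) base_gens) by (apply HX; lia). assert (In (GX k) base_gens) by (apply HX; lia).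
  simpl in H. intuition congruence.
 + destruct (nth_error Rs j) as [r|] eqn:Hr; [|destruct I].
  assert (HR : In (GR j) base_gens) by (apply in_base, nth_error_Some; congruence).
  assert (Hin : In r Rs) by (eapply nth_error_In; eauto).
  assert (Hi : In (GX (r_reg r)) base_gens) by (apply HX, (Wf r Hin)).
  assert (In (GT (r_src r)) base_gens /\ In (GT (r_dst r)) base_gens) as [Hs Ht].
  { split; apply HT; do 2 right; apply in_or_app; [left|right]; apply in_map; auto. }
  assert (Rep : forall h n b, In (g, b) (repeat (h, true) n) -> g = h).
  { intros h n b' Hn. apply repeat_spec in Hn. congruence. }
  assert (Cw : forall h n t, In (g, b) (conjw h n t) -> g = h \/ g = t).
  { intros h n t Hn. apply in_app_or in Hn as [Hn|[Hn|Hn]]; [left; eauto|right; congruence|].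
   apply in_winv in Hn as [b' Hn]. left; eauto. }
  apply in_app_or in I as [[E|[E|[E|[]]]]|I].
  * injection E as <- <-. destruct H as [[H|H]|H]; [congruence|apply Rep in H; congruence|].
   apply in_app_or in H as [H|[H|[]]]; [apply Rep in H|]; congruence.
  * injection E as <- <-. destruct H as [[H|H]|H]; [congruence|apply Cw in H as [H|H]; congruence|].
   apply in_app_or in H as [H|[H|[]]]; [apply Cw in H as [H|H]|]; congruence.
  * injection E as <- <-. simpl in H. intuition congruence.
  * apply in_flat_map in I as (k & Hk & I). apply in_seq in Hk.
   assert (In (GX k) base_gens) by (apply HX; lia).
   destruct (Nat.eqb_spec k (r_reg r)); [destruct I|]. destruct I as [E|[]].
   injection E as <- <-. simpl in H. intuition congruence.
Qed.

(* Acting by conjugation on the subgroup generated by the fixed generators turns central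
  relators into trivial ones; so the generators are central, and being perfect the subgroup
  is trivial. *)
Theorem central_collapse (G : group) (x : gen -> G) (N : nat) :
 (forall r, In r Rs -> rule_wf d r) -> 0 < d ->
 clos_refl_trans _ (zstep Rs) (0, upd (fun _ => 0%Z) 0 (Z.of_nat N)) (acc, fun _ => 0%Z) ->
 kills_all x -> chain x ->
 (forall u v s, In (u, v) (([(GK, true); (GC N, true)], [(GC N, true); (GK, true)]) :: machine_words) ->
   In s fixed_gens -> x s ** (weval x u ** (weval x v)^-1) = (weval x u ** (weval x v)^-1) ** x s) ->
 (forall s, In s fixed_gens -> x s = 1) /\ (forall i, x (GC i) = 1).
Proof.
intros Wf Hd Run Kl Ch Cen.
set (P := fun g : G => exists w, (forall h b, In (h, b) w -> In h fixed_gens) /\ weval x w = g).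
assert (P1 : P 1) by (exists []; split; auto; intros h b []).
assert (PM : forall g h, P g -> P h -> P (g ** h)).
{ intros g h (w & H & <-) (w' & H' & <-). exists (w ++ w'). rewrite weval_app. split; auto.
 intros k b I. apply in_app_or in I as [I|I]; eauto. }
assert (PV : forall g, P g -> P g^-1).
{ intros g (w & H & <-). exists (winv w). rewrite weval_inv. split; auto.
 intros k b I. apply in_winv in I as [b' I]. eauto. }
assert (Pg : forall s, In s fixed_gens -> P (x s)).
{ intros s Hs. exists [(s, true)]. split; [|apply gone_r]. intros h b [E|[]]. congruence. }
set (E := subG G P P1 PM PV).
assert (cj : forall e : E, {p : Sym E | forall y, pf p y = gconj e y}).
{ intros e. unshelve eexists.
 - refine (Perm (fun y : E => gconj e y) (fun y => gconj e^-1 y) _ _); intros y; unfold gconj; gsimp; auto.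
 - auto. }
set (phi := fun e => proj1_sig (cj e)).
assert (Hphi : forall e y, pf (phi e) y = gconj e y) by (intros e; apply (proj2_sig (cj e))).
assert (hphi : hom phi).
{ intros e e'. apply perm_ext. intros y. change (pf (phi (e ** e')) y = pf (phi e) (pf (phi e') y)).
 rewrite !Hphi. unfold gconj; gsimp; auto. }
assert (Central : forall e : E, (forall s, In s fixed_gens -> x s ** proj1_sig e = proj1_sig e ** x s) -> phi e = 1).
{ intros e He. apply perm_ext. intros [y (w & Hw & Ey)]. rewrite Hphi. apply sub_ext. simpl.
 rewrite <- gassoc. apply (gcancel_r (proj1_sig e)). rewrite gassoc, ginv_l, gone_r. clear cj phi Hphi hphi.
 subst y. induction w as [|[g b] w IH]; simpl; [gsimp; auto|].
 assert (Hg : x g ** proj1_sig e = proj1_sig e ** x g) by (eapply He, Hw; left; reflexivity).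
 rewrite gassoc, <- IH by (intros; eapply Hw; right; eauto). rewrite <- !gassoc. f_equal.
 destruct b; auto. apply (gcancel_l (x g)). rewrite <- gassoc, Hg. gsimp. auto. }
(* Letters whose value is outside the subgroup get the default 1; all letters in the relations below
   have their values inside. *)
set (lift := fun g : gen => match em (P (x g)) with
              | left H => exist P (x g) H : E | right _ => 1 end).
assert (Hl : forall g, P (x g) -> proj1_sig (lift g) = x g).
{ intros g H. unfold lift. destruct (em _); [auto|tauto]. }
set (xb := fun g => phi (lift g)).
assert (PC : forall i, P (x (GC i))).
{ destruct Ch as [C0 CS]. induction i.
 - rewrite C0. apply Pg, base_fixed, in_base. left; auto.
 - rewrite CS. assert (P (x (GX 0))) by (apply Pg, base_fixed, in_base; auto). apply PM; auto. }
assert (Hw : forall w, (forall g b, In (g, b) w -> P (x g)) -> proj1_sig (weval lift w) = weval x w).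
{ intros w H. rewrite (weval_hom (fun e : E => proj1_sig e) lift w) by (intros a b; auto).
 apply weval_ext. intros g b I. apply Hl. eauto. }
assert (Hxb : forall w, weval xb w = phi (weval lift w)) by (intros w; symmetry; apply (weval_hom phi lift w hphi)).
assert (Rel : forall u v, In (u, v) (([(GK, true); (GC N, true)], [(GC N, true); (GK, true)]) :: machine_words) ->
 weval xb u = weval xb v).
{ intros u v I.
 assert (Pu : forall g b, In (g, b) u \/ In (g, b) v -> P (x g)).
 { destruct I as [Eq|I].
  - injection Eq as <- <-. assert (P (x GK)) by (apply Pg, base_fixed, in_base; auto).
   pose proof (PC N). simpl. intuition congruence.
  - intros g b H. apply Pg, base_fixed. eapply machine_words_gens; eauto. }
 rewrite !Hxb. apply geq_of_div. rewrite <- (homV phi hphi), <- hphi. apply Central.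
 intros s Hs. simpl. rewrite !Hw by eauto. apply Cen; auto. }
assert (Klb : kills_all xb).
{ intros s Hs. destruct (Kl s Hs) as [K1 K2].
 assert (Q1 : P (x (killer s))) by apply Pg, killer_fixed.
 assert (Q2 : P (x (GE s))) by (apply Pg, in_or_app; right; apply in_map; auto).
 assert (Q3 : forall g b, In (g, b) (target_word s) -> P (x g)).
 { intros g b I. apply Pg, in_or_app; left.
  assert (g = s \/ g = GY) as [-> | ->]; [|auto|right; left; auto].
  destruct s; simpl in I; intuition congruence. }
 rewrite Hxb. unfold xb. split; rewrite <- !hphi; f_equal; apply sub_ext; simpl;
  rewrite ?Hw, ?Hl by eauto; auto. }
assert (Chb : chain xb).
{ destruct Ch as [C0 CS].
 assert (Q : P (x (GX 0))) by (apply Pg, base_fixed, in_base; auto).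
 assert (Q' : P (x (GT 0))) by (rewrite <- C0; apply (PC 0)).
 split; [|intros i]; unfold xb, gconj; rewrite <- ?(homV phi hphi), <- ?hphi; f_equal; apply sub_ext; simpl;
  rewrite ?Hl; auto. }
assert (Ta : xb (GT acc) = 1).
{ eapply (halting_collapse (Sym E) Rs d acc (fun i => xb (GX i)) (fun q => xb (GT q)) (fun j => xb (GR j)) (xb GK));
  eauto.
 - apply machine_words_rel. intros u v I. apply Rel. right; auto.
 - specialize (Rel _ _ (or_introl eq_refl)). cbn [weval] in Rel. rewrite !gone_r in Rel.
  rewrite <- chain_pow by auto. auto. }
assert (Tr : forall s, In s fixed_gens -> xb s = 1).
{ intros s Hs. apply in_app_or in Hs as [Hs|Hs]; [apply target_trivial; auto|].
 apply in_map_iff in Hs as (s' & <- & Hs). apply target_trivial; auto. }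
(* [xb s = 1] says that conjugation by [x s] is trivial on the subgroup, which contains [x s']. *)
assert (Com : forall s s', In s fixed_gens -> In s' fixed_gens -> x s ** x s' = x s' ** x s).
{ intros s s' Hs Hs'. specialize (Tr s Hs).
 apply (f_equal (fun p : perm E => proj1_sig (pf p (lift s')))) in Tr.
 unfold xb in Tr. rewrite Hphi in Tr. simpl in Tr. rewrite !Hl in Tr by auto.
 rewrite <- Tr at 2. gsimp. auto. }
(* This is where perfectness enters: among commuting elements a relation [a e = e e a] forces
   [e = 1]. *)
assert (KE : forall s, In s targets -> x (GE s) = 1 /\ weval x (target_word s) = 1).
{ intros s Hs. destruct (Kl s Hs) as [K1 K2].
 assert (Q1 : In (killer s) fixed_gens) by apply killer_fixed.
 assert (Q2 : In (GE s) fixed_gens) by (apply in_or_app; right; apply in_map; auto).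
 assert (E1 : x (GE s) = 1).
 { rewrite (Com (killer s) (GE s)) in K1 by auto. apply gcancel_l in K1.
  apply (gcancel_r (x (killer s))). rewrite gone_l. auto. }
 split; auto. rewrite E1, gone_l, gone_r in K2.
 apply (gcancel_l (weval x (target_word s))). rewrite gone_r. auto. }
assert (Ey : x GY = 1).
{ destruct (KE GY (or_intror (or_introl eq_refl))) as [_ H]. simpl in H. rewrite gone_r in H. auto. }
assert (All : forall s, In s fixed_gens -> x s = 1).
{ intros s Hs. apply in_app_or in Hs as [Hs|Hs].
 - destruct (KE s Hs) as [_ H]. destruct s; simpl in H; rewrite ?Ey, ?gone_r in H; auto.
 - apply in_map_iff in Hs as (s' & <- & Hs). apply KE; auto. }
split; auto. intros i. rewrite chain_pow by auto.
rewrite (All (GT 0)); [unfold gconj; gsimp; auto|]. apply base_fixed, in_base. left; auto.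
Qed.

(** To the model of the rule system the letters [y] and [z] are added, then a killer for each
    target. The only freeness that depends on the rules is that of [T acc] and [z], and it comes
    from the infinite order of [T acc]. *)
Theorem presentation_model (N : nat) :
 (forall r, In r Rs -> rule_wf d r /\ r_src r <> acc) -> deterministic Rs ->
 ~ clos_refl_trans _ (zstep Rs) (0, upd (fun _ => 0%Z) 0 (Z.of_nat N)) (acc, fun _ => 0%Z) ->
 exists (G : group) (x : gen -> G),
  kills_all x /\ chain x /\ (forall j, x (GG j) = 1) /\ infinite_order (x (GT acc)) /\
  forall u v, In (u, v) (([(GK, true); (GC N, true)], [(GC N, true); (GK, true)]) :: machine_words) ->
   weval x u = weval x v.
Proof.
intros Wf Det NR. destruct (machine_model Rs d acc N Wf Det NR) as (M & X & T & Rj & K & Rel & EK & Inf).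
destruct (add_letters M) as (M1 & j1 & y & z & I1 & FT & Fy & Fs).
set (x1 := fun g => match g with
          | GX i => j1 (X i) | GT q => j1 (T q) | GR j => j1 (Rj j) | GK => j1 K
          | GY => y | GZ => z | _ => 1 end).
destruct (add_killers gen targets M1 (fun s => x1 (killer s)) (fun s => weval x1 (target_word s)))
 as (M2 & j2 & I2 & Kl).
{ intros s [<-|[<-|Hs]]; [| |apply in_base in Hs; destruct s; try tauto]; simpl; rewrite gone_r; auto. }
set (ee := fun s => epsilon (inhabits (1 : M2)) (fun e => kills (j2 (x1 (killer s))) e (j2 (weval x1 (target_word s))))).
set (x := fun g => match g with
          | GE s => ee s | GC i => j2 (gconj (gpow (x1 (GX 0)) i) (x1 (GT 0))) | GG _ => 1 | _ => j2 (x1 g) end).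
destruct I1 as [h1 i1], I2 as [h2 i2].
assert (Hx : forall s, In s targets -> x s = j2 (x1 s)).
{ intros s [<-|[<-|Hs]]; auto. apply in_base in Hs; destruct s; tauto. }
exists M2, x. split; [|split; [|split; [|split]]].
- intros s Hs. destruct (Kl s Hs) as [e He].
 assert (E : kills (j2 (x1 (killer s))) (ee s) (j2 (weval x1 (target_word s)))).
 { apply (epsilon_spec (inhabits (1 : M2)) (fun e => kills (j2 (x1 (killer s))) e (j2 (weval x1 (target_word s))))).
  eauto. }
 replace (x (killer s)) with (j2 (x1 (killer s))) by (destruct s; auto).
 replace (weval x (target_word s)) with (j2 (weval x1 (target_word s))); auto.
 rewrite (weval_hom j2) by auto. apply weval_ext. intros g b I.
 destruct s; simpl in I; repeat (destruct I as [I|I]; [injection I as <- _; auto; try (symmetry; apply Hx; auto)|]); try destruct I.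
- split.
 + simpl. unfold gconj; simpl. gsimp. auto.
 + intros i. simpl. unfold gconj; simpl. rewrite !h2, !(homV j2 h2), ?h2. gsimp. auto.
- auto.
- intros k Hk E. simpl in E. rewrite <- (zpow_hom (fun g => j2 (j1 g))) in E by (apply hom_comp; auto).
 apply i2, i1 in E. apply (Inf k Hk E).
- intros u v [E|I].
 + injection E as <- <-. simpl. rewrite !gone_r, <- !h2. apply f_equal.
  assert (G1 : forall i, gpow (j1 (X 0)) i = j1 (gpow (X 0) i)).
  { intros i. rewrite <- !zpow_nat. symmetry; apply zpow_hom; auto. }
  unfold gconj. rewrite G1, <- (homV j1 h1), <- !h1. apply f_equal. auto.
 + revert u v I. apply machine_words_rel.
  assert (G1 : forall a i, gpow (j2 (j1 a)) i = j2 (j1 (gpow a i))).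
  { intros a i. rewrite <- !zpow_nat. symmetry; apply (zpow_hom (fun g => j2 (j1 g))), hom_comp; auto. }
  set (f := fun g => j2 (j1 g)).
  assert (hf : hom f) by exact (hom_comp j1 j2 h1 h2).
  assert (G2 : forall a b, gconj (f a) (f b) = f (gconj a b)).
  { intros a b. unfold gconj. rewrite <- (homV f hf), <- !hf. auto. }
  simpl. destruct Rel as (R1 & R2 & R3). split; [|split].
  * intros i k Hi Hk. change (f (X i) ** f (X k) = f (X k) ** f (X i)). rewrite <- !hf. apply f_equal; auto.
  * intros j r Hr. destruct (R2 j r Hr) as (S1 & S2 & S3 & S4).
   repeat split; try (intros k Hk Nk); rewrite ?G1;
    repeat match goal with |- context [j2 (j1 ?a)] => change (j2 (j1 a)) with (f a) end;
    rewrite ?G2, <- !hf; apply f_equal; auto.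
  * repeat match goal with |- context [j2 (j1 ?a)] => change (j2 (j1 a)) with (f a) end.
   rewrite <- !hf. apply f_equal; auto.
Qed.
End Presentation.

Ltac subset := let y := fresh in let Hy := fresh in intros y Hy; simpl in Hy |- *; clear - Hy; tauto.

(** * Ordered simplicial cochains *)

Section Cochains.
Context {V : Type}.
Implicit Types (a b : list V -> R) (s t l : list V).

(** The alternating sum over the faces, with the first vertex split off so that identities are
    inductions on the tuple. Tuples come in every order and may repeat vertices. *)
Fixpoint D a s : R := match s with [] => 0%R | x :: s => (a s - D (fun l => a (x :: l)) s)%R end.

Lemma D_ext a b s : (forall t, incl t s -> S (length t) = length s -> a t = b t) -> D a s = D b s.
Proof.
revert a b. induction s as [|x s IH]; intros a b H; simpl; auto. f_equal.
- apply H; auto. apply incl_tl, incl_refl.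
- apply IH. intros t I L. apply H; [|simpl; auto]. intros y [<-|Hy]; [left|right]; auto.
Qed.
Lemma D_scal (c : R) a s : D (fun l => c * a l)%R s = (c * D a s)%R.
Proof. revert a. induction s as [|x s IH]; intros a; simpl; [lra|]. rewrite IH. lra. Qed.
Lemma D_sub a b s : D (fun l => a l - b l)%R s = (D a s - D b s)%R.
Proof. revert a b. induction s as [|x s IH]; intros a b; simpl; [lra|]. rewrite IH. lra. Qed.
Lemma D_zero a s : (forall t, incl t s -> S (length t) = length s -> a t = 0%R) -> D a s = 0%R.
Proof.
intros H. rewrite (D_ext a (fun _ => 0 * 0)%R) by (intros; rewrite H; auto; lra).
rewrite (D_scal 0 (fun _ => 0%R)). lra.
Qed.
Lemma D_D a s : D (D a) s = 0%R.
Proof.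
revert a. induction s as [|x s IH]; intros a; simpl; auto.
rewrite (D_sub a (D (fun l => a (x :: l)))), IH. lra.
Qed.

Definition closed (P : list V -> Prop) : Prop := forall s t, P s -> incl t s -> P t.

(* Vanishing of the [n]-th real cohomology, computed on all tuples
  satisfying [P]; it is reduced for [n = 0], since [D b [x] = b []]. *)
Definition Hv (P : list V -> Prop) (n : nat) : Prop :=
 forall a, (forall s, P s -> length s = S (S n) -> D a s = 0%R) ->
  exists b, forall s, P s -> length s = S n -> D b s = a s.

Lemma Hv_ext (P Q : list V -> Prop) n : (forall s, P s <-> Q s) -> Hv P n -> Hv Q n.
Proof.
intros E H a Ha. destruct (H a) as [b Hb].
- intros s Hs. apply Ha, E, Hs.
- exists b. intros s Hs. apply Hb, E, Hs.
Qed.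

(** Mayer-Vietoris. The primitives on the two parts differ on the intersection by a cocycle; it
    suffices that this is, up to a coboundary, the restriction of a cocycle [g] of [P], for [g] can
    be subtracted from the primitive on [P]. *)
Lemma Hv_union_ext (P Q : list V -> Prop) n : closed P -> closed Q -> Hv P (S n) -> Hv Q (S n) ->
 (forall f, (forall s, P s -> Q s -> length s = S (S n) -> D f s = 0%R) ->
   exists g c, (forall s, P s -> length s = S (S n) -> D g s = 0%R) /\
    forall s, P s -> Q s -> length s = S n -> f s = (g s + D c s)%R) ->
 Hv (fun s => P s \/ Q s) (S n).
Proof.
intros CP CQ HP HQ X a Ha.
destruct (HP a) as [bP HbP]; [intros; apply Ha; auto|].
destruct (HQ a) as [bQ HbQ]; [intros; apply Ha; auto|].
destruct (X (fun l => bP l - bQ l)%R) as (g & c & Hg & Hc).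
{ intros s Ps Qs L. rewrite D_sub, HbP, HbQ by auto. lra. }
exists (fun s => if em (P s) then (bP s - g s - D c s)%R else bQ s).
intros s Hs L. destruct (classic (P s)) as [Ps|NPs].
- rewrite (D_ext _ (fun s => (bP s - g s) - D c s)%R).
 + rewrite (D_sub (fun s => bP s - g s)%R), (D_sub bP), D_D, HbP, Hg by auto. lra.
 + intros t I _. destruct (em (P t)); auto. destruct n0. eapply CP; eauto.
- destruct Hs as [Ps|Qs]; [tauto|]. rewrite (D_ext _ bQ); [apply HbQ; auto|].
 intros t I Lt. destruct (em (P t)) as [Pt|]; auto.
 assert (Qt : Q t) by (eapply CQ; eauto).
 assert (E := Hc t Pt Qt). rewrite L in Lt. specialize (E (eq_add_S _ _ Lt)). lra.
Qed.

Lemma Hv_union (P Q : list V -> Prop) n : closed P -> closed Q -> Hv P (S n) -> Hv Q (S n) ->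
 Hv (fun s => P s /\ Q s) n -> Hv (fun s => P s \/ Q s) (S n).
Proof.
intros CP CQ HP HQ HI. apply Hv_union_ext; auto. intros f Hf.
destruct (HI f) as [c Hc]; [intros s []; auto|].
exists (fun _ => 0%R), c. split.
- intros. apply D_zero; auto.
- intros s Ps Qs L. rewrite Hc by auto. lra.
Qed.

Lemma Hv_cone (P : list V -> Prop) x n : (forall s, P s -> P (x :: s)) -> Hv P n.
Proof.
intros C a Ha. exists (fun s => a (x :: s)). intros s Ps L.
specialize (Ha (x :: s) (C s Ps)). simpl in Ha. rewrite L in Ha. specialize (Ha eq_refl). lra.
Qed.

Definition fc (F : list (list V)) (s : list V) : Prop := exists f, In f F /\ incl s f.

Lemma fc_closed F : closed (fc F).
Proof. intros s t (f & H & I) It. exists f. split; auto. eapply incl_tran; eauto. Qed.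
Lemma incl_closed f : closed (fun s => incl s f).
Proof. intros s t H It. eapply incl_tran; eauto. Qed.
Lemma or_closed (P Q : list V -> Prop) : closed P -> closed Q -> closed (fun s => P s \/ Q s).
Proof. intros CP CQ s t [H|H] I; eauto. Qed.
Lemma Hv_simplex f n : Hv (fun s => incl s f) n.
Proof.
destruct f as [|x f].
- intros a _. exists a. intros s I L. apply incl_l_nil in I. subst. easy.
- apply Hv_cone with (x := x). intros s I y [<-|Hy]; [left|]; auto.
Qed.

Definition meet (f g : list V) : list V :=
 filter (fun x => if em (In x g) then true else false) f.
Lemma in_meet x f g : In x (meet f g) <-> In x f /\ In x g.
Proof.
unfold meet. rewrite filter_In. destruct (em (In x g)); intuition congruence.
Qed.
Lemma incl_meet s f g : incl s (meet f g) <-> incl s f /\ incl s g.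
Proof.
split.
- intros H; split; intros x Hx; apply H, in_meet in Hx; tauto.
- intros [H1 H2] x Hx. apply in_meet; auto.
Qed.
Lemma meet_length f g : ~ incl f g -> length (meet f g) < length f.
Proof.
induction f as [|x f IH]; intros N; [destruct N; intros y []|].
unfold meet; simpl. fold (meet f g). destruct (em (In x g)) as [I|I]; simpl.
- enough (length (meet f g) < length f) by lia. apply IH. intros I'. apply N.
 intros y [<-|Hy]; auto.
- unfold meet. pose proof (filter_length_le (fun x => if em (In x g) then true else false) f). lia.
Qed.

(* Peeling off one facet at a time; the facet meets the others in dimension one less. *)
Lemma facet_induction (Q : nat -> (list V -> Prop) -> Prop) :
 (forall n P P', (forall s, P s <-> P' s) -> Q n P -> Q n P') ->
 (forall F, (forall f, In f F -> f = []) -> Q 0 (fc F)) ->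
 (forall n, Q (S n) (fc [])) ->
 (forall n f F, Q (S n) (fc F) -> Q n (fun s => incl s f /\ fc F s) -> Q (S n) (fun s => incl s f \/ fc F s)) ->
 forall n F, (forall f, In f F -> length f <= n) -> Q n (fc F).
Proof.
intros Qext Q0 Qnil Qcons. induction n as [|n IHn]; intros F HF.
- apply Q0. intros f Hf. specialize (HF f Hf). destruct f; auto. simpl in HF; lia.
- induction F as [|f F IHF]; [apply Qnil|].
 assert (HF' : Q (S n) (fc F)) by (apply IHF; intros; apply HF; right; auto).
 destruct (classic (exists g, In g F /\ incl f g)) as [(g & Hg & I)|N].
 + apply Qext with (P := fc F); auto. intros s; split.
  * intros (h & Hh & Is). exists h. split; auto. right; auto.
  * intros (h & [<-|Hh] & Is); [exists g; split; auto; eapply incl_tran; eauto|exists h; auto].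
 + apply Qext with (P := fun s => incl s f \/ fc F s).
  * intros s; split.
   -- intros [I|(h & Hh & I)]; [exists f|exists h]; split; auto; [left|right]; auto.
   -- intros (h & [<-|Hh] & Is); [left; auto|right; exists h; auto].
  * apply Qcons; auto. apply Qext with (P := fc (map (meet f) F)).
   -- intros s; split.
     ++ intros (h & Hh & I). apply in_map_iff in Hh as (g & <- & Hg). apply incl_meet in I as [I1 I2].
      split; auto. exists g; auto.
     ++ intros (I1 & g & Hg & I2). exists (meet f g). split; [apply in_map; auto|apply incl_meet; auto].
   -- apply IHn. intros h Hh. apply in_map_iff in Hh as (g & <- & Hg).
     assert (~ incl f g) by (intro; apply N; eauto). pose proof (meet_length f g H).
     pose proof (HF f (or_introl eq_refl)). lia.
Qed.

(** At most [n] vertices means dimension below [n], but there are still degenerate tuples in degree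
    [n]. Mayer-Vietoris for one facet and the rest reduces them to an intersection of lower
    dimension. *)
Lemma Hv_dim n F : (forall f, In f F -> length f <= n) -> Hv (fc F) n.
Proof.
revert n F. apply (facet_induction (fun n P => Hv P n)).
- intros n P P' E H. eapply Hv_ext; eauto.
- intros F HF a _. exists a. intros s (f & Hf & I) L. rewrite (HF f Hf) in I.
 apply incl_l_nil in I. subst; easy.
- intros n a _. exists a. intros s (f & [] & _).
- intros n f F H1 H2. apply Hv_union; auto; [apply incl_closed|apply fc_closed|apply Hv_simplex].
Qed.

(** The prism operator from the identity to [f]: a signed sum over the positions at which the tuple
    switches to its image. *)
Fixpoint Hp (f : V -> V) a s : R :=
 match s with
 | [] => 0%R
 | x :: s => (a (x :: f x :: map f s) - Hp f (fun l => a (x :: l)) s)%R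
 end.

Lemma Hp_sub f a b s : Hp f (fun l => a l - b l)%R s = (Hp f a s - Hp f b s)%R.
Proof. revert a b. induction s as [|x s IH]; intros a b; simpl; [lra|]. rewrite IH. lra. Qed.

Lemma Hp_ext f a b s : (forall t, incl t (s ++ map f s) -> length t = S (length s) -> a t = b t) ->
 Hp f a s = Hp f b s.
Proof.
revert a b. induction s as [|x s IH]; intros a b H; simpl; auto. f_equal.
- apply H; [|simpl; rewrite length_map; auto]. intros y [<-|[<-|Hy]].
 + left; auto.
 + apply in_or_app; right. left; auto.
 + apply in_or_app; right. right; auto.
- apply IH. intros t I L. apply H; [|simpl; auto]. intros y [<-|Hy]; [left; auto|].
 apply I, in_app_or in Hy. apply in_or_app. destruct Hy; [left; right|right; right]; auto.
Qed.
End Cochains.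

Lemma D_map {V W : Type} (f : V -> W) (a : list W -> R) s : D a (map f s) = D (fun l => a (map f l)) s.
Proof. revert a. induction s as [|x s IH]; intros a; simpl; auto. rewrite IH. auto. Qed.

Lemma Hp_homotopy {V : Type} (f : V -> V) a s : (D (Hp f a) s + Hp f (D a) s = a (map f s) - a s)%R.
Proof.
revert a. induction s as [|x s IH]; intros a; simpl; [lra|].
rewrite (D_sub (fun l => a (x :: f x :: map f l)) (Hp f (fun l => a (x :: l)))).
rewrite <- (D_map f (fun l => a (x :: f x :: l))).
rewrite (Hp_sub f a (D (fun l => a (x :: l)))).
specialize (IH (fun l => a (x :: l))). lra.
Qed.

Lemma Hv_contiguous {V : Type} (f : V -> V) (P Q : list V -> Prop) n :
 closed P -> (forall s, P s -> P (s ++ map f s)) -> (forall s, P s -> Q (map f s)) ->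
 (forall s, Q s -> P s) -> Hv Q n -> Hv P n.
Proof.
intros CP Cf PQ QP HQ a Ha. destruct (HQ a) as [b Hb]; [intros; apply Ha; auto|].
exists (fun s => b (map f s) - Hp f a s)%R. intros s Ps L.
rewrite (D_sub (fun s => b (map f s))), <- (D_map f b), Hb by (rewrite ?length_map; auto).
pose proof (Hp_homotopy f a s) as E.
rewrite (Hp_ext f (D a) (fun l => 0 - 0)%R) in E.
- rewrite Hp_sub in E. lra.
- intros t I Lt. rewrite Ha; [lra| |lia]. apply (CP (s ++ map f s)); auto.
Qed.

Lemma Hv_retract {V W : Type} (g : V -> W) (r : W -> V) (P : list V -> Prop) (Q : list W -> Prop) n :
 (forall s, Q s -> P (map r s)) -> (forall t, P t -> Q (map g t)) ->
 (forall s, Q s -> map g (map r s) = s) -> Hv P n -> Hv Q n.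
Proof.
intros H1 H2 H3 HP a Ha. destruct (HP (fun s => a (map g s))) as [b Hb].
- intros s Ps L. rewrite <- D_map. apply Ha; rewrite ?length_map; auto.
- exists (fun s => b (map r s)). intros s Qs L. rewrite <- (D_map r b), Hb, H3 by (rewrite ?length_map; auto). auto.
Qed.

Definition prodc {V W : Type} (P : list V -> Prop) (L : list W -> Prop) (s : list (V * W)) : Prop :=
 P (map fst s) /\ L (map snd s).

Lemma incl_map {V W : Type} (f : V -> W) s t : incl s t -> incl (map f s) (map f t).
Proof. intros H y Hy. apply in_map_iff in Hy as (x & <- & Hx). apply in_map; auto. Qed.

Lemma prodc_closed {V W : Type} (P : list V -> Prop) (L : list W -> Prop) : closed P -> closed L -> closed (prodc P L).
Proof. intros CP CL s t [H1 H2] I. split; [eapply CP|eapply CL]; eauto using @incl_map. Qed.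

Lemma Hv_prod_simplex {V W : Type} (P : list V -> Prop) (f : list W) n :
 closed P -> Hv P n -> Hv (prodc P (fun s => incl s f)) n.
Proof.
intros CP HP. destruct f as [|i f].
- intros a _. exists a. intros s [_ I] L. apply incl_l_nil, map_eq_nil in I. subst; easy.
- assert (Hv (fun s : list (V * W) => P (map fst s) /\ forall x, In x s -> snd x = i) n).
 { eapply (Hv_retract (fun v => (v, i)) fst P); eauto.
  - intros s [H _]; auto.
  - intros t Ht. rewrite map_map. simpl. rewrite map_id. split; auto.
   intros x Hx. apply in_map_iff in Hx as (v & <- & _). auto.
  - intros s [_ H]. rewrite map_map. rewrite <- (map_id s) at 2. apply map_ext_in.
   intros [v j] Hx. specialize (H _ Hx). simpl in *. congruence. }
 eapply (Hv_contiguous (fun x => (fst x, i))); [| | | |exact H].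
 + apply prodc_closed; auto. apply incl_closed.
 + intros s [H1 H2]. split.
  * rewrite map_app, map_map. simpl. apply (CP (map fst s)); auto. apply incl_app; apply incl_refl.
  * rewrite map_app, map_map. simpl. apply incl_app; auto. intros y Hy.
   apply in_map_iff in Hy as (x & <- & _). left; auto.
 + intros s [H1 H2]. rewrite map_map. simpl. split; auto. intros x Hx.
  apply in_map_iff in Hx as (y & <- & _). auto.
 + intros s [H1 H2]. split; auto. intros y Hy. apply in_map_iff in Hy as (x & <- & Hx).
  left. symmetry; apply H2; auto.
Qed.

(** The case of the Kuenneth formula in which the degree exceeds the dimension of the second factor.
    Peeling a facet off that factor lowers its dimension and the degree together. *)
Lemma Hv_prod_dim {V W : Type} (P : list V -> Prop) n (F : list (list W)) : closed P ->
 (forall k, 1 <= k <= n -> Hv P k) -> (forall f, In f F -> length f <= n) -> Hv (prodc P (fc F)) n.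
Proof.
intros CP HP HF. revert HP. revert n F HF.
apply (facet_induction (fun n L => (forall k, 1 <= k <= n -> Hv P k) -> Hv (prodc P L) n)).
- intros n L L' E H HP. eapply Hv_ext; [|apply H; auto]. intros s. unfold prodc. rewrite E. tauto.
- intros F HF _ a _. exists a. intros s (_ & f & Hf & I) L. rewrite (HF f Hf) in I.
 apply incl_l_nil, map_eq_nil in I. subst; easy.
- intros n _ a _. exists a. intros s (_ & f & [] & _).
- intros n f F H1 H2 HP.
 apply Hv_ext with (P := fun s => prodc P (fun s => incl s f) s \/ prodc P (fc F) s).
 { intros s. unfold prodc. tauto. }
 apply Hv_union; auto.
 + apply prodc_closed; auto. apply incl_closed.
 + apply prodc_closed; auto. apply fc_closed.
 + apply Hv_prod_simplex; auto. apply HP. lia.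
 + eapply Hv_ext; [|apply H2; intros; apply HP; lia]. intros s. unfold prodc. tauto.
Qed.

(** * Alternating cochains and formal boundaries *)

Section Alternating.
Context {V : Type}.
Implicit Types (a u F : list V -> R) (l : list V).

Definition alt u : Prop := forall l1 x y l2, u (l1 ++ x :: y :: l2) = (- u (l1 ++ y :: x :: l2))%R.

Lemma alt_cons u x : alt u -> alt (fun l => u (x :: l)).
Proof. intros H l1 y z l2. apply (H (x :: l1)). Qed.

Lemma D_alt u : alt u -> alt (D u).
Proof.
intros H l1. revert u H. induction l1 as [|w l1 IH]; intros u H x y l2; simpl.
- rewrite (D_ext (fun l => u (y :: x :: l)) (fun l => -1 * u (x :: y :: l))%R).
 + rewrite (D_scal (-1) (fun l => u (x :: y :: l))). lra.
 + intros t _ _. pose proof (H [] y x t). simpl in *. lra.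
- rewrite H, (IH (fun l => u (w :: l))) by (apply alt_cons; auto). lra.
Qed.

Lemma alt_zero_perm u : alt u -> forall l l', Permutation l l' -> u l = 0%R -> u l' = 0%R.
Proof.
intros H l l' P. revert u H. induction P; intros u H E; auto.
- apply (IHP (fun l => u (x :: l))); auto. apply alt_cons; auto.
- pose proof (H [] x y l). simpl in *. lra.
Qed.

Lemma alt_dup u l : alt u -> ~ NoDup l -> u l = 0%R.
Proof.
intros H N.
assert (E : exists x l', Permutation (x :: x :: l') l).
{ clear u H. induction l as [|x l IH]; [destruct N; constructor|].
 destruct (classic (In x l)) as [I|I].
 - apply in_split in I as (l1 & l2 & ->). exists x, (l1 ++ l2). constructor. apply Permutation_middle.
 - destruct IH as (y & l' & P); [intro; apply N; constructor; auto|].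
  exists y, (x :: l'). rewrite <- P. apply Permutation_sym, perm_trans with (y :: x :: y :: l'); constructor.
  constructor. }
destruct E as (x & l' & P). apply (alt_zero_perm u H _ _ P).
pose proof (H [] x x l'). simpl in *. lra.
Qed.

Lemma D_alt_dup u l : alt u -> ~ NoDup l -> D u l = 0%R.
Proof. intros H. apply alt_dup, D_alt, H. Qed.

Lemma D_faces_zero F l : (forall k z m, l = k ++ z :: m -> F (k ++ m) = 0%R) -> D F l = 0%R.
Proof.
revert F. induction l as [|w l IH]; intros F H; simpl; auto.
rewrite IH; [pose proof (H [] w l eq_refl) as E; simpl in E; lra|]. intros k z m ->. apply (H (w :: k) z m eq_refl).
Qed.

Lemma D_two F l1 x y l2 :
 (forall k z m, l1 = k ++ z :: m -> F (k ++ m ++ x :: y :: l2) = 0%R) ->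
 (forall k z m, l2 = k ++ z :: m -> F (l1 ++ x :: y :: k ++ m) = 0%R) ->
 D F (l1 ++ x :: y :: l2) = ((-1) ^ length l1 * (F (l1 ++ y :: l2) - F (l1 ++ x :: l2)))%R.
Proof.
revert F. induction l1 as [|w l1 IH]; intros F H1 H2; simpl.
- rewrite (D_faces_zero (fun l => F (x :: y :: l))) by (intros k z m E; apply (H2 k z m E)). lra.
- pose proof (H1 [] w l1 eq_refl) as E0. simpl in E0. rewrite E0, IH.
 + simpl. ring.
 + intros k z m ->. apply (H1 (w :: k) z m eq_refl).
 + intros k z m Ek. apply (H2 k z m Ek).
Qed.

(* Since [D (D b) = 0], moving one vertex of a tuple does not change [D b] when the
  intermediate faces contribute nothing. *)
Lemma D_move b l1 x y l2 :
 (forall k z m, l1 = k ++ z :: m -> D b (k ++ m ++ x :: y :: l2) = 0%R) ->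
 (forall k z m, l2 = k ++ z :: m -> D b (l1 ++ x :: y :: k ++ m) = 0%R) ->
 D b (l1 ++ y :: l2) = D b (l1 ++ x :: l2).
Proof.
intros H1 H2. pose proof (D_two (D b) l1 x y l2 H1 H2) as E. rewrite D_D in E.
assert ((-1) ^ length l1 <> 0)%R by (apply pow_nonzero; lra). nra.
Qed.

(** [D b] need not be alternating. [D (D b) = 0] on the tuple [y, x, y] still gives the sign of one
    transposition if its remaining faces contribute nothing. *)
Lemma D_swap b l1 x y l2 :
 (forall k z m, l1 = k ++ z :: m -> D b (k ++ m ++ y :: x :: y :: l2) = 0%R) ->
 (forall k z m, l2 = k ++ z :: m -> D b (l1 ++ y :: x :: y :: k ++ m) = 0%R) ->
 D b (l1 ++ y :: y :: l2) = 0%R ->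
 D b (l1 ++ y :: x :: l2) = (- D b (l1 ++ x :: y :: l2))%R.
Proof.
intros H1 H2 H0.
enough (E : forall F, (forall k z m, l1 = k ++ z :: m -> F (k ++ m ++ y :: x :: y :: l2) = 0%R) ->
 (forall k z m, l2 = k ++ z :: m -> F (l1 ++ y :: x :: y :: k ++ m) = 0%R) ->
 D F (l1 ++ y :: x :: y :: l2) = ((-1) ^ length l1 *
  (F (l1 ++ x :: y :: l2) - F (l1 ++ y :: y :: l2) + F (l1 ++ y :: x :: l2)))%R).
{ specialize (E (D b) H1 H2). rewrite D_D, H0 in E.
 assert ((-1) ^ length l1 <> 0)%R by (apply pow_nonzero; lra). nra. }
clear. induction l1 as [|w l1 IH]; intros F H1 H2; simpl.
- rewrite (D_faces_zero (fun l => F (y :: x :: y :: l))) by (intros k z m E; apply (H2 k z m E)). lra.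
- pose proof (H1 [] w l1 eq_refl) as E0. simpl in E0. rewrite E0, IH.
 + simpl. ring.
 + intros k z m ->. apply (H1 (w :: k) z m eq_refl).
 + intros k z m Ek. apply (H2 k z m Ek).
Qed.
End Alternating.

Definition sgn_lt (x y : nat) : R := if x <? y then 1%R else if y <? x then (-1)%R else 0%R.
(** The sign of the permutation that sorts the tuple, and 0 if an entry repeats; as a product over
    pairs it is visibly alternating. *)
Fixpoint sg (l : list nat) : R :=
 match l with [] => 1%R | x :: l => (fold_right Rmult 1 (map (sgn_lt x) l) * sg l)%R end.

Lemma sg_alt : alt sg.
Proof.
intros l1. induction l1 as [|w l1 IH]; intros x y l2; simpl.
- assert (E : sgn_lt x y = (- sgn_lt y x)%R).
 { unfold sgn_lt. destruct (Nat.ltb_spec x y), (Nat.ltb_spec y x); try lia; lra. }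
 rewrite E. ring.
- rewrite (IH x y l2), !map_app, !fold_right_app. simpl.
 rewrite <- !Rmult_assoc, (Rmult_comm (sgn_lt w x)). ring.
Qed.

Lemma sg_sorted n k : sg (seq k n) = 1%R.
Proof.
revert k. induction n; intros k; simpl; auto. rewrite IHn.
assert (E : forall l, (forall y, In y l -> k < y) -> fold_right Rmult 1%R (map (sgn_lt k) l) = 1%R).
{ induction l as [|y l IH]; intros H; simpl; auto. rewrite IH by (intros; apply H; right; auto).
 unfold sgn_lt. rewrite (proj2 (Nat.ltb_lt k y)) by (apply H; left; auto). lra. }
rewrite E; [lra|]. intros y Hy. apply in_seq in Hy. lia.
Qed.

(** * Flat labellings *)

(** A cocycle of degree one with values in a possibly nonabelian group, that is, a representation of
    the groupoid of edge paths; [trivializes] makes it a coboundary. Quantifying over all groups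
    turns this into simple connectedness. *)
Definition flat_lab {V : Type} (P : list V -> Prop) {M : group} (l : V -> V -> M) : Prop :=
 forall u v w, P [u; v; w] -> l u v ** l v w = l u w.
Definition trivializes {V : Type} (P : list V -> Prop) {M : group} (l : V -> V -> M) (h : V -> M) : Prop :=
 forall u v, P [u; v] -> l u v = (h u)^-1 ** h v.
Definition RG : group := Group R Rplus 0%R Ropp Rplus_assoc Rplus_0_l Rplus_opp_l.

Section Labels.
Context {V : Type} {M : group} (P : list V -> Prop) (l : V -> V -> M).
Hypotheses (CP : closed P) (Fl : flat_lab P l).

Lemma flat_refl u : P [u] -> l u u = 1.
Proof.
intros H. apply (gcancel_l (l u u)). rewrite gone_r. apply Fl.
eapply CP; eauto. subset.
Qed.
Lemma flat_sym u v : P [u; v] -> l v u = (l u v)^-1.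
Proof.
intros H. apply ginv_unique. rewrite Fl.
- apply flat_refl. eapply CP; eauto. subset.
- eapply CP; eauto. subset.
Qed.
(** A potential that is right along the edges from one vertex of a simplex is right on all its
    edges, by flatness. *)
Lemma star_trivial f x (h : V -> M) : (forall s, incl s f -> P s) -> In x f ->
 (forall y, In y f -> h y = h x ** l x y) -> forall u v, incl [u; v] f -> l u v = (h u)^-1 ** h v.
Proof.
intros HP Hx H u v I.
assert (Hu : In u f) by (apply I; left; auto). assert (Hv : In v f) by (apply I; right; left; auto).
rewrite (H u Hu), (H v Hv). gsimp. rewrite <- (flat_sym x u).
- symmetry; apply Fl, HP. intros y [<-|[<-|[<-|[]]]]; auto.
- apply HP. intros y [<-|[<-|[]]]; auto.
Qed.
End Labels.

Lemma potential_flat {V : Type} {M : group} (l : V -> V -> M) (f : list V) (p : V -> M) :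
 (forall u v, In u f -> In v f -> l u v = (p u)^-1 ** p v) -> flat_lab (fun s => incl s f) l.
Proof.
intros H u v w I. rewrite !H by (apply I; simpl; auto). gsimp. auto.
Qed.

Lemma Hv_1_of_trivial {V : Type} (P : list V -> Prop) :
 (forall l : V -> V -> RG, flat_lab P l -> exists h, trivializes P l h) -> Hv P 1.
Proof.
intros T a Ha. destruct (T (fun u v => a [u; v])) as [h Hh].
- intros u v w Huvw. specialize (Ha _ Huvw eq_refl). simpl in *. lra.
- exists (fun s => match s with [v] => h v | _ => 0%R end). intros [|u [|v [|w s]]] Hs L; try easy.
 specialize (Hh u v Hs). simpl in *. lra.
Qed.

Fixpoint seqprod {M : group} (f : nat -> M) (n : nat) : M :=
 match n with 0 => 1 | S n => seqprod f n ** f n end.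

Ltac pick_in :=
 first [congruence | left; congruence | right; left; congruence | right; right; left; congruence
    | right; right; right; left; congruence].

(** * Attaching a disc along a closed path *)

Lemma half_even i : 2 * i / 2 = i /\ Nat.even (2 * i) = true.
Proof. rewrite Nat.even_mul, (Nat.mul_comm 2 i), Nat.div_mul by lia. auto. Qed.
Lemma half_odd i : (2 * i + 1) / 2 = i /\ Nat.even (2 * i + 1) = false.
Proof.
rewrite Nat.even_add, Nat.even_mul, (Nat.mul_comm 2 i), Nat.div_add_l by lia. simpl. split; auto; lia.
Qed.

Section Disc.
Context {V : Type} (P : list V -> Prop) (CP : closed P).
Variables (N : nat) (be r : nat -> V) (c : V) (kind : V -> option nat).
Hypotheses (N0 : 0 < N) (Pbe : forall i, i < N -> P [be i; be (S i)]) (beN : be N = be 0)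
 (rN : r (2 * N) = r 0) (kr : forall k, k < 2 * N -> kind (r k) = Some k)
 (kold : forall s v, P s -> In v s -> kind v = None) (kc : kind c = None)
 (cold : forall s, P s -> ~ In c s).

(** An annulus between the path and a ring of twice as many new vertices, three triangles for each
    edge. The path may run through a vertex or an edge several times; the ring does not, so a cone
    over it closes the disc. *)
Definition collar (i : nat) : list (list V) :=
 [[be i; r (2 * i); r (2 * i + 1)]; [be i; be (S i); r (2 * i + 1)]; [be (S i); r (2 * i + 1); r (2 * i + 2)]].
Definition collars : list (list V) := flat_map collar (seq 0 N).
Definition cones : list (list V) := map (fun k => [c; r k; r (S k)]) (seq 0 (2 * N)).
Definition ring : list (list V) := map (fun k => [r k; r (S k)]) (seq 0 (2 * N)).
Definition disc_cells : list (list V) := collars ++ cones.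
Definition with_disc (s : list V) : Prop := P s \/ fc disc_cells s.

Lemma with_disc_closed : closed with_disc.
Proof. apply or_closed; auto. apply fc_closed. Qed.

Lemma in_collars i f : i < N -> In f (collar i) -> In f collars.
Proof. intros Hi Hf. apply in_flat_map. exists i. rewrite in_seq. split; auto. lia. Qed.
Lemma in_cones k : k < 2 * N -> In [c; r k; r (S k)] cones.
Proof. intros Hk. apply (in_map (fun k => [c; r k; r (S k)])), in_seq. lia. Qed.
Lemma collar_disc i f s : i < N -> In f (collar i) -> incl s f -> with_disc s.
Proof. intros Hi Hf I. right. exists f. split; auto. apply in_or_app; left. eapply in_collars; eauto. Qed.
Lemma cone_disc k s : k < 2 * N -> incl s [c; r k; r (S k)] -> with_disc s.
Proof. intros Hk I. right. eexists; split; eauto. apply in_or_app; right. apply in_cones; auto. Qed.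

Lemma kr' k : k <= 2 * N -> exists k', k' < 2 * N /\ r k = r k' /\ kind (r k) = Some k' /\ (k' = k \/ k = 2 * N /\ k' = 0).
Proof.
intros Hk. destruct (Nat.eq_dec k (2 * N)) as [->|].
- exists 0. rewrite rN, kr by lia. repeat split; auto; lia.
- exists k. rewrite kr by lia. repeat split; auto; lia.
Qed.
Lemma r_not_c k : k <= 2 * N -> r k <> c.
Proof. intros Hk E. destruct (kr' k Hk) as (k' & _ & _ & E' & _). congruence. Qed.
Lemma P_be i : i <= N -> P [be i].
Proof.
intros Hi. destruct i; [eapply CP; [apply (Pbe 0 N0)|]|eapply CP; [apply (Pbe i); lia|]]; subset.
Qed.
Lemma be_old i : i <= N -> kind (be i) = None /\ be i <> c.
Proof.
intros Hi. assert (Hs := P_be i Hi). assert (Hb : In (be i) [be i]) by (left; auto).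
split; [eapply kold; eauto|]. intros E. rewrite E in *. eapply cold; eauto.
Qed.

(** [A i] is the label from [be i] over the ring to the centre. Each edge of the path changes it by
    its own label, and after a full turn it has returned to its initial value. *)
Lemma disc_holonomy (M : group) (l : V -> V -> M) : flat_lab with_disc l ->
 seqprod (fun i => l (be i) (be (S i))) N = 1.
Proof.
intros Fl. set (A := fun i => l (be i) (r (2 * i)) ** l (r (2 * i)) c).
assert (St : forall i, i < N -> A i = l (be i) (be (S i)) ** A (S i)).
{ intros i Hi. unfold A. replace (2 * S i) with (2 * i + 2) by lia.
 assert (T : forall f x y z, In f (collar i) -> incl [x; y; z] f -> l x y ** l y z = l x z).
 { intros f x y z Hf I. apply Fl. eapply collar_disc; eauto. }
 assert (C : forall k, k < 2 * N -> l (r k) c = l (r k) (r (S k)) ** l (r (S k)) c).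
 { intros k Hk. symmetry. apply Fl, (cone_disc k); auto. subset. }
 rewrite (C (2 * i)) by lia. replace (S (2 * i)) with (2 * i + 1) by lia.
 rewrite <- gassoc, (T _ _ _ _ (or_introl eq_refl)) by apply incl_refl.
 rewrite <- (T _ (be i) (be (S i)) (r (2 * i + 1)) (or_intror (or_introl eq_refl))) by apply incl_refl.
 rewrite gassoc. f_equal. rewrite (C (2 * i + 1)) by lia. replace (S (2 * i + 1)) with (2 * i + 2) by lia.
 rewrite <- gassoc, (T _ _ _ _ (or_intror (or_intror (or_introl eq_refl)))) by apply incl_refl. auto. }
assert (E : forall n, n <= N -> A 0 = seqprod (fun i => l (be i) (be (S i))) n ** A n).
{ induction n; intros Hn; simpl; [rewrite gone_l; auto|]. rewrite gassoc, <- St by lia. apply IHn. lia. }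
specialize (E N (le_n N)). assert (EA : A N = A 0) by (unfold A; rewrite beN, rN; auto).
rewrite EA in E. apply (gcancel_r (A 0)). rewrite <- E, gone_l. auto.
Qed.

(** Edges among ring vertices and centre get label 1, and an edge from the ring to the path gets the
    label of the path up to that point. The hypothesis on the total label is what closes the ring
    consistently. *)
Lemma disc_extend_label (M : group) (l : V -> V -> M) : flat_lab P l ->
 seqprod (fun i => l (be i) (be (S i))) N = 1 ->
 exists l', flat_lab with_disc l' /\
  forall u v, kind u = None -> kind v = None -> u <> c -> v <> c -> l' u v = l u v.
Proof.
intros Fl HN. set (H := seqprod (fun i => l (be i) (be (S i)))) in *.
set (new := fun v => v = c \/ kind v <> None).
(* An even ring vertex is joined only to [be (k / 2)], an odd one to both ends of its edge; hence
   the test on [u]. *)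
set (psi := fun v u => match kind v with
            | Some k => if Nat.even k then H (k / 2) else
             if em (u = be (k / 2)) then H (k / 2) else H (S (k / 2))
            | None => 1 end).
set (l' := fun u v => if em (new u)
       then (if em (new v) then 1 else psi u v)
       else (if em (new v) then (psi v u)^-1 else l u v)).
assert (Nr : forall k, k <= 2 * N -> new (r k)).
{ intros k Hk. destruct (kr' k Hk) as (k' & _ & _ & E & _). right. congruence. }
assert (Nb : forall i, i <= N -> ~ new (be i)).
{ intros i Hi. destruct (be_old i Hi). unfold new. tauto. }
assert (Lnn : forall u v, new u -> new v -> l' u v = 1) by (intros u v; unfold l'; destruct (em _), (em _); tauto).
assert (Lno : forall u v, new u -> ~ new v -> l' u v = psi u v) by (intros u v; unfold l'; destruct (em _), (em _); tauto).
assert (Lon : forall u v, ~ new u -> new v -> l' u v = (psi v u)^-1)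
 by (intros u v; unfold l'; destruct (em _), (em _); tauto).
assert (Loo : forall u v, ~ new u -> ~ new v -> l' u v = l u v) by (intros u v; unfold l'; destruct (em _), (em _); tauto).
assert (HS : forall i, H (S i) = H i ** l (be i) (be (S i))) by auto.
(* If both ends of an edge coincide, the test in [psi] cannot tell them apart, but then the two
   values agree. *)
assert (Lb : forall i, i < N -> be i = be (S i) -> H i = H (S i)).
{ intros i Hi E. rewrite HS, <- E, (flat_refl P l CP Fl), gone_r; auto.
 apply P_be; lia. }
assert (Even : forall i u, i <= N -> psi (r (2 * i)) u = H i).
{ intros i u Hi. destruct (kr' (2 * i)) as (k' & Hk & _ & E & [->|[E2 ->]]); [lia| |]; unfold psi; rewrite E.
 - destruct (half_even i) as [-> ->]. auto.
 - change (H 0 = H i). replace i with N by lia. rewrite HN. auto. }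
assert (Odd : forall i, i < N -> psi (r (2 * i + 1)) (be i) = H i /\ psi (r (2 * i + 1)) (be (S i)) = H (S i)).
{ intros i Hi. unfold psi. rewrite kr by lia.
 destruct (half_odd i) as [-> ->].
 split; destruct (em _); try tauto. apply Lb; auto. }
exists l'. split; [|intros u v Hu Hv Cu Cv; apply Loo; unfold new; tauto].
intros u v w [Hs|(f & Hf & I)].
{ assert (No : forall y, In y [u; v; w] -> ~ new y).
 { intros y Hy [->|Hk]; [eapply cold; eauto|]. apply Hk. eapply kold; eauto. }
 rewrite !Loo by (apply No; simpl; auto). auto. }
revert u v w I. apply in_app_or in Hf as [Hf|Hf].
- apply in_flat_map in Hf as (i & Hi & Hf). apply in_seq in Hi. destruct Hi as [_ Hi]. simpl in Hi.
 set (p := fun u => if em (new u) then 1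
           else if em (u = be i) then H i else H (S i)).
 assert (Pn : forall u, new u -> p u = 1) by (intros u Hu; unfold p; destruct (em _); tauto).
 assert (P0 : p (be i) = H i).
 { unfold p. destruct (em _) as [X|_]; [destruct (Nb i); auto; lia|].
  destruct (em _); tauto. }
 assert (PS : p (be (S i)) = H (S i)).
 { unfold p. destruct (em _) as [X|_]; [destruct (Nb (S i)); auto; lia|].
  destruct (em _); auto. }
 assert (N1 := Nr (2 * i) ltac:(lia)). assert (N2 := Nr (2 * i + 1) ltac:(lia)).
 assert (N3 := Nr (2 * i + 2) ltac:(lia)).
 assert (N4 := Nb i ltac:(lia)). assert (N5 := Nb (S i) ltac:(lia)). specialize (Odd i Hi) as [O1 O2].
 assert (E1 := Even i (be i) ltac:(lia)). assert (E2 := Even (S i) (be (S i)) ltac:(lia)).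
 replace (2 * S i) with (2 * i + 2) in E2 by lia.
 assert (Rf : forall j, j <= N -> l (be j) (be j) = 1).
 { intros j Hj. apply (flat_refl P); auto using P_be. }
 apply (potential_flat l' f p). intros u v Hu Hv.
 destruct Hf as [<-|[<-|[<-|[]]]].
 + destruct Hu as [<-|[<-|[<-|[]]]], Hv as [<-|[<-|[<-|[]]]];
   rewrite ?P0, ?Pn by auto;
   rewrite ?Loo, ?Lnn, ?Lno, ?Lon by auto; rewrite ?E1, ?O1, ?Rf by lia; gsimp; auto.
 + destruct Hu as [<-|[<-|[<-|[]]]], Hv as [<-|[<-|[<-|[]]]];
   rewrite ?P0, ?PS, ?Pn by auto;
   rewrite ?Loo, ?Lnn, ?Lno, ?Lon by auto; rewrite ?O1, ?O2, ?Rf by lia; rewrite ?HS; gsimp; auto.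
  apply (flat_sym P l); auto.
 + destruct Hu as [<-|[<-|[<-|[]]]], Hv as [<-|[<-|[<-|[]]]];
   rewrite ?PS, ?Pn by auto;
   rewrite ?Loo, ?Lnn, ?Lno, ?Lon by auto; rewrite ?E2, ?O2, ?Rf by lia; gsimp; auto.
- apply in_map_iff in Hf as (k & <- & Hk). apply in_seq in Hk.
 apply (potential_flat l' _ (fun _ => 1)). intros u v Hu Hv.
 assert (Q : forall y, In y [c; r k; r (S k)] -> new y).
 { intros y [<-|[<-|[<-|[]]]]; [left; auto|apply Nr; lia|apply Nr; lia]. }
 rewrite Lnn by auto. gsimp. auto.
Qed.

Lemma disc_extend_trivial (M : group) (l : V -> V -> M) (h : V -> M) : flat_lab with_disc l ->
 trivializes P l h -> exists h', trivializes with_disc l h' /\ forall v, kind v = None -> v <> c -> h' v = h v.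
Proof.
intros Fl Tr. set (h0 := fun v => match kind v with Some k => h (be (k / 2)) ** l (be (k / 2)) v | None => h v end).
set (h' := fun v => if em (v = c) then h0 (r 0) ** l (r 0) c else h0 v).
assert (Hold : forall v, kind v = None -> v <> c -> h' v = h v).
{ intros v Hk Hc. unfold h', h0. rewrite Hk. destruct (em _); tauto. }
assert (Hr : forall k, k <= 2 * N -> h' (r k) = h0 (r k)).
{ intros k Hk. unfold h'. destruct (em _) as [E|_]; auto. destruct (r_not_c k Hk E). }
assert (Hb : forall i, i <= N -> h' (be i) = h (be i)).
{ intros i Hi. destruct (be_old i Hi). apply Hold; auto. }
assert (Ev : forall i, i <= N -> h' (r (2 * i)) = h (be i) ** l (be i) (r (2 * i))).
{ intros i Hi. rewrite Hr by lia. unfold h0.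
 destruct (kr' (2 * i)) as (k' & Hk & E1 & E & [->|[E2 ->]]); [lia| |]; rewrite E.
 - destruct (half_even i) as [-> _]. auto.
 - simpl. replace i with N by lia. rewrite beN. auto. }
assert (Od : forall i, i < N -> h' (r (2 * i + 1)) = h (be i) ** l (be i) (r (2 * i + 1))).
{ intros i Hi. rewrite Hr by lia. unfold h0. rewrite kr by lia. destruct (half_odd i) as [-> _]. auto. }
assert (Pb : forall i, i < N -> h (be (S i)) = h (be i) ** l (be i) (be (S i))).
{ intros i Hi. rewrite (Tr _ _ (Pbe i Hi)), gmulKr. auto. }
assert (Pb' : forall i, i <= N -> l (be i) (be i) = 1).
{ intros j Hj. apply (flat_refl with_disc); auto using with_disc_closed. left. apply P_be, Hj. }
assert (Od' : forall i, i < N -> h' (r (2 * i + 1)) = h (be (S i)) ** l (be (S i)) (r (2 * i + 1))).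
{ intros i Hi. rewrite Od, Pb by auto. rewrite gassoc. f_equal. symmetry. apply Fl.
 apply (collar_disc i _ _ Hi (or_intror (or_introl eq_refl))), incl_refl. }
assert (Col : forall i f, i < N -> In f (collar i) -> forall u v, incl [u; v] f -> l u v = (h' u)^-1 ** h' v).
{ intros i f Hi Hf.
 assert (E2 := Ev (S i)). replace (2 * S i) with (2 * i + 2) in E2 by lia.
 assert (X : exists x, In x f /\ forall y, In y f -> h' y = h' x ** l x y).
 { destruct Hf as [<-|[<-|[<-|[]]]]; eexists; (split; [left; reflexivity|]);
   intros y [<-|[<-|[<-|[]]]]; rewrite ?Hb by lia;
   rewrite ?Ev, ?Od, ?E2, ?Pb' by lia; rewrite ?gone_r; auto.
  rewrite <- Od by auto; auto. }
 destruct X as (x & Hx & X). apply (star_trivial with_disc l with_disc_closed Fl f x); auto.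
 intros s I. eapply collar_disc; eauto. }
assert (Ring : forall k, k < 2 * N -> h' (r (S k)) = h' (r k) ** l (r k) (r (S k))).
{ intros k Hk. enough (E : l (r k) (r (S k)) = (h' (r k))^-1 ** h' (r (S k))) by (rewrite E, gmulKr; auto).
 destruct (Nat.Even_or_Odd k) as [[i ->]|[i ->]].
 - replace (S (2 * i)) with (2 * i + 1) by lia. apply (Col i _ ltac:(lia) (or_introl eq_refl)).
  subset.
 - replace (S (2 * i + 1)) with (2 * i + 2) by lia.
  apply (Col i _ ltac:(lia) (or_intror (or_intror (or_introl eq_refl)))). subset. }
assert (Cc : forall k, k <= 2 * N -> h' (r k) ** l (r k) c = h' c).
{ induction k; intros Hk.
 - rewrite Hr by lia. unfold h'. destruct (em _); tauto.
 - rewrite Ring, gassoc by lia. rewrite <- IHk by lia. f_equal. apply Fl.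
  apply (cone_disc k); auto. subset. }
exists h'. split; auto. intros u v [Hs|(f & Hf & I)].
- assert (O : forall y, In y [u; v] -> h' y = h y).
 { intros y Hy. apply Hold; [eapply kold; eauto|]. intros ->. eapply cold; eauto. }
 rewrite (O u), (O v) by (simpl; auto). apply Tr; auto.
- revert u v I. apply in_app_or in Hf as [Hf|Hf].
 + apply in_flat_map in Hf as (i & Hi & Hf). apply in_seq in Hi. apply (Col i); auto. lia.
 + apply in_map_iff in Hf as (k & <- & Hk). apply in_seq in Hk.
  apply (star_trivial with_disc l with_disc_closed Fl _ (r k)).
  * intros s I. apply (cone_disc k); auto. lia.
  * right; left; auto.
  * intros y [<-|[<-|[<-|[]]]].
   -- symmetry; apply Cc; lia.
   -- rewrite (flat_refl with_disc l with_disc_closed Fl); [rewrite gone_r; auto|].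
     apply (cone_disc k); [lia|]. subset.
   -- apply Ring; lia.
Qed.

Definition with_collars (s : list V) : Prop := P s \/ fc collars s.
(** The collar is pushed onto the path in two contiguous steps, even ring vertices first. In one
    step the triangle [be (S i), r (2 i + 1), r (2 i + 2)] and its image would span four vertices,
    which is no simplex. *)
Definition pull1 (v : V) : V := match kind v with Some k => if Nat.even k then be (k / 2) else v | None => v end.
Definition pull2 (v : V) : V := match kind v with Some k => be (k / 2) | None => v end.
Definition half_collars (s : list V) : Prop :=
 P s \/ exists i, i < N /\ incl s [be i; be (S i); r (2 * i + 1)].

Lemma pull_be i : i <= N -> pull1 (be i) = be i /\ pull2 (be i) = be i.
Proof. intros Hi. destruct (be_old i Hi) as [E _]. unfold pull1, pull2. rewrite E. auto. Qed.
Lemma pull_even i : i <= N -> pull1 (r (2 * i)) = be i /\ pull2 (r (2 * i)) = be i.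
Proof.
intros Hi. unfold pull1, pull2.
destruct (kr' (2 * i)) as (k' & Hk & E1 & E & [->|[E2 ->]]); [lia| |]; rewrite E.
- destruct (half_even i) as [-> ->]. auto.
- simpl. replace i with N by lia. rewrite beN. auto.
Qed.
Lemma pull_odd i : i < N -> pull1 (r (2 * i + 1)) = r (2 * i + 1) /\ pull2 (r (2 * i + 1)) = be i.
Proof.
intros Hi. unfold pull1, pull2. rewrite kr by lia.
destruct (half_odd i) as [-> ->]. auto.
Qed.
Lemma pull_old s : P s -> map pull1 s = s /\ map pull2 s = s.
Proof.
intros Ps. rewrite <- (map_id s) at 2 4. split; apply map_ext_in; intros v Hv;
 unfold pull1, pull2; rewrite (kold s v Ps Hv); auto.
Qed.

Lemma incl_map_to {W : Type} (f : V -> W) s g h : incl s g -> (forall x, In x g -> In (f x) h) -> incl (map f s) h.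
Proof. intros I H y Hy. apply in_map_iff in Hy as (x & <- & Hx). auto. Qed.

Lemma Hv_with_collars n : Hv P n -> Hv with_collars n.
Proof.
intros HP.
assert (HQ : Hv half_collars n).
{ apply (Hv_contiguous pull2 half_collars P); auto.
 - apply or_closed; auto. intros s t (i & Hi & I) It. exists i. split; auto. eapply incl_tran; eauto.
 - intros s [Ps|(i & Hi & I)].
  + left. rewrite (proj2 (pull_old s Ps)). eapply CP; eauto. apply incl_app; apply incl_refl.
  + right. exists i. split; auto. apply incl_app; auto. eapply incl_map_to; eauto.
   destruct (pull_be i), (pull_be (S i)), (pull_odd i); try lia.
   intros x [<-|[<-|[<-|[]]]]; cbn [In]; pick_in.
 - intros s [Ps|(i & Hi & I)]; [rewrite (proj2 (pull_old s Ps)); auto|].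
  eapply CP; [apply (Pbe i Hi)|]. eapply incl_map_to; eauto.
  destruct (pull_be i), (pull_be (S i)), (pull_odd i); try lia.
  intros x [<-|[<-|[<-|[]]]]; cbn [In]; pick_in.
 - intros s Ps; left; auto. }
assert (St : forall i f s, i < N -> In f (collar i) -> incl s f ->
  incl (map pull1 s) f /\ half_collars (map pull1 s)).
{ intros i f s Hi Hf I.
 destruct (pull_be i), (pull_be (S i)), (pull_odd i), (pull_even i), (pull_even (S i)); try lia.
 replace (2 * S i) with (2 * i + 2) in * by lia.
 split; [|right; exists i; split; auto]; eapply incl_map_to; eauto;
  destruct Hf as [<-|[<-|[<-|[]]]]; intros x [<-|[<-|[<-|[]]]]; cbn [In]; pick_in. }
apply (Hv_contiguous pull1 with_collars half_collars); auto.
- apply or_closed; auto. apply fc_closed.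
- intros s [Ps|(f & Hf & I)].
 + left. rewrite (proj1 (pull_old s Ps)). eapply CP; eauto. apply incl_app; apply incl_refl.
 + right. exists f. split; auto. apply in_flat_map in Hf as (i & Hi & Hf). apply in_seq in Hi.
  apply incl_app; auto. apply (St i); auto; lia.
- intros s [Ps|(f & Hf & I)].
 + rewrite (proj1 (pull_old s Ps)). left; auto.
 + apply in_flat_map in Hf as (i & Hi & Hf). apply in_seq in Hi. apply (St i f); auto; lia.
- intros s [Ps|(i & Hi & I)]; [left; auto|]. right. eexists. split; [|exact I].
 apply (in_collars i); auto. right; left; auto.
Qed.

Lemma collars_cones s : with_collars s /\ fc cones s <-> fc ring s.
Proof.
assert (Bc : forall i, i <= N -> be i <> c) by (intros i Hi; apply (be_old i Hi)).
split.
- intros [H (f & Hf & I)]. apply in_map_iff in Hf as (k & <- & Hk).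
 exists [r k; r (S k)]. split; [apply (in_map (fun k => [r k; r (S k)])); auto|].
 intros x Hx. destruct (I x Hx) as [<-|]; auto. exfalso.
 destruct H as [Ps|(g & Hg & Ig)]; [apply (cold s Ps Hx)|].
 apply in_flat_map in Hg as (i & Hi & Hg). apply in_seq in Hi. specialize (Ig c Hx).
 destruct Hg as [<-|[<-|[<-|[]]]]; destruct Ig as [E|[E|[E|[]]]];
  first [apply (Bc i); auto; lia|apply (Bc (S i)); auto; lia|eapply r_not_c; [|exact E]; lia].
- intros (f & Hf & I). apply in_map_iff in Hf as (k & <- & Hk). apply in_seq in Hk. split.
 + right. destruct (Nat.Even_or_Odd k) as [[i ->]|[i ->]].
  * eexists. split; [apply (in_collars i); [lia|left; reflexivity]|].
   intros x Hx. replace (2 * i + 1) with (S (2 * i)) by lia. right; auto.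
  * eexists. split; [apply (in_collars i); [lia|right; right; left; reflexivity]|].
   intros x Hx. replace (2 * i + 2) with (S (2 * i + 1)) by lia. right; auto.
 + eexists. split; [apply (in_cones k); lia|]. intros x Hx; right; auto.
Qed.

Lemma ring_trivial (f : list V -> R) : (forall s, fc ring s -> length s = 3 -> D f s = 0%R) ->
 seqprod (fun k => f [r k; r (S k)] : RG) (2 * N) = (0%R : RG) ->
 exists b, forall s, fc ring s -> length s = 2 -> D b s = f s.
Proof.
intros Hf H0. set (H := seqprod (fun k => f [r k; r (S k)] : RG)) in *.
set (p := fun v => match kind v with Some k => H k | None => 0%R end).
assert (Pr : forall k, k <= 2 * N -> p (r k) = H k).
{ intros k Hk. unfold p. destruct (kr' k Hk) as (k' & _ & _ & E & [->|[-> ->]]); rewrite E; auto. }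
assert (HS : forall k, H (S k) = (H k + f [r k; r (S k)])%R) by auto.
assert (Rg : forall k s, k < 2 * N -> incl s [r k; r (S k)] -> fc ring s).
{ intros k s Hk I. eexists; split; [apply (in_map (fun k => [r k; r (S k)])), in_seq|exact I]. lia. }
assert (Refl : forall k u, k < 2 * N -> In u [r k; r (S k)] -> f [u; u] = 0%R).
{ intros k u Hk Hu. specialize (Hf [u; u; u]). simpl in Hf.
 enough (f [u; u] - (f [u; u] - (f [u; u] - 0)) = 0)%R by lra. apply Hf; auto.
 apply (Rg k); auto. intros y Hy. simpl in *. intuition congruence. }
exists (fun s => match s with [v] => p v | _ => 0%R end).
intros [|u [|v [|w s]]] (g & Hg & I) L; try easy. simpl.
apply in_map_iff in Hg as (k & <- & Hk). apply in_seq in Hk.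
assert (Hu : In u [r k; r (S k)]) by (apply I; left; auto).
assert (Hv : In v [r k; r (S k)]) by (apply I; right; left; auto).
assert (R1 := Refl k _ ltac:(lia) Hu). assert (R2 := Refl k _ ltac:(lia) Hv).
assert (Sy : (f [r (S k); r k] = - f [r k; r (S k)])%R).
{ specialize (Hf [r k; r (S k); r k]). simpl in Hf.
 rewrite (Refl k (r k)) in Hf by (simpl; auto; lia).
 enough (f [r (S k); r k] - (0 - (f [r k; r (S k)] - 0)) = 0)%R by lra. apply Hf; auto.
 apply (Rg k); [lia|]. subset. }
destruct Hu as [<-|[<-|[]]], Hv as [<-|[<-|[]]]; rewrite ?Pr by lia; rewrite ?R1, ?Sy, ?HS; lra.
Qed.

(* For the second cohomology, the disc must bound a cycle detected by a 1-cocycle [th]. *)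
Theorem Hv_disc n : Hv P (S (S n)) ->
 (exists th : V -> V -> RG, flat_lab P th /\ seqprod (fun i => th (be i) (be (S i))) N <> (0%R : RG)) ->
 Hv with_disc (S (S n)).
Proof.
intros HP (th & Fth & Hth).
assert (HA : Hv with_collars (S (S n))) by (apply Hv_with_collars; auto).
assert (HB : Hv (fc cones) (S (S n))).
{ apply (Hv_cone _ c). intros s (f & Hf & I). exists f. split; auto.
 apply in_map_iff in Hf as (k & <- & _). intros x [<-|Hx]; [left; auto|auto]. }
apply Hv_ext with (P := fun s => with_collars s \/ fc cones s).
{ intros s. unfold with_collars, with_disc. split.
 - intros [[H|(f & H1 & H2)]|(f & H1 & H2)]; auto; right; exists f; split; auto; apply in_or_app; auto.
 - intros [H|(f & H1 & H2)]; auto. apply in_app_or in H1 as [H1|H1]; [left; right|right]; exists f; auto. }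
assert (CA : closed with_collars) by (apply or_closed; auto; apply fc_closed).
destruct n as [|n].
- apply Hv_union_ext; auto using fc_closed. intros f Hf.
 set (g0 := fun s => match map pull2 s with [u; v] => th u v | _ => 0%R end : R).
 assert (Pl : forall s, with_collars s -> P (map pull2 s)).
 { intros s [Ps|(g & Hg & I)]; [rewrite (proj2 (pull_old s Ps)); auto|].
  apply in_flat_map in Hg as (i & Hi & Hg). apply in_seq in Hi.
  eapply CP; [apply (Pbe i); lia|]. eapply incl_map_to; eauto.
  destruct (pull_be i), (pull_be (S i)), (pull_odd i), (pull_even i), (pull_even (S i)); try lia.
  replace (2 * S i) with (2 * i + 2) in * by lia.
  destruct Hg as [<-|[<-|[<-|[]]]]; intros x [<-|[<-|[<-|[]]]]; cbn [In]; pick_in. }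
 set (S0 := seqprod (fun i => th (be i) (be (S i))) N : R) in *.
 set (Sf := seqprod (fun k => f [r k; r (S k)] : RG) (2 * N) : R).
 assert (Sum : forall m, m <= N -> (seqprod (fun k => g0 [r k; r (S k)] : RG) (2 * m) : R) =
   seqprod (fun i => th (be i) (be (S i))) m).
 { induction m; intros Hm; auto. replace (2 * S m) with (S (S (2 * m))) by lia.
  cbn [seqprod]. rewrite IHm by lia. unfold g0. cbn [map].
  destruct (pull_odd m) as [_ O]; [lia|]. destruct (pull_even m) as [_ E]; [lia|].
  destruct (pull_even (S m)) as [_ E']; [lia|].
  replace (S (2 * m)) with (2 * m + 1) by lia. replace (S (2 * m + 1)) with (2 * S m) by lia.
  rewrite O, E, E'. rewrite (flat_refl P th CP Fth (be m)).
  - rewrite gone_r. auto.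
  - eapply CP; [apply (Pbe m Hm)|]. intros y [<-|[]]. left; auto. }
 (* The pullback [g0] of [th] has the nonzero sum [S0] over the ring, so subtracting this multiple
    leaves a cocycle of sum 0, which is a coboundary on the circle. *)
 destruct (ring_trivial (fun s => f s - (Sf / S0) * g0 s)%R) as [b Hb].
 + intros s Hs L. apply collars_cones in Hs as [Hs1 Hs2].
  rewrite (D_sub f), (D_scal (Sf / S0) g0), Hf by auto.
  enough (D g0 s = 0%R) by (rewrite H; lra).
  destruct s as [|u [|v [|w [|]]]]; try easy. simpl. unfold g0. simpl.
  specialize (Fth (pull2 u) (pull2 v) (pull2 w) (Pl [u; v; w] Hs1)). simpl in Fth. lra.
 + assert (Lin : forall m, (seqprod (fun k => (f [r k; r (S k)] - (Sf / S0) * g0 [r k; r (S k)])%R : RG) m : R) =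
   ((seqprod (fun k => f [r k; r (S k)] : RG) m : R) - (Sf / S0) * (seqprod (fun k => g0 [r k; r (S k)] : RG) m : R))%R).
  { induction m; simpl; [lra|]. rewrite IHm. lra. }
  rewrite Lin. rewrite (Sum N) by lia. fold S0. fold Sf. simpl. field. exact Hth.
 + exists (fun s => (Sf / S0) * g0 s)%R, b. split.
  * intros s Hs L. rewrite (D_scal (Sf / S0) g0). enough (D g0 s = 0%R) by (rewrite H; lra).
   destruct s as [|u [|v [|w [|]]]]; try easy. simpl. unfold g0. simpl.
   specialize (Fth (pull2 u) (pull2 v) (pull2 w) (Pl [u; v; w] Hs)). simpl in Fth. lra.
  * intros s Hs1 Hs2 L. rewrite Hb; auto; [lra|]. apply collars_cones; auto.
- apply Hv_union; auto using fc_closed.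
 apply Hv_ext with (P := fc ring); [intros s; symmetry; apply collars_cones|].
 apply Hv_dim. intros f Hf. apply in_map_iff in Hf as (k & <- & _). simpl. lia.
Qed.
End Disc.

(** * Presentation complexes *)

(* [RK1 s], [RK2 s]: the relators of [kills]; [RM j], [RV]: a relator of the rule system, resp. the
  commutator of [GK] and [GC N], equals the central letter [GG]; [RC0], [RC i]: definition of [GC]. *)
Inductive rel := RK1 (s : gen) | RK2 (s : gen) | RM (j : nat) | RC0 | RC (i : nat) | RV.

(* [Lp g b] are the two inner vertices of the triangle representing [g], [Rg r k] and [Ct r] the ring
  and the centre of the disc of the relator [r], [Pr j b v] the two further copies of [v] in the
  [j]-th product with a triangle, [Bs i] fill up the dimension, [Nv k l] span the tube. *)
Inductive vx :=
| Base | Lp (g : gen) (b : bool) | Rg (r : rel) (k : nat) | Ct (r : rel)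
| Pr (j : nat) (b : bool) (v : vx) | Bs (i : nat) | Nv (k l : nat).

(** The triangle of the central letter [GG j] is the circle over the base vertex in the [j]-th
    product; other letters have a triangle of their own. *)
Definition lv (g : gen) (b : bool) : vx := match g with GG j => Pr j b Base | _ => Lp g b end.
Definition loop_facets (g : gen) : list (list vx) :=
 [[Base; lv g false]; [lv g false; lv g true]; [lv g true; Base]].

(** The closed path spelled by [w], three edges for each letter; an inverse letter exchanges the two
    inner vertices. Reducing the index modulo the length closes the path. *)
Definition be (w : word) (i : nat) : vx :=
 let l := nth ((i / 3) mod length w) w (GK, true) in
 match i mod 3 with 0 => Base | 1 => lv (fst l) (negb (snd l)) | _ => lv (fst l) (snd l) end.
Definition plen (w : word) : nat := 3 * length w.
Definition rv (r : rel) (w : word) (k : nat) : vx := Rg r (k mod (2 * plen w)).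
Definition disc_facets (r : rel) (w : word) : list (list vx) :=
 disc_cells (plen w) (be w) (rv r w) (Ct r).
Definition kindr (r : rel) (v : vx) : option nat :=
 match v with Rg r' k => if em (r' = r) then Some k else None | _ => None end.

Definition hol {M : group} (l : vx -> vx -> M) (g : gen) : M :=
 l Base (lv g false) ** (l (lv g false) (lv g true) ** l (lv g true) Base).

Definition has_loop (P : list vx -> Prop) (g : gen) : Prop := forall f, In f (loop_facets g) -> P f.

Lemma be_at w q t : t < 3 -> w <> [] -> q < length w ->
 be w (3 * q + t) = let l := nth q w (GK, true) in
  match t with 0 => Base | 1 => lv (fst l) (negb (snd l)) | _ => lv (fst l) (snd l) end.
Proof.
intros Ht Nw Hq. unfold be.
replace ((3 * q + t) mod 3) with t by (apply Nat.mod_unique with q; lia).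
replace ((3 * q + t) / 3) with q by (apply Nat.div_unique with t; lia).
rewrite Nat.mod_small by auto. auto.
Qed.

Lemma be_wrap w : w <> [] -> be w (plen w) = Base /\ be w 0 = Base.
Proof.
intros Nw. unfold be, plen. replace (3 * length w) with (length w * 3) by lia.
rewrite Nat.Div0.mod_mul. auto.
Qed.

Lemma be_step P w i : closed P -> w <> [] -> (forall g b, In (g, b) w -> has_loop P g) ->
 i < plen w -> P [be w i; be w (S i)].
Proof.
intros CP Nw HL Hi. unfold plen in Hi.
destruct (Nat.div_mod i 3 ltac:(lia)) as [].
pose proof (Nat.div_mod i 3 ltac:(lia)) as Ei.
pose proof (Nat.mod_upper_bound i 3 ltac:(lia)) as Em.
set (q := i / 3) in *. set (t := i mod 3) in *.
assert (Hq : q < length w) by lia.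
assert (Hin : In (nth q w (GK, true)) w) by (apply nth_In; auto).
assert (E := be_at w q). rewrite Ei.
destruct (nth q w (GK, true)) as [g b] eqn:En.
assert (L := HL g b Hin).
assert (L1 := L _ (or_introl eq_refl)). assert (L2 := L _ (or_intror (or_introl eq_refl))).
assert (L3 := L _ (or_intror (or_intror (or_introl eq_refl)))).
assert (S1 : forall x y, P [x; y] -> P [y; x]).
{ intros x y H. eapply CP; eauto. subset. }
destruct t as [|[|[|]]]; try lia.
- replace (S (3 * q + 0)) with (3 * q + 1) by lia. rewrite !E by (auto; lia). simpl. rewrite ?En. simpl.
 destruct b; auto.
- replace (S (3 * q + 1)) with (3 * q + 2) by lia. rewrite !E by (auto; lia). simpl. rewrite ?En. simpl.
 destruct b; auto.
- rewrite (E 2) by (auto; lia). simpl. rewrite ?En. simpl.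
 assert (EB : be w (S (3 * q + 2)) = Base).
 { destruct (Nat.eq_dec (S q) (length w)) as [Eq|Nq].
  - replace (S (3 * q + 2)) with (plen w) by (unfold plen; lia). apply be_wrap; auto.
  - replace (S (3 * q + 2)) with (3 * S q + 0) by lia. rewrite (be_at w (S q) 0); auto; lia. }
 change (q + (q + (q + 0)) + 2) with (3 * q + 2). rewrite EB. destruct b; auto.
Qed.

Lemma seqprod_word {M : group} (P : list vx -> Prop) (l : vx -> vx -> M) w : closed P -> flat_lab P l ->
 (forall g b, In (g, b) w -> has_loop P g) -> w <> [] ->
 seqprod (fun i => l (be w i) (be w (S i))) (plen w) = weval (hol l) w.
Proof.
intros CP Fl HL Nw.
assert (G : forall q, q <= length w ->
 seqprod (fun i => l (be w i) (be w (S i))) (3 * q) = weval (hol l) (firstn q w)).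
{ induction q; intros Hq; auto.
 replace (3 * S q) with (S (S (S (3 * q)))) by lia. cbn [seqprod]. rewrite IHq by lia.
 assert (Ef : firstn (S q) w = firstn q w ++ [nth q w (GK, true)]).
 { clear -Hq. revert q Hq. induction w as [|x w IH]; intros [|q] Hq; simpl in *; try lia; auto.
  rewrite <- IH by lia. auto. }
 rewrite Ef, weval_app, !gassoc. f_equal.
 assert (Hin : In (nth q w (GK, true)) w) by (apply nth_In; auto).
 assert (E := be_at w q). destruct (nth q w (GK, true)) as [g b] eqn:En.
 assert (E0 := E 0 ltac:(lia) Nw ltac:(lia)). assert (E1 := E 1%nat ltac:(lia) Nw ltac:(lia)).
 assert (E2 := E 2 ltac:(lia) Nw ltac:(lia)). rewrite ?En in *. cbn [fst snd] in *.
 assert (EB : be w (S (3 * q + 2)) = Base).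
 { destruct (Nat.eq_dec (S q) (length w)) as [Eq|Nq].
  - replace (S (3 * q + 2)) with (plen w) by (unfold plen; lia). apply be_wrap; auto.
  - replace (S (3 * q + 2)) with (3 * S q + 0) by lia. rewrite (be_at w (S q) 0); auto; lia. }
 replace (3 * q) with (3 * q + 0) at 1 by lia.
 replace (S (3 * q)) with (3 * q + 1) by lia. replace (S (3 * q + 1)) with (3 * q + 2) by lia.
 rewrite E0, E1, E2, EB. simpl. rewrite gone_r. unfold hol.
 assert (L := HL g b Hin).
 assert (L1 := L _ (or_introl eq_refl)). assert (L2 := L _ (or_intror (or_introl eq_refl))).
 assert (L3 := L _ (or_intror (or_intror (or_introl eq_refl)))).
 destruct b; simpl; auto.
 rewrite (flat_sym P l CP Fl _ _ L1), (flat_sym P l CP Fl _ _ L2), (flat_sym P l CP Fl _ _ L3). gsimp. auto. }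
unfold plen. rewrite G by auto. rewrite firstn_all. auto.
Qed.

Definition fresh_rel (P : list vx -> Prop) (r : rel) : Prop :=
 forall s, P s -> ~ In (Ct r) s /\ forall k, ~ In (Rg r k) s.

Definition attachable (P : list vx -> Prop) (r : rel) (w : word) : Prop :=
 w <> [] /\ (forall g b, In (g, b) w -> has_loop P g) /\ fresh_rel P r.

Section OneDisc.
Context (P : list vx -> Prop) (CP : closed P) (r : rel) (w : word) (At : attachable P r w).
Lemma disc_N0 : 0 < plen w.
Proof. destruct At as (Nw & _). unfold plen. destruct w; simpl; [congruence|lia]. Qed.
Lemma disc_be i : i < plen w -> P [be w i; be w (S i)].
Proof. destruct At as (Nw & HL & _). intros; apply be_step; auto. Qed.
Lemma disc_beN : be w (plen w) = be w 0.
Proof. destruct At as (Nw & _). destruct (be_wrap w Nw). congruence. Qed.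
Lemma disc_rN : rv r w (2 * plen w) = rv r w 0.
Proof. pose proof disc_N0. unfold rv. rewrite Nat.Div0.mod_same, Nat.mod_small; auto; lia. Qed.
Lemma disc_kr k : k < 2 * plen w -> kindr r (rv r w k) = Some k.
Proof.
intros Hk. unfold rv, kindr. rewrite Nat.mod_small by auto.
destruct (em _); tauto.
Qed.
Lemma disc_kold s v : P s -> In v s -> kindr r v = None.
Proof.
destruct At as (_ & _ & F). intros Ps Hv. destruct v; simpl; auto.
destruct (em _) as [->|]; auto. destruct (F s Ps) as [_ H]. destruct (H k); auto.
Qed.
Lemma disc_cold s : P s -> ~ In (Ct r) s.
Proof. destruct At as (_ & _ & F). intros Ps. apply (F s Ps). Qed.
End OneDisc.

Ltac disc_side At :=
 solve [ eapply disc_N0; exact At | intros; eapply disc_be; [|exact At|]; assumption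
    | eapply disc_beN; exact At | eapply disc_rN; exact At
    | intros; eapply disc_kr; eassumption | intros; eapply disc_kold; eassumption
    | intros; eapply disc_cold; eassumption | assumption | reflexivity ].

Section Attach.
Variable relw : rel -> word.

Definition attach (P : list vx -> Prop) (ds : list rel) (s : list vx) : Prop :=
 P s \/ fc (flat_map (fun r => disc_facets r (relw r)) ds) s.

Lemma attach_closed P ds : closed P -> closed (attach P ds).
Proof. intros CP. apply or_closed; auto. apply fc_closed. Qed.

Lemma attach_snoc P ds r s : attach P (ds ++ [r]) s <->
 with_disc (attach P ds) (plen (relw r)) (be (relw r)) (rv r (relw r)) (Ct r) s.
Proof.
unfold attach, with_disc. rewrite flat_map_app. simpl. rewrite app_nil_r. split.
- intros [H|(f & Hf & I)]; auto. apply in_app_or in Hf as [Hf|Hf]; [left; right|right]; exists f; auto.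
- intros [[H|(f & Hf & I)]|(f & Hf & I)]; auto; right; exists f; split; auto; apply in_or_app; auto.
Qed.
(** Lists of relators can contain repetitions, since a state may occur several times as source and
    target of rules. *)
Lemma attach_dup P ds r s : In r ds -> attach P (ds ++ [r]) s <-> attach P ds s.
Proof.
intros Hr. unfold attach. rewrite flat_map_app. simpl. rewrite app_nil_r. split.
- intros [H|(f & Hf & I)]; auto. right. apply in_app_or in Hf as [Hf|Hf]; exists f; split; auto.
 apply in_flat_map; eauto.
- intros [H|(f & Hf & I)]; auto. right. exists f. split; auto. apply in_or_app; auto.
Qed.
Lemma disc_vertices r f v : In f (disc_facets r (relw r)) -> In v f ->
 (exists i, v = be (relw r) i) \/ v = Ct r \/ exists k, v = Rg r k.
Proof.
intros Hf Hv. apply in_app_or in Hf as [Hf|Hf].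
- apply in_flat_map in Hf as (i & _ & Hf).
 destruct Hf as [<-|[<-|[<-|[]]]]; destruct Hv as [<-|[<-|[<-|[]]]]; unfold rv; eauto.
- apply in_map_iff in Hf as (k & <- & _). destruct Hv as [<-|[<-|[<-|[]]]]; unfold rv; eauto.
Qed.
Lemma be_not_new w i r : be w i <> Ct r /\ forall k, be w i <> Rg r k.
Proof.
unfold be, lv. destruct (i mod 3) as [|[|]]; [split; easy| |];
 match goal with |- context [fst ?x] => destruct (fst x) end; split; easy.
Qed.

Lemma attach_fresh P ds r : fresh_rel P r -> ~ In r ds -> fresh_rel (attach P ds) r.
Proof.
intros F N s [Ps|(f & Hf & I)]; [apply F; auto|].
apply in_flat_map in Hf as (r' & Hr' & Hf).
assert (Q : forall v, In v s -> v <> Ct r /\ forall k, v <> Rg r k).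
{ intros v Hv. destruct (disc_vertices r' f v Hf (I v Hv)) as [(i & ->)|[->|(k & ->)]].
 - apply be_not_new.
 - split; [congruence|easy].
 - split; [easy|]. intros k' E. congruence. }
split; [|intros k]; intros H; destruct (Q _ H) as [Q1 Q2]; [apply Q1; auto|apply (Q2 k); auto].
Qed.
Lemma attach_attachable P ds r : attachable P r (relw r) -> ~ In r ds -> attachable (attach P ds) r (relw r).
Proof.
intros (H1 & H2 & H3) N. split; [|split]; auto using attach_fresh.
intros g b H f Hf. left. eapply H2; eauto.
Qed.

Definition realizes (P : list vx -> Prop) (gs : gen -> Prop) {M : group} (x : gen -> M) : Prop :=
 exists l, flat_lab P l /\ forall g, gs g -> hol l g = x g.

Lemma lv_not_new g b r : kindr r (lv g b) = None /\ lv g b <> Ct r.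
Proof. destruct g; simpl; split; auto; easy. Qed.

Lemma attach_realizes (gs : gen -> Prop) (M : group) (x : gen -> M) P ds : closed P ->
 (forall r, In r ds -> attachable P r (relw r) /\ weval x (relw r) = 1 /\ forall g b, In (g, b) (relw r) -> gs g) ->
 realizes P gs x -> realizes (attach P ds) gs x.
Proof.
intros CP. induction ds as [|r ds IH] using rev_ind; intros H HR.
- destruct HR as (l & Fl & E). exists l. split; auto. intros u v w [Hs|(f & [] & _)]; auto.
- destruct IH as (l & Fl & E); auto; [intros r' Hr'; apply H, in_or_app; auto|].
 destruct (classic (In r ds)) as [I|N].
 { exists l. split; auto. intros u v w Hs. apply attach_dup in Hs; auto. }
 destruct (H r) as (At & E1 & Hg); [apply in_or_app; right; left; auto|].
 assert (At' := attach_attachable P ds r At N). assert (CP' := attach_closed P ds CP).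
 destruct (disc_extend_label (attach P ds) CP' (plen (relw r)) (be (relw r)) (rv r (relw r)) (Ct r) (kindr r))
  with (M := M) (l := l) as (l' & Fl' & E'); try disc_side At'.
 + rewrite (seqprod_word (attach P ds)); auto; try apply At'.
  rewrite <- E1. apply weval_ext. intros g b I. apply E. eauto.
 + exists l'. split.
  * intros u v w Hs. apply attach_snoc in Hs. auto.
  * intros g Hg'. rewrite <- E by auto. unfold hol.
   destruct (lv_not_new g false r), (lv_not_new g true r). rewrite !E'; auto; easy.
Qed.

Lemma attach_trivial (M : group) (l : vx -> vx -> M) (h : vx -> M) P ds : closed P ->
 (forall r, In r ds -> attachable P r (relw r)) -> flat_lab (attach P ds) l -> trivializes P l h ->
 exists h', trivializes (attach P ds) l h' /\ forall v, (forall r, kindr r v = None /\ v <> Ct r) -> h' v = h v.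
Proof.
intros CP. induction ds as [|r ds IH] using rev_ind; intros H Fl T.
- exists h. split; auto. intros u v [Hs|(f & [] & _)]; auto.
- destruct IH as (h0 & T0 & E0); auto.
 { intros r' Hr'; apply H, in_or_app; auto. }
 { intros u v w [Hs|(f & Hf & I)]; apply Fl; [left; auto|right; exists f; split; auto].
  rewrite flat_map_app. apply in_or_app; auto. }
 destruct (classic (In r ds)) as [I|N].
 { exists h0. split; auto. intros u v Hs. apply attach_dup in Hs; auto. }
 assert (At : attachable P r (relw r)) by (apply H, in_or_app; right; left; auto).
 assert (At' := attach_attachable P ds r At N). assert (CP' := attach_closed P ds CP).
 destruct (disc_extend_trivial (attach P ds) CP' (plen (relw r)) (be (relw r)) (rv r (relw r)) (Ct r) (kindr r))
  with (M := M) (l := l) (h := h0) as (h' & T' & E'); try disc_side At'.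
 + intros u v w Hs. apply attach_snoc in Hs. auto.
 + exists h'. split.
  * intros u v Hs. apply attach_snoc in Hs. auto.
  * intros v Hv. rewrite E' by apply Hv. auto.
Qed.

Lemma attach_holonomy (M : group) (l : vx -> vx -> M) P ds r : closed P -> In r ds ->
 attachable P r (relw r) -> flat_lab (attach P ds) l -> weval (hol l) (relw r) = 1.
Proof.
intros CP Hr At Fl.
assert (FP : flat_lab P l) by (intros u v w Hs; apply Fl; left; auto).
rewrite <- (seqprod_word P) by (auto; apply At).
eapply (disc_holonomy P (plen (relw r)) (be (relw r)) (rv r (relw r)) (Ct r)); try disc_side At.
intros u v w [Hs|(f & Hf & I)]; apply Fl; [left; auto|right; exists f; split; auto].
apply in_flat_map; eauto.
Qed.

(** The last hypothesis is linear independence of the abelianised relators, in triangular form: the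
    assignment [x] extends over the discs already attached and has a nonzero sum along the boundary
    of the next one, as required for attaching it in degree two. *)
Lemma attach_Hv (gs : gen -> Prop) P ds n : closed P -> Hv P (S (S n)) ->
 (forall r, In r ds -> attachable P r (relw r) /\ forall g b, In (g, b) (relw r) -> gs g) ->
 (forall ds1 r ds2, ds = ds1 ++ r :: ds2 -> ~ In r ds1 -> exists x : gen -> RG,
  realizes P gs x /\ (forall r', In r' ds1 -> weval x (relw r') = 1) /\ weval x (relw r) <> 1) ->
 Hv (attach P ds) (S (S n)).
Proof.
intros CP HP. induction ds as [|r ds IH] using rev_ind; intros HA HX.
- eapply Hv_ext; [|exact HP]. intros s. split; [left; auto|intros [H|(f & [] & _)]; auto].
- assert (HD : Hv (attach P ds) (S (S n))).
 { apply IH.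
  - intros r' Hr'; apply HA, in_or_app; auto.
  - intros ds1 r' ds2 E N. apply (HX ds1 r' (ds2 ++ [r])); auto. rewrite E, <- app_assoc. auto. }
 destruct (classic (In r ds)) as [I|N].
 { eapply Hv_ext; [|exact HD]. intros s. symmetry. apply attach_dup; auto. }
 destruct (HA r) as [At Hg]; [apply in_or_app; right; left; auto|].
 assert (At' := attach_attachable P ds r At N). assert (CP' := attach_closed P ds CP).
 eapply Hv_ext; [intros s; symmetry; apply attach_snoc|].
 apply (Hv_disc (attach P ds) CP' _ _ _ _ (kindr r)); try disc_side At'.
 destruct (HX ds r [] eq_refl N) as (x & Rx & H0 & H1).
 destruct (attach_realizes gs RG x P ds CP) as (l & Fl & E); auto.
 { intros r' Hr'. destruct (HA r') as [At1 Hg1]; [apply in_or_app; auto|]. auto. }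
 exists l. split; auto. rewrite (seqprod_word (attach P ds)) by (auto; apply At').
 rewrite (weval_ext (hol l) x); auto. intros g b I. apply E. eauto.
Qed.
End Attach.

Definition is_gg (g : gen) : Prop := exists j, g = GG j.
Lemma lv_Lp g b : ~ is_gg g -> lv g b = Lp g b.
Proof. intros N. destruct g; auto. destruct N. eexists; eauto. Qed.

Definition bouquet (gs : list gen) : list (list vx) := flat_map loop_facets gs.

Lemma bouquet_loop gs g : In g gs -> has_loop (fc (bouquet gs)) g.
Proof. intros H f Hf. exists f. split; [apply in_flat_map; eauto|apply incl_refl]. Qed.

Lemma bouquet_vertices gs f v : In f (bouquet gs) -> In v f -> v = Base \/ exists g b, In g gs /\ v = lv g b.
Proof.
intros Hf Hv. apply in_flat_map in Hf as (g & Hg & Hf).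
destruct Hf as [<-|[<-|[<-|[]]]]; destruct Hv as [<-|[<-|[]]]; eauto.
Qed.

Lemma bouquet_fresh gs r : fresh_rel (fc (bouquet gs)) r.
Proof.
intros s (f & Hf & I).
assert (Q : forall v, In v s -> v <> Ct r /\ forall k, v <> Rg r k).
{ intros v Hv. destruct (bouquet_vertices gs f v Hf (I v Hv)) as [->|(g & b & _ & ->)].
 - split; easy.
 - destruct g; simpl; split; easy. }
split; [|intros k]; intros H; destruct (Q _ H) as [Q1 Q2]; [apply Q1; auto|apply (Q2 k); auto].
Qed.

Lemma bouquet_realizes gs (M : group) (x : gen -> M) : (forall g, In g gs -> ~ is_gg g) ->
 realizes (fc (bouquet gs)) (fun g => In g gs) x.
Proof.
intros NG.
exists (fun u v => match u, v with
          | Lp g false, Lp _ true => x g | Lp g true, Lp _ false => (x g)^-1 | _, _ => 1 end).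
split.
- intros u v w (f & Hf & I). revert u v w I. apply in_flat_map in Hf as (g & Hg & Hf).
 unfold loop_facets in Hf. rewrite !lv_Lp in Hf by auto.
 destruct Hf as [<-|[<-|[<-|[]]]].
 + apply (potential_flat _ _ (fun _ => 1)). intros u v [<-|[<-|[]]] [<-|[<-|[]]]; simpl; gsimp; auto.
 + apply (potential_flat _ _ (fun u => match u with Lp _ true => x g | _ => 1 end)).
  intros u v [<-|[<-|[]]] [<-|[<-|[]]]; simpl; gsimp; auto.
 + apply (potential_flat _ _ (fun _ => 1)). intros u v [<-|[<-|[]]] [<-|[<-|[]]]; simpl; gsimp; auto.
- intros g Hg. unfold hol. rewrite !lv_Lp by auto. gsimp. auto.
Qed.

Lemma bouquet_trivial gs (M : group) (l : vx -> vx -> M) : (forall g, In g gs -> ~ is_gg g) ->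
 flat_lab (fc (bouquet gs)) l -> (forall g, In g gs -> hol l g = 1) ->
 trivializes (fc (bouquet gs)) l (fun v => match v with Lp _ _ => l Base v | _ => 1 end).
Proof.
intros NG Fl H u v (f & Hf & I). revert u v I. apply in_flat_map in Hf as (g & Hg & Hf).
specialize (H g Hg). assert (L := bouquet_loop gs g Hg).
assert (RB : l Base Base = 1).
{ apply (flat_refl (fc (bouquet gs)) l (fc_closed _) Fl). eapply fc_closed; [apply (L _ (or_introl eq_refl))|].
 intros y [<-|[]]; left; auto. }
assert (Sub : forall f', In f' (loop_facets g) -> forall s, incl s f' -> fc (bouquet gs) s).
{ intros f' Hf' s I. eapply fc_closed; eauto. }
assert (S1 : forall b, l (lv g b) (lv g b) = 1).
{ intros b. apply (flat_refl (fc (bouquet gs)) l (fc_closed _) Fl).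
 eapply fc_closed; [apply (L _ (or_intror (or_introl eq_refl)))|].
 intros y [<-|[]]; destruct b; simpl; auto. }
assert (S2 : l (lv g true) Base = (l Base (lv g true))^-1).
{ apply (flat_sym (fc (bouquet gs)) l (fc_closed _) Fl). eapply fc_closed; [apply (L _ (or_intror (or_intror (or_introl eq_refl))))|].
 subset. }
assert (E : l Base (lv g true) = l Base (lv g false) ** l (lv g false) (lv g true)).
{ unfold hol in H. rewrite S2, <- gassoc in H. symmetry. apply geq_of_div. auto. }
assert (Hlv : forall b, lv g b = Lp g b) by (intros; apply lv_Lp; auto).
pose proof (Sub f Hf) as Sf.
destruct Hf as [<-|[<-|[<-|[]]]]; rewrite !Hlv in *.
- apply (star_trivial (fc (bouquet gs)) l (fc_closed _) Fl _ Base); auto; [left; auto|].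
 intros y [<-|[<-|[]]]; rewrite ?RB; gsimp; auto.
- apply (star_trivial (fc (bouquet gs)) l (fc_closed _) Fl _ (Lp g false)); auto; [left; auto|].
 specialize (S1 false). rewrite Hlv in S1.
 intros y [<-|[<-|[]]]; rewrite ?S1; gsimp; auto.
- apply (star_trivial (fc (bouquet gs)) l (fc_closed _) Fl _ Base); auto; [right; left; auto|].
 intros y [<-|[<-|[]]]; rewrite ?RB; gsimp; auto.
Qed.

(** * Products with a labelled base *)

Section ProdLabels.
Context {V W : Type} (P : list V -> Prop) (L : list W -> Prop) (o : V) (i0 : W)
 (CP : closed P) (CL : closed L) (M : group) (l : V * W -> V * W -> M).
Hypotheses (Fl : flat_lab (prodc P L) l) (L0 : forall i, L [i] -> L [i0; i]).

Definition turn (i i' : W) (v : V) : M := l (v, i0) (v, i) ** (l (v, i) (v, i') ** l (v, i') (v, i0)).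

Lemma prod_pair u v i i' : P [u; v] -> L [i; i'] -> forall x y z,
 incl [x; y; z] [(u, i); (u, i'); (v, i); (v, i')] -> l x y ** l y z = l x z.
Proof.
intros HP HL x y z I. apply Fl. split.
- eapply CP; eauto. intros a Ha. apply (incl_map fst _ _ I) in Ha. simpl in *. tauto.
- eapply CL; eauto. intros a Ha. apply (incl_map snd _ _ I) in Ha. simpl in *. tauto.
Qed.

(** A loop in the fibre is carried across an edge of the base by means of the squares above that
    edge. *)
Lemma turn_slide u v i i' : P [u; v] -> L [i; i'] ->
 l (u, i0) (v, i0) ** turn i i' v = turn i i' u ** l (u, i0) (v, i0).
Proof.
intros HP HL.
assert (Li : L [i0; i]) by (apply L0, (CL [i; i']); auto; intros y [<-|[]]; left; auto).
assert (Li' : L [i0; i']) by (apply L0, (CL [i; i']); auto; intros y [<-|[]]; right; left; auto).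
assert (Sq : forall a b, L [a; b] -> l (u, a) (v, a) ** l (v, a) (v, b) = l (u, a) (u, b) ** l (u, b) (v, b)).
{ intros a b Hab. rewrite (prod_pair u v a b HP Hab (u, a) (v, a) (v, b)), (prod_pair u v a b HP Hab (u, a) (u, b) (v, b));
  auto; subset. }
assert (Li0 : L [i'; i0]) by (apply (CL [i0; i']); auto; subset).
unfold turn. rewrite <- !gassoc, (Sq i0 i Li), !gassoc. f_equal.
rewrite <- !gassoc, (Sq i i' HL), !gassoc. f_equal. apply (Sq i' i0 Li0).
Qed.

Inductive linked : V -> Prop :=
| linked_base : linked o
| linked_edge u v : linked u -> P [u; v] -> linked v.

(** Sliding makes the fibre loops trivial over every vertex once they are trivial over [o]. Then a
    potential on the slice [i0] extends along the fibres. *)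
Lemma prod_trivial (h0 : V -> M) : (forall v, P [v] -> linked v) ->
 (forall u v, P [u; v] -> l (u, i0) (v, i0) = (h0 u)^-1 ** h0 v) ->
 (forall i i', L [i; i'] -> turn i i' o = 1) ->
 trivializes (prodc P L) l (fun x => h0 (fst x) ** l (fst x, i0) x).
Proof.
intros Lk H0 HT.
assert (T1 : forall i i' v, L [i; i'] -> linked v -> turn i i' v = 1).
{ intros i i' v HL Hv. induction Hv as [|u v Hu IH HP]; auto.
 pose proof (turn_slide u v i i' HP HL) as E. rewrite IH, gone_l in E.
 apply (gcancel_l (l (u, i0) (v, i0))). rewrite gone_r. auto. }
intros [u i] [v i'] [HP HL]. simpl in HP, HL. cbn [fst].
assert (Pu : P [u]) by (apply (CP [u; v]); auto; intros y [<-|[]]; left; auto).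
assert (Li : L [i]) by (apply (CL [i; i']); auto; intros y [<-|[]]; left; auto).
assert (Li' : L [i']) by (apply (CL [i; i']); auto; intros y [<-|[]]; right; left; auto).
pose proof (T1 i i' u HL (Lk u Pu)) as T. unfold turn in T.
assert (Q : forall x y z, incl [x; y; z] [(u, i0); (u, i'); (v, i0); (v, i')] -> l x y ** l y z = l x z)
 by (apply prod_pair; auto).
assert (Q2 : forall x y z, incl [x; y; z] [(u, i); (u, i'); (v, i); (v, i')] -> l x y ** l y z = l x z)
 by (apply prod_pair; auto).
rewrite <- (Q2 (u, i) (u, i') (v, i')) by (subset).
assert (E1 : l (u, i') (u, i0) = (l (u, i0) (u, i'))^-1).
{ apply (flat_sym (prodc P L) l); auto using prodc_closed. split; simpl.
 - eapply CP; eauto. subset.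
 - apply L0; auto. }
rewrite E1, <- gassoc in T. apply geq_of_div in T.
apply (gcancel_l (h0 u ** l (u, i0) (u, i))). gsimp. rewrite <- (gassoc _ (l (u, i0) (u, i))), T.
assert (E2 : h0 v = h0 u ** l (u, i0) (v, i0)) by (rewrite H0, gmulKr; auto).
rewrite E2, gassoc. f_equal. rewrite (Q (u, i0) (u, i') (v, i')) by (subset).
rewrite (Q (u, i0) (v, i0) (v, i')) by (subset). auto.
Qed.
End ProdLabels.

(** * The complex of a rule system *)

Section Complex.
Variables (Rs : list rule) (d acc N m : nat).
Hypotheses (Wf : forall r, In r Rs -> rule_wf d r) (Hd : 0 < d).

Notation targets := (targets Rs d acc).
Notation fixed_gens := (fixed_gens Rs d acc).
Notation machine_words := (machine_words Rs d acc).

Definition relw (r : rel) : word :=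
 match r with
 | RK1 s => [(killer acc s, true); (GE s, true); (killer acc s, false); (GE s, false); (GE s, false)]
 | RK2 s => (GE s, true) :: target_word s ++ (GE s, false) :: winv (target_word s) ++ winv (target_word s)
 | RM j => match nth_error machine_words j with
      | Some (u, v) => (GG (S j), false) :: u ++ winv v | None => [] end
 | RC0 => [(GC 0, true); (GT 0, false)]
 | RC i => [(GX 0, true); (GC i, true); (GX 0, false); (GC (S i), false)]
 | RV => [(GG 0, false); (GK, true); (GC N, true); (GK, false); (GC N, false)]
 end.

Definition all_gens : list gen := fixed_gens ++ map GC (seq 0 (S N)).
Definition kill_rels : list rel := map RK1 targets ++ map RK2 targets.
(** One product for each relator of the rule system, and number 0 for the relator [RV]. *)
Definition nprod : nat := S (length machine_words).
Definition late_rels : list rel :=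
 map RM (seq 0 (length machine_words)) ++ RC0 :: map RC (seq 0 N) ++ [RV].

Definition Qf : list (list vx) := bouquet fixed_gens ++ flat_map (fun r => disc_facets r (relw r)) kill_rels.
Definition prod_facets (j : nat) : list (list vx) :=
 flat_map (fun f => [f ++ map (Pr j false) f; map (Pr j false) f ++ map (Pr j true) f; map (Pr j true) f ++ f]) Qf.
(** The common base of all products. The letters [GC i] are left out, so it does not depend on the
    number of stages and commutation with the central letters is imposed on finitely many fixed
    letters only. *)
Definition Q : list vx -> Prop := attach relw (fc (bouquet fixed_gens)) kill_rels.
Definition P1 : list vx -> Prop := attach relw (fc (bouquet all_gens)) kill_rels.
Definition P2 (s : list vx) : Prop := P1 s \/ fc (flat_map prod_facets (seq 0 nprod)) s.
Definition P3 : list vx -> Prop := attach relw P2 late_rels.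
Definition big : list vx := Base :: map Bs (seq 0 m).
(** The simplex [big] meets the rest in [Base] only; it guarantees dimension [m] and changes neither
    cohomology in positive degrees nor loops. *)
Definition X (s : list vx) : Prop := P3 s \/ incl s big.

Lemma fc_app {V : Type} (F G : list (list V)) s : fc (F ++ G) s <-> fc F s \/ fc G s.
Proof.
split.
- intros (f & Hf & I). apply in_app_or in Hf as [Hf|Hf]; [left|right]; exists f; auto.
- intros [(f & Hf & I)|(f & Hf & I)]; exists f; split; auto; apply in_or_app; auto.
Qed.
Lemma Q_Qf s : Q s <-> fc Qf s.
Proof. unfold Q, Qf, attach. rewrite fc_app. tauto. Qed.
Lemma Q_closed : closed Q.
Proof. apply attach_closed, fc_closed. Qed.
Lemma P1_closed : closed P1.
Proof. apply attach_closed, fc_closed. Qed.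
Lemma P2_closed : closed P2.
Proof. apply or_closed; [apply P1_closed|apply fc_closed]. Qed.
Lemma P3_closed : closed P3.
Proof. apply attach_closed, P2_closed. Qed.
Lemma X_closed : closed X.
Proof. apply or_closed; [apply P3_closed|apply incl_closed]. Qed.

Lemma in_targets s : In s targets -> match s with GE _ | GC _ | GG _ => False | _ => True end.
Proof. intros [<-|[<-|H]]; auto. apply in_base in H. destruct s; auto. Qed.
Lemma fixed_cases s : In s fixed_gens -> In s targets \/ exists s', In s' targets /\ s = GE s'.
Proof. intros H. apply in_app_or in H as [H|H]; auto. apply in_map_iff in H as (s' & <- & H). eauto. Qed.
Lemma fixed_not s : In s fixed_gens -> match s with GC _ | GG _ => False | _ => True end.
Proof. intros H. apply fixed_cases in H as [H|(s' & _ & ->)]; auto. apply in_targets in H. destruct s; auto. Qed.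
Lemma all_not_gg g : In g all_gens -> ~ is_gg g.
Proof.
intros H [j ->]. apply in_app_or in H as [H|H]; [exact (fixed_not _ H)|].
apply in_map_iff in H as (i & E & _). easy.
Qed.
Lemma fixed_all g : In g fixed_gens -> In g all_gens.
Proof. intros H. apply in_or_app; auto. Qed.
Lemma gc_all i : i <= N -> In (GC i) all_gens.
Proof. intros H. apply in_or_app; right. apply in_map, in_seq. lia. Qed.

Lemma target_word_letters s g b : In s targets -> In (g, b) (target_word s) -> g = s \/ g = GY.
Proof. intros _ H. destruct s; simpl in H; intuition congruence. Qed.
Lemma kill_letters r g b : In r kill_rels -> In (g, b) (relw r) -> In g fixed_gens.
Proof.
assert (Tw : forall s g b, In s targets -> In (g, b) (target_word s) -> In g fixed_gens).
{ intros s g0 b0 Hs H. apply in_or_app; left.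
 destruct (target_word_letters s g0 b0 Hs H) as [->| ->]; auto. right; left; auto. }
intros Hr H. apply in_app_or in Hr as [Hr|Hr]; apply in_map_iff in Hr as (s & <- & Hs); simpl in H.
- assert (In (GE s) fixed_gens) by (apply in_or_app; right; apply in_map; auto).
 pose proof (killer_fixed Rs d acc s). intuition congruence.
- assert (In (GE s) fixed_gens) by (apply in_or_app; right; apply in_map; auto).
 destruct H as [H|H]; [congruence|]. apply in_app_or in H as [H|[H|H]]; [eauto|congruence|].
 apply in_app_or in H as [H|H]; apply in_winv in H as [b' H]; eauto.
Qed.
Lemma kill_nonempty r : In r kill_rels -> relw r <> [].
Proof. intros Hr. apply in_app_or in Hr as [Hr|Hr]; apply in_map_iff in Hr as (s & <- & _); easy. Qed.

Lemma kill_attachable gs r : (forall g, In g fixed_gens -> In g gs) -> In r kill_rels ->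
 attachable (fc (bouquet gs)) r (relw r).
Proof.
intros Hg Hr. split; [apply kill_nonempty; auto|split; [|apply bouquet_fresh]].
intros g b H. apply bouquet_loop, Hg. eapply kill_letters; eauto.
Qed.

Lemma val_RK1 (x : gen -> RG) s : weval x (relw (RK1 s)) = (- x (GE s))%R.
Proof. simpl. lra. Qed.
Lemma val_RK2 (x : gen -> RG) s : weval x (relw (RK2 s)) = (- (weval x (target_word s) : R))%R.
Proof.
change (weval x (relw (RK2 s))) with
 (x (GE s) ** weval x (target_word s ++ (GE s, false) :: winv (target_word s) ++ winv (target_word s))).
rewrite weval_app. cbn [weval]. rewrite weval_app, !weval_inv. simpl. lra.
Qed.

Definition ind (p : gen -> Prop) (g : gen) : RG := if em (p g) then 1%R else 0%R.
Lemma ind_1 (p : gen -> Prop) g : p g -> ind p g = 1%R.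
Proof. intros H. unfold ind. destruct (em _); tauto. Qed.
Lemma ind_0 (p : gen -> Prop) g : ~ p g -> ind p g = 0%R.
Proof. intros H. unfold ind. destruct (em _); tauto. Qed.

(** Up to sign, [RK1 s] counts [GE s] and [RK2 s] counts the target word of [s]. Indicators serve as
    dual assignments except for [GY]: the words of the base letters contain [GY], so these letters
    have to take the value -1. *)
Lemma kill_dual r : In r kill_rels -> exists x : gen -> RG,
 (forall r', In r' kill_rels -> r' <> r -> weval x (relw r') = 1) /\ weval x (relw r) <> 1.
Proof.
intros Hr.
assert (Sp : forall r', In r' kill_rels -> (exists s, In s targets /\ r' = RK1 s) \/ (exists s, In s targets /\ r' = RK2 s)).
{ intros r' H. apply in_app_or in H as [H|H]; apply in_map_iff in H as (s & <- & H); eauto. }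
destruct (Sp r Hr) as [(s & Hs & ->)|(s & Hs & ->)].
- exists (ind (eq (GE s))). split.
 + intros r' H Nr. destruct (Sp r' H) as [(s' & Hs' & ->)|(s' & Hs' & ->)].
  * rewrite val_RK1, ind_0 by congruence. simpl. lra.
  * rewrite val_RK2.
   apply in_targets in Hs'. destruct s'; try tauto; simpl; rewrite !ind_0 by easy; lra.
 + rewrite val_RK1, ind_1 by auto. simpl. lra.
- destruct (classic (s = GY)) as [->|Ny].
 + exists (fun g => match g with GY => 1%R | GX _ | GT _ | GR _ | GK => (-1)%R | _ => 0%R end : RG). split.
  * intros r' H Nr. destruct (Sp r' H) as [(s' & Hs' & ->)|(s' & Hs' & ->)].
   -- rewrite val_RK1. simpl. lra.
   -- rewrite val_RK2.
     apply in_targets in Hs'. destruct s'; try tauto; simpl; lra.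
  * rewrite val_RK2. simpl. lra.
 + exists (ind (eq s)). split.
  * intros r' H Nr. destruct (Sp r' H) as [(s' & Hs' & ->)|(s' & Hs' & ->)].
   -- rewrite val_RK1, ind_0; [simpl; lra|].
     intros ->. exact (in_targets _ Hs).
   -- rewrite val_RK2.
     assert (Ns : s <> s') by congruence.
     destruct s'; simpl; rewrite !ind_0 by auto; lra.
  * rewrite val_RK2.
   destruct s; try congruence; simpl; rewrite ?(ind_1 (eq _)), ?(ind_0 (eq _)) by auto; lra.
Qed.

Lemma Hv_kill gs n : (forall g, In g fixed_gens -> In g gs) -> (forall g, In g gs -> ~ is_gg g) ->
 Hv (attach relw (fc (bouquet gs)) kill_rels) (S (S n)).
Proof.
intros Hg NG. apply (attach_Hv relw (fun g => In g gs)).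
- apply fc_closed.
- apply Hv_dim. intros f Hf. apply in_flat_map in Hf as (g & _ & Hf).
 destruct Hf as [<-|[<-|[<-|[]]]]; simpl; lia.
- intros r Hr. split; [apply kill_attachable; auto|]. intros g b H. apply Hg. eapply kill_letters; eauto.
- intros ds1 r ds2 E Nr. destruct (kill_dual r) as (x & H1 & H2).
 { rewrite E. apply in_or_app; right; left; auto. }
 exists x. split; [apply bouquet_realizes; auto|]. split; auto. intros r' Hr'. apply H1; [|congruence].
 rewrite E. apply in_or_app; auto.
Qed.

Lemma kills_of_words (M : group) (x : gen -> M) :
 (forall r, In r kill_rels -> weval x (relw r) = 1) <-> kills_all Rs d acc x.
Proof.
assert (E1 : forall s, weval x (relw (RK1 s)) = 1 <->
 x (killer acc s) ** x (GE s) = x (GE s) ** (x (GE s) ** x (killer acc s))).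
{ intros s. simpl. gsimp. split; intros H.
 - apply geq_of_div. gsimp. auto.
 - rewrite <- !gassoc, H. gsimp. auto. }
assert (E2 : forall s, weval x (relw (RK2 s)) = 1 <->
 x (GE s) ** weval x (target_word s) = weval x (target_word s) ** (weval x (target_word s) ** x (GE s))).
{ intros s. change (weval x (relw (RK2 s))) with
  (x (GE s) ** weval x (target_word s ++ (GE s, false) :: winv (target_word s) ++ winv (target_word s))).
 rewrite weval_app. cbn [weval]. rewrite weval_app, !weval_inv. gsimp. split; intros H.
 - apply geq_of_div. gsimp. auto.
 - rewrite <- !gassoc, H. gsimp. auto. }
split.
- intros H s Hs. split; [apply E1|apply E2]; apply H, in_or_app; [left|right]; apply in_map; auto.
- intros H r Hr. apply in_app_or in Hr as [Hr|Hr]; apply in_map_iff in Hr as (s & <- & Hs);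
  [apply E1|apply E2]; apply H; auto.
Qed.

Lemma Q_trivial (M : group) (l : vx -> vx -> M) : flat_lab Q l -> (forall g, In g fixed_gens -> hol l g = 1) ->
 exists h, trivializes Q l h /\ h Base = 1.
Proof.
intros Fl H. destruct (attach_trivial relw M l (fun v => match v with Lp _ _ => l Base v | _ => 1 end)
 (fc (bouquet fixed_gens)) kill_rels) as (h & T & E).
- apply fc_closed.
- intros r Hr. apply kill_attachable; auto.
- auto.
- apply bouquet_trivial; auto.
 + intros g Hg. apply all_not_gg, fixed_all, Hg.
 + intros u v w Hs. apply Fl. left; auto.
- exists h. split; auto. rewrite E; auto. intros r. split; [auto|easy].
Qed.

Lemma kill_holonomy (M : group) (l : vx -> vx -> M) : flat_lab Q l -> kills_all Rs d acc (hol l).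
Proof.
intros Fl. apply kills_of_words. intros r Hr.
apply (attach_holonomy relw M l (fc (bouquet fixed_gens)) kill_rels r); auto using fc_closed.
apply kill_attachable; auto.
Qed.

(** In degree one, the killing relations read additively give that each [GE s] and each target word
    is 0, hence every letter; in higher degrees independence of the relators suffices. *)
Lemma Hv_Q n : Hv Q (S n).
Proof.
destruct n as [|n].
- apply Hv_1_of_trivial. intros l Fl.
 enough (H : forall g, In g fixed_gens -> hol l g = 1) by (destruct (Q_trivial RG l Fl H) as (h & T & _); eauto).
 pose proof (kill_holonomy RG l Fl) as K.
 assert (V1 : forall s, In s targets -> hol l (GE s) = (0%R : RG) /\ weval (hol l) (target_word s) = (0%R : RG)).
 { intros s Hs. destruct (K s Hs) as [K1 K2]. simpl in *. split; lra. }
 assert (Vy : hol l GY = (0%R : RG)).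
 { destruct (V1 GY (or_intror (or_introl eq_refl))) as [_ H]. cbn [target_word weval] in H.
  rewrite gone_r in H. auto. }
 intros g Hg. apply fixed_cases in Hg as [Hg|(s & Hs & ->)]; [|apply V1; auto].
 destruct (V1 g Hg) as [_ H]. destruct g; cbn [target_word weval] in H; rewrite gone_r, ?Vy in H; simpl in *; lra.
- apply Hv_kill; auto. intros g Hg. apply all_not_gg, fixed_all, Hg.
Qed.

(** The boundary of a triangle. The vertex [None] carries the copy of [Q] that is shared with the
    rest of the complex. *)
Definition C3 : list (option bool) -> Prop := fc [[None; Some false]; [Some false; Some true]; [Some true; None]].
Ltac c3 := solve [eexists; split; [left; reflexivity|subset] | eexists; split; [right; left; reflexivity|subset] |
 eexists; split; [do 2 right; left; reflexivity|subset]].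
Definition psi (j : nat) (x : vx * option bool) : vx :=
 match snd x with None => fst x | Some b => Pr j b (fst x) end.
Definition strip (j : nat) (v : vx) : vx * option bool :=
 match v with Pr j' b w => if j' =? j then (w, Some b) else (v, None) | _ => (v, None) end.
Definition is_pr (v : vx) : Prop := exists j b w, v = Pr j b w.
Definition Prod (j : nat) : list vx -> Prop := fc (prod_facets j).

Lemma psi_strip j v : psi j (strip j v) = v.
Proof. unfold strip, psi. destruct v; auto. destruct (Nat.eqb_spec j0 j) as [->|]; auto. Qed.
Lemma strip_psi j v o : ~ is_pr v -> strip j (psi j (v, o)) = (v, o).
Proof.
intros Np. destruct o as [b|]; simpl; [rewrite Nat.eqb_refl; auto|].
unfold strip. destruct v; auto. destruct Np. do 3 eexists; eauto.
Qed.
Lemma strip_old j v : ~ is_pr v -> strip j v = (v, None).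
Proof. apply (strip_psi j v None). Qed.
Lemma is_pr_lv g b : ~ is_gg g -> ~ is_pr (lv g b).
Proof. intros H (j & b' & w & E). rewrite lv_Lp in E by auto. easy. Qed.

Lemma P1_old s v : P1 s -> In v s -> ~ is_pr v.
Proof.
intros [(f & Hf & I)|(f & Hf & I)] Hv; specialize (I v Hv).
- destruct (bouquet_vertices _ _ _ Hf I) as [->|(g & b & Hg & ->)].
 + intros (j & b & w & E); easy.
 + apply is_pr_lv, all_not_gg, Hg.
- apply in_flat_map in Hf as (r & Hr & Hf).
 destruct (disc_vertices relw r f v Hf I) as [(i & ->)|[->|(k & ->)]];
  [|intros (j & b & w & E); easy|intros (j & b & w & E); easy].
 unfold be. destruct (i mod 3) as [|[|]]; [intros (j & b & w & E); easy| |];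
  (apply is_pr_lv, all_not_gg, fixed_all;
   set (q := (i / 3) mod length (relw r));
   assert (In (nth q (relw r) (GK, true)) (relw r)) by
    (apply nth_In, Nat.mod_upper_bound; pose proof (kill_nonempty r Hr); destruct (relw r); simpl; [congruence|lia]);
   destruct (nth q (relw r) (GK, true)) as [g b]; eapply kill_letters; eauto).
Qed.
Lemma Q_P1 s : Q s -> P1 s.
Proof.
intros [(f & Hf & I)|H]; [left|right]; auto. exists f. split; auto.
apply in_flat_map in Hf as (g & Hg & Hf). apply in_flat_map. exists g. split; auto. apply fixed_all; auto.
Qed.
Lemma Q_old s v : Q s -> In v s -> ~ is_pr v.
Proof. intros H. apply P1_old, Q_P1, H. Qed.
Lemma Q_Base : Q [Base].
Proof.
left. exists [Base; lv GZ false]. split; [apply in_flat_map; exists GZ; split; left; auto|].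
intros y [<-|[]]; left; auto.
Qed.

Lemma C3_closed : closed C3.
Proof. apply fc_closed. Qed.
Lemma C3_None i : C3 [i] -> C3 [None; i].
Proof.
intros _. destruct i as [[|]|]; c3.
Qed.
Lemma C3_refl i : C3 [i].
Proof.
destruct i as [[|]|]; c3.
Qed.

Lemma Prod_prodc j s : Prod j s <-> prodc Q C3 (map (strip j) s).
Proof.
split.
- intros (f & Hf & I). apply in_flat_map in Hf as (f0 & Hf0 & Hf).
 assert (Q0 : Q f0) by (apply Q_Qf; exists f0; split; auto; apply incl_refl).
 assert (E : exists e, In e [[None; Some false]; [Some false; Some true]; [Some true; None]] /\
  forall v, In v s -> In (fst (strip j v)) f0 /\ In (snd (strip j v)) e).
 { assert (E0 : forall v, In v f0 -> strip j v = (v, None)) by (intros; eapply strip_old, Q_old; eauto).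
  destruct Hf as [<-|[<-|[<-|[]]]];
   [exists [None; Some false]|exists [Some false; Some true]|exists [Some true; None]]; (split; [simpl; auto|]); intros v Hv; apply I in Hv;
   apply in_app_or in Hv as [Hv|Hv]; try (apply in_map_iff in Hv as (w & <- & Hw));
   rewrite ?E0 by auto; cbn [strip fst snd]; rewrite ?Nat.eqb_refl; cbn [fst snd]; simpl; auto. }
 destruct E as (e & He & E). split.
 + apply (Q_closed f0); auto. intros y Hy. apply in_map_iff in Hy as (p & <- & Hp).
  apply in_map_iff in Hp as (v & <- & Hv). apply E, Hv.
 + exists e. split; auto. intros y Hy. apply in_map_iff in Hy as (p & <- & Hp).
  apply in_map_iff in Hp as (v & <- & Hv). apply E, Hv.
- intros [HQ (e & He & I)]. apply Q_Qf in HQ as (f0 & Hf0 & I0).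
 assert (E : forall v, In v s -> exists w o, In w f0 /\ In o e /\ v = psi j (w, o)).
 { intros v Hv. exists (fst (strip j v)), (snd (strip j v)). split; [|split].
  - apply I0, in_map, in_map, Hv.
  - apply I, in_map, in_map, Hv.
  - rewrite <- surjective_pairing, psi_strip. auto. }
 destruct He as [<-|[<-|[<-|[]]]];
  [exists (f0 ++ map (Pr j false) f0)|exists (map (Pr j false) f0 ++ map (Pr j true) f0)|exists (map (Pr j true) f0 ++ f0)];
  (split; [apply in_flat_map; exists f0; simpl; auto|]; intros v Hv; destruct (E v Hv) as (w & o & Hw & Ho & ->);
   apply in_or_app; destruct Ho as [<-|[<-|[]]]; unfold psi; cbn [fst snd]; auto using in_map).
Qed.

Lemma Prod_strip j s v : Prod j s -> In v s -> ~ is_pr (fst (strip j v)).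
Proof. intros H Hv. apply Prod_prodc in H as [H _]. apply (Q_old _ _ H), in_map, in_map, Hv. Qed.
Lemma Prod_psi j t : prodc Q C3 t -> Prod j (map (psi j) t).
Proof.
intros H. apply Prod_prodc. rewrite map_map, (map_ext_in _ (fun x => x)), map_id; auto.
intros [v o] Hv. apply strip_psi. eapply Q_old; [apply H|]. apply (in_map fst _ _ Hv).
Qed.

Lemma Hv_Prod j n : 2 <= n -> Hv (Prod j) n.
Proof.
intros Hn. apply (Hv_retract (psi j) (strip j) (prodc Q C3)).
- intros s. apply Prod_prodc.
- apply Prod_psi.
- intros s _. rewrite map_map, (map_ext _ (fun x => x)), map_id; auto. apply psi_strip.
- apply Hv_prod_dim; [apply Q_closed| |].
 + intros [|k] Hk; [lia|]. apply Hv_Q.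
 + intros f [<-|[<-|[<-|[]]]]; simpl; lia.
Qed.

Lemma Prod_old j s : Prod j s -> (forall v, In v s -> strip j v = (v, None)) -> Q s.
Proof.
intros H E. apply Prod_prodc in H as [H _].
rewrite (map_ext_in _ (fun v => (v, None)) s), map_map, map_id in H; auto.
Qed.
Lemma Q_Prod j s : Q s -> Prod j s.
Proof.
intros H. apply Prod_prodc. rewrite (map_ext_in _ (fun v => (v, None)) s).
- split; simpl; rewrite ?map_map; [rewrite map_id; auto|].
 exists [None; Some false]. split; [left; auto|]. intros y Hy. apply in_map_iff in Hy as (? & <- & _). left; auto.
- intros v Hv. eapply strip_old, Q_old; eauto.
Qed.

(** Each product meets everything before it exactly in [Q], which has no cohomology in positive
    degrees. The circle factors themselves contribute to degree one, whence the bound on [n]. *)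
Lemma Hv_P2 n : 2 <= n -> Hv P2 n.
Proof.
intros Hn. unfold P2. generalize nprod as J. induction J as [|J IH].
- eapply Hv_ext with (P := P1); [intros s; split; [auto|intros [H|(f & [] & _)]; auto]|].
 destruct n as [|[|n]]; try lia. apply Hv_kill; auto using fixed_all. apply all_not_gg.
- rewrite seq_S, flat_map_app. simpl. rewrite app_nil_r.
 eapply Hv_ext with (P := fun s => (P1 s \/ fc (flat_map prod_facets (seq 0 J)) s) \/ Prod J s).
 { intros s. rewrite fc_app. unfold Prod. tauto. }
 destruct n as [|n]; [lia|]. apply Hv_union; auto using fc_closed, Hv_Prod.
 { apply or_closed; auto using P1_closed, fc_closed. }
 { apply fc_closed. }
 eapply Hv_ext with (P := Q); [|destruct n; [lia|apply Hv_Q]].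
 intros s. split.
 + intros H. split; [left; apply Q_P1; auto|apply Q_Prod; auto].
 + intros [[H|(f & Hf & I)] HJ]; apply (Prod_old J); auto; intros v Hv.
  * eapply strip_old, P1_old; eauto.
  * apply in_flat_map in Hf as (j & Hj & Hf). apply in_seq in Hj.
   assert (Pj : Prod j s) by (exists f; split; auto).
   pose proof (Prod_strip _ _ _ Pj Hv) as Np. rewrite <- (psi_strip j v).
   destruct (strip j v) as [w o]. simpl in Np. destruct o as [b|]; simpl; [|apply strip_old; auto].
   rewrite (proj2 (Nat.eqb_neq j J)) by lia. auto.
Qed.

Definition level (v : vx) : option (nat * bool) := match v with Pr j b _ => Some (j, b) | _ => None end.
Definition below (v : vx) : vx := match v with Pr _ _ w => w | _ => v end.
(** The value of the central letter sits on the third edge of the triangle; centrality lets it be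
    multiplied to the label of the simplex below without spoiling flatness. *)
Definition twist {M : group} (x : gen -> M) (a b : option (nat * bool)) : M :=
 match a, b with
 | Some (j, true), None => x (GG j) | None, Some (j, true) => (x (GG j))^-1 | _, _ => 1 end.

Lemma P2_realizes (M : group) (x : gen -> M) : (forall j y, x (GG j) ** y = y ** x (GG j)) ->
 (forall r, In r kill_rels -> weval x (relw r) = 1) ->
 realizes P2 (fun g => In g all_gens \/ is_gg g) x.
Proof.
intros Cen H.
destruct (attach_realizes relw (fun g => In g all_gens) M x (fc (bouquet all_gens)) kill_rels) as (l & Fl & E).
- apply fc_closed.
- intros r Hr. split; [apply kill_attachable; auto using fixed_all|]. split; auto.
 intros g b Hg. eapply fixed_all, kill_letters; eauto.
- apply bouquet_realizes, all_not_gg.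
- fold P1 in Fl.
 assert (CenI : forall j y, (x (GG j))^-1 ** y = y ** (x (GG j))^-1).
 { intros j y. apply (gcancel_l (x (GG j))), (gcancel_r (x (GG j))). gsimp. rewrite <- Cen. gsimp. auto. }
 assert (CenT : forall a b y, twist x a b ** y = y ** twist x a b).
 { intros [[j [|]]|] [[j' [|]]|] y; simpl; gsimp; auto. }
 assert (RB : l Base Base = 1) by (apply (flat_refl P1 l P1_closed Fl), Q_P1, Q_Base).
 exists (fun u v => l (below u) (below v) ** twist x (level u) (level v)). split.
 + intros u v w [Hs|(f & Hf & I)].
  * assert (Eb : forall y, In y [u; v; w] -> below y = y /\ level y = None).
   { intros y Hy. pose proof (P1_old _ _ Hs Hy) as Np. destruct y; auto. destruct Np. do 3 eexists; eauto. }
   destruct (Eb u (or_introl eq_refl)) as [-> ->], (Eb v (or_intror (or_introl eq_refl))) as [-> ->],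
    (Eb w (or_intror (or_intror (or_introl eq_refl)))) as [-> ->]. simpl. gsimp. apply Fl; auto.
  * apply in_flat_map in Hf as (j & Hj & Hf).
   assert (Pj : Prod j [u; v; w]) by (exists f; auto). pose proof (proj1 (Prod_prodc _ _) Pj) as [PQ PC].
   assert (Eb : forall y, In y [u; v; w] -> below y = fst (strip j y) /\
     level y = match snd (strip j y) with Some b => Some (j, b) | None => None end).
   { intros y Hy. pose proof (Prod_strip _ _ _ Pj Hy) as Np. rewrite <- (psi_strip j y) at 1 3.
    destruct (strip j y) as [y' [b|]]; simpl in *; auto.
    destruct y'; auto. destruct Np. do 3 eexists; eauto. }
   destruct (Eb u (or_introl eq_refl)) as [-> ->], (Eb v (or_intror (or_introl eq_refl))) as [-> ->],
    (Eb w (or_intror (or_intror (or_introl eq_refl)))) as [-> ->].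
   assert (F3 : l (fst (strip j u)) (fst (strip j v)) ** l (fst (strip j v)) (fst (strip j w)) =
          l (fst (strip j u)) (fst (strip j w))) by (apply Fl, Q_P1, PQ).
   rewrite <- F3, gassoc, <- (gassoc _ (twist x _ _) (l _ _)), CenT. gsimp. do 2 f_equal.
   simpl in PC. destruct PC as (e & He & I').
   assert (Hu := I' _ (or_introl eq_refl)). assert (Hv := I' _ (or_intror (or_introl eq_refl))).
   assert (Hw := I' _ (or_intror (or_intror (or_introl eq_refl)))).
   destruct He as [<-|[<-|[<-|[]]]]; destruct Hu as [<-|[<-|[]]], Hv as [<-|[<-|[]]], Hw as [<-|[<-|[]]]; simpl; gsimp; auto.
 + intros g [Hg|[j ->]].
  * rewrite <- E by auto. unfold hol. rewrite !lv_Lp by (apply all_not_gg; auto). simpl. gsimp. auto.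
  * unfold hol. simpl. rewrite RB. gsimp. auto.
Qed.

Lemma base_all g : In g (base_gens Rs d acc) -> In g all_gens.
Proof. intros H. apply fixed_all, base_fixed, H. Qed.
Lemma base_simple : In (GX 0) (base_gens Rs d acc) /\ In (GT 0) (base_gens Rs d acc) /\
 In GK (base_gens Rs d acc) /\ In (GT acc) (base_gens Rs d acc).
Proof.
rewrite !in_base. simpl. auto 6.
Qed.
Lemma late_cases r : In r late_rels -> (exists j u v, r = RM j /\ In (u, v) machine_words /\ nth_error machine_words j = Some (u, v) /\ relw r = (GG (S j), false) :: u ++ winv v) \/
 r = RC0 \/ (exists i, i < N /\ r = RC i) \/ r = RV.
Proof.
intros Hr. apply in_app_or in Hr as [Hr|[<-|Hr]]; auto.
- left. apply in_map_iff in Hr as (j & <- & Hj). apply in_seq in Hj. cbn [relw].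
 destruct (nth_error machine_words j) as [[u v]|] eqn:E.
 + exists j, u, v. split; auto. split; [apply nth_error_In in E; auto|auto].
 + apply nth_error_None in E. lia.
- right; right. apply in_app_or in Hr as [Hr|[<-|[]]]; auto. left.
 apply in_map_iff in Hr as (i & <- & Hi). apply in_seq in Hi. exists i. split; auto. lia.
Qed.
Ltac late r Hr := destruct (late_cases r Hr) as [(j & u & v & -> & Hw & Ej & E)|[->|[(i & Hi & ->)| ->]]].
Lemma machine_letters u v g b : In (u, v) machine_words -> In (g, b) (u ++ winv v) -> In g (base_gens Rs d acc).
Proof.
intros Hw H. apply in_app_or in H as [H|H].
- apply (machine_words_gens Rs d acc u v g b); auto.
- apply in_winv in H as [b' H]. apply (machine_words_gens Rs d acc u v g b'); auto.
Qed.

Lemma late_letters r g b : In r late_rels -> In (g, b) (relw r) ->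
 In g all_gens \/ exists j, j < nprod /\ g = GG j.
Proof.
intros Hr H. destruct base_simple as (B1 & B2 & B3 & _). apply base_all in B1, B2, B3.
late r Hr.
- rewrite E in H. destruct H as [H|H].
 + injection H as <- _. right. exists (S j). split; auto. unfold nprod.
  assert (j < length machine_words) by (apply nth_error_Some; congruence). lia.
 + left. eapply base_all, machine_letters; eauto.
- left. destruct H as [H|[H|[]]]; injection H as <- _; auto. apply gc_all; lia.
- left. destruct H as [H|[H|[H|[H|[]]]]]; injection H as <- _; auto; apply gc_all; lia.
- destruct H as [H|[H|[H|[H|[H|[]]]]]]; injection H as <- _; auto; try (left; apply gc_all; lia).
 right. exists 0. unfold nprod. split; auto; lia.
Qed.

Lemma P2_vertex s v : P2 s -> In v s -> (exists s', P1 s' /\ In v s') \/ is_pr v.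
Proof.
intros [Hs|(f & Hf & I)] Hv; [left; eauto|].
apply in_flat_map in Hf as (j & _ & Hf). assert (Pj : Prod j s) by (exists f; auto).
apply Prod_prodc in Pj as [PQ _].
assert (Hs : In (fst (strip j v)) (map fst (map (strip j) s))) by (apply in_map, in_map, Hv).
rewrite <- (psi_strip j v). destruct (strip j v) as [w [b|]]; cbn [psi fst snd] in *.
- right. exists j, b, w. reflexivity.
- left. eexists. split; [apply Q_P1, PQ|]; auto.
Qed.

Lemma late_not_kill r : In r late_rels -> ~ In r kill_rels.
Proof.
intros Hr H. apply in_app_or in H as [H|H]; apply in_map_iff in H as (s & E & _); subst r;
 destruct (late_cases _ Hr) as [(j & u & v & E & _)|[E|[(i & _ & E)|E]]]; easy.
Qed.

Lemma late_attachable r : In r late_rels -> attachable P2 r (relw r).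
Proof.
intros Hr. split; [|split].
- late r Hr; try easy.
 rewrite E. easy.
- intros g b H. destruct (late_letters r g b Hr H) as [Hg|(j & Hj & ->)].
 + intros f Hf. left; left. apply (bouquet_loop all_gens g Hg f Hf).
 + assert (E : forall a b, C3 [a; b] -> P2 [psi j (Base, a); psi j (Base, b)]).
  { intros a b0 HC. right. destruct (Prod_psi j [(Base, a); (Base, b0)]) as (f & Hf & I).
   - split; auto. simpl. apply (Q_closed [Base]); [apply Q_Base|subset].
   - exists f. split; auto. apply in_flat_map. exists j. rewrite in_seq. split; auto. lia. }
  intros f [<-|[<-|[<-|[]]]]; [apply (E None (Some false))|apply (E (Some false) (Some true))|apply (E (Some true) None)];
   eexists; (split; [|apply incl_refl]); simpl; auto.
- intros s Hs.
 assert (NV : forall v, In v s -> v <> Ct r /\ forall k, v <> Rg r k).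
 { intros v Hv. destruct (P2_vertex s v Hs Hv) as [(s' & Hs' & Hv')|(j & b & w & ->)]; [|split; easy].
  destruct (attach_fresh relw (fc (bouquet all_gens)) kill_rels r (bouquet_fresh _ _) (late_not_kill r Hr) s' Hs') as [F1 F2].
  split; [intros ->; auto|intros k ->; apply (F2 k); auto]. }
 split; [|intros k]; intros H; destruct (NV _ H) as [N1 N2]; [apply N1; auto|apply (N2 k); auto].
Qed.

Lemma weval_zero (x : gen -> RG) w : (forall g b, In (g, b) w -> x g = (0%R : RG)) -> weval x w = (0%R : RG).
Proof.
intros H. rewrite (weval_ext x (fun _ => (0%R : RG)) w) by auto.
induction w as [|[g [|]] w IH]; cbn [weval]; auto; rewrite IH by (intros; eapply H; right; eauto); simpl; lra.
Qed.

Lemma val_RM (x : gen -> RG) j u v : In (u, v) machine_words -> relw (RM j) = (GG (S j), false) :: u ++ winv v ->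
 (forall g, In g (base_gens Rs d acc) -> x g = (0%R : RG)) -> weval x (relw (RM j)) = (- x (GG (S j)))%R.
Proof.
intros Hw E H. rewrite E. cbn [weval]. rewrite (weval_zero x (u ++ winv v)).
- simpl. lra.
- intros g b Hg. eapply H, machine_letters; eauto.
Qed.

(** The central letter of [RM j] or of [RV] occurs in no other relator. The relator [RC i] compares
    two consecutive [GC], so it alone sees the jump of the indicator of all indices above [i]; the
    constant 1 on all [GC] is seen only by [RC0]. *)
Lemma late_dual r : In r late_rels -> exists x : gen -> RG,
 (forall g, In g fixed_gens -> x g = (0%R : RG)) /\
 (forall r', In r' late_rels -> r' <> r -> weval x (relw r') = 1) /\ weval x (relw r) <> 1.
Proof.
intros Hr.
destruct base_simple as (B1 & B2 & B3 & _).
assert (Gen : forall p : gen -> Prop, (forall g, p g -> ~ In g fixed_gens) ->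
 (forall r', In r' late_rels -> r' <> r -> match r' with
   | RM j => ~ p (GG (S j)) | RC0 => ~ p (GC 0) | RC i => (p (GC i) <-> p (GC (S i))) | RV => ~ p (GG 0) | _ => True end) ->
 match r with
   | RM j => p (GG (S j)) | RC0 => p (GC 0) | RC i => ~ (p (GC i) <-> p (GC (S i))) | RV => p (GG 0) | _ => True end ->
 exists x : gen -> RG, (forall g, In g fixed_gens -> x g = (0%R : RG)) /\
  (forall r', In r' late_rels -> r' <> r -> weval x (relw r') = 1) /\ weval x (relw r) <> 1).
{ intros p Hp H1 H2. assert (Fx : forall g, In g fixed_gens -> ind p g = (0%R : RG)).
 { intros g Hg. apply ind_0. intros H. apply (Hp g); auto. }
 exists (ind p). split; auto.
 assert (Fb : forall g, In g (base_gens Rs d acc) -> ind p g = (0%R : RG)) by auto using base_fixed.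
 assert (V : forall r', In r' late_rels -> weval (ind p) (relw r') = match r' with
   | RM j => (- ind p (GG (S j)))%R | RC0 => ind p (GC 0) | RC i => (ind p (GC i) - ind p (GC (S i)))%R
   | RV => (- ind p (GG 0))%R | _ => 0%R end).
 { intros r' Hr'. late r' Hr'.
  - eapply val_RM; eauto.
  - simpl. rewrite (Fb _ B2). simpl. lra.
  - simpl. rewrite (Fb _ B1). simpl. lra.
  - simpl. rewrite (Fb _ B3). simpl. lra. }
 split.
 - intros r' Hr' Nr. rewrite V by auto. specialize (H1 r' Hr' Nr).
  destruct r'; try reflexivity; rewrite ?ind_0 by auto; try (simpl; lra).
  destruct (classic (p (GC i))); [rewrite !ind_1 by tauto|rewrite !ind_0 by tauto]; simpl; lra.
 - rewrite V by auto. late r Hr;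
   rewrite ?ind_1 by auto; try (simpl; lra).
  destruct (classic (p (GC i))); [rewrite ind_1, ind_0 by tauto|rewrite ind_0, ind_1 by tauto]; simpl; lra. }
late r Hr.
- apply (Gen (eq (GG (S j)))); auto; [intros g <-; exact (fixed_not _)|].
 intros [] _ Nr; try congruence; try (split; easy); auto; easy.
- apply (Gen (fun g => exists i, g = GC i)); eauto; [intros g [i ->]; exact (fixed_not _)|].
 intros [] _ Nr; try congruence; try (intros [? ?]; easy); try (split; eauto); auto.
- apply (Gen (fun g => exists k, g = GC k /\ i < k)); [intros g (k & -> & _); exact (fixed_not _)| |].
 + intros [] _ Nr; auto; try (intros (? & ? & ?); easy).
  * intros (k & E & L). injection E as <-. lia.
  * split; intros (k & E & L); injection E as <-; eexists; split; eauto; try lia.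
   enough (i <> i0) by lia. congruence.
 + intros [_ H]. destruct H as (k & E & L); [exists (S i); split; auto|]. injection E as <-. lia.
- apply (Gen (eq (GG 0))); auto; [intros g <-; exact (fixed_not _)|].
 intros [] _ Nr; try congruence; try (split; easy); auto; easy.
Qed.

Lemma kills_zero (x : gen -> RG) : (forall g, In g fixed_gens -> x g = (0%R : RG)) ->
 forall r, In r kill_rels -> weval x (relw r) = 1.
Proof. intros H r Hr. apply weval_zero. intros g b Hg. eapply H, kill_letters; eauto. Qed.

Lemma Hv_P3 n : 2 <= n -> Hv P3 n.
Proof.
intros Hn. destruct n as [|[|n]]; try lia.
apply (attach_Hv relw (fun g => In g all_gens \/ is_gg g)).
- apply P2_closed.
- apply Hv_P2; lia.
- intros r Hr. split; [apply late_attachable; auto|]. intros g b H.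
 destruct (late_letters r g b Hr H) as [|(j & _ & ->)]; auto. right. exists j; auto.
- intros ds1 r ds2 E Nr. destruct (late_dual r) as (x & H0 & H1 & H2).
 { rewrite E. apply in_or_app; right; left; auto. }
 exists x. split; [|split]; auto.
 + apply P2_realizes; [intros; simpl; lra|apply kills_zero; auto].
 + intros r' Hr'. apply H1; [|congruence]. rewrite E. apply in_or_app; auto.
Qed.

Lemma P3_vertex s v : P3 s -> In v s -> (forall i, v <> Bs i) /\ forall k l, v <> Nv k l.
Proof.
assert (B : forall w i, (forall j, be w i <> Bs j) /\ forall k l, be w i <> Nv k l).
{ intros w i. unfold be, lv. destruct (i mod 3) as [|[|]]; [split; easy| |];
  match goal with |- context [fst ?x] => destruct (fst x) end; split; easy. }
assert (Dv : forall r f, In f (disc_facets r (relw r)) -> In v f -> (forall i, v <> Bs i) /\ forall k l, v <> Nv k l).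
{ intros r f Hf Hv. destruct (disc_vertices relw r f v Hf Hv) as [(i & ->)|[->|(k & ->)]]; auto; split; easy. }
assert (A1 : forall s, P1 s -> In v s -> (forall i, v <> Bs i) /\ forall k l, v <> Nv k l).
{ intros s' [(f & Hf & I)|(f & Hf & I)] Hv; specialize (I v Hv).
 - destruct (bouquet_vertices _ _ _ Hf I) as [->|(g & b & Hg & ->)]; [split; easy|].
  rewrite lv_Lp by (apply all_not_gg; auto). split; easy.
 - apply in_flat_map in Hf as (r & _ & Hf). eauto. }
intros [[Hs|(f & Hf & I)]|(f & Hf & I)] Hv; eauto.
- apply in_flat_map in Hf as (j & Hj & Hf). assert (Pj : Prod j s) by (exists f; auto).
 apply Prod_prodc in Pj as [PQ _].
 assert (Hs : In (fst (strip j v)) (map fst (map (strip j) s))) by (apply in_map, in_map, Hv).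
 assert (Hp := psi_strip j v). destruct (strip j v) as [w [b|]]; cbn [psi fst snd] in *; [subst v; split; easy|].
 subst w. apply (A1 _ (Q_P1 _ PQ) Hs).
- apply in_flat_map in Hf as (r & _ & Hf). eauto.
Qed.
Lemma P3_big s : P3 s -> incl s big -> incl s [Base].
Proof.
intros Hs I v Hv. destruct (I v Hv) as [<-|H]; [left; auto|].
apply in_map_iff in H as (i & <- & _). destruct (P3_vertex s _ Hs Hv) as [H _]. destruct (H i); auto.
Qed.
Lemma P3_Base : P3 [Base].
Proof. left; left. apply Q_P1, Q_Base. Qed.
Lemma P3_of_incl s : incl s [Base] -> P3 s.
Proof. apply P3_closed, P3_Base. Qed.

Lemma Hv_X n : 2 <= n -> Hv X n.
Proof.
intros Hn. destruct n as [|n]; [lia|]. apply Hv_union; auto using P3_closed, incl_closed, Hv_simplex, Hv_P3.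
apply Hv_ext with (P := fun s => incl s [Base]); [|apply Hv_simplex].
intros s. split; [|intros [H1 H2]; apply P3_big; auto].
intros I. split; [apply P3_of_incl; auto|]. intros v Hv. destruct (I v Hv) as [<-|[]]. left; auto.
Qed.
Lemma linked_mono (P P' : list vx -> Prop) o v : (forall s, P s -> P' s) -> linked P o v -> linked P' o v.
Proof. intros H L. induction L; [constructor|]. econstructor; eauto. Qed.

Lemma bouquet_linked gs v : fc (bouquet gs) [v] -> linked (fc (bouquet gs)) Base v.
Proof.
intros (f & Hf & I). apply in_flat_map in Hf as (g & Hg & Hf).
assert (Hv := I v (or_introl eq_refl)). pose proof (bouquet_loop gs g Hg) as L.
assert (L1 : linked (fc (bouquet gs)) Base (lv g false)).
{ econstructor; [constructor|]. apply L. left; auto. }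
assert (L2 : linked (fc (bouquet gs)) Base (lv g true)).
{ econstructor; [apply L1|]. apply L. right; left; auto. }
destruct Hf as [<-|[<-|[<-|[]]]]; destruct Hv as [<-|[<-|[]]]; auto; constructor.
Qed.

Lemma attach_linked P ds : closed P -> (forall r, In r ds -> attachable P r (relw r)) ->
 (forall v, P [v] -> linked P Base v) -> forall v, attach relw P ds [v] -> linked (attach relw P ds) Base v.
Proof.
intros CP HA HL v Hv. set (A := attach relw P ds).
assert (LP : forall u, P [u] -> linked A Base u).
{ intros u Hu. apply (linked_mono P); auto. intros s. left; auto. }
destruct Hv as [Hv|(f & Hf & I)]; auto. apply in_flat_map in Hf as (r & Hr & Hf).
destruct (HA r Hr) as (Nw & Hw & Fr). set (w := relw r) in *.
assert (Sub : forall f, In f (disc_facets r w) -> forall s, incl s f -> A s).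
{ intros f' Hf' s Is. right. exists f'. split; auto. apply in_flat_map. exists r. auto. }
assert (Pb : forall i, i <= plen w -> P [be w i]).
{ assert (0 < plen w) by (unfold plen; destruct w; simpl; [congruence|lia]).
 intros [|i] Hi.
 - apply (CP [be w 0; be w 1]); [apply be_step; auto|]. subset.
 - apply (CP [be w i; be w (S i)]); [apply be_step; auto|]. subset. }
assert (Col : forall i c, i < plen w -> In c (collar (be w) (rv r w) i) -> In c (disc_facets r w)).
{ intros i c Hi Hc. apply in_or_app; left. apply in_flat_map. exists i. rewrite in_seq. split; auto; lia. }
assert (R0 : forall i, i < plen w -> linked A Base (rv r w (2 * i)) /\ linked A Base (rv r w (2 * i + 1)) /\
 linked A Base (rv r w (2 * i + 2))).
{ intros i Hi. assert (B1 := LP _ (Pb i ltac:(lia))). assert (B2 := LP _ (Pb (S i) ltac:(lia))).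
 split; [|split]; econstructor.
 - apply B1.
 - eapply Sub; [apply (Col i); [auto|left; reflexivity]|]. subset.
 - apply B1.
 - eapply Sub; [apply (Col i); [auto|left; reflexivity]|]. subset.
 - apply B2.
 - eapply Sub; [apply (Col i); [auto|right; right; left; reflexivity]|]. subset. }
assert (R1 : forall k, k < 2 * plen w -> linked A Base (rv r w k) /\ linked A Base (rv r w (S k))).
{ intros k Hk. pose proof (Nat.div_mod k 2 ltac:(lia)). pose proof (Nat.mod_upper_bound k 2 ltac:(lia)).
 destruct (R0 (k / 2) ltac:(lia)) as (E1 & E2 & E3).
 replace (2 * (k / 2) + 2) with (S (2 * (k / 2) + 1)) in E3 by lia.
 destruct (Nat.eq_dec (k mod 2) 0) as [E|E].
 - replace (2 * (k / 2) + 1) with (S k) in E2 by lia. replace (2 * (k / 2)) with k in E1 by lia. auto.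
 - replace (2 * (k / 2) + 1) with k in * by lia. auto. }
assert (Hv := I v (or_introl eq_refl)). apply in_app_or in Hf as [Hf|Hf].
- apply in_flat_map in Hf as (i & Hi & Hf). apply in_seq in Hi.
 destruct (R0 i ltac:(lia)) as (E1 & E2 & E3). assert (B1 := LP _ (Pb i ltac:(lia))). assert (B2 := LP _ (Pb (S i) ltac:(lia))).
 destruct Hf as [<-|[<-|[<-|[]]]]; destruct Hv as [<-|[<-|[<-|[]]]]; auto.
- apply in_map_iff in Hf as (k & <- & Hk). apply in_seq in Hk. destruct (R1 k ltac:(lia)) as [E1 E2].
 destruct Hv as [<-|[<-|[<-|[]]]]; auto. econstructor; [apply E1|].
 eapply Sub; [apply in_or_app; right; apply (in_map (fun k => [Ct r; rv r w k; rv r w (S k)])), in_seq; instantiate (1 := k); lia|].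
 subset.
Qed.

Lemma Q_linked v : Q [v] -> linked Q Base v.
Proof.
apply attach_linked; auto using fc_closed, bouquet_linked. intros r Hr. apply kill_attachable; auto.
Qed.
Lemma P1_linked v : P1 [v] -> linked P1 Base v.
Proof.
apply attach_linked; auto using fc_closed, bouquet_linked. intros r Hr. apply kill_attachable; auto using fixed_all.
Qed.
Lemma Prod_P2 j s : j < nprod -> Prod j s -> P2 s.
Proof.
intros Hj (f & Hf & I). right. exists f. split; auto. apply in_flat_map. exists j. rewrite in_seq. split; auto. lia.
Qed.
Lemma P2_linked v : P2 [v] -> linked P2 Base v.
Proof.
assert (L1 : forall v, P1 [v] -> linked P2 Base v).
{ intros u Hu. apply (linked_mono P1); [left; auto|]. apply P1_linked, Hu. }
intros [Hv|(f & Hf & I)]; auto. apply in_flat_map in Hf as (j & Hj & Hf). apply in_seq in Hj.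
assert (Pj : Prod j [v]) by (exists f; auto). apply Prod_prodc in Pj as [PQ _].
cbn [map] in PQ. rewrite <- (psi_strip j v). destruct (strip j v) as [w [b|]]; cbn [psi fst snd] in *; [|apply L1, Q_P1, PQ].
econstructor; [apply L1, Q_P1, PQ|]. apply (Prod_P2 j); [lia|].
apply (Prod_psi j [(w, None); (w, Some b)]). split; simpl.
- apply (Q_closed [w]); auto. subset.
- apply C3_None, C3_refl.
Qed.
Lemma X_linked v : X [v] -> linked X Base v.
Proof.
intros [Hv|I].
- apply (linked_mono P3); [left; auto|]. apply attach_linked; auto using P2_closed, P2_linked, late_attachable.
- econstructor; [constructor|]. right. intros y [<-|[<-|[]]]; [left; auto|apply I; left; auto].
Qed.

Lemma prod_label_flat (M : group) (l : vx -> vx -> M) j : j < nprod -> flat_lab P2 l ->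
 flat_lab (prodc Q C3) (fun a b => l (psi j a) (psi j b)).
Proof. intros Hj Fl u v w H. apply Fl, (Prod_P2 j), (Prod_psi j [u; v; w]); auto. Qed.

(** The circle of the product is slid once around the loop of [s] inside [Q], edge by edge. *)
Lemma prod_central (M : group) (l : vx -> vx -> M) j s : j < nprod -> flat_lab P2 l -> In s fixed_gens ->
 hol l s ** hol l (GG j) = hol l (GG j) ** hol l s.
Proof.
intros Hj Fl Hs.
assert (Sl : forall u v, Q [u; v] -> l u v ** turn None M (fun a b => l (psi j a) (psi j b)) (Some false) (Some true) v =
 turn None M (fun a b => l (psi j a) (psi j b)) (Some false) (Some true) u ** l u v).
{ intros u v HQ. apply (turn_slide Q C3 None Q_closed C3_closed M _ (prod_label_flat M l j Hj Fl) C3_None u v); auto.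
 eexists; split; [right; left; reflexivity|apply incl_refl]. }
assert (L : forall f, In f (loop_facets s) -> Q f).
{ intros f Hf. left. apply (bouquet_loop fixed_gens s Hs f Hf). }
assert (L1 := Sl _ _ (L _ (or_introl eq_refl))). assert (L2 := Sl _ _ (L _ (or_intror (or_introl eq_refl)))).
assert (L3 := Sl _ _ (L _ (or_intror (or_intror (or_introl eq_refl))))).
change (hol l (GG j)) with (turn None M (fun a b => l (psi j a) (psi j b)) (Some false) (Some true) Base).
unfold hol. rewrite !gassoc, L3, <- !gassoc, (gassoc _ (l Base _)), L2, <- !gassoc, L1. auto.
Qed.

Lemma weval_one (M : group) (x : gen -> M) w : (forall g b, In (g, b) w -> x g = 1) -> weval x w = 1.
Proof.
induction w as [|[g b] w IH]; intros H; cbn [weval]; auto.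
rewrite IH by (intros; eapply H; right; eauto). rewrite (H g b) by (left; auto). destruct b; gsimp; auto.
Qed.

(** * The halting and the non-halting case *)

Definition halts : Prop :=
 clos_refl_trans _ (zstep Rs) (0, upd (fun _ => 0%Z) 0 (Z.of_nat N)) (acc, fun _ => 0%Z).

Lemma hol_trivial (M : group) (l : vx -> vx -> M) : halts -> flat_lab P3 l ->
 (forall g, In g all_gens -> hol l g = 1) /\ forall j, j < nprod -> hol l (GG j) = 1.
Proof.
intros Run Fl.
assert (F2 : flat_lab P2 l) by (intros u v w H; apply Fl; left; auto).
assert (FQ : flat_lab Q l) by (intros u v w H; apply F2; left; apply Q_P1; auto).
assert (Late : forall r, In r late_rels -> weval (hol l) (relw r) = 1).
{ intros r Hr. apply (attach_holonomy relw M l P2 late_rels r); auto using P2_closed, late_attachable. }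
set (x := hol l) in *.
(* The complex contains [GC i] only for [i <= N], while [chain] speaks of all [i]; the conjugates
   themselves are taken as values, and [EC] shows that nothing changes up to [N]. *)
set (x' := fun g => match g with GC i => gconj (gpow (x (GX 0)) i) (x (GT 0)) | _ => x g end).
assert (Ex : forall g, In g fixed_gens -> x' g = x g) by (intros [] H; auto; destruct (fixed_not _ H)).
assert (LR : In RC0 late_rels /\ (forall i, i < N -> In (RC i) late_rels) /\ In RV late_rels /\
 forall j, j < length machine_words -> In (RM j) late_rels).
{ unfold late_rels. repeat split; intros; apply in_or_app.
 - right; left; auto.
 - right; right; apply in_or_app; left. apply in_map, in_seq. lia.
 - right; right; apply in_or_app; right; left; auto.
 - left. apply in_map, in_seq. lia. }
destruct LR as (LR0 & LRi & LRV & LRM).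
assert (EC : forall i, i <= N -> x (GC i) = x' (GC i)).
{ induction i; intros Hi.
 - pose proof (Late _ LR0) as E. simpl in E. rewrite gone_r in E. apply geq_of_div in E. simpl.
  unfold gconj. simpl. gsimp. auto.
 - pose proof (Late _ (LRi i ltac:(lia))) as E. simpl in E. rewrite gone_r, <- !gassoc in E.
  apply geq_of_div in E. rewrite <- E, IHi by lia. simpl. unfold gconj. simpl. gsimp. auto. }
assert (Ew : forall u v, In (u, v) machine_words -> weval x' u = weval x u /\ weval x' v = weval x v).
{ intros u v Hw. split; apply weval_ext; intros g b Hg; apply Ex, base_fixed, (machine_words_gens Rs d acc u v g b); auto. }
assert (EM : forall j u v, nth_error machine_words j = Some (u, v) ->
 x (GG (S j)) = weval x u ** (weval x v)^-1).
{ intros j u v Ej. assert (Hj : j < length machine_words) by (apply nth_error_Some; congruence).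
 pose proof (Late _ (LRM j Hj)) as E. simpl in E. rewrite Ej in E. cbn [weval] in E.
 rewrite weval_app, weval_inv in E. apply (f_equal (gop (x (GG (S j))))) in E. gsimp_in E. auto. }
assert (EV : x (GG 0) = x GK ** x (GC N) ** (x (GC N) ** x GK)^-1).
{ pose proof (Late _ LRV) as E. cbn [relw weval] in E. apply (f_equal (gop (x (GG 0)))) in E. gsimp_in E.
 gsimp. auto. }
destruct (central_collapse Rs d acc M x' N) as [C1 C2]; auto.
- apply kills_of_words. intros r Hr. rewrite (weval_ext x' x).
 + apply kills_of_words; auto. apply kill_holonomy; auto.
 + intros g b Hg. apply Ex. eapply kill_letters; eauto.
- split; [simpl; unfold gconj; simpl; gsimp; auto|]. intros i. simpl. unfold gconj; simpl. gsimp. auto.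
- intros u v s Hw Hs. assert (Es : x' s = x s) by auto.
 assert (E : exists j, j < nprod /\ weval x' u ** (weval x' v)^-1 = x (GG j)).
 { destruct Hw as [Hw|Hw].
  - injection Hw as <- <-. exists 0. split; [unfold nprod; lia|]. cbn [weval]. rewrite <- EC, EV by auto.
   rewrite !gone_r. change (x' GK) with (x GK). auto.
  - destruct (Ew u v Hw) as [-> ->]. apply In_nth_error in Hw as [j Ej]. exists (S j). split; [|symmetry; eauto].
   assert (Hj : j < length machine_words) by (apply (nth_error_Some (A := word * word)); intros E0; pose proof (eq_trans (eq_sym E0) Ej); easy).
   unfold nprod. lia. }
 destruct E as (j & Hj & ->). rewrite Es. apply prod_central; auto.
- assert (A : forall g, In g all_gens -> x g = 1).
 { intros g Hg. apply in_app_or in Hg as [Hg|Hg].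
  - rewrite <- Ex; auto.
  - apply in_map_iff in Hg as (i & <- & Hi). apply in_seq in Hi. rewrite EC by lia. auto. }
 split; auto. destruct base_simple as (_ & _ & B3 & _). intros [|j] Hj.
 + rewrite EV, (A GK) by (apply base_all; auto). rewrite (A (GC N)) by (apply gc_all; auto). gsimp. auto.
 + unfold nprod in Hj. destruct (nth_error machine_words j) as [[u v]|] eqn:E.
  * rewrite (EM j u v E). apply nth_error_In in E.
   assert (E1 : weval x u = 1) by (apply weval_one; intros g b Hg; apply A, base_all, (machine_words_gens Rs d acc u v g b); auto).
   assert (E2 : weval x v = 1) by (apply weval_one; intros g b Hg; apply A, base_all, (machine_words_gens Rs d acc u v g b); auto).
   rewrite E1, E2. gsimp. auto.
  * apply nth_error_None in E. lia.
Qed.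

Theorem X_trivial (M : group) (l : vx -> vx -> M) : halts -> flat_lab X l -> exists h, trivializes X l h.
Proof.
intros Run Fl.
assert (F3 : flat_lab P3 l) by (intros u v w H; apply Fl; left; auto).
assert (F2 : flat_lab P2 l) by (intros u v w H; apply F3; left; auto).
assert (F1 : flat_lab P1 l) by (intros u v w H; apply F2; left; auto).
destruct (hol_trivial M l Run F3) as [HA HG].
destruct (attach_trivial relw M l (fun v => match v with Lp _ _ => l Base v | _ => 1 end)
 (fc (bouquet all_gens)) kill_rels) as (h1 & T1 & _).
{ apply fc_closed. }
{ intros r Hr. apply kill_attachable; auto using fixed_all. }
{ exact F1. }
{ apply bouquet_trivial; auto using all_not_gg. intros u v w H. apply F1. left; auto. }
set (h2 := fun v => match v with Pr j b w => h1 w ** l w (Pr j b w) | _ => h1 v end).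
assert (Eh : forall v, ~ is_pr v -> h2 v = h1 v).
{ intros v Nv. destruct v; auto. destruct Nv. do 3 eexists; eauto. }
assert (T2 : trivializes P2 l h2).
{ intros u v [H|(f & Hf & I)].
 - rewrite !Eh by (apply (P1_old _ _ H); simpl; auto). apply T1, H.
 - apply in_flat_map in Hf as (j & Hj & Hf). apply in_seq in Hj.
  assert (Pj : Prod j [u; v]) by (exists f; auto). apply Prod_prodc in Pj.
  assert (Ej : forall y, In y [u; v] -> h2 y = h1 (fst (strip j y)) ** l (psi j (fst (strip j y), None)) (psi j (strip j y))).
  { intros y Hy. assert (Hs : In (fst (strip j y)) (map fst (map (strip j) [u; v]))) by (apply in_map, in_map, Hy).
   pose proof (Q_old _ _ (proj1 Pj) Hs) as Ny. rewrite <- (psi_strip j y) at 1.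
   assert (Qy : Q [fst (strip j y)]) by (eapply Q_closed; [apply (proj1 Pj)|]; intros z [<-|[]]; auto).
   destruct (strip j y) as [w [b|]]; cbn [psi fst snd] in *; auto.
   rewrite Eh by auto. rewrite (flat_refl P1 l P1_closed F1 w) by (apply Q_P1, Qy). gsimp. auto. }
  rewrite (Ej u), (Ej v) by (simpl; auto).
  rewrite <- (psi_strip j u) at 1. rewrite <- (psi_strip j v) at 1.
  apply (prod_trivial Q C3 Base None Q_closed C3_closed M (fun a b => l (psi j a) (psi j b))); auto.
  + apply prod_label_flat; auto; lia.
  + intros i _. apply C3_None, C3_refl.
  + apply Q_linked.
  + intros a b Hab. apply T1, Q_P1, Hab.
  + intros i i' HL. specialize (HG j ltac:(lia)).
   pose proof (prod_label_flat M l j ltac:(lia) F2) as Fj.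
   assert (QB : forall s, incl s [Base] -> Q s) by (intros s; apply Q_closed, Q_Base).
   set (k := fun a b => l (psi j (Base, a)) (psi j (Base, b))).
   assert (Fk : flat_lab C3 k).
   { intros a b c H. apply (Fj (Base, a) (Base, b) (Base, c)). split; auto. apply QB. subset. }
   assert (Rf := fun a => flat_refl C3 k C3_closed Fk a (C3_refl a)). assert (Sy := flat_sym C3 k C3_closed Fk).
   change (k None (Some false) ** (k (Some false) (Some true) ** k (Some true) None) = 1) in HG.
   change (k None i ** (k i i' ** k i' None) = 1).
   (* The walk from [None] through [i] and [i'] back is degenerate, or the triangle, or the triangle
      run backwards. *)
   destruct i as [[|]|], i' as [[|]|]; try exact HG; try (rewrite !Fk by c3; apply Rf).
   rewrite (Sy (Some false) (Some true)), (Sy (Some true) None), (Sy None (Some false)) by c3.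
   apply (f_equal ginv) in HG. gsimp_in HG. gsimp. rewrite HG. auto. }
destruct (attach_trivial relw M l h2 P2 late_rels) as (h3 & T3 & _); auto using P2_closed, late_attachable.
set (h4 := fun v => match v with Bs i => h3 Base ** l Base v | _ => h3 v end).
exists h4. intros u v [H|I].
- assert (E4 : forall y, In y [u; v] -> h4 y = h3 y).
 { intros y Hy. destruct (P3_vertex _ _ H Hy) as [B _]. destruct y; auto. destruct (B i); auto. }
 rewrite !E4 by (simpl; auto). apply T3, H.
- apply (star_trivial X l X_closed Fl big Base); auto; [right; auto|left; auto|].
 intros y [<-|Hy].
 + simpl. rewrite (flat_refl P3 l P3_closed F3 Base P3_Base). gsimp. auto.
 + apply in_map_iff in Hy as (i & <- & _). auto.
Qed.

Theorem Hv_X_halts n : halts -> Hv X (S n).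
Proof.
intros Run. destruct n as [|n]; [|apply Hv_X; lia].
apply Hv_1_of_trivial. intros l Fl. apply X_trivial; auto.
Qed.

Theorem X_holonomy : (forall r, In r Rs -> r_src r <> acc) -> deterministic Rs -> ~ halts ->
 exists (M : group) (l : vx -> vx -> M), flat_lab X l /\ infinite_order (hol l (GT acc)).
Proof.
intros Ac Det NR. destruct (presentation_model Rs d acc N) as (M & x & Kl & Ch & Eg & Inf & Rel); auto.
destruct (attach_realizes relw (fun g => In g all_gens \/ is_gg g) M x P2 late_rels) as (l & Fl & E).
- apply P2_closed.
- intros r Hr. split; [apply late_attachable; auto|split].
 + late r Hr.
  * rewrite E. cbn [weval]. rewrite weval_app, weval_inv, Eg, (Rel u v) by (right; auto). gsimp. auto.
  * simpl. rewrite (proj1 Ch). gsimp. auto.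
  * simpl. rewrite (proj2 Ch). unfold gconj. gsimp. auto.
  * cbn [relw weval]. rewrite Eg. specialize (Rel _ _ (or_introl eq_refl)). cbn [weval] in Rel.
   rewrite !gone_r in Rel. gsimp. rewrite <- (gassoc _ (x GK)), Rel. gsimp. auto.
 + intros g b Hg. destruct (late_letters r g b Hr Hg) as [|(j & _ & ->)]; auto. right. exists j; auto.
- apply P2_realizes; [intros j y; rewrite Eg; gsimp; auto|]. apply kills_of_words, Kl.
(* The simplex [big] is collapsed to [Base]. *)
- set (c := fun v => match v with Bs _ => Base | _ => v end).
 exists M, (fun u v => l (c u) (c v)). split.
 + intros u v w [H|I].
  * assert (Ec : forall y, In y [u; v; w] -> c y = y).
   { intros y Hy. destruct (P3_vertex _ _ H Hy) as [B _]. destruct y; auto. destruct (B i); auto. }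
   rewrite !Ec by (simpl; auto). apply Fl, H.
  * assert (Ec : forall y, In y [u; v; w] -> c y = Base).
   { intros y Hy. destruct (I y Hy) as [<-|Hy']; auto. apply in_map_iff in Hy' as (i & <- & _). auto. }
   rewrite !Ec by (simpl; auto). apply Fl, P3_of_incl. subset.
 + enough (E' : hol (fun u v => l (c u) (c v)) (GT acc) = x (GT acc)) by (rewrite E'; auto).
  rewrite <- E; [reflexivity|]. left. apply base_all, base_simple.
Qed.
End Complex.

(** * Edge paths and lifted cochains *)

Lemma D_sum (f : list nat -> R) s :
 fold_right Rplus 0%R (map (fun i => ((-1) ^ i * f (remove_nth i s))%R) (seq 0 (length s))) = D f s.
Proof.
revert f. induction s as [|x s IH]; intros f; auto.
cbn [length seq map fold_right D]. rewrite <- seq_shift, map_map.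
replace (remove_nth 0 (x :: s)) with s by reflexivity. rewrite <- IH.
enough (E : forall l, fold_right Rplus 0%R (map (fun i => ((-1) ^ S i * f (remove_nth (S i) (x :: s)))%R) l) =
 (- fold_right Rplus 0%R (map (fun i => ((-1) ^ i * f (x :: remove_nth i s))%R) l))%R) by (rewrite E; simpl; lra).
induction l as [|i l IHl]; cbn [map fold_right]; [lra|]. rewrite IHl.
change (remove_nth (S i) (x :: s)) with (x :: remove_nth i s). simpl. lra.
Qed.

(** Only the face without the first vertex changes its path, which is prolonged to the second
    vertex; this is the sole difference between the coboundary on the cover and [D]. *)
Lemma cobdry_D (a : cochain) p x s :
 cobdry a p (x :: s) = (a (p ++ [hd 0%nat s]) s - D (fun l => a p (x :: l)) s)%R.
Proof.
unfold cobdry. replace (nth 1 (x :: s) 0) with (hd 0 s) by (destruct s; auto).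
change (tl (x :: s)) with s. replace (length (x :: s) - 1) with (length s) by (simpl; lia).
rewrite <- (D_sum (fun l => a p (x :: l)) s). unfold Rminus. f_equal.
rewrite <- seq_shift, map_map.
generalize (seq 0 (length s)) as l. induction l as [|i l IHl]; cbn [map fold_right]; [lra|]. rewrite IHl.
change (remove_nth (S i) (x :: s)) with (x :: remove_nth i s). simpl. lra.
Qed.

Section Paths.
Variables (K : list (list nat)) (WF : wf_complex K).

Definition PK (s : list nat) : Prop := s = [] \/ is_simplex K s.
Lemma simplex_incl s t : is_simplex K s -> t <> [] -> incl t s -> is_simplex K t.
Proof.
intros (s' & Hs' & E) Nt I. apply (proj2 (proj2 WF) s'); auto. intros v Hv. apply E, I, Hv.
Qed.
Lemma PK_closed : closed PK.
Proof.
intros s t [->|H] I; [left; apply incl_l_nil; auto|].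
destruct t as [|v t]; [left; auto|right]. eapply simplex_incl; eauto. easy.
Qed.
Lemma PK_simplex s : s <> [] -> PK s -> is_simplex K s.
Proof. intros N [->|H]; [congruence|auto]. Qed.

Lemma last_d (l : list nat) x d d' : last (l ++ [x]) d = x /\ (l <> [] -> last l d = last l d').
Proof.
split; [apply last_last|]. intros N. induction l as [|y l IH]; [congruence|].
destruct l; auto. apply IH. easy.
Qed.
Lemma ep_one a : is_vertex K a -> edge_path K a a [a].
Proof. intros H. simpl; auto. Qed.
Lemma ep_cons a b c p : is_simplex K [c; a] -> edge_path K a b p -> edge_path K c b (c :: p).
Proof.
destruct p as [|u t]; simpl; [tauto|]. intros H (-> & Hv & Hs & L). repeat split; auto.
eapply simplex_incl; [exact H|easy|intros y [<-|[]]; left; auto].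
rewrite <- L. destruct t as [|w t]; auto. apply (last_d (w :: t) 0). easy.
Qed.
Lemma steps_snoc u l c : steps_ok K u (l ++ [c]) <-> steps_ok K u l /\ is_simplex K [last (u :: l) 0; c].
Proof.
revert u. induction l as [|w l IH]; intros u; simpl; [tauto|].
rewrite IH. replace (last (w :: l) 0) with (last (u :: w :: l) 0) by reflexivity. tauto.
Qed.
Lemma ep_ind a (T : nat -> list nat -> Prop) : T a [a] ->
 (forall b c p, edge_path K a b p -> T b p -> is_simplex K [b; c] -> T c (p ++ [c])) ->
 forall b p, edge_path K a b p -> T b p.
Proof.
intros H1 H2 b p. revert b. induction p as [|c p IH] using rev_ind; intros b H; [destruct H|].
destruct p as [|u t].
- simpl in H. destruct H as (-> & _ & _ & <-). auto.
- simpl in H. destruct H as (-> & Hv & Hs & L). apply steps_snoc in Hs as [Hs He].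
 assert (E : b = c).
 { rewrite <- L. change (last ((a :: t) ++ [c]) a = c). apply last_last. }
 rewrite E. apply (H2 (last (a :: t) 0) c (a :: t)); auto.
 + simpl. repeat split; auto. apply (last_d (a :: t) 0 a 0). easy.
 + apply IH. simpl. repeat split; auto. apply (last_d (a :: t) 0 a 0). easy.
Qed.
Lemma ep_snoc a b c p : edge_path K a b p -> is_simplex K [b; c] -> edge_path K a c (p ++ [c]).
Proof.
destruct p as [|u t]; simpl; [tauto|]. intros (-> & Hv & Hs & L) H. repeat split; auto.
- apply steps_snoc. split; auto. rewrite (proj2 (last_d (a :: t) 0 0 a)) by easy.
 replace (last (a :: t) a) with b; auto.
- change (last ((a :: t) ++ [c]) a = c). apply last_last.
Qed.
Lemma vertex_pair a : is_vertex K a -> is_simplex K [a; a].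
Proof. intros H. eapply simplex_incl; [exact H|easy|]. subset. Qed.
Lemma edge_vertices a b : is_simplex K [a; b] -> is_vertex K a /\ is_vertex K b.
Proof. intros H. split; (eapply simplex_incl; [exact H|easy|subset]). Qed.
Lemma edge_sym a b : is_simplex K [a; b] -> is_simplex K [b; a].
Proof. intros H. eapply simplex_incl; [exact H|easy|subset]. Qed.
Lemma ep_start a b p : edge_path K a b p -> is_vertex K a /\ exists t, p = a :: t.
Proof. destruct p as [|u t]; simpl; [tauto|]. intros (-> & H & _). eauto. Qed.
Lemma ep_end a b p : edge_path K a b p -> is_vertex K b /\ exists t, p = t ++ [b].
Proof.
intros H. split.
- pose proof (proj1 (ep_start _ _ _ H)) as Ha. revert b p H. apply ep_ind; auto.
 intros b c p _ _ E. apply (edge_vertices b c E).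
- revert b p H. apply ep_ind; [exists []; auto|eauto].
Qed.
Lemma ep_vertices a b p : edge_path K a b p -> forall v, In v p -> is_vertex K v.
Proof.
intros H. pose proof (proj1 (ep_start _ _ _ H)) as Ha. revert b p H.
apply (ep_ind a (fun b p => forall v, In v p -> is_vertex K v)).
- intros v [<-|[]]. auto.
- intros b c p _ IH E v Hv. apply in_app_or in Hv as [Hv|[<-|[]]]; auto. apply (edge_vertices b c E).
Qed.
Lemma ep_app a b c p q : edge_path K a b p -> edge_path K b c q -> edge_path K a c (p ++ q).
Proof.
intros Hp Hq. revert c q Hq. apply ep_ind.
- apply (ep_snoc a b b); auto. apply vertex_pair, (ep_end a b p Hp).
- intros c c' q _ IH E. rewrite app_assoc. eapply ep_snoc; eauto.
Qed.
Lemma ep_rev a b p : edge_path K a b p -> edge_path K b a (rev p).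
Proof.
intros H. pose proof (proj1 (ep_start _ _ _ H)) as Ha. revert b p H. apply ep_ind.
- apply ep_one, Ha.
- intros b c p _ IH E. rewrite rev_app_distr. simpl. apply (ep_cons b); auto. apply edge_sym, E.
Qed.

Global Instance htp_equiv : Equivalence (htp K).
Proof. split; red; unfold htp; intros; [apply rst_refl|apply rst_sym; auto|eapply rst_trans; eauto]. Qed.
Global Instance app_htp : Proper (htp K ==> htp K ==> htp K) (@app nat).
Proof.
intros p p' Hp q q' Hq. transitivity (p' ++ q).
- clear Hq. induction Hp as [x y H| | |].
 + apply rst_step. destruct H as [l1 u l2|l1 u v w l2 H]; rewrite <- !app_assoc; simpl; constructor; auto.
 + reflexivity.
 + symmetry; auto.
 + etransitivity; eauto.
- clear Hp. induction Hq as [x y H| | |].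
 + apply rst_step. destruct H as [l1 u l2|l1 u v w l2 H]; rewrite !app_assoc; constructor; auto.
 + reflexivity.
 + symmetry; auto.
 + etransitivity; eauto.
Qed.
Lemma htp_stut a : htp K [a; a] [a].
Proof. symmetry. apply rst_step, (htp_stutter K [] a []). Qed.
Lemma htp_mid u v w : is_simplex K [u; v; w] -> htp K [u; v; w] [u; w].
Proof. intros H. symmetry. apply rst_step, (htp_tri K [] u v w []), H. Qed.
Lemma htp_end a b p : edge_path K a b p -> htp K (p ++ [b]) p.
Proof.
intros H. destruct (ep_end a b p H) as [_ [t ->]]. rewrite <- app_assoc. simpl. rewrite htp_stut. reflexivity.
Qed.
Lemma htp_start a b p : edge_path K a b p -> htp K ([a] ++ p) p.
Proof.
intros H. destruct (ep_start a b p H) as [_ [t ->]].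
change (htp K ([a; a] ++ t) ([a] ++ t)). rewrite htp_stut. reflexivity.
Qed.
Lemma htp_revl a b p : edge_path K a b p -> htp K (rev p ++ p) [b].
Proof.
revert b p. apply ep_ind; [apply htp_stut|]. intros b c p H IH E.
rewrite rev_app_distr. change (htp K ([c] ++ rev p ++ p ++ [c]) [c]). rewrite app_assoc, app_assoc, <- (app_assoc [c]), IH.
simpl. rewrite htp_mid, htp_stut; [reflexivity|].
eapply simplex_incl; [exact E|easy|]. subset.
Qed.
Lemma htp_revr a b p : edge_path K a b p -> htp K (p ++ rev p) [a].
Proof. intros H. rewrite <- (rev_involutive p) at 1. apply (htp_revl b). apply ep_rev, H. Qed.

Fixpoint wp {M : group} (l : nat -> nat -> M) (p : list nat) : M :=
 match p with u :: t => match t with v :: _ => l u v ** wp l t | [] => 1 end | [] => 1 end.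
Lemma wp_app {M : group} (l : nat -> nat -> M) p b c q :
 wp l (p ++ b :: c :: q) = wp l (p ++ [b]) ** (l b c ** wp l (c :: q)).
Proof.
induction p as [|x p IH]; simpl; [gsimp; auto|]. rewrite IH.
destruct p; simpl; gsimp; auto.
Qed.
Lemma wp_snoc {M : group} (l : nat -> nat -> M) a b c p : edge_path K a b p -> wp l (p ++ [c]) = wp l p ** l b c.
Proof.
intros H. destruct (ep_end a b p H) as [_ [t ->]]. rewrite <- app_assoc. simpl. rewrite wp_app. simpl. gsimp. auto.
Qed.
Lemma wp_htp {M : group} (l : nat -> nat -> M) : flat_lab PK l -> (forall u, l u u = 1) ->
 forall p q, htp K p q -> wp l p = wp l q.
Proof.
intros Fl Hu p q H. induction H as [x y H| | |]; try congruence.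
destruct H as [l1 u l2|l1 u v w l2 H].
- rewrite wp_app, Hu. destruct l2 as [|v l2]; simpl; gsimp; auto. rewrite !wp_app. simpl. auto.
- rewrite !wp_app. f_equal. simpl. rewrite <- gassoc, Fl; auto. right; auto.
Qed.
Lemma wp_trivial {M : group} (l : nat -> nat -> M) h a b p : flat_lab PK l -> trivializes PK l h -> edge_path K a b p ->
 wp l p = (h a)^-1 ** h b.
Proof.
intros Fl T. revert b p. apply ep_ind; [simpl; gsimp; auto|]. intros b c p H IH E.
rewrite (wp_snoc l a b c p H), IH, (T b c) by (right; auto). gsimp. auto.
Qed.

(** * From trivial labellings to homotopies of edge paths *)

Section SimplyConnected.
Hypothesis CN : connected K.
Let o := base K.
Hypothesis Ho : is_vertex K o.
(** Chosen representatives replace the quotient by homotopy. Loops act on the representatives of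
    loop classes by concatenation on the left and fix all other lists, which yields permutations of
    the plain type of lists. *)
Definition canon (p : list nat) : list nat := epsilon (inhabits []) (htp K p).
Definition way (v : nat) : list nat := epsilon (inhabits []) (edge_path K o v).
Definition is_loop (p : list nat) : Prop := edge_path K o o p.
Definition cls (p : list nat) : Prop := canon p = p /\ exists q, is_loop q /\ htp K p q.
Definition lact (q p : list nat) : list nat :=
 if em (is_loop q /\ cls p) then canon (q ++ p) else p.

Lemma canon_htp p : htp K p (canon p).
Proof. apply (epsilon_spec (inhabits []) (htp K p)). exists p. reflexivity. Qed.
Lemma canon_eq p q : htp K p q -> canon p = canon q.
Proof.
intros H. unfold canon. f_equal. apply functional_extensionality. intros r. apply propositional_extensionality.
rewrite H. tauto.
Qed.
Lemma way_path v : is_vertex K v -> edge_path K o v (way v).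
Proof. intros H. apply (epsilon_spec (inhabits []) (edge_path K o v)). apply CN; auto. Qed.
Lemma act_cls q p : is_loop q -> cls p -> lact q p = canon (q ++ p) /\ cls (lact q p).
Proof.
intros Hq Hp. assert (E : lact q p = canon (q ++ p)).
{ unfold lact. destruct (em _); tauto. }
split; auto. rewrite E. split; [symmetry; apply canon_eq, canon_htp|].
destruct Hp as (_ & r & Hr & Hpr). exists (q ++ r). split; [eapply ep_app; eauto|].
rewrite <- canon_htp, Hpr. reflexivity.
Qed.
Lemma act_out q p : ~ (is_loop q /\ cls p) -> lact q p = p.
Proof. intros N. unfold lact. destruct (em _); tauto. Qed.
Lemma cls_start p : cls p -> htp K ([o] ++ p) p.
Proof. intros (_ & r & Hr & Hpr). rewrite Hpr. eapply htp_start; eauto. Qed.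
Lemma act_inv q p : is_loop q -> lact (rev q) (lact q p) = p.
Proof.
intros Hq. destruct (classic (cls p)) as [Hp|Hp]; [|rewrite !(act_out _ p) by tauto; auto].
destruct (act_cls q p Hq Hp) as [E C]. destruct (act_cls (rev q) (lact q p)) as [E' _]; auto.
{ apply ep_rev; auto. }
rewrite E', E. transitivity (canon p); [apply canon_eq|apply Hp]. rewrite <- canon_htp, app_assoc, (htp_revl o o q Hq).
apply cls_start, Hp.
Qed.
Definition act_perm (q : list nat) : Sym (list nat).
Proof.
refine (if em (is_loop q) then Perm (lact q) (lact (rev q)) _ _ else 1).
- intros x. rewrite <- (rev_involutive q) at 1. apply act_inv, ep_rev; auto.
- intros x. apply act_inv; auto.
Defined.
Lemma act_permE q p : is_loop q -> pf (act_perm q) p = lact q p.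
Proof. intros H. unfold act_perm. destruct (em _); tauto. Qed.

Definition tour (u v : nat) : list nat := way u ++ [v] ++ rev (way v).
Lemma tour_loop u v : is_simplex K [u; v] -> is_loop (tour u v).
Proof.
intros H. destruct (edge_vertices u v H). unfold tour. rewrite app_assoc.
eapply ep_app; [eapply ep_snoc; [apply way_path|]|apply ep_rev, way_path]; eauto.
Qed.

Lemma tour_flat : flat_lab PK (fun u v => act_perm (tour u v)).
Proof.
intros u v w H. apply PK_simplex in H; [|easy].
assert (E1 : is_simplex K [u; v]) by (eapply simplex_incl; [exact H|easy|subset]).
assert (E2 : is_simplex K [v; w]) by (eapply simplex_incl; [exact H|easy|subset]).
assert (E3 : is_simplex K [u; w]) by (eapply simplex_incl; [exact H|easy|subset]).
apply perm_ext. intros p. simpl. rewrite !act_permE by (apply tour_loop; auto).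
destruct (classic (cls p)) as [Hp|Hp]; [|rewrite !(act_out _ p); rewrite ?act_out; tauto].
destruct (act_cls (tour v w) p (tour_loop _ _ E2) Hp) as [-> C].
destruct (act_cls (tour v w) p (tour_loop _ _ E2) Hp) as [Ea Ca]. rewrite Ea in Ca.
destruct (act_cls (tour u v) (canon (tour v w ++ p)) (tour_loop _ _ E1) Ca) as [-> _].
destruct (act_cls (tour u w) p (tour_loop _ _ E3) Hp) as [-> _].
apply canon_eq. rewrite <- canon_htp. unfold tour. destruct (edge_vertices u v E1) as [Hu Hv].
rewrite <- !app_assoc. rewrite (app_assoc (rev (way v)) (way v)), (htp_revl o v (way v)) by (apply way_path; auto).
rewrite <- (htp_end o u (way u)) by (apply way_path; auto). rewrite <- !app_assoc.
rewrite (app_assoc [v] [v]). simpl ([v] ++ [v]). rewrite htp_stut.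
rewrite (app_assoc [u] [v]), (app_assoc ([u] ++ [v]) [w]), (app_assoc [u] [w]). simpl ([u] ++ [v]). simpl ([u; v] ++ [w]).
rewrite htp_mid by auto. reflexivity.
Qed.

(** The labelling by the action of the loops [tour] is the universal one: its product along [p] acts
    by concatenation with [p], closed up by chosen ways. If it is a coboundary, paths with the same
    ends act alike, and their action on the class of the constant loop recovers them up to
    homotopy. *)
Theorem paths_htp : (forall (M : group) (l : nat -> nat -> M), flat_lab PK l -> exists h, trivializes PK l h) ->
 forall v p q, edge_path K o v p -> edge_path K o v q -> htp K p q.
Proof.
intros Tr v p q Hp Hq. destruct (Tr _ _ tour_flat) as [h Th].
set (l := fun u v => act_perm (tour u v)) in *.
set (x := canon [o]).
assert (Cx : cls x).
{ split; [symmetry; apply canon_eq, canon_htp|]. exists [o]. split; [apply ep_one; auto|]. symmetry. apply canon_htp. }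
assert (Wo := way_path o Ho).
assert (E : forall v p, edge_path K o v p -> forall y, cls y ->
 pf (wp l p) y = canon (way o ++ p ++ rev (way v) ++ y)).
{ apply (ep_ind o (fun v p => forall y, cls y -> pf (wp l p) y = canon (way o ++ p ++ rev (way v) ++ y))).
 - intros y Hy. simpl. transitivity (canon y); [symmetry; apply Hy|apply canon_eq].
  change (o :: rev (way o) ++ y) with ([o] ++ rev (way o) ++ y).
  rewrite (app_assoc [o]), (htp_start o o (rev (way o))) by (apply ep_rev; auto).
  rewrite app_assoc, (htp_revr o o (way o)) by auto. symmetry. apply cls_start; auto.
 - intros b c r Hr IH Hbc y Hy. rewrite (wp_snoc l o b c r Hr). simpl. unfold l at 2.
  destruct (edge_vertices b c Hbc) as [Hb Hc].
  rewrite act_permE by (apply tour_loop; auto). destruct (act_cls (tour b c) y (tour_loop _ _ Hbc) Hy) as [Ea Ca].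
  rewrite IH by auto. rewrite Ea. apply canon_eq. rewrite <- canon_htp. unfold tour. rewrite <- !app_assoc.
  rewrite (app_assoc (rev (way b)) (way b)), (htp_revl o b (way b)) by (apply way_path; auto).
  rewrite (app_assoc r [b]), (htp_end o b r Hr). reflexivity. }
assert (Ew : wp l p = wp l q).
{ rewrite (wp_trivial l h o v p tour_flat Th Hp), (wp_trivial l h o v q tour_flat Th Hq). auto. }
assert (Hv : is_vertex K v) by apply (ep_end o v p Hp).
assert (E1 := E v p Hp x Cx). rewrite Ew, (E v q Hq x Cx) in E1.
assert (H : forall r, edge_path K o v r -> htp K (rev (way o) ++ (way o ++ r ++ rev (way v) ++ x) ++ way v) r).
{ intros r Hr. unfold x. rewrite <- canon_htp. rewrite <- !app_assoc.
 rewrite (app_assoc (rev (way o)) (way o)), (htp_revl o o (way o)) by auto.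
 rewrite (htp_start o v (way v)) by (apply way_path; auto).
 rewrite (htp_revl o v (way v)) by (apply way_path; auto).
 rewrite (htp_end o v r Hr). apply (htp_start o v r Hr). }
rewrite <- (H p Hp), <- (H q Hq), (canon_htp (way o ++ p ++ _)), (canon_htp (way o ++ q ++ _)), E1. reflexivity.
Qed.

(** As paths with the same ends are homotopic, a cochain does not depend on the path. Each orbit is
    then a single simplex, on which an ordinary primitive is automatically bounded. *)
Theorem vanishing (n : nat) :
 (forall (M : group) (l : nat -> nat -> M), flat_lab PK l -> exists h, trivializes PK l h) ->
 Hv PK (S n) -> linf_vanishes K (S n).
Proof.
intros Tr HK a [Wd _] Cyc.
set (a' := fun s => a (way (hd 0 s)) s).
assert (HP := paths_htp Tr).
assert (Sub : forall x s t, is_simplex K (x :: s) -> incl t s -> is_simplex K (x :: t)).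
{ intros x s t H I. eapply simplex_incl; [exact H|easy|]. intros y [<-|Hy]; [left|right]; auto. }
assert (Cb : forall k (b : cochain) (b' : list nat -> R), (forall p s, lift_ok K k p s -> b p s = b' s) ->
 forall p s, lift_ok K (S k) p s -> cobdry b p s = D b' s).
{ intros k b b' Hb p s [[L H] Hp]. destruct s as [|x [|y s]]; try easy.
 rewrite cobdry_D. simpl in Hp |- *. f_equal.
 - apply Hb. split; [split; [simpl in *; lia|]|].
  + eapply simplex_incl; [exact H|easy|]. apply incl_tl, incl_refl.
  + apply (ep_snoc o x); auto. eapply simplex_incl; [exact H|easy|]. subset.
 - change (a' (x :: s)) with (a' (x :: s)). f_equal.
  + apply Hb. split; [split; [simpl in *; lia|]|auto].
   eapply Sub; [exact H|]. apply incl_tl, incl_refl.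
  + apply D_ext. intros t I Lt. apply Hb. split; [split; [simpl in *; lia|]|auto].
   eapply Sub; [exact H|]. intros z [<-|Hz]; [left; auto|right; auto]. }
assert (Ha : forall p s, lift_ok K (S n) p s -> a p s = a' s).
{ intros p s Hl. apply Wd; auto.
 - destruct Hl as [Hs Hp]. split; auto. apply way_path, (ep_end o _ p Hp).
 - destruct Hl as [Hs Hp]. apply (HP (hd 0 s)); auto. apply way_path, (ep_end o _ p Hp). }
destruct (HK a') as [b Hb].
- intros s Hs L. assert (Hl : lift_ok K (S (S n)) (way (hd 0 s)) s).
 { apply PK_simplex in Hs; [|destruct s; easy]. split; [split; auto|]. apply way_path.
  eapply simplex_incl; [exact Hs|easy|]. destruct s; [easy|]. intros y [<-|[]]; left; auto. }
 rewrite <- (Cb _ a a' Ha _ s Hl). apply Cyc, Hl.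
- exists (fun _ s => b s). split; [split|].
 + intros p p' s _ _ _. auto.
 + intros s _. exists (Rabs (b s)). intros p _. lra.
 + intros p s Hl. replace (S n - 1) with n in * by lia. rewrite (Cb n (fun _ s => b s) b) by auto.
  rewrite Hb; [symmetry; apply Ha, Hl|right; apply Hl|apply Hl].
Qed.
End SimplyConnected.
End Paths.

(** * Skeleta and their encodings *)

(** [k] counts vertices, so this is the skeleton of dimension [k - 1]. The bound concerns a tuple
    containing the vertices of [s], because [s] itself may repeat vertices. *)
Definition skel {V : Type} (k : nat) (P : list V -> Prop) (s : list V) : Prop :=
 exists t, P t /\ length t <= k /\ incl s t.

Lemma skel_closed {V : Type} k (P : list V -> Prop) : closed (skel k P).
Proof. intros s t (u & Hu & L & I) J. exists u. repeat split; auto. eapply incl_tran; eauto. Qed.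
Lemma skel_small {V : Type} k (P : list V -> Prop) s : closed P -> length s <= k -> (skel k P s <-> P s).
Proof.
intros CP L. split; [|intros H; exists s; repeat split; auto; apply incl_refl].
intros (t & Ht & _ & I). eapply CP; eauto.
Qed.
Lemma skel_sub {V : Type} k (P : list V -> Prop) s : closed P -> skel k P s -> P s.
Proof. intros CP (t & Ht & _ & I). eapply CP; eauto. Qed.
Lemma skel_Hv {V : Type} k (P : list V -> Prop) n : closed P -> n + 2 <= k -> Hv P n -> Hv (skel k P) n.
Proof.
intros CP Hk H a Ha. destruct (H a) as [b Hb].
- intros s Hs L. apply Ha; auto. apply skel_small; auto. lia.
- exists b. intros s Hs L. apply Hb; auto. eapply skel_sub; eauto.
Qed.
Lemma skel_flat {V : Type} {M : group} k (P : list V -> Prop) (l : V -> V -> M) : closed P -> 3 <= k ->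
 (flat_lab (skel k P) l <-> flat_lab P l).
Proof. intros CP Hk. split; intros H u v w Hs; apply H, (skel_small k P); auto. Qed.

Fixpoint sublists {V : Type} (l : list V) : list (list V) :=
 match l with [] => [[]] | x :: l => sublists l ++ map (cons x) (sublists l) end.
Definition faces {V : Type} (k : nat) (f : list V) : list (list V) :=
 filter (fun t => (0 <? length t) && (length t <=? k)) (sublists f).

Lemma sublists_incl {V : Type} (f t : list V) : In t (sublists f) -> incl t f.
Proof.
revert t. induction f as [|x f IH]; intros t H.
- destruct H as [<-|[]]. apply incl_refl.
- apply in_app_or in H as [H|H]; [apply incl_tl; auto|].
 apply in_map_iff in H as (t' & <- & H). intros y [<-|Hy]; [left; auto|right; apply (IH t'); auto].
Qed.
Lemma sublists_exists {V : Type} (f s : list V) :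
 exists t, In t (sublists f) /\ NoDup t /\ forall v, In v t <-> In v s /\ In v f.
Proof.
induction f as [|x f IH].
- exists []. repeat split; simpl; auto; try constructor; tauto.
- destruct IH as (t & Ht & Nt & E). destruct (classic (In x s /\ ~ In x t)) as [[H1 H2]|H].
 + exists (x :: t). repeat split; [apply in_or_app; right; apply in_map; auto|constructor; auto| | |];
   intros; simpl in *; rewrite ?E in *; intuition (subst; auto).
 + exists t. repeat split; [apply in_or_app; auto|auto| | |]; intros; simpl in *; rewrite ?E in *; try tauto.
  destruct H0 as [H1 [->|H2]]; tauto.
Qed.
Lemma sublists_map {V W : Type} (g : V -> W) f : sublists (map g f) = map (map g) (sublists f).
Proof. induction f as [|x f IH]; auto. simpl. rewrite IH, map_app, !map_map. auto. Qed.
Lemma faces_map {V W : Type} (g : V -> W) k f : faces k (map g f) = map (map g) (faces k f).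
Proof.
unfold faces. rewrite sublists_map. induction (sublists f) as [|t l IH]; auto. simpl.
rewrite length_map, IH. destruct (_ && _); auto.
Qed.

Lemma faces_skel {V : Type} k (F : list (list V)) s : s <> [] ->
 ((exists t, In t (flat_map (faces k) F) /\ forall v, In v s <-> In v t) <-> skel k (fc F) s).
Proof.
intros Ns. split.
- intros (t & Ht & E). apply in_flat_map in Ht as (f & Hf & Ht). apply filter_In in Ht as [Ht L].
 apply andb_true_iff in L as [_ L]. apply Nat.leb_le in L. exists t. repeat split; auto.
 + exists f. split; auto. apply sublists_incl; auto.
 + intros v Hv. apply E, Hv.
- intros (t & (f & Hf & I) & L & J). destruct (sublists_exists f s) as (t' & Ht' & N' & E).
 assert (E' : forall v, In v s <-> In v t') by (intros v; rewrite E; split; [auto|tauto]).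
 exists t'. split; auto. apply in_flat_map. exists f. split; auto. apply filter_In. split; auto.
 apply andb_true_iff. split.
 + apply Nat.ltb_lt. destruct t'; [|simpl; lia]. destruct s as [|v s]; [congruence|]. destruct (proj1 (E' v)). left; auto.
 + apply Nat.leb_le. transitivity (length t); auto. apply NoDup_incl_length; auto.
  intros v Hv. apply J, E', Hv.
Qed.
Lemma faces_nonempty {V : Type} k (F : list (list V)) s : In s (flat_map (faces k) F) -> s <> [].
Proof. intros H. apply in_flat_map in H as (f & _ & H). apply filter_In in H as [_ H]. destruct s; easy. Qed.

Section Realize.
Context {V : Type} (enc : V -> nat) (o : V) (L : list (list V)) (P : list V -> Prop).
Hypotheses (Inj : forall x y, enc x = enc y -> x = y) (CP : closed P) (Po : P [o])
 (NL : forall s, In s L -> s <> [])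
 (HP : forall s, s <> [] -> ((exists t, In t L /\ forall v, In v s <-> In v t) <-> P s)).

(** The vertex put in front is the one that [base] returns. *)
Definition cx : list (list nat) := [enc o] :: map (map enc) L.
Definition dec (k : nat) : V := epsilon (inhabits o) (fun v => enc v = k).
Lemma dec_enc v : dec (enc v) = v.
Proof. apply Inj. apply (epsilon_spec (inhabits o) (fun w => enc w = enc v)). eauto. Qed.
Lemma map_dec t : map dec (map enc t) = t.
Proof. rewrite map_map, (map_ext _ (fun v => v)), map_id; auto. intros; apply dec_enc. Qed.
Lemma in_enc v t : In (enc v) (map enc t) <-> In v t.
Proof.
split; [|apply in_map]. intros H. apply in_map_iff in H as (w & E & H). apply Inj in E. congruence.
Qed.
Lemma P_nil : P [].
Proof. apply (CP [o]); auto. intros y []. Qed.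

Lemma cx_enc t : t <> [] -> (is_simplex cx (map enc t) <-> P t).
Proof.
intros Nt. split.
- intros (s & [<-|Hs] & E).
 + apply (CP [o]); auto. intros v Hv. apply in_enc, E in Hv as [Hv|[]]; auto. apply Inj in Hv. left; auto.
 + apply in_map_iff in Hs as (s' & <- & Hs). apply HP; auto. exists s'. split; auto.
  intros v. rewrite <- (in_enc v t), <- (in_enc v s'). apply E.
- intros H. apply HP in H as (s & Hs & E); auto. exists (map enc s). split; [right; apply in_map; auto|].
 intros k. split; intros Hk; apply in_map_iff in Hk as (v & <- & Hv); apply in_map, E, Hv.
Qed.
Lemma cx_range s : is_simplex cx s -> s = map enc (map dec s).
Proof.
intros (t & Ht & E). rewrite map_map, <- (map_id s) at 1. apply map_ext_in. intros k Hk. apply E in Hk.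
destruct Ht as [<-|Ht].
- destruct Hk as [<-|[]]. rewrite dec_enc. auto.
- apply in_map_iff in Ht as (t' & <- & Ht). apply in_map_iff in Hk as (v & <- & Hv). rewrite dec_enc. auto.
Qed.
Lemma cx_simplex s : is_simplex cx s -> P (map dec s).
Proof.
intros H. destruct s as [|k s]; [apply P_nil|]. apply cx_enc; [easy|]. rewrite <- cx_range; auto.
Qed.
Lemma cx_nonempty s : is_simplex cx s -> s <> [].
Proof.
intros (t & Ht & E) ->. assert (N : t <> []).
{ destruct Ht as [<-|Ht]; [easy|]. apply in_map_iff in Ht as (t' & <- & Ht). apply NL in Ht.
 destruct t'; [congruence|easy]. }
destruct t as [|v t]; [congruence|]. destruct (proj2 (E v)). left; auto.
Qed.
Lemma cx_wf : wf_complex cx.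
Proof.
assert (S : forall s, In s cx -> is_simplex cx s) by (intros s Hs; exists s; tauto).
split; [easy|]. split.
- intros s Hs. apply cx_nonempty, S, Hs.
- intros s t Hs Nt I. apply S in Hs. pose proof (cx_range s Hs) as R.
 assert (Et : t = map enc (map dec t)).
 { rewrite map_map, <- (map_id t) at 1. apply map_ext_in. intros k Hk. apply I in Hk. rewrite R in Hk.
  apply in_map_iff in Hk as (v & <- & _). rewrite dec_enc. auto. }
 rewrite Et. apply cx_enc; [destruct t; [congruence|easy]|].
 apply (CP (map dec s)); [apply cx_simplex, Hs|]. apply incl_map, I.
Qed.
Lemma PK_cx s : PK cx s <-> exists t, s = map enc t /\ P t.
Proof.
split.
- intros [->|H]; [exists []; split; auto using P_nil|]. exists (map dec s). split; [apply cx_range; auto|apply cx_simplex; auto].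
- intros (t & -> & H). destruct t as [|v t]; [left; auto|right]. apply cx_enc; auto. easy.
Qed.
Lemma PK_enc t : PK cx (map enc t) <-> P t.
Proof.
rewrite PK_cx. split; [|eauto]. intros (t' & E & H).
rewrite <- (map_dec t), E, map_dec. auto.
Qed.
Lemma base_cx : base cx = enc o.
Proof. reflexivity. Qed.
Lemma vertex_cx v : P [v] -> is_vertex cx (enc v).
Proof. intros H. apply (cx_enc [v]); auto. easy. Qed.
Lemma edge_cx u v : P [u; v] -> is_simplex cx [enc u; enc v].
Proof. intros H. apply (cx_enc [u; v]); auto. easy. Qed.

Lemma linked_path v : linked P o v -> exists p, edge_path cx (enc o) (enc v) p.
Proof.
intros H. induction H as [|u v _ [p IH] H].
- exists [enc o]. apply ep_one, vertex_cx, Po.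
- exists (p ++ [enc v]). eapply ep_snoc; eauto using cx_wf. apply edge_cx, H.
Qed.
Lemma cx_connected : (forall v, P [v] -> linked P o v) -> connected cx.
Proof.
intros H a b Ha Hb.
assert (E : forall a, is_vertex cx a -> exists p, edge_path cx (enc o) a p).
{ intros c Hc. pose proof (cx_range [c] Hc) as R. injection R as R. rewrite R. apply linked_path, H.
 apply (cx_simplex [c] Hc). }
destruct (E a Ha) as [p Hp], (E b Hb) as [q Hq]. exists (rev p ++ q).
eapply ep_app; eauto using cx_wf. apply ep_rev; auto using cx_wf.
Qed.

Lemma label_cx (M : group) (l : V -> V -> M) : flat_lab P l -> flat_lab (PK cx) (fun a b => l (dec a) (dec b)).
Proof.
intros Fl u v w H. apply PK_cx in H as (t & E & H). apply Fl.
replace [dec u; dec v; dec w] with (map dec [u; v; w]) by auto. rewrite E, map_dec. auto.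
Qed.

Theorem cx_vanishing n : (forall v, P [v] -> linked P o v) ->
 (forall (M : group) (l : V -> V -> M), flat_lab P l -> exists h, trivializes P l h) ->
 Hv P (S n) -> linf_vanishes cx (S n).
Proof.
intros Lk Tr H. apply vanishing; auto using cx_wf, cx_connected.
- rewrite base_cx. apply vertex_cx, Po.
- intros M l Fl. destruct (Tr M (fun u v => l (enc u) (enc v))) as [h Hh].
 + intros u v w Hs. apply Fl, (PK_enc [u; v; w]), Hs.
 + exists (fun a => h (dec a)). intros a b Hab. apply PK_cx in Hab as ([|u [|v [|]]] & E & Hs); try easy.
  injection E as -> ->. rewrite !dec_enc. apply Hh, Hs.
- apply (Hv_retract enc dec P); auto.
 + intros s Hs. apply PK_cx in Hs as (t & -> & Hs). rewrite map_dec. auto.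
 + intros t Ht. apply PK_enc; auto.
 + intros s Hs. apply PK_cx in Hs as (t & -> & Hs). rewrite map_dec. auto.
Qed.

Lemma cx_has_dim m : (exists t, P t /\ NoDup t /\ length t = S m) ->
 (forall t, P t -> exists t', incl t t' /\ length t' <= S m) -> has_dim cx m.
Proof.
intros (t & Ht & Nt & Lt) H. split.
- exists (map enc t). split; [apply cx_enc; auto; destruct t; easy|].
 split; [|rewrite length_map; auto].
 apply NoDup_map_NoDup_ForallPairs; auto. intros a b _ _. apply Inj.
- intros s Hs Ns. destruct (H (map dec s) (cx_simplex s Hs)) as (t' & I & L').
 rewrite <- (length_map dec s). transitivity (length t'); auto. apply NoDup_incl_length; auto.
 apply (NoDup_map_inv enc). rewrite <- cx_range; auto.
Qed.
End Realize.

(** * Degree one *)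

Lemma infinite_order_inj {G : group} (g : G) j k : infinite_order g -> gpow g j = gpow g k -> j = k.
Proof.
intros H E. destruct (Nat.eq_dec j k) as [|N]; auto. destruct (H (Z.of_nat j - Z.of_nat k)%Z); [lia|].
unfold Z.sub. rewrite zpow_add, zpow_opp, !zpow_nat, E, ginv_r. auto.
Qed.

Fixpoint words {A : Type} (l : list A) (n : nat) : list (list A) :=
 match n with 0 => [[]] | S n => [] :: flat_map (fun w => map (fun x => x :: w) l) (words l n) end.
Lemma in_words {A : Type} (l w : list A) n : incl w l -> length w <= n -> In w (words l n).
Proof.
revert w. induction n as [|n IH]; intros [|x w] I H; simpl in *; auto; [lia|].
right. apply in_flat_map. exists w. split; [apply IH; [|lia]|apply (in_map (fun x => x :: w)), I; left; auto].
intros y Hy. apply I. right; auto.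
Qed.

Section H1.
Context (K : list (list nat)) (WF : wf_complex K) (M : group) (l : nat -> nat -> M).
Hypotheses (Fl : flat_lab (PK K) l) (Lu : forall u, l u u = 1).
Let o := base K.

Lemma wp_join a b c p q : edge_path K a b p -> edge_path K b c q -> wp l (p ++ q) = wp l p ** wp l q.
Proof.
intros Hp Hq. destruct (ep_start K _ _ _ Hq) as [_ [t ->]]. destruct (ep_end K WF _ _ _ Hp) as [_ [t' ->]].
rewrite <- app_assoc. simpl. rewrite wp_app, Lu, gone_l. auto.
Qed.
Lemma ep_pow p k : edge_path K o o p ->
 edge_path K o o (Nat.iter k (app p) [o]) /\ wp l (Nat.iter k (app p) [o]) = gpow (wp l p) k.
Proof.
intros Hp. pose proof (proj1 (ep_start K _ _ _ Hp)) as Ho. induction k as [|k [IH1 IH2]].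
- split; [apply ep_one; auto|auto].
- simpl. split; [eapply ep_app; eauto|]. rewrite (wp_join o o o), IH2; auto.
Qed.

(** [dist v g] measures the distance from the base point to the point over [v] with label [g], in
    the covering defined by the labelling. *)
Definition geodesic (v : nat) (g : M) (n : nat) : Prop :=
 (exists q, edge_path K o v q /\ length q = n /\ wp l q = g) /\
 forall q, edge_path K o v q -> wp l q = g -> n <= length q.
Definition dist (v : nat) (g : M) : nat := epsilon (inhabits 0) (geodesic v g).
Lemma dist_spec v p : edge_path K o v p -> geodesic v (wp l p) (dist v (wp l p)).
Proof.
intros Hp. apply (epsilon_spec (inhabits 0) (geodesic v (wp l p))).
destruct (dec_inh_nat_subset_has_unique_least_element
 (fun n => exists q, edge_path K o v q /\ length q = n /\ wp l q = wp l p)) as (n & [H1 H2] & _).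
- intros n. apply classic.
- exists (length p), p. auto.
- exists n. split; auto. intros q Hq E. apply H2. eauto.
Qed.
Lemma dist_step v w p : edge_path K o v p -> is_simplex K [v; w] ->
 dist w (wp l p ** l v w) <= S (dist v (wp l p)) /\ dist v (wp l p) <= S (dist w (wp l p ** l v w)).
Proof.
intros Hp E. assert (Hpw := ep_snoc K _ _ _ _ Hp E).
pose proof (dist_spec v p Hp) as [(q & Hq & Lq & Wq) H1].
pose proof (dist_spec w _ Hpw) as [(q' & Hq' & Lq' & Wq') H2]. rewrite (wp_snoc K WF l o v w p Hp) in *.
split.
- rewrite <- Lq. replace (S (length q)) with (length (q ++ [w])) by (rewrite length_app; simpl; lia).
 apply H2; [eapply ep_snoc; eauto|]. rewrite (wp_snoc K WF l o v w q Hq), Wq. auto.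
- rewrite <- Lq'. replace (S (length q')) with (length (q' ++ [v])) by (rewrite length_app; simpl; lia).
 apply H1; [eapply ep_snoc; eauto using edge_sym|].
 rewrite (wp_snoc K WF l o w v q' Hq'), Wq', gassoc, Fl, Lu, gone_r; auto.
 apply (PK_closed K WF [v; w]); [right; auto|]. subset.
Qed.

(** The distance changes by at most 1 along an edge, so its coboundary is bounded. A bounded
    primitive would differ from the distance by a constant over the base vertex; then words of
    bounded length in finitely many vertices would realize infinitely many powers of the label. *)
Theorem h1_nonvanishing p : edge_path K o o p -> infinite_order (wp l p) -> ~ linf_vanishes K 1.
Proof.
intros Hp Inf Van.
set (be := fun (q s : list nat) => INR (dist (hd 0 s) (wp l q))).
assert (Eb : forall q x y, cobdry be q [x; y] = (be (q ++ [y]) [y] - be q [x])%R).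
{ intros q x y. rewrite cobdry_D. simpl. lra. }
destruct (Van (cobdry be)) as (b & [Wb Bb] & Hb).
- split.
 + intros q q' s [[Ls Hs] Hq] _ E. destruct s as [|x [|y [|]]]; try easy. rewrite !Eb. unfold be.
  rewrite (wp_htp K l Fl Lu q q' E), (wp_htp K l Fl Lu (q ++ [y]) (q' ++ [y])); auto. rewrite E. reflexivity.
 + intros s [Ls Hs]. exists 1%R. intros q [_ Hq]. destruct s as [|x [|y [|]]]; try easy.
  rewrite Eb. unfold be. simpl hd in *. rewrite (wp_snoc K WF l o x y q Hq).
  destruct (dist_step x y q Hq Hs) as [D1 D2]. apply le_INR in D1, D2. rewrite S_INR in D1, D2.
  apply Rabs_le. lra.
- intros q s [[Ls Hs] Hq]. destruct s as [|x [|y [|z [|]]]]; try easy.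
 rewrite cobdry_D. cbn [hd D]. rewrite !Eb. rewrite <- app_assoc. simpl app. unfold be. simpl hd.
 rewrite (wp_htp K l Fl Lu (q ++ [y; z]) (q ++ [z])); [lra|].
 destruct (ep_end K WF _ _ _ Hq) as [_ [t ->]]. rewrite <- !app_assoc. simpl in *.
 rewrite (app_htp K t t ltac:(reflexivity) _ _ (htp_mid K x y z Hs)). reflexivity.
- simpl in Hb, Wb, Bb.
 assert (Ho : is_vertex K o) by apply (ep_start K _ _ _ Hp).
 assert (C : forall v q, edge_path K o v q -> (be q [v] - b q [v] = be [o] [o] - b [o] [o])%R).
 { apply (ep_ind K o (fun v q => (be q [v] - b q [v] = be [o] [o] - b [o] [o])%R)); auto.
  intros v w q Hq IH E. specialize (Hb q [v; w]). rewrite Eb, cobdry_D in Hb. simpl in Hb.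
  rewrite <- IH. enough (b (q ++ [w]) [w] - (b q [v] - 0) = be (q ++ [w]) [w] - be q [v])%R by lra.
  apply Hb. split; [split; auto|auto]. }
 destruct (Bb [o]) as [B HB]; [split; auto|].
 assert (Bd : exists n, forall q, edge_path K o o q -> dist o (wp l q) <= n).
 { destruct (INR_unbounded (B + (be [o] [o] - b [o] [o]))) as [n Hn]. exists n. intros q Hq.
  apply INR_le. specialize (C o q Hq). change (be q [o]) with (INR (dist o (wp l q))) in C.
  assert (Rabs (b q [o]) <= B)%R by (apply HB; split; [split; auto|auto]).
  pose proof (Rle_abs (b q [o])). lra. }
 destruct Bd as [n Hn].
 set (Vs := concat K).
 assert (HV : forall v, is_vertex K v -> In v Vs).
 { intros v (t & Ht & E). apply in_concat. exists t. split; auto. apply E. left; auto. }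
 assert (Hq : forall k, exists q, In q (words Vs n) /\ wp l q = gpow (wp l p) k).
 { intros k. destruct (ep_pow p k Hp) as [E1 E2]. destruct (dist_spec _ _ E1) as [(q & Hq & Lq & Wq) _].
  exists q. rewrite Wq, E2. split; auto. apply in_words; [|rewrite Lq; auto].
  intros y Hy. apply HV. eapply ep_vertices; eauto. }
 set (f := fun k => epsilon (inhabits []) (fun q => In q (words Vs n) /\ wp l q = gpow (wp l p) k)).
 assert (Hf : forall k, In (f k) (words Vs n) /\ wp l (f k) = gpow (wp l p) k).
 { intros k. apply (epsilon_spec (inhabits []) (fun q => In q (words Vs n) /\ wp l q = gpow (wp l p) k)), Hq. }
 assert (Nf : NoDup (map f (seq 0 (S (length (words Vs n)))))).
 { apply NoDup_map_NoDup_ForallPairs; [|apply seq_NoDup]. intros j k _ _ E.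
  apply (infinite_order_inj (wp l p)); auto. rewrite <- (proj2 (Hf j)), <- (proj2 (Hf k)), E. auto. }
 apply NoDup_incl_length with (l' := words Vs n) in Nf.
 + rewrite length_map, length_seq in Nf. lia.
 + intros q Hq'. apply in_map_iff in Hq' as (k & <- & _). apply Hf.
Qed.
End H1.

(** * A sphere bundle with one filled fibre *)

Section Sphere.
Context {V : Type} (X : list V -> Prop) (o : V) (n : nat).
Hypotheses (CX : closed X) (Xo : X [o]) (Hn : 2 <= n).

Definition omit (i : nat) : list nat := filter (fun j => negb (j =? i)) (seq 0 (S n)).
Definition sphere_facets : list (list nat) := map omit (seq 0 (S n)).
Definition sphere : list nat -> Prop := fc sphere_facets.
Definition fibre (v : V) : list (V * nat) := map (pair v) (seq 0 (S n)).
Definition Y (s : list (V * nat)) : Prop := prodc X sphere s \/ incl s (fibre o).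

Lemma in_omit i j : In j (omit i) <-> j <= n /\ j <> i.
Proof.
unfold omit. rewrite filter_In, in_seq, negb_true_iff, Nat.eqb_neq. lia.
Qed.
Lemma sphere_spec s : sphere s <-> exists i, i <= n /\ forall j, In j s -> j <= n /\ j <> i.
Proof.
split.
- intros (f & Hf & I). apply in_map_iff in Hf as (i & <- & Hi). apply in_seq in Hi. exists i. split; [lia|].
 intros j Hj. apply in_omit, I, Hj.
- intros (i & Hi & H). exists (omit i). split; [apply in_map, in_seq; lia|]. intros j Hj. apply in_omit, H, Hj.
Qed.
Lemma omit_length i : i <= n -> length (omit i) <= n.
Proof.
intros Hi. enough (length (i :: omit i) <= length (seq 0 (S n))) by (rewrite length_seq in *; simpl in *; lia).
apply NoDup_incl_length.
- constructor; [intros H; apply in_omit in H; tauto|]. apply NoDup_filter, seq_NoDup.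
- intros j [<-|Hj]; [apply in_seq; lia|]. apply in_omit in Hj. apply in_seq. lia.
Qed.
Lemma sphere_dup s : sphere s -> length s = S n -> ~ NoDup s.
Proof.
intros H L N. apply sphere_spec in H as (i & Hi & H).
apply NoDup_incl_length with (l' := omit i) in N; [|intros j Hj; apply in_omit, H, Hj].
pose proof (omit_length i Hi). lia.
Qed.
(** Two positions leave a third one to omit, since [2 <= n]. So everything over an edge of the base
    that involves at most two positions belongs to the product. *)
Lemma sphere_two i i' s : i <= n -> i' <= n -> (forall j, In j s -> j = i \/ j = i') -> sphere s.
Proof.
intros Hi Hi' H. apply sphere_spec.
assert (E : exists k, k <= n /\ k <> i /\ k <> i').
{ destruct (Nat.eq_dec i 0), (Nat.eq_dec i' 0), (Nat.eq_dec i 1), (Nat.eq_dec i' 1);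
  try (exists 0; lia); try (exists 1%nat; lia); exists 2; lia. }
destruct E as (k & Hk & N1 & N2). exists k. split; auto. intros j Hj. destruct (H j Hj); subst; auto.
Qed.
Lemma sphere_closed : closed sphere.
Proof. apply fc_closed. Qed.
Lemma Y_closed : closed Y.
Proof. apply or_closed; [apply prodc_closed; auto using sphere_closed|apply incl_closed]. Qed.
Lemma in_fibre v x : In x (fibre v) <-> fst x = v /\ snd x <= n.
Proof.
unfold fibre. rewrite in_map_iff. split.
- intros (i & <- & Hi). apply in_seq in Hi. simpl. split; auto; lia.
- intros [<- H]. exists (snd x). split; [symmetry; apply surjective_pairing|]. apply in_seq. lia.
Qed.
Lemma sphere_zero i : sphere [i] -> sphere [0; i].
Proof.
intros H. apply sphere_spec in H as (k & Hk & H). destruct (H i (or_introl eq_refl)) as [Hi _].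
apply (sphere_two 0 i); try lia. intros j [<-|[<-|[]]]; auto.
Qed.

Lemma Y_linked : (forall v, X [v] -> linked X o v) -> forall x, Y [x] -> linked Y (o, 0) x.
Proof.
intros Lk [v i] H.
assert (L0 : forall v, linked X o v -> linked Y (o, 0) (v, 0)).
{ intros w Hw. induction Hw as [|u w Hu IH E]; [constructor|]. econstructor; [apply IH|]. left. split; auto.
 apply (sphere_two 0 0); try lia. intros j [<-|[<-|[]]]; auto. }
assert (Hv : X [v] /\ i <= n).
{ destruct H as [[H1 H2]|H].
 - split; auto. simpl in H2. apply sphere_spec in H2 as (k & _ & H2). apply (H2 i (or_introl eq_refl)).
 - destruct (proj1 (in_fibre _ _) (H (v, i) (or_introl eq_refl))) as [E Hi]. simpl in *. subst. auto. }
destruct Hv as [Hv Hi]. econstructor; [apply L0, Lk, Hv|]. left. split.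
- apply (CX [v]); auto. subset.
- apply (sphere_two 0 i); try lia. intros j [<-|[<-|[]]]; auto.
Qed.

(** The filled fibre trivializes the fibre loops over [o], also for [n = 2], where the fibres are
    circles; sliding does the rest. *)
Lemma Y_trivial (M : group) (l : V * nat -> V * nat -> M) : (forall v, X [v] -> linked X o v) ->
 (forall l0 : V -> V -> M, flat_lab X l0 -> exists h, trivializes X l0 h) ->
 flat_lab Y l -> exists h, trivializes Y l h.
Proof.
intros Lk Tr Fl.
assert (S0 : forall s, incl s [0] -> sphere s).
{ intros s I. apply (sphere_two 0 0); try lia. intros j Hj. destruct (I j Hj) as [<-|[]]; auto. }
destruct (Tr (fun u v => l (u, 0) (v, 0))) as [h0 H0].
{ intros u v w H. apply Fl. left. split; auto. apply S0. subset. }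
assert (Fp : flat_lab (prodc X sphere) l) by (intros u v w H; apply Fl; left; auto).
assert (Fo : forall a b c, a <= n -> b <= n -> c <= n -> l (o, a) (o, b) ** l (o, b) (o, c) = l (o, a) (o, c)).
{ intros a b c Ha Hb Hc. apply Fl. right. intros y [<-|[<-|[<-|[]]]]; apply in_fibre; auto. }
assert (Fr : forall a, a <= n -> l (o, a) (o, a) = 1).
{ intros a Ha. apply (gcancel_l (l (o, a) (o, a))). rewrite gone_r. auto. }
exists (fun x => h0 (fst x) ** l (fst x, 0) x). intros x y [H|H].
- apply (prod_trivial X sphere o 0 CX sphere_closed M l Fp sphere_zero); auto.
 intros i i' HL. apply sphere_spec in HL as (k & _ & HL).
 destruct (HL i (or_introl eq_refl)), (HL i' (or_intror (or_introl eq_refl))).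
 unfold turn. rewrite !Fo, Fr by lia. auto.
- destruct (proj1 (in_fibre _ _) (H x (or_introl eq_refl))) as [E1 Hi].
 destruct (proj1 (in_fibre _ _) (H y (or_intror (or_introl eq_refl)))) as [E2 Hj].
 destruct x as [u i], y as [v j]; simpl in *; subst u v. rewrite ginvM. gsimp.
 rewrite <- (Fo i 0 j) by lia. f_equal. apply ginv_unique. rewrite Fo, Fr by lia. auto.
Qed.

(** The filled fibre meets the product in the sphere over [o], which has cohomology of degree
    [n - 1]. Projecting the product to that sphere extends each of its cocycles, as the refined
    Mayer-Vietoris lemma requires. *)
Lemma Hv_Y : (forall k, 1 <= k <= n -> Hv X k) -> Hv Y n.
Proof.
intros HX. destruct n as [|n'] eqn:En; [lia|]. rewrite <- En in *.
replace (Hv Y n) with (Hv Y (S n')) by (rewrite En; auto).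
apply Hv_union_ext.
- apply prodc_closed; auto using sphere_closed.
- apply incl_closed.
- rewrite <- En. apply Hv_prod_dim; auto. intros f Hf. apply in_map_iff in Hf as (i & <- & Hi). apply in_seq in Hi.
 apply omit_length. lia.
- apply Hv_simplex.
- intros f Hf. exists (fun s => f (map (fun x => (o, snd x)) s)), (fun _ => 0%R).
 assert (In1 : forall s, prodc X sphere s -> let s' := map (fun x => (o, snd x)) s in prodc X sphere s' /\ incl s' (fibre o)).
 { intros s [H1 H2]. split; [split|]; rewrite ?map_map; simpl; auto.
  - apply (CX [o]); auto. intros y Hy. apply in_map_iff in Hy as (x & <- & _). left; auto.
  - apply sphere_spec in H2 as (k & _ & H2). intros y Hy. apply in_map_iff in Hy as (x & <- & Hx).
   apply in_fibre. split; auto. apply (H2 (snd x)), in_map, Hx. }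
 split.
 + intros s Hs Ls. rewrite <- (D_map (fun x => (o, snd x)) f). apply Hf; rewrite ?length_map; auto; apply In1, Hs.
 + intros s Hs I Ls. rewrite (D_zero (fun _ => 0%R)) by auto. rewrite (map_ext_in _ (fun x => x)), map_id; [lra|].
  intros x Hx. destruct (proj1 (in_fibre _ _) (I x Hx)) as [<- _]. symmetry. apply surjective_pairing.
Qed.

Section Cocycle.
Context (k : nat) (enc : V * nat -> nat) (L : list (list (V * nat))) (M : group) (l : V -> V -> M).
Let P := skel k Y.
Hypotheses (Hk : n + 2 <= k) (Inj : forall x y, enc x = enc y -> x = y) (NL : forall s, In s L -> s <> [])
 (HP : forall s, s <> [] -> ((exists t, In t L /\ forall v, In v s <-> In v t) <-> P s))
 (Fl : flat_lab X l) (Lu : forall u, l u u = 1).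
Let K := cx enc (o, 0) L.
Notation de := (dec enc (o, 0)).
Let lK (a b : nat) : M := l (fst (de a)) (fst (de b)).

Lemma CP : closed P.
Proof. apply skel_closed. Qed.
Lemma PY s : length s <= k -> (P s <-> Y s).
Proof. apply skel_small, Y_closed. Qed.
Lemma Po : P [(o, 0)].
Proof.
apply PY; [simpl; lia|]. right. intros y [<-|[]]. apply in_fibre. simpl. split; auto; lia.
Qed.
Lemma WFK : wf_complex K.
Proof. apply (cx_wf enc (o, 0) L P); auto using CP, Po. Qed.
Lemma lK_flat : flat_lab (PK K) lK.
Proof.
apply (label_cx enc (o, 0) L P Inj CP Po HP M (fun x y => l (fst x) (fst y))).
intros x y z H. apply PY in H; [|simpl; lia]. destruct H as [[H _]|H]; [apply Fl, H|].
assert (E : forall w, In w [x; y; z] -> fst w = o) by (intros w Hw; apply (in_fibre o), H, Hw).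
rewrite !E by (simpl; auto). rewrite Lu. apply gone_l.
Qed.

(** The fundamental cochain of the simplex that fills the fibre over [o]. It vanishes on tuples with
    a repeated position, hence on the sphere bundle in degree [n]. *)
Definition fundamental (t : list (V * nat)) : R :=
 if em (forall x, In x t -> fst x = o) then sg (map snd t) else 0%R.
(** Selects the lifts of the filled fibre that are reached by paths of label 1. *)
Definition delta1 (g : M) : R := if em (g = 1) then 1%R else 0%R.
Definition acoc : cochain := fun q s => (delta1 (wp lK q) * fundamental (map de s))%R.

Lemma fundamental_sphere t : prodc X sphere t -> length t = S n -> fundamental t = 0%R.
Proof.
intros [_ H] Lt. unfold fundamental. destruct (em _); auto.
apply alt_dup; [apply sg_alt|]. apply sphere_dup; rewrite ?length_map; auto.
Qed.
Lemma fundamental_D t : Y t -> length t = S (S n) -> D fundamental t = 0%R.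
Proof.
intros [H|H] Lt.
- apply D_zero. intros s I Ls. apply fundamental_sphere; [|lia].
 eapply prodc_closed; eauto using sphere_closed.
- rewrite (D_ext fundamental (fun s => sg (map snd s))).
 + rewrite <- (D_map snd sg). apply D_alt_dup; [apply sg_alt|]. intros N.
  apply NoDup_incl_length with (l' := seq 0 (S n)) in N; [rewrite length_map, length_seq in N; lia|].
  intros j Hj. apply in_map_iff in Hj as (x & <- & Hx). apply H, in_fibre in Hx. apply in_seq. lia.
 + intros s I _. unfold fundamental. destruct (em _) as [|N]; auto.
  destruct N. intros x Hx. apply (in_fibre o), H, I, Hx.
Qed.

Lemma acoc_bcochain : bcochain K n acoc.
Proof.
split.
- intros q q' s _ _ E. unfold acoc. rewrite (wp_htp K lK lK_flat (fun u => Lu _) q q' E). auto.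
- intros s _. exists (Rabs (fundamental (map de s))). intros q _. unfold acoc, delta1.
 destruct (em _); rewrite Rabs_mult, ?Rabs_R1, ?Rabs_R0;
  pose proof (Rabs_pos (fundamental (map de s))); lra.
Qed.
Lemma acoc_closed q s : lift_ok K (S n) q s -> cobdry acoc q s = 0%R.
Proof.
intros [[Ls Hs] Hq]. destruct s as [|x [|y s]]; try easy.
assert (Yt : Y (map de (x :: y :: s))).
{ eapply skel_sub; [apply Y_closed|]. apply (cx_simplex enc (o, 0) L P Inj CP Po HP), Hs. }
rewrite cobdry_D. cbn [hd]. simpl in Hq. unfold acoc at 1. rewrite (wp_snoc K WFK lK (base K) x y q Hq).
rewrite (D_ext (fun l0 => acoc q (x :: l0)) (fun l0 => delta1 (wp lK q) * fundamental (de x :: map de l0))%R) by reflexivity.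
rewrite (D_scal (delta1 (wp lK q)) (fun l0 => fundamental (de x :: map de l0))).
rewrite <- (D_map de (fun l0 => fundamental (de x :: l0))).
assert (Lt : length (map de (x :: y :: s)) = S (S n)) by (rewrite length_map; auto).
assert (F := fundamental_D _ Yt Lt). cbn [map] in F, Yt, Lt. simpl in F.
destruct Yt as [Yt|Yt].
- rewrite fundamental_sphere in *.
 + simpl. rewrite Rmult_0_r. replace (fundamental (de x :: map de s) - D (fun l0 => fundamental (de x :: de y :: l0)) (map de s))%R with 0%R; lra.
 + eapply prodc_closed; eauto using sphere_closed. subset.
 + simpl in *. lia.
 + eapply prodc_closed; eauto using sphere_closed. subset.
 + simpl in *. lia.
- unfold lK at 1.
 assert (E1 : fst (de x) = o) by (apply (in_fibre o), Yt; left; auto).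
 assert (E2 : fst (de y) = o) by (apply (in_fibre o), Yt; right; left; auto).
 unfold lK. fold lK. rewrite E1, E2, Lu, gone_r. simpl. rewrite <- Rmult_minus_distr_l.
 rewrite F. ring.
Qed.

Notation e v i := (enc (v, i)).
(** Paths in the slice of position 0; fibres are compared along them. *)
Inductive level0 : V -> list nat -> Prop :=
| level0_base : level0 o [e o 0]
| level0_step v w p : level0 v p -> X [v; w] -> level0 w (p ++ [e w 0]).

Lemma square_P u v i i' t : X [u; v] -> i <= n -> i' <= n -> length t <= k ->
 (forall x, In x t -> (fst x = u \/ fst x = v) /\ (snd x = i \/ snd x = i')) -> P t.
Proof.
intros HX Hi Hi' Lt H. apply PY; auto. left. split.
- apply (CX [u; v]); auto. intros y Hy. apply in_map_iff in Hy as (x & <- & Hx).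
 destruct (H x Hx) as [[->| ->] _]; simpl; auto.
- apply (sphere_two i i'); auto. intros j Hj. apply in_map_iff in Hj as (x & <- & Hx). apply H, Hx.
Qed.
Lemma tri_K x y z : P [x; y; z] -> htp K [enc x; enc y; enc z] [enc x; enc z].
Proof. intros H. apply htp_mid. apply (cx_enc enc (o, 0) L P Inj CP Po HP [x; y; z]); auto. easy. Qed.
Lemma level0_X v p : level0 v p -> X [v] /\ edge_path K (base K) (e v 0) p.
Proof.
intros H. induction H as [|v w p _ [IH1 IH2] E].
- split; auto. apply ep_one. apply (vertex_cx enc (o, 0) L P Inj CP Po HP), Po.
- split; [apply (CX [v; w]); auto; subset|].
 eapply ep_snoc; [exact IH2|]. apply (edge_cx enc (o, 0) L P Inj CP Po HP).
 apply (square_P v w 0 0); auto; [lia|lia|simpl; lia|].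
 intros x [<-|[<-|[]]]; simpl; auto.
Qed.
Lemma level0_end v p : level0 v p -> exists t, p = t ++ [e v 0].
Proof. intros H. destruct H; [exists []; auto|eauto]. Qed.

Lemma slide_edge v w p : level0 v p -> X [v; w] ->
 (forall i i', i <= n -> i' <= n -> htp K (p ++ [e v i; e v i']) (p ++ [e v i'])) ->
 forall u1 u2 i i', (u1 = v \/ u1 = w) -> (u2 = v \/ u2 = w) -> i <= n -> i' <= n ->
  htp K (p ++ [e u1 i; e u2 i']) (p ++ [e u2 i']).
Proof.
intros Hp HX Sl u1 u2 i i' H1 H2 Hi Hi'. destruct (level0_end v p Hp) as [t Et].
assert (Sq : forall a b x y z, a <= n -> b <= n ->
 (forall q, In q [x; y; z] -> (fst q = v \/ fst q = w) /\ (snd q = a \/ snd q = b)) ->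
 htp K [enc x; enc y; enc z] [enc x; enc z]).
{ intros a b x y z Ha Hb H. apply tri_K, (square_P v w a b); auto. simpl; lia. }
assert (Ins : forall u j r, (u = v \/ u = w) -> j <= n ->
 htp K (p ++ e u j :: r) (p ++ e v j :: e u j :: r)).
{ intros u j r Hu Hj. rewrite Et, <- !app_assoc. simpl.
 change (htp K (t ++ [e v 0; e u j] ++ r) (t ++ [e v 0; e v j; e u j] ++ r)).
 rewrite (Sq 0 j (v, 0) (v, j) (u, j)); [reflexivity|lia|auto|].
 intros q [<-|[<-|[<-|[]]]]; simpl; auto. }
rewrite (Ins u1 i), (Ins u2 i') by auto.
change (htp K (p ++ [e v i; e u1 i; e u2 i']) (p ++ [e v i'; e u2 i'])).
rewrite (Sq i i' (v, i) (u1, i) (u2, i')); auto; [|intros q [<-|[<-|[<-|[]]]]; simpl; auto].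
rewrite <- (Sq i i' (v, i) (v, i') (u2, i')); auto; [|intros q [<-|[<-|[<-|[]]]]; simpl; auto].
change [e v i; e v i'; e u2 i'] with ([e v i; e v i'] ++ [e u2 i']). rewrite app_assoc, Sl by auto.
rewrite <- app_assoc. reflexivity.
Qed.
(** Over [o] the filled fibre provides the triangle; along the path the homotopy is carried over by
    the squares above each edge. This is what makes a lift of a fibre depend only on the path
    below. *)
Lemma slide_fibre v p : level0 v p -> forall i i', i <= n -> i' <= n ->
 htp K (p ++ [e v i; e v i']) (p ++ [e v i']).
Proof.
intros H. induction H as [|v w q Hq IH HX]; intros i i' Hi Hi'.
- apply (tri_K (o, 0) (o, i) (o, i')). apply PY; [simpl; lia|]. right.
 intros y [<-|[<-|[<-|[]]]]; apply in_fibre; simpl; split; auto; lia.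
- pose proof (slide_edge v w q Hq HX IH) as Sl. rewrite <- !app_assoc.
 change (htp K (q ++ [e w 0; e w i] ++ [e w i']) (q ++ [e w 0; e w i'])).
 rewrite app_assoc, (Sl w w 0 i), (Sl w w 0 i') by (auto; lia). rewrite <- app_assoc. apply (Sl w w i i'); auto.
Qed.
Lemma slide v w p u1 u2 i i' : level0 v p -> X [v; w] -> (u1 = v \/ u1 = w) -> (u2 = v \/ u2 = w) ->
 i <= n -> i' <= n -> htp K (p ++ [e u1 i; e u2 i']) (p ++ [e u2 i']).
Proof. intros Hp HX. apply (slide_edge v w p Hp HX (slide_fibre v p Hp)). Qed.

Section Filling.
Context (b : cochain) (Wb : cochain_wd K (n - 1) b)
 (Hb : forall q s, lift_ok K n q s -> cobdry b q s = acoc q s).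

Definition lifted (p : list nat) (t : list (V * nat)) : R :=
 match t with [] => 0%R | x :: _ => b (p ++ [enc x]) (map enc t) end.

Lemma step_edge v w p u i : level0 v p -> X [v; w] -> (u = v \/ u = w) -> i <= n ->
 edge_path K (base K) (e u i) (p ++ [e u i]).
Proof.
intros Hp HX Hu Hi. destruct (level0_X v p Hp) as [_ E]. eapply ep_snoc; [exact E|].
apply (edge_cx enc (o, 0) L P Inj CP Po HP), (square_P v w 0 i); auto; [lia|simpl; lia|].
intros x [<-|[<-|[]]]; simpl; auto.
Qed.
Definition near (v w : V) (t : list (V * nat)) : Prop :=
 forall x, In x t -> (fst x = v \/ fst x = w) /\ snd x <= n.

Lemma lifted_D v w p t : level0 v p -> X [v; w] -> near v w t -> P t -> length t = S n ->
 D (lifted p) t = acoc (p ++ [enc (hd (o, 0) t)]) (map enc t).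
Proof.
intros Hp HX Nt Pt Lt. destruct t as [|x [|y t]]; simpl in Lt; try lia.
assert (Hx := Nt x (or_introl eq_refl)). assert (Hy := Nt y (or_intror (or_introl eq_refl))).
assert (Ex := step_edge v w p (fst x) (snd x) Hp HX (proj1 Hx) (proj2 Hx)).
assert (Ey := step_edge v w p (fst y) (snd y) Hp HX (proj1 Hy) (proj2 Hy)).
rewrite <- !surjective_pairing in Ex, Ey.
assert (Exy : is_simplex K [enc x; enc y]).
{ apply (edge_cx enc (o, 0) L P Inj CP Po HP). apply (CP (x :: y :: t)); auto.
 subset. }
rewrite <- Hb.
- cbn [map hd]. rewrite cobdry_D. cbn [hd].
 change (D (lifted p) (x :: y :: t)) with (lifted p (y :: t) - D (fun l0 => lifted p (x :: l0)) (y :: t))%R.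
 change (enc y :: map enc t) with (map enc (y :: t)).
 rewrite (D_map enc (fun l0 => b (p ++ [enc x]) (enc x :: l0)) (y :: t)). f_equal.
 + simpl lifted. symmetry. assert (Py : ord_simplex K (n - 1) (enc y :: map enc t)).
  { split; [simpl; rewrite length_map; lia|]. apply (cx_enc enc (o, 0) L P Inj CP Po HP (y :: t)); [easy|].
   apply (CP (x :: y :: t)); auto. intros z Hz; right; auto. }
  apply Wb; [split; auto; eapply ep_snoc; eauto|split; auto|].
  rewrite <- app_assoc. pose proof (slide v w p (fst x) (fst y) (snd x) (snd y) Hp HX) as S.
  rewrite <- !surjective_pairing in S. apply S; tauto.
- split; [split; [rewrite length_map; auto|apply (cx_enc enc (o, 0) L P Inj CP Po HP); auto; easy]|exact Ex].
Qed.
(** A tuple that misses a position lies in the sphere bundle, where the cocycle vanishes. *)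
Lemma lifted_zero v w p t i : level0 v p -> X [v; w] -> near v w t -> length t = S n -> i <= n ->
 (forall x, In x t -> snd x <> i) -> D (lifted p) t = 0%R.
Proof.
intros Hp HX Nt Lt Hi Ht.
assert (PX : prodc X sphere t).
{ split.
 - apply (CX [v; w]); auto. intros y Hy. apply in_map_iff in Hy as (x & <- & Hx).
  destruct (Nt x Hx) as [[->| ->] _]; simpl; auto.
 - apply sphere_spec. exists i. split; auto. intros j Hj. apply in_map_iff in Hj as (x & <- & Hx).
  split; [apply Nt, Hx|apply Ht, Hx]. }
rewrite (lifted_D v w); auto; [|apply PY; [lia|left; auto]].
unfold acoc. rewrite (map_dec enc (o, 0) Inj), fundamental_sphere; auto. ring.
Qed.

(** The fibre over [v] is moved to the one over [w] vertex by vertex. Every other face of the tuple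
    with one doubled position misses a position, so [D_move] applies. *)
Lemma lifted_move v w p : level0 v p -> X [v; w] -> forall j, j <= S n ->
 D (lifted p) (map (pair w) (seq 0 j) ++ map (pair v) (seq j (S n - j))) = D (lifted p) (fibre v).
Proof.
intros Hp HX. induction j as [|j IH]; intros Hj; [simpl; auto|].
rewrite <- IH by lia. replace (S n - j) with (S (S n - S j)) by lia. rewrite seq_S, map_app, <- app_assoc. simpl.
set (l1 := map (pair w) (seq 0 j)). set (l2 := map (pair v) (seq (S j) (n - j))).
assert (N1 : forall x, In x l1 -> fst x = w /\ snd x < j).
{ intros x Hx. apply in_map_iff in Hx as (i & <- & Hi). apply in_seq in Hi. simpl. split; auto; lia. }
assert (N2 : forall x, In x l2 -> fst x = v /\ j < snd x <= n).
{ intros x Hx. apply in_map_iff in Hx as (i & <- & Hi). apply in_seq in Hi. simpl. split; auto; lia. }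
assert (Ls : length l1 = j /\ length l2 = n - j) by (unfold l1, l2; rewrite !length_map, !length_seq; auto).
assert (D1 : NoDup (map snd l1)) by (unfold l1; rewrite map_map, map_id; apply seq_NoDup).
assert (D2 : NoDup (map snd l2)) by (unfold l2; rewrite map_map, map_id; apply seq_NoDup).
assert (G : forall (A : list (V * nat)) z m, forall (NA : NoDup (map snd (A ++ z :: m))) x, In x (A ++ m) -> snd x <> snd z).
{ intros A z m NA x Hx E. rewrite map_app in NA. simpl in NA. apply NoDup_remove_2 in NA. apply NA.
 rewrite <- E, <- map_app. apply in_map, Hx. }
apply D_move.
- intros A z m E. rewrite E in D1, N1, Ls. rewrite length_app in Ls. simpl in Ls.
 assert (Nz := N1 z ltac:(apply in_or_app; right; left; auto)).
 apply (lifted_zero v w p _ (snd z)); auto; [| |lia|].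
 + intros x Hx. rewrite app_assoc in Hx. apply in_app_or in Hx as [Hx|[<-|[<-|Hx]]]; simpl; auto; try (split; auto; lia).
  * destruct (N1 x) as [-> ?]; [apply in_app_or in Hx as [Hx|Hx]; apply in_or_app; simpl; auto|]. split; auto; lia.
  * destruct (N2 x Hx) as [-> ?]. split; auto; lia.
 + rewrite !length_app. simpl. lia.
 + intros x Hx. rewrite app_assoc in Hx. apply in_app_or in Hx as [Hx|[<-|[<-|Hx]]]; simpl; try lia.
  * apply (G A z m D1); auto.
  * apply N2 in Hx. lia.
- intros A z m E. rewrite E in D2, N2, Ls. rewrite length_app in Ls. simpl in Ls.
 assert (Nz := N2 z ltac:(apply in_or_app; right; left; auto)).
 apply (lifted_zero v w p _ (snd z)); auto; [| |lia|].
 + intros x Hx. apply in_app_or in Hx as [Hx|[<-|[<-|Hx]]]; simpl; auto; try (split; auto; lia).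
  * destruct (N1 x Hx) as [-> ?]. split; auto; lia.
  * destruct (N2 x) as [-> ?]; [apply in_app_or in Hx as [Hx|Hx]; apply in_or_app; simpl; auto|]. split; auto; lia.
 + rewrite !length_app. simpl. rewrite length_app. lia.
 + intros x Hx. apply in_app_or in Hx as [Hx|[<-|[<-|Hx]]]; simpl; try lia.
  * apply N1 in Hx. lia.
  * apply (G A z m D2); auto.
Qed.

Lemma lifted_invariant v p : level0 v p -> D (lifted p) (fibre v) = D (lifted [e o 0]) (fibre o).
Proof.
intros H. induction H as [|v w p Hp IH HX]; auto. rewrite <- IH.
rewrite <- (lifted_move v w p Hp HX (S n)) by lia. rewrite Nat.sub_diag. simpl (map (pair v) _). rewrite app_nil_r.
apply D_ext. intros t I Lt. unfold fibre in Lt. rewrite length_map, length_seq in Lt.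
destruct t as [|x t]; [simpl in Lt; lia|]. simpl lifted.
assert (Hx : fst x = w /\ snd x <= n) by (apply in_fibre, I; left; auto).
assert (Os : ord_simplex K (n - 1) (enc x :: map enc t)).
{ split; [simpl in *; rewrite length_map; lia|]. apply (cx_enc enc (o, 0) L P Inj CP Po HP (x :: t)); [easy|].
 apply PY; [simpl in *; lia|]. left. split.
 - apply (CX [w]); [apply (level0_X w (p ++ [e w 0])); econstructor; eauto|]. intros y Hy.
  apply in_map_iff in Hy as (z & <- & Hz). left. symmetry. apply (in_fibre w), I, Hz.
 - apply NNPP. intros Ns. assert (Nd : incl (seq 0 (S n)) (map snd (x :: t))).
  { intros j Hj. apply NNPP. intros Nj. apply Ns, sphere_spec. exists j. apply in_seq in Hj. split; [lia|].
   intros j' Hj'. split; [|congruence]. apply in_map_iff in Hj' as (z & <- & Hz). apply (in_fibre w), I, Hz. }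
  apply NoDup_incl_length in Nd; [|apply seq_NoDup]. rewrite length_map, length_seq in Nd. simpl in *. lia. }
destruct x as [x i]. simpl in Hx. destruct Hx as [-> Hi].
apply Wb.
- split; auto. apply (step_edge w w (p ++ [e w 0])); auto; [econstructor; eauto|].
 apply (CX [v; w]); auto. subset.
- split; auto. apply (step_edge v w p); auto.
- rewrite <- app_assoc. apply (slide v w p w w 0 i); auto; lia.
Qed.
Lemma fibre_value p : level0 o p -> D (lifted p) (fibre o) = delta1 (wp lK p).
Proof.
intros Hp. assert (Xoo : X [o; o]) by (apply (CX [o]); auto; subset).
rewrite (lifted_D o o); auto.
- unfold acoc. rewrite (map_dec enc (o, 0) Inj). unfold fundamental.
 destruct (em _) as [_|N]; [|destruct N; intros x Hx; apply (in_fibre o), Hx].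
 replace (map snd (fibre o)) with (seq 0 (S n)) by (unfold fibre; rewrite map_map, map_id; auto).
 rewrite sg_sorted, Rmult_1_r. f_equal.
 simpl hd. rewrite (wp_htp K lK lK_flat (fun u => Lu _) _ p); auto. destruct (level0_X o p Hp) as [_ E].
 apply (htp_end K WFK _ _ _ E).
- intros x Hx. apply in_fibre in Hx. tauto.
- apply PY; [unfold fibre; rewrite length_map, length_seq; lia|]. right. apply incl_refl.
- unfold fibre. rewrite length_map, length_seq. auto.
Qed.
End Filling.

(** The sum of [b] over the boundary of a lifted fibre is the same for all lifts. Being a primitive
    forces it to be 1 over the constant path and 0 over a loop with nontrivial label. *)
Theorem sphere_nonvanishing p : level0 o p -> wp lK p <> 1 -> ~ linf_vanishes K n.
Proof.
intros Hp Np Van. destruct (Van acoc acoc_bcochain acoc_closed) as (b & [Wb _] & Hb).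
pose proof (lifted_invariant b Wb Hb o p Hp) as E.
rewrite (fibre_value b Wb Hb p Hp), (fibre_value b Wb Hb [e o 0] level0_base) in E. unfold delta1 in E. simpl in E.
destruct (em (wp lK p = 1)); [tauto|].
destruct (em ((1 : M) = 1)); [lra|tauto].
Qed.
End Cocycle.
End Sphere.

(** * Attaching top-dimensional cells *)

Lemma D_one {V : Type} (F : list V -> R) A z B :
 (forall k y m, A = k ++ y :: m -> F (k ++ m ++ z :: B) = 0%R) ->
 (forall k y m, B = k ++ y :: m -> F (A ++ z :: k ++ m) = 0%R) ->
 D F (A ++ z :: B) = ((-1) ^ length A * F (A ++ B))%R.
Proof.
revert F. induction A as [|w A IH]; intros F H1 H2; simpl.
- rewrite (D_faces_zero (fun l => F (z :: l))) by (intros k y m E; apply (H2 k y m E)). lra.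
- pose proof (H1 [] w A eq_refl) as E. simpl in E. rewrite E, IH; [ring| |].
 + intros k y m ->. apply (H1 (w :: k) y m eq_refl).
 + intros k y m Ek. apply (H2 k y m Ek).
Qed.

Section Cells.
Context {V : Type}.
Implicit Types (f s : list V).

Fixpoint rank f (v : V) : nat :=
 match f with [] => 0 | x :: f => if em (v = x) then 0 else S (rank f v) end.
Lemma map_rank f k : NoDup f -> map (fun v => k + rank f v) f = seq k (length f).
Proof.
revert k. induction f as [|x f IH]; intros k N; simpl; auto. inversion N as [|? ? Nx Nf]; subst.
destruct (em (x = x)) as [_|]; [|tauto]. f_equal; [lia|].
rewrite <- IH by auto. apply map_ext_in. intros v Hv.
destruct (em (v = x)) as [->|]; [tauto|lia].
Qed.
Definition same s f : Prop := forall v, In v s <-> In v f.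
Definition orient (rk : V -> nat) (T : list V -> Prop) s : R :=
 if em (exists f, T f /\ same s f) then sg (map rk s) else 0%R.
Lemma orient_alt rk T : alt (orient rk T).
Proof.
intros l1 x y l2. unfold orient.
assert (E : forall f, same (l1 ++ x :: y :: l2) f <-> same (l1 ++ y :: x :: l2) f).
{ intros f. unfold same. split; intros H v; rewrite <- H, !in_app_iff; simpl; tauto. }
destruct (em _) as [H|H], (em _) as [H'|H'].
- rewrite !map_app. apply (sg_alt (map rk l1)).
- destruct H' as []. destruct H as (f & Tf & H). exists f. rewrite <- E. auto.
- destruct H as []. destruct H' as (f & Tf & H). exists f. rewrite E. auto.
- lra.
Qed.
Lemma orient_out rk (T : list V -> Prop) s : (forall f, T f -> ~ same s f) -> orient rk T s = 0%R.
Proof.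
intros H. unfold orient. destruct (em _) as [(f & Tf & E)|]; auto. destruct (H f Tf E).
Qed.
Lemma orient_in rk (T : list V -> Prop) s f : T f -> same s f -> orient rk T s = sg (map rk s).
Proof. intros Tf E. unfold orient. destruct (em _) as [|N]; auto. destruct N. eauto. Qed.

Definition face_dual f : list V -> R := orient (rank f) (eq f).
Lemma face_dual_self f : NoDup f -> face_dual f f = 1%R.
Proof.
intros N. unfold face_dual. rewrite (orient_in _ _ f f); [|reflexivity|intros v; tauto].
rewrite <- (sg_sorted (length f) 0). f_equal. apply (map_rank f 0 N).
Qed.
Lemma face_dual_out f s : ~ same s f -> face_dual f s = 0%R.
Proof. intros H. apply orient_out. intros g <-. auto. Qed.
Lemma face_dual_D_out f s : ~ incl f s -> D (face_dual f) s = 0%R.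
Proof.
intros H. apply D_zero. intros t I _. apply face_dual_out. intros E. apply H. intros v Hv. apply I, E, Hv.
Qed.
Lemma face_dual_D A z B : NoDup (A ++ z :: B) -> D (face_dual (A ++ B)) (A ++ z :: B) <> 0%R.
Proof.
intros N. pose proof (NoDup_remove_2 _ _ _ N) as Nz. pose proof (NoDup_remove_1 _ _ _ N) as N'.
rewrite D_one.
- rewrite face_dual_self, Rmult_1_r by auto. apply pow_nonzero. lra.
- intros k y m E. apply face_dual_out. intros H. apply Nz, H. rewrite !in_app_iff. simpl. auto.
- intros k y m E. apply face_dual_out. intros H. apply Nz, H. rewrite !in_app_iff. simpl. auto.
Qed.

(** [h] need not be alternating. A transposition is handled by [D_swap], since the other faces of
    the tuple with a doubled vertex lie in proper faces of [f]. *)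
Lemma D_perm_zero (h : list V -> R) f : NoDup f ->
 (forall s, incl s f -> ~ incl f s -> length s = length f -> D h s = 0%R) -> D h f = 0%R ->
 forall s, Permutation f s -> D h s = 0%R.
Proof.
intros N H H0.
assert (G : forall l l', Permutation l l' -> forall A, Permutation f (A ++ l) -> D h (A ++ l) = 0%R -> D h (A ++ l') = 0%R).
{ intros l l' P. induction P; intros A PA E; auto.
 - change (x :: l') with ([x] ++ l'). rewrite app_assoc. apply IHP; rewrite <- app_assoc; auto.
 - assert (NA := Permutation_NoDup PA N).
  assert (Sub : forall s, incl s (A ++ y :: x :: l) -> length s = length f -> ~ incl (A ++ y :: x :: l) s -> D h s = 0%R).
  { intros s I L Ni. apply H; auto; [intros v Hv; eapply Permutation_in; [symmetry; exact PA|auto]|].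
   intros I'. apply Ni. intros v Hv. apply I'. eapply Permutation_in; [symmetry; exact PA|auto]. }
  assert (Lf := Permutation_length PA). rewrite length_app in Lf. simpl in Lf.
  rewrite D_swap, E; [lra| | |].
  + intros k z m ->. apply Sub.
   * intros v. rewrite !in_app_iff. simpl. tauto.
   * rewrite !length_app in *. simpl in *. lia.
   * rewrite <- app_assoc in NA. simpl in NA. apply NoDup_remove_2 in NA. intros I. apply NA.
    assert (Hz : In z (k ++ m ++ x :: y :: x :: l)) by (apply I; rewrite !in_app_iff; simpl; auto).
    rewrite !in_app_iff in *. simpl in *. tauto.
  + intros k z m ->. apply Sub.
   * intros v. rewrite !in_app_iff. simpl. rewrite !in_app_iff. simpl. tauto.
   * rewrite !length_app in *. simpl in *. rewrite length_app in *. simpl in *. lia.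
   * intros I. assert (Hz : In z (A ++ x :: y :: x :: k ++ m)) by (apply I; rewrite !in_app_iff; simpl; rewrite in_app_iff; simpl; auto 10).
    change (A ++ y :: x :: k ++ z :: m) with (A ++ [y; x] ++ k ++ z :: m) in NA. rewrite !app_assoc in NA.
    apply NoDup_remove_2 in NA. apply NA. rewrite !in_app_iff in *. simpl in *. rewrite in_app_iff in Hz. tauto.
  + apply Sub.
   * intros v. rewrite !in_app_iff. simpl. tauto.
   * rewrite !length_app in *. simpl in *. lia.
   * intros I. assert (Hz : In y (A ++ x :: x :: l)) by (apply I; rewrite in_app_iff; simpl; auto).
    apply NoDup_remove_2 in NA. apply NA. rewrite !in_app_iff in *. simpl in *. tauto.
 - apply IHP2; [rewrite PA; apply Permutation_app_head; auto|]. apply IHP1; auto. }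
intros s P. apply (G f s P []); auto.
Qed.

(** The cocycle [u] of [U] detects the boundary of the cell. Correcting the primitive on [U] by the
    multiple [c] of it removes the obstruction to extending over the cell. *)
Lemma Hv_attach_cell (U : list V -> Prop) f n u : closed U -> NoDup f -> length f = S (S n) ->
 (forall s, incl s f -> ~ incl f s -> U s) ->
 (forall s, U s -> length s = S (S n) -> D u s = 0%R) -> D u f <> 0%R ->
 Hv U (S n) -> Hv (fun s => U s \/ incl s f) (S n).
Proof.
intros CU N Lf Pf Hu Nu HU. apply Hv_union_ext; auto using incl_closed, Hv_simplex.
intros h Hh. set (c := (D h f / D u f)%R). exists (fun s => c * u s)%R.
assert (Z : forall s, incl s f -> length s = S (S n) -> D (fun s => h s - c * u s)%R s = 0%R).
{ assert (Z1 : forall s, incl s f -> ~ incl f s -> length s = length f -> D (fun s => h s - c * u s)%R s = 0%R).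
 { intros s I Ni L. rewrite (D_sub h (fun s => c * u s)%R), (D_scal c u), Hh, Hu; auto; try lia; try lra. }
 intros s I L. destruct (classic (incl f s)) as [I'|Ni]; [|apply Z1; auto; lia].
 apply (D_perm_zero _ f); auto.
 - rewrite (D_sub h (fun s => c * u s)%R), (D_scal c u). unfold c. field. auto.
 - apply NoDup_Permutation_bis; auto. lia. }
destruct (Hv_simplex f n (fun s => h s - c * u s)%R Z) as [c0 Hc0].
exists c0. split.
- intros s Us L. rewrite (D_scal c u), Hu by auto. ring.
- intros s Us I L. rewrite Hc0 by auto. ring.
Qed.

(** The cohomology in the dimension of the cells vanishes when their boundaries are linearly
    independent; this is asked in triangular form, by cochains that vanish on the boundaries of all
    earlier cells. *)
Lemma Hv_cells F0 fs n : (forall f, In f F0 -> length f <= S n) ->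
 (forall f, In f fs -> NoDup f /\ length f = S (S n) /\ forall s, incl s f -> ~ incl f s -> fc F0 s) ->
 (forall fs1 f fs2, fs = fs1 ++ f :: fs2 ->
  exists u, alt u /\ (forall f', In f' fs1 -> D u f' = 0%R) /\ D u f <> 0%R) ->
 Hv (fc (F0 ++ fs)) (S n).
Proof.
intros H0. induction fs as [|f fs IH] using rev_ind; intros H1 H2.
- rewrite app_nil_r. apply Hv_dim; auto.
- destruct (H2 fs f []) as (u & Au & Uz & Uf); auto.
 destruct (H1 f) as (N & Lf & Pf); [apply in_or_app; right; left; auto|].
 apply Hv_ext with (P := fun s => fc (F0 ++ fs) s \/ incl s f).
 + intros s. rewrite app_assoc, (fc_app (F0 ++ fs)). split; (intros [H|H]; [left; auto|right]).
  * exists f. split; auto. left; auto.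
  * destruct H as (g & [<-|[]] & H). auto.
 + apply (Hv_attach_cell _ f n u); auto using fc_closed.
  * intros s I Ni. apply fc_app. left. auto.
  * intros s Hs L. destruct (classic (NoDup s)) as [Ns|Ns]; [|apply D_alt_dup; auto].
   destruct Hs as (g & Hg & I). pose proof (NoDup_incl_length Ns I) as Lg.
   apply in_app_or in Hg as [Hg|Hg]; [apply H0 in Hg; lia|].
   destruct (H1 g) as (Ng & Lg' & _); [apply in_or_app; auto|].
   apply (alt_zero_perm (D u) (D_alt u Au) g); auto. symmetry. apply NoDup_Permutation_bis; auto. lia.
  * apply IH.
   -- intros g Hg. apply H1, in_or_app; auto.
   -- intros fs1 g fs2 ->. apply (H2 fs1 g (fs2 ++ [f])). rewrite <- app_assoc. auto.
Qed.
End Cells.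

(** * The orientation-reversing tube *)

(* The vertices [(q, l)], [q <= n], are those of the fibre over the [l]-th vertex of a triangle;
  the fibre over the third vertex is the initial one with vertices 1 and 2 exchanged. *)
Definition tau (q : nat) : nat := match q with 1 => 2 | 2 => 1 | _ => q end.
Lemma tau_spec q : q = 1%nat /\ tau q = 2 \/ q = 2 /\ tau q = 1%nat \/ q <> 1%nat /\ q <> 2 /\ tau q = q.
Proof. destruct q as [|[|[|q]]]; simpl; lia. Qed.
Definition shift (q l : nat) : nat * nat := match l with 3 => (tau q, 0) | _ => (q, l) end.
Lemma shift_spec q l : l <= 2 -> fst (shift q (S l)) = (if l =? 2 then tau q else q) /\
 snd (shift q (S l)) = (if l =? 2 then 0 else S l).
Proof. intros H. destruct l as [|[|[|l]]]; simpl; auto; lia. Qed.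

Section Tube.
Variable n : nat.
Hypothesis Hn : 4 <= n.

Definition ne (k q : nat) : bool := negb (q =? k).
Definition lower (l j : nat) (om : nat -> bool) : list (nat * nat) := map (fun q => shift q (S l)) (filter om (seq 0 j)).
Definition upper (l j : nat) (om : nat -> bool) : list (nat * nat) := map (fun q => (q, l)) (filter om (seq j (S n - j))).
(** The fibre on its way from [l] to [l + 1]: the positions below [j] have moved, the others have
    not. [om] selects the positions that are kept. *)
Definition stage (l j : nat) (om : nat -> bool) : list (nat * nat) := lower l j om ++ upper l j om.
(** The usual subdivision of a prism has one simplex for each [j], in which position [j] occurs at
    both ends. Here the fibre is only the boundary of a simplex, so a further position [k] is
    omitted. *)
Definition cell (l j k : nat) : list (nat * nat) :=
 lower l j (ne k) ++ (j, l) :: shift j (S l) :: upper l (S j) (ne k).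

Lemma in_lower v l j om : In v (lower l j om) <-> exists q, q < j /\ om q = true /\ v = shift q (S l).
Proof.
unfold lower. rewrite in_map_iff. split.
- intros (q & <- & H). apply filter_In in H as [H E]. apply in_seq in H. exists q. repeat split; auto; lia.
- intros (q & H & E & ->). exists q. split; auto. apply filter_In. rewrite in_seq. split; auto; lia.
Qed.
Lemma in_upper v l j om : In v (upper l j om) <-> exists q, j <= q <= n /\ om q = true /\ v = (q, l).
Proof.
unfold upper. rewrite in_map_iff. split.
- intros (q & <- & H). apply filter_In in H as [H E]. apply in_seq in H. exists q. repeat split; auto; lia.
- intros (q & H & E & ->). exists q. split; auto. apply filter_In. rewrite in_seq. split; auto; lia.
Qed.
Lemma ne_true k q : ne k q = true <-> q <> k.
Proof. unfold ne. rewrite negb_true_iff, Nat.eqb_neq. tauto. Qed.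
Lemma in_stage v l j om : In v (stage l j om) <->
 (exists q, q < j /\ om q = true /\ v = shift q (S l)) \/ exists q, j <= q <= n /\ om q = true /\ v = (q, l).
Proof. unfold stage. rewrite in_app_iff, in_lower, in_upper. tauto. Qed.
Lemma in_cell v l j k : j <= n -> k <> j -> In v (cell l j k) <->
 (exists q, q <= j /\ q <> k /\ v = shift q (S l)) \/ exists q, j <= q <= n /\ q <> k /\ v = (q, l).
Proof.
intros Hj Hk. unfold cell. rewrite in_app_iff. simpl. rewrite in_lower, in_upper. split.
- intros [(q & H & E & ->)|[<-|[<-|(q & H & E & ->)]]]; try apply ne_true in E.
 + left. exists q. repeat split; auto; lia.
 + right. exists j. repeat split; auto; lia.
 + left. exists j. repeat split; auto; lia.
 + right. exists q. repeat split; auto; lia.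
- intros [(q & H & E & ->)|(q & H & E & ->)]; (destruct (Nat.eq_dec q j) as [->|N]; [tauto|]).
 + left. exists q. rewrite ne_true. repeat split; auto; lia.
 + right; right; right. exists q. rewrite ne_true. repeat split; auto; lia.
Qed.

Lemma stage_S l j om : om j = true -> j <= n ->
 stage l (S j) om = lower l j om ++ shift j (S l) :: upper l (S j) om /\
 stage l j om = lower l j om ++ (j, l) :: upper l (S j) om.
Proof.
intros E Hj. unfold stage, lower, upper. rewrite seq_S, filter_app, map_app, <- app_assoc.
replace (S n - j) with (S (n - j)) by lia. replace (S n - S j) with (n - j) by lia.
cbn [seq filter plus]. rewrite E. auto.
Qed.

Ltac pairs := repeat match goal with H : (_, _) = (_, _) |- _ => injection H; clear H; intros; subst end.
Ltac cases l := destruct l as [|[|[|l]]]; [| | |lia].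
Ltac taus := repeat match goal with
 | H : context [tau ?q] |- _ => let t := fresh "t" in pose proof (tau_spec q); set (t := tau q) in *; clearbody t
 | |- context [tau ?q] => let t := fresh "t" in pose proof (tau_spec q); set (t := tau q) in *; clearbody t end.
Ltac grind := simpl in *; taus; pairs; try lia; try congruence.

Lemma cell_nodup l j k : l <= 2 -> j <= n -> NoDup (cell l j k).
Proof.
intros Hl Hj. unfold cell.
assert (NL : NoDup (lower l j (ne k) ++ [shift j (S l)])).
{ assert (E : lower l j (ne k) ++ [shift j (S l)] = map (fun q => shift q (S l)) (filter (ne k) (seq 0 j) ++ [j])).
 { rewrite map_app. auto. }
 rewrite E. apply NoDup_map_NoDup_ForallPairs.
 - intros a b _ _ Eab. cases l; grind.
 - apply NoDup_Add with (a := j) (l := filter (ne k) (seq 0 j)).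
  + pose proof (Add_app j (filter (ne k) (seq 0 j)) []) as H. rewrite app_nil_r in H. auto.
  + split; [apply NoDup_filter, seq_NoDup|]. intros H. apply filter_In in H as [H _]. apply in_seq in H. lia. }
assert (NU : NoDup ((j, l) :: upper l (S j) (ne k))).
{ constructor.
 - intros H. apply in_upper in H as (q & H & _ & E). injection E as E. lia.
 - apply NoDup_map_NoDup_ForallPairs; [intros a b _ _ E; injection E; auto|apply NoDup_filter, seq_NoDup]. }
assert (PP : Permutation ((lower l j (ne k) ++ [shift j (S l)]) ++ ((j, l) :: upper l (S j) (ne k)))
 (lower l j (ne k) ++ (j, l) :: shift j (S l) :: upper l (S j) (ne k))).
{ rewrite <- app_assoc. apply Permutation_app_head. simpl. constructor. }
apply (Permutation_NoDup PP). apply NoDup_app; auto.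
intros v Hv Hu.
assert (E1 : snd v = if l =? 2 then 0 else S l).
{ apply in_app_or in Hv as [Hv|[<-|[]]]; [apply in_lower in Hv as (q & _ & _ & ->)|]; apply shift_spec; auto. }
assert (E2 : snd v = l) by (destruct Hu as [<-|Hu]; auto; apply in_upper in Hu as (q & _ & _ & ->); auto).
destruct (Nat.eqb_spec l 2); lia.
Qed.
Lemma filter_ne_length k a len : length (filter (ne k) (seq a len)) = if (a <=? k) && (k <? a + len) then len - 1 else len.
Proof.
revert a. induction len as [|len IH]; intros a; simpl.
- destruct (Nat.leb_spec a k), (Nat.ltb_spec k (a + 0)); simpl; lia.
- unfold ne at 1. destruct (Nat.eqb_spec a k); simpl; rewrite IH; destruct (Nat.leb_spec (S a) k), (Nat.leb_spec a k),
  (Nat.ltb_spec k (S a + len)), (Nat.ltb_spec k (a + S len)); simpl; lia.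
Qed.
Lemma cell_length l j k : j <= n -> k <= n -> k <> j -> length (cell l j k) = S n.
Proof.
intros Hj Hk N. unfold cell, lower, upper. rewrite length_app, length_map, filter_ne_length. simpl.
rewrite length_map, filter_ne_length.
destruct (Nat.ltb_spec k j), (Nat.leb_spec (S j) k), (Nat.ltb_spec k (S j + (n - j))); cbn [andb]; lia.
Qed.

Definition valid_cell (i : nat * nat * nat) : Prop :=
 let '(l, j, k) := i in l <= 2 /\ j <= n /\ k <= n /\ k <> j.
(** The cells are ordered around the tube, then along the prism, and for equal [l] and [j <> 0] the
    one omitting 0 comes last. For other omissions only their being different matters. *)
Definition earlier (i' i : nat * nat * nat) : Prop :=
 let '(l', j', k') := i' in let '(l, j, k) := i in
 l' < l \/ l' = l /\ (j' < j \/ j' = j /\ k' <> k /\ (j <> 0 -> k' <> 0)).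
Definition cellof (i : nat * nat * nat) : list (nat * nat) := let '(l, j, k) := i in cell l j k.

Lemma private_start l k l' j' k' : valid_cell (l, 0, k) -> valid_cell (l', j', k') -> earlier (l', j', k') (l, 0, k) ->
 ~ incl (shift 0 (S l) :: upper l 1 (ne k)) (cell l' j' k').
Proof.
intros (Hl & _ & Hk & Nk) (Hl' & Hj' & Hk' & Nk') Ea I.
assert (IU : forall q, 1 <= q <= n -> q <> k -> In (q, l) (cell l' j' k')).
{ intros q Hq Nq. apply I. right. apply in_upper. exists q. rewrite ne_true. auto. }
destruct Ea as [Ea|(-> & [Ea|(-> & Ne & _)])]; [|lia|].
- assert (Iy := I _ (or_introl eq_refl)). apply in_cell in Iy; auto.
 assert (Eq : exists q, 1 <= q <= n /\ q <> k) by (destruct (Nat.eq_dec k 1); [exists 2|exists 1%nat]; lia).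
 destruct Eq as (q0 & Hq0 & Nq0). assert (Iq := IU q0 Hq0 Nq0). apply in_cell in Iq; auto.
 destruct Iy as [(q & H1 & H2 & E)|(q & H1 & H2 & E)], Iq as [(p & H3 & H4 & E')|(p & H3 & H4 & E')];
  cases l; cases l'; grind.
- assert (Iq := IU k' ltac:(lia) ltac:(lia)). apply in_cell in Iq; auto.
 destruct Iq as [(p & H3 & H4 & E')|(p & H3 & H4 & E')]; cases l; grind.
Qed.

Lemma private_edge l j k l' j' k' : valid_cell (l, j, k) -> j <> 0 -> k <> 0 -> valid_cell (l', j', k') ->
 earlier (l', j', k') (l, j, k) ->
 ~ incl (map (fun q => shift q (S l)) (filter (ne k) (seq 1 (j - 1))) ++ (j, l) :: shift j (S l) :: upper l (S j) (ne k)) (cell l' j' k').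
Proof.
intros (Hl & Hj & Hk & Nk) Nj N0 (Hl' & Hj' & Hk' & Nk') Ea I.
assert (Ix : In (j, l) (cell l' j' k')) by (apply I, in_or_app; right; left; auto).
assert (Iy : In (shift j (S l)) (cell l' j' k')) by (apply I, in_or_app; right; right; left; auto).
apply in_cell in Ix, Iy; auto.
assert (Em : l' = l /\ j' = j).
{ destruct Ix as [(q & H1 & H2 & E)|(q & H1 & H2 & E)], Iy as [(p & H3 & H4 & E')|(p & H3 & H4 & E')];
  cases l; cases l'; grind. }
destruct Em as [-> ->]. destruct Ea as [|(_ & [|(_ & Ne & Nk0)])]; [lia|lia|].
assert (Iz : (exists q, q < j /\ q = k' /\ In (shift q (S l)) (cell l j k')) \/ (j < k' /\ In (k', l) (cell l j k'))).
{ destruct (Nat.lt_total k' j) as [L|[L|L]]; [left|lia|right].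
 - exists k'. repeat split; auto. apply I, in_or_app; left. apply (in_map (fun q => shift q (S l))), filter_In.
  rewrite ne_true, in_seq. specialize (Nk0 Nj). split; auto; lia.
 - split; auto. apply I, in_or_app; right; right; right. apply in_upper. exists k'. rewrite ne_true. repeat split; auto; lia. }
destruct Iz as [(q0 & Hq0 & -> & Iz)|(L & Iz)]; apply in_cell in Iz; auto;
 destruct Iz as [(p & H3 & H4 & E')|(p & H3 & H4 & E')]; clear I Ix Iy; cases l; grind.
Qed.

Lemma private_end l j l' j' k' : valid_cell (l, j, 0) -> ~ (l = 2 /\ j = n) -> valid_cell (l', j', k') ->
 earlier (l', j', k') (l, j, 0) -> ~ incl (lower l j (ne 0) ++ shift j (S l) :: upper l (S j) (ne 0)) (cell l' j' k').
Proof.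
intros (Hl & Hj & _ & Nj) NL (Hl' & Hj' & Hk' & Nk') Ea I.
assert (Iy : In (shift j (S l)) (cell l' j' k')) by (apply I, in_or_app; right; left; auto).
apply in_cell in Iy; auto.
destruct Ea as [Ea|(-> & [Ea|(-> & Ne & Nk0)])].
- assert (Iz : l = 2 -> In (n, l) (cell l' j' k')).
 { intros ->. apply I, in_or_app; right; right. apply in_upper. exists n. rewrite ne_true. repeat split; auto; lia. }
 clear I. destruct Iy as [(q & H1 & H2 & E)|(q & H1 & H2 & E)]; cases l; cases l'; grind;
  specialize (Iz eq_refl); apply in_cell in Iz; auto; destruct Iz as [(p & H3 & H4 & E')|(p & H3 & H4 & E')]; grind.
- destruct Iy as [(q & H1 & H2 & E)|(q & H1 & H2 & E)]; clear I; cases l; grind.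
- assert (Iz : (k' < j /\ In (shift k' (S l)) (cell l j k')) \/ (j < k' /\ In (k', l) (cell l j k'))).
 { destruct (Nat.lt_total k' j) as [L|[L|L]]; [left|lia|right]; split; auto; apply I, in_or_app.
  - left. apply in_lower. exists k'. rewrite ne_true. split; auto.
  - right; right. apply in_upper. exists k'. rewrite ne_true. repeat split; auto; lia. }
 clear I Iy. destruct Iz as [(L & Iz)|(L & Iz)]; apply in_cell in Iz; auto;
  destruct Iz as [(p & H3 & H4 & E')|(p & H3 & H4 & E')]; cases l; grind.
Qed.

(** The dual of a face contained in no earlier cell separates the cell from its predecessors. For
    [j = 0] this face drops the unmoved vertex, for [j <> 0] and [k = 0] it is the face after the
    move, otherwise it drops the moved vertex of position 0. The last cell is excepted, since there
    the tube closes up. *)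
Lemma private_face l j k : valid_cell (l, j, k) -> ~ (l = 2 /\ j = n /\ k = 0) ->
 exists A z B, cell l j k = A ++ z :: B /\
  forall i', valid_cell i' -> earlier i' (l, j, k) -> ~ incl (A ++ B) (cellof i').
Proof.
intros Hv Nl. destruct (Nat.eq_dec j 0) as [->|Nj]; [|destruct (Nat.eq_dec k 0) as [->|Nk]].
- exists [], (0, l), (shift 0 (S l) :: upper l 1 (ne k)). split; auto.
 intros [[l' j'] k'] Hv' Ea. apply private_start; auto.
- exists (lower l j (ne 0)), (j, l), (shift j (S l) :: upper l (S j) (ne 0)). split; auto.
 intros [[l' j'] k'] Hv' Ea. apply private_end; auto. tauto.
- exists [], (shift 0 (S l)),
  (map (fun q => shift q (S l)) (filter (ne k) (seq 1 (j - 1))) ++ (j, l) :: shift j (S l) :: upper l (S j) (ne k)).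
 split.
 + unfold cell, lower. replace j with (S (j - 1)) at 1 by lia. simpl seq. simpl filter.
  replace (ne k 0) with true by (symmetry; apply ne_true; auto). auto.
 + intros [[l' j'] k'] Hv' Ea. apply private_edge; auto.
Qed.

(** Early and late stages are the places of the face omitting position 0 on its way round the tube;
    they become late once the exchange of 1 and 2 affects them. From then on moved vertices are
    ranked by their position before the exchange. [stage 2 1] is left out because, without position
    0, it equals [stage 2 0]. *)
Definition early_stage (f : list (nat * nat)) : Prop :=
 (exists l j, l <= 1 /\ j <= n /\ f = stage l j (ne 0)) \/ f = stage 2 0 (ne 0).
Definition late_stage (f : list (nat * nat)) : Prop := exists j, 2 <= j <= n /\ f = stage 2 j (ne 0).
Definition late_rank (v : nat * nat) : nat := if snd v =? 0 then tau (fst v) else fst v.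
(** An orientation of that face, carried along. A cell with [k = 0] compares two consecutive places
    and gives 0, except the last one: there the face has returned with reversed orientation, and 1
    is compared with -1. This expresses the nonorientability of the tube. *)
Definition transport (s : list (nat * nat)) : R := (orient fst early_stage s + orient late_rank late_stage s)%R.

Lemma transport_alt : alt transport.
Proof.
intros l1 x y l2. unfold transport. rewrite (orient_alt fst early_stage l1), (orient_alt late_rank late_stage l1). lra.
Qed.
Lemma transport_out s : (forall f, early_stage f \/ late_stage f -> ~ same s f) -> transport s = 0%R.
Proof. intros H. unfold transport. rewrite !orient_out by (intros f Hf; apply H; auto). lra. Qed.
Lemma stage_form f : early_stage f \/ late_stage f -> exists l j, l <= 2 /\ j <= n /\ f = stage l j (ne 0).
Proof.
intros [[(l & j & Hl & Hj & ->)| ->]|(j & Hj & ->)].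
- exists l, j. auto.
- exists 2, 0. repeat split; auto; lia.
- exists 2, j. repeat split; auto; lia.
Qed.
Lemma stage_has l j k : l <= 2 -> 1 <= k <= n -> (k < j /\ In (shift k (S l)) (stage l j (ne 0))) \/ (j <= k /\ In (k, l) (stage l j (ne 0))).
Proof.
intros Hl Hk. rewrite !in_stage. destruct (le_lt_dec j k); [right|left]; split; auto; [right|left]; exists k;
 rewrite ne_true; repeat split; auto; lia.
Qed.
Lemma stage_edge l j l' j' : l <= 2 -> 1 <= j <= n -> l' <= 2 -> j' <= n ->
 In (j, l) (stage l' j' (ne 0)) -> In (shift j (S l)) (stage l' j' (ne 0)) -> False.
Proof.
intros Hl Hj Hl' Hj' I1 I2. apply in_stage in I1, I2.
destruct I1 as [(q & H1 & H2 & E)|(q & H1 & H2 & E)], I2 as [(p & H3 & H4 & E')|(p & H3 & H4 & E')];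
 cases l; cases l'; grind.
Qed.
Lemma stage_cell l j k f : valid_cell (l, j, k) -> k <> 0 -> early_stage f \/ late_stage f -> ~ incl f (cell l j k).
Proof.
intros (Hl & Hj & Hk & Nk) N0 Hf I.
assert (HI : forall v, In v f -> (exists q, q <= j /\ q <> k /\ v = shift q (S l)) \/ exists q, j <= q <= n /\ q <> k /\ v = (q, l)).
{ intros v Hv. apply in_cell, I, Hv; auto. }
clear I. destruct (stage_form f Hf) as (l' & j' & Hl' & Hj' & ->).
assert (A1 := stage_has l' j' 1 Hl' ltac:(lia)). assert (A2 := stage_has l' j' n Hl' ltac:(lia)).
assert (A3 := stage_has l' j' k Hl' ltac:(lia)). assert (A4 := stage_has l' j' (tau k) Hl' ltac:(pose proof (tau_spec k); lia)).
destruct A1 as [[L1 A1]|[L1 A1]], A2 as [[L2 A2]|[L2 A2]], A3 as [[L3 A3]|[L3 A3]], A4 as [[L4 A4]|[L4 A4]];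
 apply HI in A1, A2, A3, A4; clear HI Hf;
 destruct A3 as [(q & H1 & H2 & E)|(q & H1 & H2 & E)]; (cases l; cases l'; grind);
 destruct A4 as [(r & H7 & H8 & E3)|(r & H7 & H8 & E3)]; grind;
 destruct A2 as [(p & H3 & H4 & E')|(p & H3 & H4 & E')]; grind;
 destruct A1 as [(p' & H3' & H4' & E'')|(p' & H3' & H4' & E'')]; grind.
Qed.

Lemma positions j : j <= S n -> filter (ne 0) (seq 0 j) ++ filter (ne 0) (seq j (S n - j)) = seq 1 n.
Proof.
intros Hj. rewrite <- filter_app. replace (seq j (S n - j)) with (seq (0 + j) (S n - j)) by auto.
rewrite <- seq_app. replace (j + (S n - j)) with (S n) by lia. simpl. apply forallb_filter_id.
apply forallb_forall. intros x Hx. apply in_seq in Hx. apply ne_true. lia.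
Qed.
Lemma early_value l j : l <= 1 -> j <= n -> transport (stage l j (ne 0)) = 1%R.
Proof.
intros Hl Hj. unfold transport.
assert (E : early_stage (stage l j (ne 0))) by (left; exists l, j; auto).
rewrite (orient_in fst early_stage _ _ E) by (intros v; tauto).
rewrite orient_out.
- replace (map fst (stage l j (ne 0))) with (seq 1 n); [rewrite sg_sorted; lra|].
 rewrite <- (positions j) by lia. unfold stage, lower, upper. rewrite map_app, !map_map. f_equal.
 + rewrite <- (map_id (filter _ (seq 0 j))) at 1. apply map_ext. intros q. destruct l as [|[|l]]; auto; lia.
 + rewrite map_id. auto.
- intros f (j' & Hj' & ->) S. destruct (stage_has 2 j' 1 ltac:(lia) ltac:(lia)) as [[L1 A1]|[L1 A1]]; [|lia].
 destruct (stage_has 2 j' n ltac:(lia) ltac:(lia)) as [[L2 A2]|[L2 A2]]; [lia|].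
 apply S, in_stage in A1, A2.
 destruct A1 as [(q & H1 & H2 & E1)|(q & H1 & H2 & E1)], A2 as [(p & H3 & H4 & E2)|(p & H3 & H4 & E2)];
  destruct l as [|[|l]]; grind.
Qed.
Lemma late_value j : 2 <= j <= n -> transport (stage 2 j (ne 0)) = 1%R.
Proof.
intros Hj. unfold transport.
assert (E : late_stage (stage 2 j (ne 0))) by (exists j; auto).
rewrite (orient_in late_rank late_stage _ _ E) by (intros v; tauto).
rewrite orient_out.
- replace (map late_rank (stage 2 j (ne 0))) with (seq 1 n); [rewrite sg_sorted; lra|].
 rewrite <- (positions j) by lia. unfold stage, lower, upper. rewrite map_app, !map_map. f_equal.
 + rewrite <- (map_id (filter _ (seq 0 j))) at 1. apply map_ext. intros q. unfold late_rank. simpl. grind.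
 + rewrite map_ext with (g := fun q => q); [rewrite map_id; auto|]. auto.
- intros f Hf S. destruct (stage_has 2 j 1 ltac:(lia) ltac:(lia)) as [[L1 A1]|[L1 A1]]; [|lia].
 destruct (stage_has 2 j n ltac:(lia) ltac:(lia)) as [[L2 A2]|[L2 A2]]; [lia|].
 apply S in A1, A2. destruct Hf as [(l & j' & Hl & Hj' & ->)| ->]; apply in_stage in A1, A2;
 destruct A1 as [(q & H1 & H2 & E1)|(q & H1 & H2 & E1)], A2 as [(p & H3 & H4 & E2)|(p & H3 & H4 & E2)];
  try destruct l as [|[|l]]; grind.
Qed.
Lemma stage_turn l : l <= 1 -> stage l (S n) (ne 0) = stage (S l) 0 (ne 0).
Proof.
intros Hl. replace (stage (S l) 0 (ne 0)) with (map (fun q => (q, S l)) (filter (ne 0) (seq 0 (S n))))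
 by (unfold stage, lower, upper; rewrite Nat.sub_0_r; reflexivity).
unfold stage, lower, upper. rewrite Nat.sub_diag. change (filter (ne 0) (seq (S n) 0)) with (@nil nat).
rewrite app_nil_r.
apply map_ext. intros q. destruct l as [|[|l]]; auto; lia.
Qed.
Lemma stage_first l : stage l 1 (ne 0) = stage l 0 (ne 0).
Proof. unfold stage, lower, upper. simpl. rewrite Nat.sub_0_r. auto. Qed.
Lemma mid_value : transport (stage 2 0 (ne 0)) = 1%R.
Proof.
unfold transport. assert (E : early_stage (stage 2 0 (ne 0))) by (right; auto).
rewrite (orient_in fst early_stage _ _ E) by (intros v; tauto).
rewrite orient_out.
- replace (map fst (stage 2 0 (ne 0))) with (seq 1 n); [rewrite sg_sorted; lra|].
 rewrite <- (positions 0) by lia. unfold stage, lower, upper. simpl. rewrite map_map, map_id. auto.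
- intros f (j' & Hj' & ->) S. destruct (stage_has 2 j' 1 ltac:(lia) ltac:(lia)) as [[L1 A1]|[L1 A1]]; [|lia].
 apply S, in_stage in A1. destruct A1 as [(q & H1 & H2 & E1)|(q & H1 & H2 & E1)]; grind.
Qed.
Lemma stage_value l j : l <= 2 -> j <= n -> transport (stage l j (ne 0)) = 1%R.
Proof.
intros Hl Hj. destruct (Nat.eq_dec l 2) as [->|]; [|apply early_value; lia].
destruct j as [|[|j]]; [apply mid_value|rewrite stage_first; apply mid_value|apply late_value; lia].
Qed.
(** The last stage has the vertices of the very first one, in the order with 1 and 2 exchanged. *)
Lemma last_value : transport (stage 2 (S n) (ne 0)) = (-1)%R.
Proof.
unfold transport. assert (E : early_stage (stage 0 0 (ne 0))) by (left; exists 0, 0; repeat split; auto; lia).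
assert (Es : stage 2 (S n) (ne 0) = map (fun q => (tau q, 0)) (seq 1 n)).
{ pose proof (positions (S n) (le_n _)) as Pz. rewrite Nat.sub_diag, app_nil_r in Pz. unfold stage, upper. rewrite Nat.sub_diag, app_nil_r.
 unfold lower. rewrite Pz. auto. }
rewrite (orient_in fst early_stage _ _ E).
- rewrite orient_out.
 + rewrite Es, map_map. simpl (fun q => fst (tau q, 0)).
  replace (map (fun x => tau x) (seq 1 n)) with ([] ++ 2 :: 1%nat :: seq 3 (n - 2)).
  * rewrite sg_alt. change ([] ++ 1%nat :: 2 :: seq 3 (n - 2)) with (seq 1 (S (S (n - 2)))). rewrite sg_sorted. lra.
  * replace n with (S (S (n - 2))) at 2 by lia. simpl. do 2 f_equal. rewrite <- (map_id (seq 3 _)) at 1.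
   apply map_ext_in. intros q Hq. apply in_seq in Hq. grind.
 + intros f (j' & Hj' & ->) S. destruct (stage_has 2 j' n ltac:(lia) ltac:(lia)) as [[L2 A2]|[L2 A2]]; [lia|].
  apply S in A2. rewrite Es in A2. apply in_map_iff in A2 as (q & H1 & H2). grind.
- intros v. rewrite Es, in_map_iff, in_stage. split.
 + intros (q & <- & Hq). apply in_seq in Hq. right. exists (tau q). rewrite ne_true. pose proof (tau_spec q). repeat split; auto; lia.
 + intros [(q & H & _)|(q & H & Nq & ->)]; [lia|]. apply ne_true in Nq. exists (tau q). rewrite in_seq.
  pose proof (tau_spec q). pose proof (tau_spec (tau q)). split; [f_equal; lia|lia].
Qed.

Lemma transport_cell l j k : valid_cell (l, j, k) -> (l, j, k) <> (2, n, 0) -> D transport (cell l j k) = 0%R.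
Proof.
intros Hv Nl. destruct (Nat.eq_dec k 0) as [->|Nk].
- destruct Hv as (Hl & Hj & _ & Nj).
 assert (O : forall s, In (j, l) s -> In (shift j (S l)) s -> transport s = 0%R).
 { intros s I1 I2. apply transport_out. intros f Hf E. destruct (stage_form f Hf) as (l' & j' & Hl' & Hj' & ->).
  apply (stage_edge l j l' j'); auto; [lia| |]; apply E; auto. }
 unfold cell. rewrite D_two.
 + destruct (stage_S l j (ne 0)) as [E1 E2]; [apply ne_true; auto|auto|]. rewrite <- E1, <- E2, (stage_value l j) by auto.
  replace (transport (stage l (S j) (ne 0))) with 1%R; [ring|]. symmetry.
  destruct (Nat.eq_dec j n) as [->|]; [|apply stage_value; auto; lia].
  assert (l <> 2) by congruence. rewrite stage_turn by lia. apply stage_value; lia.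
 + intros a z b _. apply O; rewrite !in_app_iff; simpl; auto.
 + intros a z b _. apply O; rewrite !in_app_iff; simpl; auto.
- apply D_zero. intros t I _. apply transport_out. intros f Hf E. apply (stage_cell l j k f Hv Nk Hf).
 intros v Hw. apply I, E, Hw.
Qed.
Lemma transport_last : D transport (cell 2 n 0) <> 0%R.
Proof.
assert (O : forall s, In (n, 2) s -> In (shift n 3) s -> transport s = 0%R).
{ intros s I1 I2. apply transport_out. intros f Hf E. destruct (stage_form f Hf) as (l' & j' & Hl' & Hj' & ->).
 apply (stage_edge 2 n l' j'); auto; [lia| |]; apply E; auto. }
unfold cell. rewrite D_two.
- destruct (stage_S 2 n (ne 0)) as [E1 E2]; [apply ne_true; lia|auto|]. rewrite <- E1, <- E2, last_value, stage_value by lia.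
 apply Rmult_integral_contrapositive. split; [apply pow_nonzero|]; lra.
- intros a z b _. apply O; rewrite !in_app_iff; simpl; auto.
- intros a z b _. apply O; rewrite !in_app_iff; simpl; auto.
Qed.

(** * The list of all cells in the order of attachment *)

Definition omissions (j : nat) : list nat := if j =? 0 then seq 1 n else filter (ne j) (seq 1 n) ++ [0].
Definition indices : list (nat * nat * nat) :=
 flat_map (fun l => flat_map (fun j => map (fun k => (l, j, k)) (omissions j)) (seq 0 (S n))) (seq 0 3).

Lemma ss_app {A : Type} (R : A -> A -> Prop) l1 l2 : StronglySorted R l1 -> StronglySorted R l2 ->
 (forall x y, In x l1 -> In y l2 -> R x y) -> StronglySorted R (l1 ++ l2).
Proof.
intros H1 H2 H. induction H1 as [|x l1 H1 IH F]; simpl; auto. constructor.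
- apply IH. intros; apply H; simpl; auto.
- apply Forall_app. split; auto. apply Forall_forall. intros y Hy. apply H; simpl; auto.
Qed.
Lemma ss_flat {A : Type} (R : A -> A -> Prop) (f : nat -> list A) a len :
 (forall x, StronglySorted R (f x)) -> (forall x y u v, x < y -> In u (f x) -> In v (f y) -> R u v) ->
 StronglySorted R (flat_map f (seq a len)).
Proof.
intros H1 H2. revert a. induction len as [|len IH]; intros a; simpl; [constructor|].
apply ss_app; auto. intros u v Hu Hv. apply in_flat_map in Hv as (y & Hy & Hv). apply in_seq in Hy.
apply (H2 a y); auto; lia.
Qed.
Lemma ss_map_seq {A : Type} (R : A -> A -> Prop) (f : nat -> A) (om : nat -> bool) a len :
 (forall x y, a <= x < y -> R (f x) (f y)) -> StronglySorted R (map f (filter om (seq a len))).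
Proof.
revert a. induction len as [|len IH]; intros a H; simpl; [constructor|].
assert (S : StronglySorted R (map f (filter om (seq (S a) len)))) by (apply IH; intros; apply H; lia).
destruct (om a); auto. simpl. constructor; auto. apply Forall_forall. intros y Hy.
apply in_map_iff in Hy as (x & <- & Hx). apply filter_In in Hx as [Hx _]. apply in_seq in Hx. apply H. lia.
Qed.
Lemma indices_sorted : StronglySorted earlier indices.
Proof.
apply ss_flat.
- intros l. apply ss_flat.
 + intros j. unfold omissions. destruct (Nat.eqb_spec j 0) as [->|Nj].
  * rewrite <- (forallb_filter_id (fun _ => true) (seq 1 n)) by (apply forallb_forall; auto).
   apply ss_map_seq. intros x y H. right. split; auto. right. repeat split; auto; lia.
  * rewrite map_app. apply ss_app.
   -- apply ss_map_seq. intros x y H. right. split; auto. right. repeat split; auto; lia.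
   -- repeat constructor.
   -- intros u v Hu [<-|[]]. apply in_map_iff in Hu as (x & <- & Hx). apply filter_In in Hx as [Hx _]. apply in_seq in Hx.
     right. split; auto. right. repeat split; auto; lia.
 + intros x y u v Hxy Hu Hv. apply in_map_iff in Hu as (k & <- & _), Hv as (k' & <- & _). right. auto.
- intros x y u v Hxy Hu Hv. apply in_flat_map in Hu as (j & _ & Hu), Hv as (j' & _ & Hv).
 apply in_map_iff in Hu as (k & <- & _), Hv as (k' & <- & _). left. auto.
Qed.
Lemma in_indices i : In i indices <-> valid_cell i.
Proof.
destruct i as [[l j] k]. unfold indices, valid_cell. rewrite in_flat_map. split.
- intros (l' & Hl & H). apply in_flat_map in H as (j' & Hj & H). apply in_map_iff in H as (k' & E & H).
 injection E as -> -> ->. apply in_seq in Hl, Hj. unfold omissions in H. destruct (Nat.eqb_spec j 0) as [->|Nj].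
 + apply in_seq in H. lia.
 + apply in_app_or in H as [H|[<-|[]]]; [|lia]. apply filter_In in H as [H E]. apply in_seq in H. apply ne_true in E. lia.
- intros (Hl & Hj & Hk & Nk). exists l. split; [apply in_seq; lia|]. apply in_flat_map. exists j. split; [apply in_seq; lia|].
 apply in_map. unfold omissions. destruct (Nat.eqb_spec j 0) as [->|Nj]; [apply in_seq; lia|]. apply in_or_app.
 destruct k; [right; left; auto|left]. apply filter_In. rewrite in_seq, ne_true. lia.
Qed.
Lemma ss_split {A : Type} (R : A -> A -> Prop) l1 x l2 : StronglySorted R (l1 ++ x :: l2) -> forall y, In y l1 -> R y x.
Proof.
induction l1 as [|z l1 IH]; intros H y Hy; [destruct Hy|]. inversion H as [|? ? H1 H2]; subst.
destruct Hy as [<-|Hy]; [|auto]. rewrite Forall_forall in H2. apply H2, in_or_app. right; left; auto.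
Qed.

Theorem tube_dual l1 i l2 : indices = l1 ++ i :: l2 ->
 exists u, alt u /\ (forall i', In i' l1 -> D u (cellof i') = 0%R) /\ D u (cellof i) <> 0%R.
Proof.
intros E. pose proof indices_sorted as S. rewrite E in S.
assert (Ea : forall i', In i' l1 -> earlier i' i /\ valid_cell i').
{ intros i' Hi'. split; [apply (ss_split _ _ _ _ S i' Hi')|]. apply in_indices. rewrite E. apply in_or_app; auto. }
assert (Hi : valid_cell i) by (apply in_indices; rewrite E; apply in_or_app; right; left; auto).
destruct i as [[l j] k]. simpl cellof. destruct (classic (l = 2 /\ j = n /\ k = 0)) as [(-> & -> & ->)|N].
- exists transport. split; [apply transport_alt|]. split; [|apply transport_last].
 intros [[l' j'] k'] Hi'. destruct (Ea _ Hi') as [H Hv']. apply transport_cell; auto.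
 intros Eq. injection Eq as -> -> ->. simpl in H. lia.
- destruct (private_face l j k Hi N) as (A & z & B & Ec & H). exists (face_dual (A ++ B)).
 split; [apply orient_alt|]. split.
 + intros i' Hi'. apply face_dual_D_out. destruct (Ea _ Hi'). apply H; auto.
 + rewrite Ec. apply face_dual_D. rewrite <- Ec. apply cell_nodup; apply Hi.
Qed.

Lemma tube_Hv {V : Type} (wv : nat * nat -> V) (pv : V -> nat * nat) (F : list (list V)) :
 (forall x, pv (wv x) = x) -> (forall f, In f F -> length f <= n) ->
 Hv (fc (F ++ map (map wv) (map cellof indices))) n.
Proof.
intros Ip HF. set (cs := map (map wv) (map cellof indices)).
assert (Hc : forall f, In f cs -> NoDup f /\ length f = S n).
{ intros f Hf. apply in_map_iff in Hf as (c & <- & Hc). apply in_map_iff in Hc as ([[l j] k] & <- & Hi).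
 apply in_indices in Hi. destruct Hi as (Hl & Hj & Hk & Nk). split.
 - apply NoDup_map_NoDup_ForallPairs; [|apply cell_nodup; auto]. intros a b _ _ E. rewrite <- (Ip a), E. auto.
 - rewrite length_map. apply cell_length; auto. }
destruct n as [|n'] eqn:En; [lia|].
(* The proper faces of the cells are added as facets, so that each cell is attached along its entire
   boundary. *)
apply Hv_ext with (P := fc ((F ++ flat_map (faces (S n')) cs) ++ cs)).
{ intros s. rewrite <- app_assoc, !fc_app. split; [|tauto]. intros [H|[(t & Ht & I)|H]]; auto. right.
 apply in_flat_map in Ht as (f & Hf & Ht). apply filter_In in Ht as [Ht _]. exists f. split; auto.
 eapply incl_tran; [exact I|apply sublists_incl; auto]. }
apply Hv_cells.
- intros f Hf. apply in_app_or in Hf as [Hf|Hf]; auto. apply in_flat_map in Hf as (g & _ & Hf).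
 apply filter_In in Hf as [_ Hf]. apply andb_true_iff in Hf as [_ Hf]. apply Nat.leb_le in Hf. auto.
- intros f Hf. destruct (Hc f Hf) as [Nf Lf]. split; auto. split; auto.
 assert (G : forall s, s <> [] -> incl s f -> ~ incl f s -> fc (F ++ flat_map (faces (S n')) cs) s).
 { intros s Ns I Ni. apply fc_app. right. destruct (sublists_exists f s) as (t & Ht & Nt & E).
  exists t. split; [|intros v Hv; apply E; auto]. apply in_flat_map. exists f. split; auto.
  apply filter_In. split; auto. apply andb_true_iff. split.
  - apply Nat.ltb_lt. destruct s as [|v s]; [congruence|]. destruct t; [|simpl; lia].
   destruct (proj2 (E v)). split; [left; auto|apply I; left; auto].
  - apply Nat.leb_le. destruct (le_lt_dec (length t) (S n')) as [|L]; auto. exfalso. apply Ni.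
   intros v Hv. apply (E v). apply (NoDup_length_incl Nt (l' := f)); auto; [lia|]. intros w Hw. apply E, Hw. }
 intros s I Ni. destruct s as [|v s]; [|apply G; auto; easy].
 destruct f as [|x [|y f]]; simpl in Lf; try lia.
 eapply fc_closed; [apply (G [x])|]; [easy|intros w [<-|[]]; left; auto| |intros w []].
 intros I'. inversion Nf as [|? ? Nx _]; subst. destruct (I' y) as [<-|[]]; [right; left; auto|]. apply Nx; left; auto.
- intros fs1 f fs2 E. unfold cs in E. rewrite map_map in E. apply map_eq_app in E as (l1 & l2 & Ei & E1 & E2).
 destruct l2 as [|i l2]; [easy|]. injection E2 as E2 _. rewrite <- En in *.
 destruct (tube_dual l1 i l2 Ei) as (u & Au & Uz & Ui). exists (fun s => u (map pv s)).
 assert (Em : forall c, map pv (map wv c) = c) by (intros c; rewrite map_map, (map_ext _ (fun x => x)), map_id; auto).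
 split; [|split].
 + intros a x y b. rewrite !map_app. apply Au.
 + intros f' Hf'. rewrite <- E1 in Hf'. apply in_map_iff in Hf' as (i' & <- & Hi'). rewrite <- (D_map pv u), Em. auto.
 + rewrite <- E2, <- (D_map pv u), Em. auto.
Qed.
End Tube.

Lemma D_bounded {V I : Type} (a : I -> list V -> R) s :
 (forall t, incl t s -> S (length t) = length s -> exists B, forall i, (Rabs (a i t) <= B)%R) ->
 exists B, forall i, (Rabs (D (a i) s) <= B)%R.
Proof.
revert a. induction s as [|x s IH]; intros a H; simpl.
- exists 0%R. intros _. rewrite Rabs_R0. lra.
- destruct (H s) as [B1 H1]; [apply incl_tl, incl_refl|auto|].
 destruct (IH (fun i l => a i (x :: l))) as [B2 H2].
 + intros t I0 L. apply H; [|simpl; auto]. intros y [<-|Hy]; [left|right]; auto.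
 + exists (B1 + B2)%R. intros i. specialize (H1 i). specialize (H2 i).
  pose proof (Rabs_triang (a i s) (- D (fun l => a i (x :: l)) s)). rewrite Rabs_Ropp in H0.
  unfold Rminus. lra.
Qed.

(** * The tube attached to a complex of dimension two along a loop *)

Section TubeOn.
Context {V : Type} (n : nat) (Hn : 4 <= n) (X : list V -> Prop) (wv : nat * nat -> V) (pv : V -> nat * nat) (rho : V -> V).
Hypotheses (CX : closed X) (Small : forall s, X s -> exists t, length t <= 3 /\ incl s t)
 (Ip : forall x, pv (wv x) = x) (Loop : forall l, l <= 2 -> X [wv (0, l); wv (shift 0 (S l))])
 (Fresh : forall s v, X s -> In v s -> rho v = v /\ forall k l, 1 <= k -> v <> wv (k, l))
 (Rw : forall k l, rho (wv (k, l)) = wv (0, l)).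
Let o := wv (0, 0).
Definition tube_facets : list (list V) := map (map wv) (map (cellof n) (indices n)).
Definition Tb (s : list V) : Prop := X s \/ fc tube_facets s.

Definition in_prism (l j : nat) (v : nat * nat) : Prop :=
 (exists q, q <= j /\ v = shift q (S l)) \/ exists q, j <= q <= n /\ v = (q, l).
Lemma wv_inj x y : wv x = wv y -> x = y.
Proof. intros E. rewrite <- (Ip x), E. auto. Qed.
Lemma Tb_closed : closed Tb.
Proof. apply or_closed; auto using fc_closed. Qed.
Lemma cell_Tb l j k s : valid_cell n (l, j, k) -> incl s (cell n l j k) -> Tb (map wv s).
Proof.
intros Hv I. right. exists (map wv (cell n l j k)). split; [|apply incl_map, I].
apply in_map. apply (in_map (cellof n) _ (l, j, k)). apply in_indices; auto.
Qed.
Lemma cell_prism l j k v : valid_cell n (l, j, k) -> In v (cell n l j k) -> in_prism l j v.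
Proof.
intros (Hl & Hj & Hk & Nk) H. apply in_cell in H; auto.
destruct H as [(q & H1 & H2 & ->)|(q & H1 & H2 & ->)]; [left|right]; eauto.
Qed.
(** In a prism, the doubled position [j] and the positions of three vertices have to be kept;
    [4 <= n] leaves a fifth position to omit. So all triangles within a prism are present. *)
Lemma avoid (ps : list nat) : length ps <= 4 -> exists k, k <= n /\ ~ In k ps.
Proof.
intros L. apply NNPP. intros N. assert (I : incl (seq 0 5) ps).
{ intros k Hk. apply in_seq in Hk. apply NNPP. intros Nk. apply N. exists k. split; auto. lia. }
apply NoDup_incl_length in I; [|apply seq_NoDup]. rewrite length_seq in I. lia.
Qed.
Lemma prism_Tb l j s : l <= 2 -> j <= n -> (forall v, In v s -> in_prism l j v) -> length s <= 3 -> Tb (map wv s).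
Proof.
intros Hl Hj H L.
assert (E : exists ps, length ps = length s /\ forall v, In v s -> exists q, In q ps /\
 (q <= j /\ v = shift q (S l) \/ j <= q <= n /\ v = (q, l))).
{ clear L. induction s as [|v s IH]; [exists []; split; auto; intros v []|].
 destruct IH as (ps & L & IH); [intros w Hw; apply H; right; auto|].
 assert (Ev : exists q, q <= j /\ v = shift q (S l) \/ j <= q <= n /\ v = (q, l)).
 { destruct (H v (or_introl eq_refl)) as [(q & H1 & H2)|(q & H1 & H2)]; exists q; auto. }
 destruct Ev as (q & Eq). exists (q :: ps). split; [simpl; auto|]. intros w [<-|Hw]; [exists q; split; auto; left; auto|].
 destruct (IH w Hw) as (q' & Hq' & E). exists q'. split; auto. right; auto. }
destruct E as (ps & Lp & E). destruct (avoid (j :: ps)) as (k & Hk & Nk); [simpl; lia|].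
assert (k <> j) by (intros ->; apply Nk; left; auto).
apply (cell_Tb l j k); [repeat split; auto|]. intros v Hv. apply in_cell; auto.
destruct (E v Hv) as (q & Hq & [[H1 ->]|[H1 ->]]); [left|right]; exists q; repeat split; auto; try lia;
 intros ->; apply Nk; right; auto.
Qed.
Lemma Tb_cases s : Tb s -> X s \/ exists l j k t, valid_cell n (l, j, k) /\ s = map wv t /\ incl t (cell n l j k).
Proof.
intros [H|(f & Hf & I)]; auto. right. apply in_map_iff in Hf as (c & <- & Hc).
apply in_map_iff in Hc as ([[l j] k] & <- & Hi). apply (in_indices n Hn) in Hi. exists l, j, k, (map pv s).
assert (E : s = map wv (map pv s)).
{ rewrite map_map, <- (map_id s) at 1. apply map_ext_in. intros v Hv. apply I in Hv.
 apply in_map_iff in Hv as (x & <- & _). rewrite Ip. auto. }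
split; auto. split; auto. intros x Hx. rewrite E in I. assert (Hw : In (wv x) (map wv (cell n l j k))) by (apply I, in_map, Hx).
apply in_map_iff in Hw as (y & Ey & Hy). apply wv_inj in Ey. congruence.
Qed.
Lemma apex l j : in_prism l j (shift 0 (S l)).
Proof. left. exists 0. split; auto. lia. Qed.

Lemma Tb_linked : (forall v, X [v] -> linked X o v) -> forall v, Tb [v] -> linked Tb o v.
Proof.
intros Lk v Hv.
assert (LX : forall v, X [v] -> linked Tb o v).
{ intros w Hw. specialize (Lk w Hw). clear -Lk. induction Lk; [constructor|]. econstructor; eauto. left; auto. }
destruct (Tb_cases _ Hv) as [H|(l & j & k & t & Hi & E & I)]; auto.
destruct t as [|x [|]]; try easy. injection E as ->. assert (Hx := cell_prism l j k x Hi (I x (or_introl eq_refl))).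
destruct Hi as (Hl & Hj & _). econstructor; [apply (LX (wv (shift 0 (S l))))|].
- eapply CX; [apply (Loop l Hl)|]. intros y [<-|[]]. right; left; auto.
- apply (prism_Tb l j [shift 0 (S l); x]); auto. intros y [<-|[<-|[]]]; auto using apex.
Qed.

(** Each vertex of a prism is joined to the core vertex at the far end of that prism, and all
    triangles with this apex are present; the potential is extended from the core along these
    edges. *)
Lemma Tb_trivial (M : group) (l : V -> V -> M) h0 : flat_lab Tb l -> trivializes X l h0 -> exists h, trivializes Tb l h.
Proof.
intros Fl T0.
assert (Tri : forall a j x y z, a <= 2 -> j <= n -> in_prism a j x -> in_prism a j y -> in_prism a j z ->
 l (wv x) (wv y) ** l (wv y) (wv z) = l (wv x) (wv z)).
{ intros a j x y z Ha Hj Hx Hy Hz. apply Fl, (prism_Tb a j [x; y; z]); auto.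
 intros w [<-|[<-|[<-|[]]]]; auto. }
assert (Rf : forall a j x, a <= 2 -> j <= n -> in_prism a j x -> l (wv x) (wv x) = 1).
{ intros a j x Ha Hj Hx. apply (gcancel_l (l (wv x) (wv x))). rewrite gone_r. eapply Tri; eauto. }
set (fresh := fun v => exists k a, 1 <= k /\ a <= 2 /\ v = wv (k, a)).
set (h := fun v => if em (fresh v) then h0 (wv (0, snd (pv v))) ** l (wv (0, snd (pv v))) v else h0 v).
assert (HX : forall s v, X s -> In v s -> h v = h0 v).
{ intros s v Hs Hv. unfold h. destruct (em (fresh v)) as [(k & a & Hk & _ & E)|]; auto.
 destruct (proj2 (Fresh s v Hs Hv) k a Hk E). }
assert (HF : forall k a, 1 <= k -> a <= 2 -> h (wv (k, a)) = h0 (wv (0, a)) ** l (wv (0, a)) (wv (k, a))).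
{ intros k a Hk Ha. unfold h. destruct (em _) as [_|N]; [rewrite Ip; auto|].
 destruct N. exists k, a. auto. }
assert (Sh : forall a, a <= 2 -> exists b, b <= 2 /\ shift 0 (S a) = (0, b) /\ forall q, exists q', shift q (S a) = (q', b) /\ (q' = 0 -> q = 0)).
{ intros a Ha. destruct a as [|[|[|a]]]; [| | |lia]; eexists; (split; [|split; [reflexivity|]]; [lia|]); intros q; eexists; (split; [reflexivity|]).
 - auto.
 - auto.
 - pose proof (tau_spec q). lia. }
assert (HT : forall a j x, a <= 2 -> j <= n -> in_prism a j x ->
 h (wv x) = h0 (wv (shift 0 (S a))) ** l (wv (shift 0 (S a))) (wv x)).
{ intros a j x Ha Hj Hx. destruct (Sh a Ha) as (b & Hb & Eb & Hq). pose proof (Loop a Ha) as La.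
 destruct Hx as [(q & H1 & ->)|(q & H1 & ->)].
 - destruct (Hq q) as (q' & Eq & Z). rewrite Eq, Eb. destruct q' as [|q'].
  + rewrite (HX _ (wv (0, b)) La) by (rewrite Eb; simpl; auto).
   rewrite (Rf a j (0, b)) by (auto; rewrite <- Eb; apply apex). gsimp. auto.
  + apply HF; auto; lia.
 - assert (E0 : h0 (wv (0, a)) = h0 (wv (shift 0 (S a))) ** l (wv (shift 0 (S a))) (wv (0, a))).
  { rewrite (T0 (wv (shift 0 (S a))) (wv (0, a))).
   - gsimp. auto.
   - eapply CX; [exact La|]. subset. }
  destruct q as [|q].
  + rewrite (HX _ _ La) by (simpl; auto). exact E0.
  + rewrite HF, E0, gassoc by lia. f_equal. apply (Tri a 0); try apply apex; try lia; right; eexists; (split; [|reflexivity]); lia. }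
exists h. intros u v Huv. destruct (Tb_cases _ Huv) as [H|(a & j & k & t & Hi & E & I)].
- rewrite !(HX _ _ H) by (simpl; auto). apply T0, H.
- destruct t as [|x [|y [|]]]; try easy. injection E as -> ->.
 assert (Hx := cell_prism a j k x Hi (I x (or_introl eq_refl))).
 assert (Hy := cell_prism a j k y Hi (I y (or_intror (or_introl eq_refl)))).
 destruct Hi as (Ha & Hj & _). rewrite (HT a j x), (HT a j y) by auto.
 rewrite ginvM. gsimp. rewrite <- (Tri a j (shift 0 (S a)) x y) by auto using apex. gsimp. auto.
Qed.

(** [rho] projects the tube to its core, and every cell goes to an edge of the loop. *)
Lemma Tb_label (M : group) (l : V -> V -> M) : flat_lab X l -> flat_lab Tb (fun u v => l (rho u) (rho v)).
Proof.
intros Fl u v w H. destruct (Tb_cases _ H) as [HX|(a & j & k & t & Hi & E & I)].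
- rewrite !(fun x Hx => proj1 (Fresh _ x HX Hx)) by (simpl; auto). apply Fl, HX.
- destruct t as [|x [|y [|z [|]]]]; try easy. injection E as -> -> ->.
 assert (R : forall q, In q (cell n a j k) -> rho (wv q) = wv (0, a) \/ rho (wv q) = wv (shift 0 (S a))).
 { intros q Hq. destruct (cell_prism a j k q Hi Hq) as [(p & _ & ->)|(p & _ & ->)]; [right|left; apply Rw].
  destruct Hi as (Ha & _). destruct a as [|[|[|a]]]; [| | |lia]; simpl; rewrite Rw; auto. }
 apply Fl. eapply CX; [apply (Loop a); apply Hi|].
 intros q [<-|[<-|[<-|[]]]]; simpl.
 + destruct (R x) as [->| ->]; auto. apply I; left; auto.
 + destruct (R y) as [->| ->]; auto. apply I; right; left; auto.
 + destruct (R z) as [->| ->]; auto. apply I; right; right; left; auto.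
Qed.

Section Twisted.
Context (enc : V -> nat) (L : list (list V)) (M : group) (l : V -> V -> M).
Hypotheses (Inj : forall x y, enc x = enc y -> x = y) (NL : forall s, In s L -> s <> [])
 (HP : forall s, s <> [] -> ((exists t, In t L /\ forall v, In v s <-> In v t) <-> Tb s))
 (Fl : flat_lab X l) (Lu : forall u, l u u = 1) (L01 : l (wv (0, 0)) (wv (0, 1%nat)) = 1).
Let K := cx enc o L.
Notation de := (dec enc o).
Let lK (a b : nat) : M := l (rho (de a)) (rho (de b)).
Let wK (x : nat * nat) : nat := enc (wv x).
Let g : M := l (wv (0, 0)) (wv (0, 1%nat)) ** (l (wv (0, 1%nat)) (wv (0, 2)) ** l (wv (0, 2)) (wv (0, 0))).
Hypothesis Inf : infinite_order g.

Lemma Tb_o : Tb [o].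
Proof. left. eapply CX; [apply (Loop 0); lia|]. intros y [<-|[]]. left; auto. Qed.
Lemma K_wf : wf_complex K.
Proof. apply (cx_wf enc o L Tb); auto using Tb_closed, Tb_o. Qed.
Lemma K_flat : flat_lab (PK K) lK.
Proof. apply (label_cx enc o L Tb Inj Tb_closed Tb_o HP M (fun u v => l (rho u) (rho v))), Tb_label, Fl. Qed.
Lemma K_simplex t : t <> [] -> Tb (map wv t) -> is_simplex K (map wK t).
Proof.
intros N H. unfold wK. rewrite <- map_map. apply (cx_enc enc o L Tb Inj Tb_closed Tb_o HP); auto.
destruct t; [congruence|easy].
Qed.
Lemma de_wK x : de (wK x) = wv x.
Proof. exact (dec_enc enc o Inj (wv x)). Qed.
Lemma lK_w x y : lK (wK x) (wK y) = l (wv (0, snd x)) (wv (0, snd y)).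
Proof. unfold lK. rewrite !de_wK. destruct x, y. rewrite !Rw. auto. Qed.

(** The bounded function [(-1)^k] at the points [g^k], [k >= 0], of the line covering the loop, and
    0 elsewhere. The tube reverses signs, so up to a sign a primitive has to solve
    [Z (k + 1) + Z k = (-1)^k], which forces linear growth. *)
Definition parity (h : M) : R :=
 if em (exists k, h = gpow g (2 * k)) then 1%R
 else if em (exists k, h = gpow g (2 * k + 1)) then (-1)%R else 0%R.
Lemma parity_pow k : parity (gpow g k) = ((-1) ^ k)%R.
Proof.
pose proof (Nat.div_mod k 2 ltac:(lia)) as E. pose proof (Nat.mod_upper_bound k 2 ltac:(lia)) as B.
unfold parity. destruct (em _) as [[q Eq]|N].
- apply infinite_order_inj in Eq; auto. rewrite Eq, pow_1_even. auto.
- destruct (em _) as [[q Eq]|N'].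
 + apply infinite_order_inj in Eq; auto. rewrite Eq, Nat.add_1_r, pow_1_odd. auto.
 + destruct (Nat.eq_dec (k mod 2) 0); [destruct N|destruct N']; exists (k / 2); f_equal; lia.
Qed.
Lemma parity_bdd h : (Rabs (parity h) <= 1)%R.
Proof.
unfold parity. destruct (em _); [|destruct (em _)];
 rewrite ?Rabs_Ropp, ?Rabs_R1, ?Rabs_R0; try lra. replace (-1)%R with (- (1))%R by lra. rewrite Rabs_Ropp, Rabs_R1. lra.
Qed.

Let top := map wv (cell n 0 0 n).
(** [top] lies over the first edge of the loop, whose label is normalised to 1; so all paths to the
    vertices of one lift within it have the same label, and the weight is well defined on that
    lift. *)
Definition tcoc : cochain := fun q s => (parity (wp lK q) * face_dual top (map de s))%R.

Lemma valid_top : valid_cell n (0, 0, n).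
Proof. repeat split; lia. Qed.
Lemma top_nodup : NoDup top /\ length top = S n.
Proof.
split; [|unfold top; rewrite length_map; apply cell_length; lia].
apply NoDup_map_NoDup_ForallPairs; [intros a b _ _; apply wv_inj|]. apply cell_nodup; lia.
Qed.
Lemma top_max t : Tb t -> incl top t -> incl t top.
Proof.
intros H I. destruct top_nodup as [N Lt]. destruct H as [H|(f & Hf & J)].
- destruct (Small t H) as (t' & L' & J). exfalso.
 assert (incl top t') by (eapply incl_tran; eauto). apply NoDup_incl_length in H0; auto. lia.
- eapply incl_tran; [exact J|]. apply NoDup_length_incl; auto; [|eapply incl_tran; eauto].
 apply in_map_iff in Hf as (c & <- & Hc). apply in_map_iff in Hc as ([[l' j] k] & <- & Hi).
 apply (in_indices n Hn) in Hi. destruct Hi as (Hl & Hj & Hk & Nk).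
 rewrite Lt, length_map. simpl. rewrite cell_length by auto. lia.
Qed.
Lemma top_rho v : In v top -> rho v = wv (0, 0) \/ rho v = wv (0, 1%nat).
Proof.
intros H. apply in_map_iff in H as (x & <- & H). destruct (cell_prism 0 0 n x valid_top H) as [(q & _ & ->)|(q & _ & ->)];
 simpl; rewrite Rw; auto.
Qed.
Lemma l_01 u v : (u = wv (0, 0) \/ u = wv (0, 1%nat)) -> (v = wv (0, 0) \/ v = wv (0, 1%nat)) -> l u v = 1.
Proof.
intros [->| ->] [->| ->]; auto. pose proof (flat_sym X l CX Fl _ _ (Loop 0 (Nat.le_0_l 2))) as E. simpl in E. rewrite E, L01. apply ginv1.
Qed.

Lemma tcoc_bcochain : bcochain K n tcoc.
Proof.
split.
- intros q q' s _ _ E. unfold tcoc. rewrite (wp_htp K lK K_flat (fun u => Lu _) q q' E). auto.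
- intros s _. exists (Rabs (face_dual top (map de s))). intros q _. unfold tcoc. rewrite Rabs_mult.
 pose proof (parity_bdd (wp lK q)). pose proof (Rabs_pos (face_dual top (map de s))). nra.
Qed.
Lemma tcoc_closed q s : lift_ok K (S n) q s -> cobdry tcoc q s = 0%R.
Proof.
intros [[Ls Hs] Hq]. destruct s as [|x [|y s]]; try easy.
assert (Yt : Tb (map de (x :: y :: s))) by (apply (cx_simplex enc o L Tb Inj Tb_closed Tb_o HP), Hs).
rewrite cobdry_D. cbn [hd]. simpl in Hq.
assert (Lt : length (map de (x :: y :: s)) = S (S n)) by (rewrite length_map; auto).
destruct top_nodup as [N Ltop].
destruct (classic (incl (map de (x :: y :: s)) top)) as [I|Ni].
- unfold tcoc at 1. rewrite (wp_snoc K K_wf lK (base K) x y q Hq).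
 assert (E1 : lK x y = 1) by (apply l_01; apply top_rho, I; simpl; auto).
 rewrite E1, gone_r.
 rewrite (D_ext (fun l0 => tcoc q (x :: l0)) (fun l0 => parity (wp lK q) * face_dual top (de x :: map de l0))%R) by reflexivity.
 rewrite (D_scal (parity (wp lK q)) (fun l0 => face_dual top (de x :: map de l0))).
 rewrite <- (D_map de (fun l0 => face_dual top (de x :: l0))). rewrite <- Rmult_minus_distr_l.
 change (parity (wp lK q) * D (face_dual top) (map de (x :: y :: s)) = 0)%R.
 rewrite D_alt_dup; [ring|apply orient_alt|]. intros Nd. apply NoDup_incl_length in I; auto. lia.
- assert (Z : forall t, incl t (map de (x :: y :: s)) -> face_dual top t = 0%R).
 { intros t It. apply face_dual_out. intros E. apply Ni, top_max; auto. intros v Hv. apply It, E, Hv. }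
 unfold tcoc at 1. rewrite Z by (simpl; apply incl_tl, incl_refl). rewrite D_zero; [ring|].
 intros t It _. unfold tcoc. rewrite Z; [ring|]. apply incl_map. intros z [<-|Hz]; [left|right]; auto.
Qed.

Section Filling.
Context (b : cochain) (Wb : cochain_wd K (n - 1) b)
 (Hb : forall q s, lift_ok K n q s -> cobdry b q s = tcoc q s).
Definition lift (q : list nat) (t : list (nat * nat)) : R :=
 match t with [] => 0%R | x :: _ => b (q ++ [wK x]) (map wK t) end.

Lemma prism_htp a j x y z : a <= 2 -> j <= n -> in_prism a j x -> in_prism a j y -> in_prism a j z ->
 htp K [wK x; wK y; wK z] [wK x; wK z].
Proof.
intros Ha Hj Hx Hy Hz. apply htp_mid, (K_simplex [x; y; z]); [easy|]. apply (prism_Tb a j); auto.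
intros v [<-|[<-|[<-|[]]]]; auto.
Qed.
Lemma prism_edge a j x y : a <= 2 -> j <= n -> in_prism a j x -> in_prism a j y -> is_simplex K [wK x; wK y].
Proof.
intros Ha Hj Hx Hy. apply (K_simplex [x; y]); [easy|]. apply (prism_Tb a j); auto.
intros v [<-|[<-|[]]]; auto.
Qed.
Lemma skip a j x y z q : a <= 2 -> j <= n -> in_prism a j x -> in_prism a j y -> in_prism a j z ->
 edge_path K (base K) (wK x) q -> htp K (q ++ [wK y; wK z]) (q ++ [wK z]).
Proof.
intros Ha Hj Hx Hy Hz Hq. destruct (ep_end K K_wf _ _ _ Hq) as [_ [t ->]]. rewrite <- !app_assoc. simpl.
rewrite (prism_htp a j x y z) by auto. reflexivity.
Qed.

Lemma lift_D a j x q t : a <= 2 -> j <= n -> in_prism a j x -> edge_path K (base K) (wK x) q ->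
 (forall v, In v t -> in_prism a j v) -> Tb (map wv t) -> length t = S n ->
 D (lift q) t = tcoc (q ++ [wK (hd (0, 0) t)]) (map wK t).
Proof.
intros Ha Hj Hx Hq Ht Pt Lt. destruct t as [|y [|z t]]; simpl in Lt; try lia.
assert (Hy := Ht y (or_introl eq_refl)). assert (Hz := Ht z (or_intror (or_introl eq_refl))).
assert (Ey : edge_path K (base K) (wK y) (q ++ [wK y])) by (eapply ep_snoc; eauto using prism_edge).
assert (Ez : edge_path K (base K) (wK z) (q ++ [wK z])) by (eapply ep_snoc; eauto using prism_edge).
rewrite <- Hb.
- cbn [map hd]. rewrite cobdry_D. cbn [hd].
 change (D (lift q) (y :: z :: t)) with (lift q (z :: t) - D (fun l0 => lift q (y :: l0)) (z :: t))%R.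
 change (wK z :: map wK t) with (map wK (z :: t)).
 rewrite (D_map wK (fun l0 => b (q ++ [wK y]) (wK y :: l0)) (z :: t)). f_equal.
 simpl lift. symmetry.
 assert (Oz : ord_simplex K (n - 1) (map wK (z :: t))).
 { split; [rewrite length_map; simpl in *; lia|]. apply K_simplex; [easy|].
  apply (Tb_closed (map wv (y :: z :: t))); auto. apply incl_tl, incl_refl. }
 apply Wb; [split; auto; eapply ep_snoc; eauto using prism_edge|split; auto|].
 rewrite <- app_assoc. apply (skip a j x y z); auto.
- split; [split; [rewrite length_map; auto|apply K_simplex; auto; easy]|exact Ey].
Qed.
Definition all (q : nat) : bool := true.

(** The edge from [(0, 0)] to [(0, 1)] occurs only in cells with [l = j = 0], so the cocycle is 0 on
    all others. *)
Lemma top_edge l' j' k' : valid_cell n (l', j', k') -> (l', j') <> (0, 0) -> exists v, In v (cell n 0 0 n) /\ ~ In v (cell n l' j' k').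
Proof.
intros (Hl & Hj & Hk & Nk) N.
assert (T1 : In (0, 0) (cell n 0 0 n)) by (apply in_cell; try lia; right; exists 0; repeat split; lia).
assert (T2 : In (0, 1%nat) (cell n 0 0 n)) by (apply in_cell; try lia; left; exists 0; repeat split; lia).
apply NNPP. intros H.
assert (I1 : In (0, 0) (cell n l' j' k')) by (apply NNPP; intros H'; apply H; eauto).
assert (I2 : In (0, 1%nat) (cell n l' j' k')) by (apply NNPP; intros H'; apply H; eauto).
apply in_cell in I1, I2; auto. apply N.
destruct I1 as [(q & H1 & H2 & E)|(q & H1 & H2 & E)], I2 as [(p & H3 & H4 & E')|(p & H3 & H4 & E')];
 destruct l' as [|[|[|l']]]; try lia; simpl in *; repeat match goal with H : (_, _) = (_, _) |- _ => injection H; clear H; intros end;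
 try easy; pose proof (tau_spec q); pose proof (tau_spec p); f_equal; lia.
Qed.

Lemma cell_zero a j x q k t : a <= 2 -> j <= n -> in_prism a j x -> edge_path K (base K) (wK x) q ->
 valid_cell n (a, j, k) -> length t = S n -> incl t (cell n a j k) ->
 (exists v, In v (cell n 0 0 n) /\ ~ In v (cell n a j k)) -> D (lift q) t = 0%R.
Proof.
intros Ha Hj Hx Hq Hc Lt I (v & Hv & Nv).
rewrite (lift_D a j x); auto; [|intros w Hw; apply (cell_prism a j k); auto|apply (cell_Tb a j k); auto].
unfold tcoc. rewrite face_dual_out; [ring|]. intros E. apply Nv, I.
assert (Hw : In (wv v) (map de (map wK t))) by (apply E, in_map, Hv).
rewrite map_map in Hw. apply in_map_iff in Hw as (w & Ew & Hw). rewrite de_wK in Ew. apply wv_inj in Ew. congruence.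
Qed.

Lemma lower_length a j : length (lower a j all) = j.
Proof. unfold lower. rewrite length_map, forallb_filter_id, length_seq; auto. apply forallb_forall; auto. Qed.
Lemma upper_length a j : length (upper n a j all) = S n - j.
Proof. unfold upper. rewrite length_map, forallb_filter_id, length_seq; auto. apply forallb_forall; auto. Qed.
Lemma shift_inj a q q' : shift q (S a) = shift q' (S a) -> q = q'.
Proof.
intros E. destruct a as [|[|[|a]]]; simpl in E; injection E; intros; auto.
pose proof (tau_spec q); pose proof (tau_spec q'); lia.
Qed.
Lemma part_nodup a j : NoDup (lower a j all) /\ NoDup (upper n a j all).
Proof.
split; (apply NoDup_map_NoDup_ForallPairs; [|apply NoDup_filter, seq_NoDup]); intros p p' _ _ E.
- eapply shift_inj; eauto.
- injection E; auto.
Qed.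
Lemma removed {A : Type} (k : list A) z m : NoDup (k ++ z :: m) -> forall v, In v (k ++ m) -> v <> z.
Proof. intros N v Hv ->. apply NoDup_remove_2 in N. auto. Qed.

Lemma lower_cell a j k z m : a <= 2 -> j <= n -> lower a j all = k ++ z :: m ->
 exists p, valid_cell n (a, j, p) /\ p < j /\ incl (k ++ m ++ (j, a) :: shift j (S a) :: upper n a (S j) all) (cell n a j p) /\
  length (k ++ m ++ (j, a) :: shift j (S a) :: upper n a (S j) all) = S n.
Proof.
intros Ha Hj E. destruct (part_nodup a j) as [N _]. pose proof (lower_length a j) as Le. rewrite E in N, Le.
assert (Hz : In z (lower a j all)) by (rewrite E; apply in_or_app; right; left; auto).
apply (in_lower n Hn) in Hz as (p & Hp & _ & ->). exists p. split; [repeat split; auto; lia|]. split; auto. split.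
- intros v Hv. rewrite app_assoc in Hv. apply (in_cell n Hn); [auto|lia|]. apply in_app_or in Hv as [Hv|[<-|[<-|Hv]]].
 + pose proof (removed _ _ _ N v Hv) as Nv. assert (Hl : In v (lower a j all)).
  { rewrite E. apply in_app_or in Hv as [Hv|Hv]; apply in_or_app; simpl; auto. }
  apply (in_lower n Hn) in Hl as (p' & Hp' & _ & ->). left. exists p'. repeat split; [lia|congruence].
 + right. exists j. repeat split; lia.
 + left. exists j. repeat split; lia.
 + apply (in_upper n Hn) in Hv as (p' & Hp' & _ & ->). right. exists p'. repeat split; lia.
- rewrite !length_app in *. simpl in *. rewrite upper_length. lia.
Qed.
Lemma upper_cell a j k z m : a <= 2 -> j <= n -> upper n a (S j) all = k ++ z :: m ->
 exists p, valid_cell n (a, j, p) /\ z = (p, a) /\ incl (lower a j all ++ (j, a) :: shift j (S a) :: k ++ m) (cell n a j p) /\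
  length (lower a j all ++ (j, a) :: shift j (S a) :: k ++ m) = S n.
Proof.
intros Ha Hj E. destruct (part_nodup a (S j)) as [_ N]. pose proof (upper_length a (S j)) as Le. rewrite E in N, Le.
assert (Hz : In z (upper n a (S j) all)) by (rewrite E; apply in_or_app; right; left; auto).
apply (in_upper n Hn) in Hz as (p & Hp & _ & ->). exists p. split; [repeat split; auto; lia|]. split; auto. split.
- intros v Hv. apply (in_cell n Hn); [auto|lia|]. apply in_app_or in Hv as [Hv|[<-|[<-|Hv]]].
 + apply (in_lower n Hn) in Hv as (p' & Hp' & _ & ->). left. exists p'. repeat split; lia.
 + right. exists j. repeat split; lia.
 + left. exists j. repeat split; lia.
 + pose proof (removed _ _ _ N v Hv) as Nv. assert (Hl : In v (upper n a (S j) all)).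
  { rewrite E. apply in_app_or in Hv as [Hv|Hv]; apply in_or_app; simpl; auto. }
  apply (in_upper n Hn) in Hl as (p' & Hp' & _ & ->). right. exists p'. repeat split; [lia|lia|congruence].
- rewrite !length_app in *. simpl in *. rewrite length_app, lower_length. lia.
Qed.

Lemma slide1 a j x q : a <= 2 -> j <= n -> (a, j) <> (0, 0) -> in_prism a j x -> edge_path K (base K) (wK x) q ->
 D (lift q) (stage n a (S j) all) = D (lift q) (stage n a j all).
Proof.
intros Ha Hj N Hx Hq. destruct (stage_S n Hn a j all eq_refl Hj) as [-> ->]. apply D_move.
- intros k z m E. destruct (lower_cell a j k z m Ha Hj E) as (p & Hv & _ & I & Le).
 eapply (cell_zero a j x q); eauto using top_edge.
- intros k z m E. destruct (upper_cell a j k z m Ha Hj E) as (p & Hv & _ & I & Le).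
 eapply (cell_zero a j x q); eauto using top_edge.
Qed.
Lemma moves a q : 1 <= a <= 2 -> edge_path K (base K) (wK (shift 0 (S a))) q ->
 D (lift q) (stage n a (S n) all) = D (lift q) (stage n a 0 all).
Proof.
intros Ha Hq. assert (E : forall j, j <= S n -> D (lift q) (stage n a j all) = D (lift q) (stage n a 0 all)).
{ induction j as [|j IH]; intros Hj; auto. rewrite (slide1 a j (shift 0 (S a))), IH; auto; try lia; [|apply apex].
 intros E. injection E; lia. }
apply E. auto.
Qed.
Lemma top_form : cell n 0 0 n = (0, 0) :: (0, 1%nat) :: map (fun p => (p, 0)) (seq 1 (n - 1)).
Proof.
unfold cell, lower, upper. simpl. do 2 f_equal. replace (n - 0) with (S (n - 1)) by lia. rewrite seq_S, filter_app.
replace (1 + (n - 1)) with n by lia. simpl. unfold ne at 2. rewrite Nat.eqb_refl. simpl. rewrite app_nil_r.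
f_equal. apply forallb_filter_id, forallb_forall. intros p Hp. apply in_seq in Hp. apply ne_true. lia.
Qed.
(** The first move crosses the cells with [l = j = 0], of which only the one omitting [n] carries
    the cocycle. It contributes its weight, and the exponent [n - 1] is the place of the omitted
    vertex [(n, 0)] in [l2]. *)
Lemma first_moves q : edge_path K (base K) (wK (0, 1%nat)) q ->
 D (lift q) (stage n 0 (S n) all) = (D (lift q) (stage n 0 0 all) - (-1) ^ (n - 1) * parity (wp lK q))%R.
Proof.
intros Hq.
assert (E : forall j, j <= n -> D (lift q) (stage n 0 (S j) all) = D (lift q) (stage n 0 1 all)).
{ induction j as [|j IH]; intros Hj; auto. rewrite (slide1 0 (S j) (0, 1%nat)), IH; auto; try lia; try easy.
 apply (apex 0). }
rewrite E by lia. destruct (stage_S n Hn 0 0 all eq_refl) as [-> ->]; [lia|]. simpl (lower 0 0 all ++ _).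
simpl (lower 0 0 all). simpl app. set (l2 := upper n 0 1 all).
pose proof (D_D (lift q) ((0, 0) :: shift 0 1 :: l2)) as DD.
change (D (D (lift q)) ((0, 0) :: shift 0 1 :: l2)) with
 (D (lift q) (shift 0 1 :: l2) - (D (lift q) ((0%nat, 0%nat) :: l2) -
  D (fun s => D (lift q) ((0%nat, 0%nat) :: shift 0 1 :: s)) l2))%R in DD.
assert (El : l2 = map (fun p => (p, 0)) (seq 1 (n - 1)) ++ [(n, 0)]).
{ unfold l2, upper. rewrite forallb_filter_id by (apply forallb_forall; auto).
 replace (S n - 1) with (S (n - 1)) by lia. rewrite seq_S, map_app. simpl. do 3 f_equal. lia. }
rewrite El in DD at 3. rewrite D_one in DD.
- rewrite app_nil_r, length_map, length_seq in DD. change (shift 0 1) with (0, 1%nat) in DD. rewrite <- top_form in DD.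
 rewrite (lift_D 0 0 (0, 1%nat) q (cell n 0 0 n)) in DD; auto; try lia.
 + unfold tcoc in DD. rewrite map_map in DD. rewrite (map_ext _ wv de_wK) in DD. fold top in DD.
  rewrite face_dual_self in DD by apply top_nodup. rewrite top_form in DD. simpl hd in DD.
  rewrite (wp_snoc K K_wf lK (base K) _ _ _ Hq), lK_w in DD. simpl snd in DD.
  rewrite (l_01 (wv (0, 1%nat)) (wv (0, 0))), gone_r in DD by auto. lra.
 + apply (apex 0).
 + intros v Hv. apply (cell_prism 0 0 n); auto. apply valid_top.
 + apply (cell_Tb 0 0 n); [apply valid_top|apply incl_refl].
 + apply cell_length; lia.
- intros k z m Ek. destruct (upper_cell 0 0 k z (m ++ [(n, 0)])) as (p & Hv & Ez & I & Le); try lia.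
 { fold l2. rewrite El, Ek, <- app_assoc. auto. }
 change (lower 0 0 all) with (@nil (nat * nat)) in I, Le. simpl app in I, Le.
 apply (cell_zero 0 0 (0, 1%nat) q p); auto; try lia; [apply (apex 0)|].
 exists (p, 0). assert (Hz : In z (map (fun p => (p, 0)) (seq 1 (n - 1)))) by (rewrite Ek; apply in_or_app; right; left; auto).
 apply in_map_iff in Hz as (p' & Ep & Hp'). rewrite Ez in Ep. injection Ep as ->. apply in_seq in Hp'. split.
 + apply in_cell; try lia. right. exists p. repeat split; lia.
 + intros H. apply in_cell in H; try lia. destruct H as [(r & _ & _ & E')|(r & _ & Nr & E')]; [simpl in E'|]; injection E'; intros; subst; try easy; tauto.
- intros k z m Ek. destruct k; easy.
Qed.

Lemma stage_start a v : In v (stage n a 0 all) -> exists p, p <= n /\ v = (p, a).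
Proof. intros Hv. apply (in_stage n Hn) in Hv as [(p & Hp & _)|(p & Hp & _ & ->)]; [lia|]. exists p. split; auto; lia. Qed.
Lemma face_simplex a t : a <= 2 -> incl t (stage n a 0 all) -> length t = n -> ord_simplex K (n - 1) (map wK t).
Proof.
intros Ha I Lt. split; [rewrite length_map; lia|]. apply K_simplex; [destruct t; simpl in *; [lia|easy]|].
assert (Ek : exists k, k <= n /\ ~ In (k, a) t).
{ apply NNPP. intros N. assert (J : incl (map (fun k => (k, a)) (seq 0 (S n))) t).
 { intros v Hv. apply in_map_iff in Hv as (k & <- & Hk). apply in_seq in Hk. apply NNPP. intros Nv. apply N. exists k. split; auto; lia. }
 apply NoDup_incl_length in J; [rewrite length_map, length_seq in J; lia|].
 apply NoDup_map_NoDup_ForallPairs; [intros u v _ _ E; injection E; auto|apply seq_NoDup]. }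
destruct Ek as (k & Hk & Nk). apply (cell_Tb a (if k =? 0 then 1 else 0) k); [destruct (Nat.eqb_spec k 0); repeat split; lia|].
intros v Hv. destruct (stage_start a v (I v Hv)) as (r & Hr & ->). assert (r <> k) by congruence.
destruct (Nat.eqb_spec k 0); apply in_cell; try lia; right; exists r; repeat split; lia.
Qed.

(** Prolonging the path to the next core vertex gives a homotopic path to each vertex of the fibre,
    hence the same lifts. *)
Lemma rebase a q : a <= 2 -> edge_path K (base K) (wK (0, a)) q ->
 edge_path K (base K) (wK (shift 0 (S a))) (q ++ [wK (shift 0 (S a))]) /\
 D (lift (q ++ [wK (shift 0 (S a))])) (stage n a 0 all) = D (lift q) (stage n a 0 all).
Proof.
intros Ha Hq.
assert (H1 : in_prism a 0 (0, a)) by (right; exists 0; split; auto; lia).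
assert (Eq : edge_path K (base K) (wK (shift 0 (S a))) (q ++ [wK (shift 0 (S a))])).
{ eapply ep_snoc; [exact Hq|]. apply (prism_edge a 0); auto; try lia. apply apex. }
split; auto. apply D_ext. intros t I Lt. destruct t as [|x t]; auto. simpl lift.
destruct (stage_start a x (I x (or_introl eq_refl))) as (p & Hp & ->).
assert (Hx : in_prism a 0 (p, a)) by (right; exists p; split; auto; lia).
unfold stage in Lt. rewrite length_app, lower_length, upper_length in Lt. simpl in Lt.
assert (Os := face_simplex a _ Ha I ltac:(simpl in *; lia)).
apply Wb; [split; auto|split; auto|].
- eapply ep_snoc; [exact Eq|]. apply (prism_edge a 0); auto; try lia. apply apex.
- eapply ep_snoc; [exact Hq|]. apply (prism_edge a 0); auto; try lia.
- rewrite <- app_assoc. apply (skip a 0 (0, a)); auto; try lia. apply apex.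
Qed.

Lemma round_zero q t r : edge_path K (base K) (wK (0, 0)) q -> r <= n -> length t = S n ->
 (forall v, In v t -> exists p, p <= n /\ p <> r /\ v = (p, 0)) -> D (lift q) t = 0%R.
Proof.
intros Hq Hr Lt Ht. pose proof (tau_spec r) as Tr.
set (j := if tau r =? n then n - 1 else n).
assert (Hv : valid_cell n (2, j, tau r)) by (unfold j; destruct (Nat.eqb_spec (tau r) n); repeat split; lia).
apply (cell_zero 2 j (0, 0) q (tau r)); auto; try apply Hv.
- apply (apex 2).
- intros v Hw. destruct (Ht v Hw) as (p & Hp & Np & ->). apply (in_cell n Hn); try apply Hv.
 left. exists (tau p). pose proof (tau_spec p). pose proof (tau_spec (tau p)).
 split; [|split; [lia|simpl; f_equal; lia]]. unfold j. destruct (Nat.eqb_spec (tau r) n); lia.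
- apply top_edge; auto. intros E. injection E; intros. lia.
Qed.
(** After a full turn the fibre is the initial one with 1 and 2 exchanged. Tuples that miss a
    position contribute 0, so the transposition just changes the sign. *)
Lemma final_swap q : edge_path K (base K) (wK (0, 0)) q ->
 D (lift q) (stage n 2 (S n) all) = (- D (lift q) (stage n 0 0 all))%R.
Proof.
intros Hq. set (l2 := map (fun p => (p, 0)) (seq 3 (n - 2))).
assert (Fl0 : forall s, filter all s = s) by (intros s; apply forallb_filter_id, forallb_forall; auto).
assert (E1 : stage n 2 (S n) all = [(0, 0)] ++ (2, 0) :: (1%nat, 0) :: l2).
{ unfold stage, lower, upper. rewrite !Fl0, Nat.sub_diag, app_nil_r. unfold l2.
 replace (S n) with (S (S (S (n - 2)))) by lia. simpl. do 3 f_equal. apply map_ext_in. intros p Hp.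
 apply in_seq in Hp. pose proof (tau_spec p). f_equal. lia. }
assert (E2 : stage n 0 0 all = [(0, 0)] ++ (1%nat, 0) :: (2, 0) :: l2).
{ unfold stage, lower, upper. rewrite !Fl0. unfold l2. replace (S n - 0) with (S (S (S (n - 2)))) by lia. reflexivity. }
assert (H2 : forall v, In v l2 -> exists p, 3 <= p <= n /\ v = (p, 0)).
{ intros v Hv. apply in_map_iff in Hv as (p & <- & Hp). apply in_seq in Hp. exists p. split; auto; lia. }
assert (Ll : length l2 = n - 2) by (unfold l2; rewrite length_map, length_seq; auto).
rewrite E1, E2. apply D_swap.
- intros k z m E. apply (round_zero q _ 0); auto; [lia| |].
 + destruct k as [|? [|]]; [|easy|easy]. injection E as _ <-. simpl. lia.
 + destruct k as [|? [|]]; [|easy|easy]. injection E as _ <-. simpl.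
  intros v [<-|[<-|[<-|Hv]]]; try (eexists; split; [|split; [|reflexivity]]; lia).
  destruct (H2 v Hv) as (p & Hp & ->). exists p. repeat split; lia.
- intros k z m E. assert (Hz : In z l2) by (rewrite E; apply in_or_app; right; left; auto).
 destruct (H2 z Hz) as (r & Hr & ->). rewrite E in Ll. rewrite length_app in Ll. simpl in Ll.
 apply (round_zero q _ r); auto; [lia| |].
 + simpl. rewrite length_app. lia.
 + intros v [<-|[<-|[<-|[<-|Hv]]]]; try (eexists; split; [|split; [|reflexivity]]; lia).
  assert (Nd : NoDup (k ++ (r, 0) :: m)).
  { rewrite <- E. apply NoDup_map_NoDup_ForallPairs; [intros u w _ _ Eq; injection Eq; auto|apply seq_NoDup]. }
  pose proof (removed _ _ _ Nd v Hv) as Nv.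
  assert (Hl : In v l2) by (rewrite E; apply in_app_or in Hv as [Hv|Hv]; apply in_or_app; simpl; auto).
  destruct (H2 v Hl) as (p & Hp & ->). exists p. repeat split; [lia|congruence].
- apply (round_zero q _ 1); auto; [lia|simpl; lia|].
 intros v [<-|[<-|[<-|Hv]]]; try (eexists; split; [|split; [|reflexivity]]; lia).
 destruct (H2 v Hv) as (p & Hp & ->). exists p. repeat split; lia.
Qed.

Definition round (p : list nat) : list nat := ((p ++ [wK (0, 1%nat)]) ++ [wK (0, 2)]) ++ [wK (0, 0)].
Lemma stage_turn_all a : a <= 1 -> stage n a (S n) all = stage n (S a) 0 all.
Proof.
intros Ha. unfold stage, lower, upper. rewrite Nat.sub_diag, Nat.sub_0_r.
rewrite !(forallb_filter_id all) by (apply forallb_forall; auto). change (seq (S n) 0) with (@nil nat).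
change (map (fun q => (q, a)) []) with (@nil (nat * nat)). rewrite app_nil_r.
change (seq 0 0) with (@nil nat). apply map_ext. intros q. destruct a as [|[|a]]; auto; lia.
Qed.
(** One turn around the tube: the path is prolonged in three steps, the fibre is moved through three
    prisms, the weighted cell is crossed once, and the final exchange reverses the sign. This is the
    operator [1 + t] written as a recursion. *)
Lemma round_spec p : edge_path K (base K) (wK (0, 0)) p ->
 edge_path K (base K) (wK (0, 0)) (round p) /\ wp lK (round p) = wp lK p ** g /\
 D (lift (round p)) (stage n 0 0 all) = ((-1) ^ (n - 1) * parity (wp lK p) - D (lift p) (stage n 0 0 all))%R.
Proof.
intros Hp. destruct (rebase 0 p ltac:(lia) Hp) as [P1 R1]. destruct (rebase 1 _ ltac:(lia) P1) as [P2 R2].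
destruct (rebase 2 _ ltac:(lia) P2) as [P3 R3]. simpl shift in *.
assert (W1 : wp lK (p ++ [wK (0, 1%nat)]) = wp lK p).
{ rewrite (wp_snoc K K_wf lK (base K) _ _ _ Hp), lK_w. simpl snd. rewrite L01. apply gone_r. }
split; [exact P3|split].
- unfold round. rewrite (wp_snoc K K_wf lK (base K) _ _ _ P2), (wp_snoc K K_wf lK (base K) _ _ _ P1), W1, !lK_w.
 simpl snd. unfold g. rewrite L01, gone_l, gassoc. auto.
- pose proof (final_swap _ P3) as S. fold (round p) in *. rewrite moves in S by (auto; lia).
 rewrite R3, <- (stage_turn_all 1), moves, R2, <- (stage_turn_all 0), first_moves, R1, W1 in S by (auto; lia). lra.
Qed.

(** The recursion is solved by [(-1)^k Z k = Z 0 - k (-1)^(n-1)], whereas boundedness of [b] on the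
    orbits of the finitely many faces of one fibre bounds all [Z k] at once. *)
Lemma filling_absurd : cochain_bdd K (n - 1) b -> False.
Proof.
intros Bb. set (rk := fun k => Nat.iter k round [wK (0, 0)]). set (Z := fun k => D (lift (rk k)) (stage n 0 0 all)).
assert (Hk : forall k, edge_path K (base K) (wK (0, 0)) (rk k) /\ wp lK (rk k) = gpow g k /\
 ((-1) ^ k * Z k = Z 0%nat - INR k * (-1) ^ (n - 1))%R).
{ induction k as [|k (H1 & H2 & H3)].
 - split; [|split]; auto; [|unfold Z; simpl; lra]. apply ep_one, (vertex_cx enc o L Tb Inj Tb_closed Tb_o HP), Tb_o.
 - destruct (round_spec (rk k) H1) as (E1 & E2 & E3). change (rk (S k)) with (round (rk k)). split; [|split]; auto.
  + rewrite E2, H2. clear. induction k as [|k IH]; [simpl; rewrite gone_l, gone_r; auto|].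
   change (gpow g (S k)) with (g ** gpow g k). rewrite gassoc, IH. auto.
  + unfold Z at 1. change (rk (S k)) with (round (rk k)). rewrite E3, H2, parity_pow. fold (Z k).
   rewrite S_INR. replace ((-1) ^ S k * ((-1) ^ (n - 1) * (-1) ^ k - Z k))%R with
    ((-1) ^ k * Z k - (-1) ^ (n - 1) * ((-1) ^ k * (-1) ^ k))%R by (simpl; ring).
   rewrite H3, <- Rpow_mult_distr. replace (-1 * -1)%R with 1%R by ring. rewrite pow1. ring. }
destruct (D_bounded (fun k => lift (rk k)) (stage n 0 0 all)) as [B HB].
{ intros t I Lt. unfold stage in Lt. rewrite length_app, lower_length, upper_length in Lt.
 destruct t as [|x t]; [simpl in Lt; lia|]. pose proof (face_simplex 0 _ ltac:(lia) I ltac:(simpl in *; lia)) as Os.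
 destruct (Bb _ Os) as [C HC]. exists C. intros k. apply HC. split; auto.
 destruct (stage_start 0 x (I x (or_introl eq_refl))) as (p & Hp & ->). eapply ep_snoc; [apply (Hk k)|].
 apply (prism_edge 0 0); auto; try lia; right; eexists; (split; [|reflexivity]); lia. }
destruct (INR_unbounded (2 * B)) as [k Kk]. destruct (Hk k) as (_ & _ & E).
pose proof (HB 0%nat) as B0. pose proof (HB k) as Bk. fold (Z 0%nat) in B0. fold (Z k) in Bk.
assert (E' : (INR k = Rabs (Z 0%nat - (-1) ^ k * Z k))%R).
{ rewrite E. replace (Z 0%nat - (Z 0%nat - INR k * (-1) ^ (n - 1)))%R with (INR k * (-1) ^ (n - 1))%R by ring.
 rewrite Rabs_mult, pow_1_abs, Rmult_1_r. symmetry. apply Rabs_pos_eq, pos_INR. }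
pose proof (Rabs_triang (Z 0%nat) (- ((-1) ^ k * Z k))) as T. rewrite Rabs_Ropp, Rabs_mult, pow_1_abs in T.
unfold Rminus in E'. lra.
Qed.
End Filling.

Theorem tube_nonvanishing : ~ linf_vanishes K n.
Proof.
intros Van. destruct (Van tcoc tcoc_bcochain tcoc_closed) as (b & [Wb Bb] & Hb). apply (filling_absurd b Wb Hb Bb).
Qed.
End Twisted.
End TubeOn.

(** * A code for the reduction *)

Lemma eval_comp1 c g args x y : eval g args x -> eval c [x] y -> eval (CComp c [g]) args y.
Proof. intros Hg Hc. econstructor; [|exact Hc]. repeat constructor; auto. Qed.
Lemma eval_comp2 c g h args x y z : eval g args x -> eval h args y -> eval c [x; y] z -> eval (CComp c [g; h]) args z.
Proof. intros Hg Hh Hc. econstructor; [|exact Hc]. repeat constructor; auto. Qed.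

Definition csucc (c : Code) : Code := CComp CSucc [c].
Lemma eval_csucc c args x : eval c args x -> eval (csucc c) args (S x).
Proof. intros H. eapply eval_comp1; [exact H|apply (ev_succ [x])]. Qed.
Fixpoint cconst (k : nat) : Code := match k with 0 => CZero | S k => csucc (cconst k) end.
Lemma eval_cconst k args : eval (cconst k) args k.
Proof. induction k; [constructor|apply eval_csucc, IHk]. Qed.

Definition add_code : Code := CRec (CProj 0) (csucc (CProj 1)).
Lemma add_code_spec x y : eval add_code [x; y] (x + y).
Proof.
induction x as [|x IH]; [constructor; apply (ev_proj 0 [y])|].
econstructor; [exact IH|]. apply eval_csucc, (ev_proj 1 [_; _; _]).
Qed.
Definition cadd (c c' : Code) : Code := CComp add_code [c; c'].
Lemma eval_cadd c c' args x y : eval c args x -> eval c' args y -> eval (cadd c c') args (x + y).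
Proof. intros. eapply eval_comp2; eauto using add_code_spec. Qed.
Definition mul_code : Code := CRec CZero (cadd (CProj 1) (CProj 2)).
Lemma mul_code_spec x y : eval mul_code [x; y] (x * y).
Proof.
induction x as [|x IH]; [repeat constructor|]. econstructor; [exact IH|]. rewrite Nat.mul_succ_l.
apply eval_cadd; [apply (ev_proj 1 [_; _; _])|apply (ev_proj 2 [_; _; _])].
Qed.
Definition cmul (c c' : Code) : Code := CComp mul_code [c; c'].
Definition tri_code : Code := CRec CZero (cadd (CProj 1) (csucc (CProj 0))).
Lemma tri_code_spec x : eval tri_code [x] (x * S x / 2).
Proof.
induction x as [|x IH]; [repeat constructor|]. econstructor; [exact IH|].
replace (S x * S (S x) / 2) with (x * S x / 2 + S x).
- apply eval_cadd; [apply (ev_proj 1 [_; _])|apply eval_csucc, (ev_proj 0 [_; _])].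
- rewrite <- Nat.div_add by lia. f_equal. lia.
Qed.
Definition cpair_code (c c' : Code) : Code := csucc (cadd (CComp tri_code [cadd c c']) c').
Lemma eval_cpair c c' args x y : eval c args x -> eval c' args y -> eval (cpair_code c c') args (S (cpair x y)).
Proof.
intros. apply eval_csucc, eval_cadd; auto. eapply eval_comp1; [apply eval_cadd; eauto|apply tri_code_spec].
Qed.
Definition pow_code : Code := CRec CZero (csucc (cadd (CProj 1) (CProj 1))).
Lemma pow_code_spec x : eval pow_code [x] (2 ^ x - 1).
Proof.
induction x as [|x IH]; [repeat constructor|]. econstructor; [exact IH|].
replace (2 ^ S x - 1) with (S (2 ^ x - 1 + (2 ^ x - 1))) by (pose proof (Nat.pow_nonzero 2 x); simpl; lia).
apply eval_csucc, eval_cadd; apply (ev_proj 1 [_; _]).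
Qed.

Definition affine (i : nat) (p : nat * nat) : nat := fst p * i + snd p.
Fixpoint list_code (i : Code) (l : list (nat * nat)) : Code :=
 match l with [] => CZero | p :: l => cpair_code (cadd (cmul (cconst (fst p)) i) (cconst (snd p))) (list_code i l) end.
Fixpoint prefix_code (i : Code) (t : list (list (nat * nat))) (c : Code) : Code :=
 match t with [] => c | l :: t => cpair_code (list_code i l) (prefix_code i t c) end.
(** In a template a vertex is a pair of slope and intercept. The stages appear in decreasing order
    because the recursion puts each new stage in front of the list. *)
Definition assemble (b : nat) (cl st : list (list (nat * nat))) (N : nat) (fx : list (list nat)) : list (list nat) :=
 [b] :: map (map (affine N)) cl ++ flat_map (fun i => map (map (affine i)) st) (rev (seq 0 N)) ++ fx.

Definition stages_code (st : list (list (nat * nat))) : Code := CRec (CProj 0) (prefix_code (CProj 0) st (CProj 1)).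
Lemma prefix_eval i t c args k B : eval i args k -> eval c args (code_complex B) ->
 eval (prefix_code i t c) args (code_complex (map (map (affine k)) t ++ B)).
Proof.
intros Hi Hc. induction t as [|l t IH]; auto. apply eval_cpair; auto. clear IH.
induction l as [|p l IH]; [constructor|]. apply eval_cpair; auto.
apply eval_cadd; [|apply eval_cconst]. eapply eval_comp2; eauto using eval_cconst, mul_code_spec.
Qed.
Lemma stages_code_spec st N fx : eval (stages_code st) [N; code_complex fx]
 (code_complex (flat_map (fun i => map (map (affine i)) st) (rev (seq 0 N)) ++ fx)).
Proof.
induction N as [|N IH]; [constructor; apply (ev_proj 0 [code_complex fx])|].
econstructor; [exact IH|]. rewrite seq_S, rev_app_distr. simpl. rewrite <- app_assoc.
apply prefix_eval; [apply (ev_proj 0)|apply (ev_proj 1 [_; _; _])].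
Qed.

(** The input serves twice: as the tail of the list to be built and, read as a number, as the source
    of the number of stages. *)
Theorem assemble_code b cl st : exists Phi, forall fx,
 eval Phi [code_complex fx] (code_complex (assemble b cl st (2 ^ code_complex fx - 1) fx)).
Proof.
exists (prefix_code CZero [[(0, b)]] (prefix_code (CComp pow_code [CProj 0]) cl
 (CComp (stages_code st) [CComp pow_code [CProj 0]; CProj 0]))).
intros fx. set (k := code_complex fx).
assert (Hk : eval (CProj 0) [k] k) by apply (ev_proj 0 [k]).
assert (Hp : eval (CComp pow_code [CProj 0]) [k] (2 ^ k - 1)) by (eapply eval_comp1; eauto using pow_code_spec).
apply (prefix_eval CZero [[(0, b)]] _ [k] 0); [constructor|]. apply prefix_eval; auto.
eapply eval_comp2; eauto using stages_code_spec.
Qed.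

(** * Vertex numbers *)

(** An injection that is affine in [b] for fixed [a], unlike the pairing [cpair]; vertex numbers
    have to be affine in the stage. *)
Definition pr (a b : nat) : nat := 2 ^ a * (2 * b + 1).
Lemma pr_inj a b a' b' : pr a b = pr a' b' -> a = a' /\ b = b'.
Proof.
unfold pr. revert a'. induction a as [|a IH]; intros [|a'] E; simpl in E; try lia.
destruct (IH a'); [simpl; lia|]. lia.
Qed.
Fixpoint gcode (g : gen) : nat :=
 match g with
 | GX i => pr 0 i | GT q => pr 1 q | GR j => pr 2 j | GC i => pr 3 i | GG j => pr 4 j
 | GE s => pr 5 (gcode s) | GK => pr 6 0 | GY => pr 7 0 | GZ => pr 8 0
 end.
Definition rcode (r : rel) : nat :=
 match r with
 | RK1 s => pr 0 (gcode s) | RK2 s => pr 1 (gcode s) | RM j => pr 2 j | RC0 => pr 3 0 | RC i => pr 4 i | RV => pr 5 0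
 end.
Lemma gcode_inj g g' : gcode g = gcode g' -> g = g'.
Proof.
revert g'. induction g; intros [] E; simpl in E; apply pr_inj in E as [E1 E2]; try easy; try congruence.
f_equal. auto.
Qed.
Lemma rcode_inj r r' : rcode r = rcode r' -> r = r'.
Proof.
destruct r, r'; intros E; simpl in E; apply pr_inj in E as [E1 E2]; try easy; try congruence;
 apply gcode_inj in E2; congruence.
Qed.

(* The vertices that depend on [i] have to be numbered by linear functions of [i]. *)
Fixpoint vcode (v : vx) : nat :=
 match v with
 | Lp (GC i) b => pr (if b then 2 else 1) i
 | Ct (RC i) => pr 3 i
 | Rg (RC i) k => pr (4 + k) i
 | Base => pr 0 (pr 0 0)
 | Lp g b => pr 0 (pr 1 (pr (if b then 1 else 0) (gcode g)))
 | Rg r k => pr 0 (pr 2 (pr k (rcode r)))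
 | Ct r => pr 0 (pr 3 (rcode r))
 | Pr j b w => pr 0 (pr 4 (pr j (pr (if b then 1 else 0) (vcode w))))
 | Bs i => pr 0 (pr 5 i)
 | Nv k l => pr 0 (pr 6 (pr k l))
 end.
Definition slope (v : vx) : nat :=
 match v with
 | Lp (GC _) b => 2 ^ (if b then 3 else 2) | Ct (RC _) => 2 ^ 4 | Rg (RC _) k => 2 ^ (5 + k) | _ => 0
 end.
Definition sh (i : nat) (v : vx) : vx :=
 match v with
 | Lp (GC k) b => Lp (GC (k + i)) b | Ct (RC k) => Ct (RC (k + i)) | Rg (RC k) c => Rg (RC (k + i)) c | _ => v
 end.
Lemma vcode_inj u v : vcode u = vcode v -> u = v.
Proof.
assert (Hb : forall b b' : bool, (if b then 1%nat else 0) = (if b' then 1%nat else 0) -> b = b') by (intros [] [] E; congruence).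
assert (Hc : forall b b' : bool, (if b then 2 else 1%nat) = (if b' then 2 else 1%nat) -> b = b') by (intros [] [] E; congruence).
revert v. induction u; intros v E; destruct v; simpl in E;
 repeat match goal with
 | H : context [match ?g with GX _ => _ | _ => _ end] |- _ => destruct g
 | H : context [match ?r with RK1 _ => _ | _ => _ end] |- _ => destruct r
 | H : pr _ _ = pr _ _ |- _ => apply pr_inj in H as [? ?]
 | H : gcode _ = gcode _ |- _ => apply gcode_inj in H
 | H : rcode _ = rcode _ |- _ => apply rcode_inj in H
 | H : (if _ then 1%nat else 0) = (if _ then 1%nat else 0) |- _ => apply Hb in H
 | H : (if _ then 2 else 1%nat) = (if _ then 2 else 1%nat) |- _ => apply Hc in H
 end; try easy; try congruence; try (destruct b; easy); try (destruct b0; easy);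
 try (apply IHu in H2; congruence).
all: try (f_equal; auto; try congruence; f_equal; lia).
Qed.
Lemma vcode_shift i v : vcode (sh i v) = slope v * i + vcode v.
Proof.
destruct v; try reflexivity; [destruct g|destruct r|destruct r]; try reflexivity; simpl sh; unfold slope; simpl vcode;
 unfold pr; try destruct b; rewrite ?Nat.pow_add_r; cbn [Nat.pow]; lia.
Qed.
Definition vcode2 (x : vx * nat) : nat := pr (snd x) (vcode (fst x)).
Definition sh2 (i : nat) (x : vx * nat) : vx * nat := (sh i (fst x), snd x).
Definition slope2 (x : vx * nat) : nat := 2 ^ S (snd x) * slope (fst x).
Lemma vcode2_inj x y : vcode2 x = vcode2 y -> x = y.
Proof. intros E. apply pr_inj in E as [E1 E2]. apply vcode_inj in E2. destruct x, y; simpl in *; congruence. Qed.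
Lemma vcode2_shift i x : vcode2 (sh2 i x) = slope2 x * i + vcode2 x.
Proof. unfold vcode2, sh2, slope2, pr. simpl fst. simpl snd. rewrite vcode_shift. cbn [Nat.pow]. lia. Qed.

Section Family.
Context {V : Type}.
Definition family (s : nat -> V -> V) (cl st : list (list V)) (N : nat) (fx : list (list V)) : list (list V) :=
 map (map (s N)) cl ++ flat_map (fun i => map (map (s i)) st) (rev (seq 0 N)) ++ fx.
Lemma assemble_cx (enc slp : V -> nat) s o cl st N fx : (forall i v, enc (s i v) = slp v * i + enc v) ->
 let tmpl := map (map (fun v => (slp v, enc v))) in
 assemble (enc o) (tmpl cl) (tmpl st) N (map (map enc) fx) = cx enc o (family s cl st N fx).
Proof.
intros H tmpl. unfold assemble, cx, family. rewrite !map_app.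
assert (E : forall i l, map (map (affine i)) (tmpl l) = map (map enc) (map (map (s i)) l)).
{ intros i l. unfold tmpl. rewrite !map_map. apply map_ext. intros f. rewrite !map_map. apply map_ext. intros v.
 unfold affine. simpl. symmetry. apply H. }
rewrite E. do 2 f_equal. f_equal. induction (rev (seq 0 N)) as [|i l IH]; auto. simpl. rewrite map_app, E, IH. auto.
Qed.
End Family.
(** Taking faces or products with a sphere commutes with the shift of stages, so the templates of
    the final complexes arise by applying these operations to the templates of [X]. *)
Lemma family_op {V W : Type} (s : nat -> V -> V) (s' : nat -> W -> W) (op : list V -> list (list W)) cl st N fx :
 (forall i f, op (map (s i) f) = map (map (s' i)) (op f)) ->
 flat_map op (family s cl st N fx) = family s' (flat_map op cl) (flat_map op st) N (flat_map op fx).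
Proof.
intros H. assert (E : forall i l, flat_map op (map (map (s i)) l) = map (map (s' i)) (flat_map op l)).
{ intros i l. induction l as [|f l IH]; auto. simpl. rewrite H, IH, map_app. auto. }
unfold family. rewrite !flat_map_app, E. do 2 f_equal.
induction (rev (seq 0 N)) as [|i l IH]; auto. simpl. rewrite flat_map_app, E, IH. auto.
Qed.

Section Facets.
Variables (Rs : list rule) (d acc m : nat).
(** Stage [i] adds the letter [GC (S i)] and the relator defining it from [GC i]. Besides the stages
    only the relator [RV], which mentions [GC N], depends on [N]; it is the closing part. *)
Definition stage0 : list (list vx) := loop_facets (GC 1) ++ disc_facets (RC 0) (relw [] 0 0 0 (RC 0)).
Definition closing0 : list (list vx) := disc_facets RV (relw [] 0 0 0 RV).
Notation discs N l := (flat_map (fun r => disc_facets r (relw Rs d acc N r)) l).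
Notation product_rels := (map RM (seq 0 (length (machine_words Rs d acc)))).
Definition fixed_facets : list (list vx) :=
 bouquet (fixed_gens Rs d acc ++ [GC 0]) ++ discs 0 (kill_rels Rs d acc) ++
 flat_map (prod_facets Rs d acc 0) (seq 0 (nprod Rs d acc)) ++
 discs 0 (product_rels ++ [RC0]) ++ [big m].
Definition FX (N : nat) : list (list vx) := family sh closing0 stage0 N fixed_facets.

Lemma relw_N N r : r <> RV -> relw Rs d acc N r = relw Rs d acc 0 r.
Proof. destruct r; auto. congruence. Qed.
Lemma stage_shift i : map (map (sh i)) stage0 = loop_facets (GC (S i)) ++ disc_facets (RC i) (relw Rs d acc 0 (RC i)).
Proof. reflexivity. Qed.
Lemma closing_shift N : map (map (sh N)) closing0 = disc_facets RV (relw Rs d acc N RV).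
Proof. reflexivity. Qed.
Lemma fc_flat {A : Type} (g h : A -> list (list vx)) l : (forall x, In x l -> g x = h x) -> flat_map g l = flat_map h l.
Proof. induction l as [|x l IH]; intros H; simpl; auto. rewrite H, IH; auto; intros; [apply H; right|left]; auto. Qed.

Lemma X_facets N s : X Rs d acc N m s <-> fc (FX N) s.
Proof.
assert (EK : discs N (kill_rels Rs d acc) = discs 0 (kill_rels Rs d acc)).
{ apply fc_flat. intros r Hr. rewrite relw_N; auto. intros ->. apply in_app_or in Hr as [Hr|Hr]; apply in_map_iff in Hr as (? & E & _); easy. }
assert (EP : flat_map (prod_facets Rs d acc N) (seq 0 (nprod Rs d acc)) = flat_map (prod_facets Rs d acc 0) (seq 0 (nprod Rs d acc))).
{ apply fc_flat. intros j _. unfold prod_facets, Qf. rewrite EK. auto. }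
assert (EL : discs N (product_rels ++ [RC0]) =
  discs 0 (product_rels ++ [RC0])).
{ apply fc_flat. intros r Hr. rewrite relw_N; auto. intros ->. apply in_app_or in Hr as [Hr|[Hr|[]]]; [|easy].
 apply in_map_iff in Hr as (? & E & _); easy. }
assert (EF : fc (FX N) s <-> fc (disc_facets RV (relw Rs d acc N RV)) s \/
 (exists i, i < N /\ (fc (loop_facets (GC (S i))) s \/ fc (disc_facets (RC i) (relw Rs d acc N (RC i))) s)) \/ fc fixed_facets s).
{ unfold FX, family. rewrite !fc_app, closing_shift. apply or_iff_compat_l, or_iff_compat_r. split.
 - intros (f & Hf & I). apply in_flat_map in Hf as (i & Hi & Hf). apply in_rev, in_seq in Hi.
  rewrite stage_shift in Hf. exists i. split; [lia|]. apply in_app_or in Hf as [Hf|Hf]; [left|right]; exists f; auto.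
 - intros (i & Hi & [(f & Hf & I)|(f & Hf & I)]); exists f; (split; [|auto]); apply in_flat_map; exists i;
   (split; [apply in_rev; rewrite rev_involutive; apply in_seq; lia|]); rewrite stage_shift; apply in_or_app; auto. }
assert (EB : fc (bouquet (all_gens Rs d acc N)) s <-> fc (bouquet (fixed_gens Rs d acc ++ [GC 0])) s \/ exists i, i < N /\ fc (loop_facets (GC (S i))) s).
{ assert (E : bouquet (all_gens Rs d acc N) = bouquet (fixed_gens Rs d acc ++ [GC 0]) ++ flat_map (fun i => loop_facets (GC (S i))) (seq 0 N)).
 { unfold all_gens, bouquet. replace (seq 0 (S N)) with (0 :: map S (seq 0 N)) by (rewrite seq_shift; auto).
  rewrite !flat_map_app, <- app_assoc. f_equal. cbn [map flat_map]. rewrite app_nil_r. f_equal.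
  induction (seq 0 N) as [|i l IH]; auto. cbn [map flat_map]. rewrite IH. auto. }
 rewrite E, fc_app. apply or_iff_compat_l. split.
 - intros (f & Hf & I). apply in_flat_map in Hf as (i & Hi & Hf). apply in_seq in Hi.
  exists i. split; [lia|]. exists f; auto.
 - intros (i & Hi & f & Hf & I). exists f. split; auto. apply in_flat_map. exists i. rewrite in_seq. split; auto. lia. }
assert (ED : fc (discs N (late_rels Rs d acc N)) s <->
  fc (discs 0 (product_rels ++ [RC0])) s \/
  (exists i, i < N /\ fc (disc_facets (RC i) (relw Rs d acc N (RC i))) s) \/ fc (disc_facets RV (relw Rs d acc N RV)) s).
{ unfold late_rels. replace (product_rels ++ RC0 :: map RC (seq 0 N) ++ [RV]) with
  ((product_rels ++ [RC0]) ++ map RC (seq 0 N) ++ [RV]) by (rewrite <- app_assoc; auto).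
 rewrite flat_map_app, (flat_map_app _ (map RC (seq 0 N))), !fc_app, EL. apply or_iff_compat_l.
 assert (E1 : forall r, discs N [r] = disc_facets r (relw Rs d acc N r))
  by (intros; apply app_nil_r).
 rewrite E1. apply or_iff_compat_r. split.
 - intros (f & Hf & I). apply in_flat_map in Hf as (g & Hg & Hf). apply in_map_iff in Hg as (i & <- & Hi). apply in_seq in Hi.
  exists i. split; [lia|]. exists f; auto.
 - intros (i & Hi & f & Hf & I). exists f. split; auto. apply in_flat_map. exists (RC i). split; auto.
  apply in_map, in_seq. lia. }
assert (EG : incl s (big m) <-> fc [big m] s).
{ split; [intros I; exists (big m); split; auto; left; auto|]. intros (f & [<-|[]] & I). auto. }
rewrite EF. unfold X, P3, attach, P2, P1, attach. rewrite ED, EB, EK, EP, EG. unfold fixed_facets. rewrite !fc_app.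
rewrite !flat_map_app, !fc_app. split.
- intros [[[[[H|H]|H]|H]|[[H|H]|[H|H]]]|H]; try tauto.
 + destruct H as (i & Hi & H). right; left. exists i. auto.
 + destruct H as (i & Hi & H). right; left. exists i. auto.
- intros [H|[(i & Hi & [H|H])|H]]; try tauto.
 + left; left; left; left; right. exists i. auto.
 + left; right; right; left. exists i. auto.
Qed.
End Facets.

(** * The three families of complexes *)

(** A change of gauge at [c1] moves the label of the loop to its last two edges. Pairs [(u, u)] get
    label 1 also where [u] is not a vertex, which saves side conditions later. *)
Lemma normal_label {V : Type} {M : group} (X : list V -> Prop) (l : V -> V -> M) c0 c1 c2 : closed X -> flat_lab X l ->
 X [c0; c1] -> X [c1; c2] -> X [c2; c0] -> c0 <> c1 -> c1 <> c2 -> c2 <> c0 ->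
 exists l' : V -> V -> M, flat_lab X l' /\ (forall u, l' u u = 1) /\ l' c0 c1 = 1 /\
  l' c0 c1 ** (l' c1 c2 ** l' c2 c0) = l c0 c1 ** (l c1 c2 ** l c2 c0).
Proof.
intros CX Fl X1 X2 X3 N1 N2 N3.
set (h := fun v => if em (v = c1) then l c0 c1 else 1).
set (l' := fun u v => if em (u = v) then 1 else h u ** (l u v ** (h v)^-1)).
assert (H1 : h c1 = l c0 c1) by (unfold h; destruct (em _); tauto).
assert (H2 : forall v, v <> c1 -> h v = 1) by (intros v N; unfold h; destruct (em _); tauto).
assert (E : forall u v, u <> v -> l' u v = h u ** (l u v ** (h v)^-1)).
{ intros u v N. unfold l'. destruct (em _); tauto. }
assert (E' : forall u v, X [u; v] -> l' u v = h u ** (l u v ** (h v)^-1)).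
{ intros u v H. unfold l'. destruct (em (u = v)) as [<-|]; auto.
 rewrite (flat_refl X l CX Fl u) by (eapply CX; [exact H|subset]). gsimp. auto. }
exists l'. split; [|split; [|split]].
- intros u v w H. rewrite !E' by (eapply CX; [exact H|subset]). rewrite <- (Fl u v w H). gsimp. auto.
- intros u. unfold l'. destruct (em _); tauto.
- rewrite E, H1, H2 by auto. gsimp. auto.
- rewrite !E, H1, !H2 by auto. gsimp. auto.
Qed.

Lemma linked_skel {V : Type} k (P : list V -> Prop) o v : closed P -> 2 <= k -> linked P o v -> linked (skel k P) o v.
Proof. intros CP Hk H. induction H; [constructor|]. econstructor; eauto. apply skel_small; auto. Qed.
Lemma skel_ext {V : Type} k (P Q : list V -> Prop) s : (forall s, P s <-> Q s) -> (skel k P s <-> skel k Q s).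
Proof. intros E. split; intros (t & H & L); exists t; (split; [apply E, H|exact L]). Qed.
Lemma family_app {V : Type} (s : nat -> V -> V) cl st N fx z : family s cl st N fx ++ z = family s cl st N (fx ++ z).
Proof. unfold family. rewrite <- !app_assoc. auto. Qed.
Lemma cx_valid {V : Type} (enc : V -> nat) (o : V) L (P : list V -> Prop) m : (forall x y, enc x = enc y -> x = y) ->
 closed P -> P [o] -> (forall s, In s L -> s <> []) ->
 (forall s, s <> [] -> ((exists t, In t L /\ forall v, In v s <-> In v t) <-> P s)) ->
 (forall v, P [v] -> linked P o v) -> (exists t, P t /\ NoDup t /\ length t = S m) ->
 (forall t, P t -> exists t', incl t t' /\ length t' <= S m) -> valid_input m (cx enc o L).
Proof.
intros. split; [|split]; [eapply cx_wf|eapply cx_connected|eapply cx_has_dim]; eauto.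
Qed.

Section Instances.
Variables (Rs : list rule) (d acc : nat).
Hypotheses (Hd : 0 < d) (Wf : forall r, In r Rs -> rule_wf d r /\ r_src r <> acc) (Det : deterministic Rs).
Let Wf' : forall r, In r Rs -> rule_wf d r := fun r Hr => proj1 (Wf r Hr).
Let c1 := Lp (GT acc) false.
Let c2 := Lp (GT acc) true.
Notation Xc N m := (X Rs d acc N m).

Lemma X_loop N m : Xc N m [Base; c1] /\ Xc N m [c1; c2] /\ Xc N m [c2; Base].
Proof.
assert (H : In (GT acc) (all_gens Rs d acc N)) by (apply base_all, base_simple, Hd).
pose proof (bouquet_loop _ _ H) as L.
repeat split; left; left; left; left; apply L; [left|right; left|right; right; left]; auto.
Qed.
Lemma X_Base N m : Xc N m [Base].
Proof. apply (X_closed Rs d acc N m [Base; c1]); [apply X_loop|intros y [<-|[]]; left; auto]. Qed.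
Lemma X_no_Nv N m s v : Xc N m s -> In v s -> forall k l, v <> Nv k l.
Proof.
intros [H|H] Hv.
- apply (P3_vertex Rs d acc N Hd s v H Hv).
- intros k l ->. destruct (H _ Hv) as [E|E]; [easy|]. apply in_map_iff in E as (i & E & _). easy.
Qed.
Lemma X_normal N m : ~ halts Rs acc N -> exists (M : group) (l : vx -> vx -> M), flat_lab (Xc N m) l /\
 (forall u, l u u = 1) /\ l Base c1 = 1 /\ infinite_order (l Base c1 ** (l c1 c2 ** l c2 Base)).
Proof.
intros NH. destruct (X_holonomy Rs d acc N m Wf' Hd (fun r Hr => proj2 (Wf r Hr)) Det NH) as (M & l & Fl & Inf).
destruct (X_loop N m) as (X1 & X2 & X3).
destruct (normal_label (Xc N m) l Base c1 c2) as (l' & F & R & E1 & E2); auto using X_closed; try easy.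
exists M, l'. repeat split; auto. rewrite E2. exact Inf.
Qed.
Lemma big_simplex m : NoDup (big m) /\ length (big m) = S m.
Proof.
unfold big. split; [|simpl; rewrite length_map, length_seq; auto]. constructor.
- intros H. apply in_map_iff in H as (i & E & _). easy.
- apply NoDup_map_NoDup_ForallPairs; [intros a b _ _ E; congruence|apply seq_NoDup].
Qed.

Definition solves (n m N : nat) (K : list (list nat)) : Prop :=
 valid_input m K /\ (halts Rs acc N -> linf_vanishes K n) /\ (~ halts Rs acc N -> ~ linf_vanishes K n).

Lemma instance_1 m N : 1 < m -> solves 1 m N (cx vcode Base (flat_map (faces (S m)) (FX Rs d acc m N))).
Proof.
intros Hm. set (XN := Xc N m). set (L := flat_map (faces (S m)) (FX Rs d acc m N)).
assert (CX : closed XN) by apply X_closed.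
assert (HP : forall s, s <> [] -> ((exists t, In t L /\ forall v, In v s <-> In v t) <-> skel (S m) XN s)).
{ intros s Ns. unfold L. rewrite faces_skel by auto. apply skel_ext. intros t. symmetry. apply X_facets. }
assert (NL : forall s, In s L -> s <> []) by (intros s; apply faces_nonempty).
assert (Po : skel (S m) XN [Base]) by (apply skel_small; [auto|simpl; lia|apply X_Base]).
assert (Lk : forall v, skel (S m) XN [v] -> linked (skel (S m) XN) Base v).
{ intros v Hv. apply linked_skel; [auto|lia|]. apply X_linked; auto. eapply skel_sub; eauto. }
assert (CS := skel_closed (S m) XN).
split; [|split].
- apply (cx_valid vcode Base L (skel (S m) XN)); auto using vcode_inj.
 + exists (big m). destruct (big_simplex m) as [Nb Lb]. split; [|auto]. apply skel_small; [auto|lia|]. right. apply incl_refl.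
 + intros t (t' & _ & Lt & I). eauto.
- intros Run. apply (cx_vanishing vcode Base L (skel (S m) XN)); auto using vcode_inj.
 + intros M l Fl. apply skel_flat in Fl; [|auto|lia]. destruct (X_trivial Rs d acc N m Wf' Hd M l Run Fl) as [h Hh].
  exists h. intros u v H. apply Hh. eapply skel_sub; eauto.
 + apply skel_Hv; [auto|lia|]. apply Hv_X_halts; auto.
- intros NH. destruct (X_normal N m NH) as (M & l & Fl & Lu & _ & Inf).
 assert (FlS : flat_lab (skel (S m) XN) l) by (apply skel_flat; [auto|lia|auto]).
 assert (WFK := cx_wf vcode Base L (skel (S m) XN) vcode_inj CS Po NL HP).
 destruct (X_loop N m) as (X1 & X2 & X3).
 assert (Ed : forall u v, XN [u; v] -> is_simplex (cx vcode Base L) [vcode u; vcode v]).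
 { intros u v H. apply (edge_cx vcode Base L (skel (S m) XN) vcode_inj CS Po HP). apply skel_small; [auto|simpl; lia|auto]. }
 apply (h1_nonvanishing _ WFK M _ (label_cx vcode Base L (skel (S m) XN) vcode_inj CS Po HP M l FlS) (fun u => Lu _)
  (map vcode [Base; c1; c2; Base])).
 + change (map vcode [Base; c1; c2; Base]) with ((([vcode Base] ++ [vcode c1]) ++ [vcode c2]) ++ [vcode Base]).
  eapply ep_snoc; [eapply ep_snoc; [eapply ep_snoc; [apply ep_one|]|]|]; eauto.
  apply (vertex_cx vcode Base L (skel (S m) XN) vcode_inj CS Po HP), Po.
 + cbn [map wp]. rewrite !(dec_enc vcode Base vcode_inj), gone_r. exact Inf.
Qed.

Definition op_sphere (n : nat) (f : list vx) : list (list (vx * nat)) := map (list_prod f) (sphere_facets n).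
Definition FY (n m N : nat) : list (list (vx * nat)) := flat_map (op_sphere n) (FX Rs d acc m N) ++ [fibre n Base].
Lemma Y_facets n m N s : Y (Xc N m) Base n s <-> fc (FY n m N) s.
Proof.
unfold FY. rewrite fc_app. unfold Y. apply Morphisms_Prop.or_iff_morphism.
- unfold prodc. rewrite X_facets. split.
 + intros [(f & Hf & I) (g & Hg & J)]. exists (list_prod f g). split.
  * apply in_flat_map. exists f. split; auto. apply in_map, Hg.
  * intros [v i] Hv. apply in_prod; [apply I; apply (in_map fst _ _ Hv)|apply J; apply (in_map snd _ _ Hv)].
 + intros (h & Hh & I). apply in_flat_map in Hh as (f & Hf & Hh). apply in_map_iff in Hh as (g & <- & Hg).
  split; [exists f|exists g]; (split; [auto|]); intros y Hy; apply in_map_iff in Hy as ([v i] & <- & Hv);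
   apply I, in_prod_iff in Hv; apply Hv.
- split; [intros I; exists (fibre n Base); split; auto; left; auto|]. intros (f & [<-|[]] & I). auto.
Qed.

Lemma instance_2 n m N : 2 <= n < m ->
 solves n m N (cx vcode2 (Base, 0) (flat_map (faces (S m)) (FY n m N))).
Proof.
intros Hnm. set (XN := Xc N m). set (YN := Y XN Base n). set (L := flat_map (faces (S m)) (FY n m N)).
assert (CX : closed XN) by apply X_closed. assert (Xo := X_Base N m). fold XN in Xo.
assert (CY : closed YN) by (apply Y_closed; auto).
assert (HP : forall s, s <> [] -> ((exists t, In t L /\ forall v, In v s <-> In v t) <-> skel (S m) YN s)).
{ intros s Ns. unfold L. rewrite faces_skel by auto. apply skel_ext. intros t. symmetry. apply Y_facets. }
assert (NL : forall s, In s L -> s <> []) by (intros s; apply faces_nonempty).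
assert (LX : forall v, XN [v] -> linked XN Base v) by (apply X_linked; auto).
assert (Po : skel (S m) YN [(Base, 0)]).
{ apply skel_small; [auto|simpl; lia|]. right. intros y [<-|[]]. apply in_map_iff. exists 0; split; [auto|apply in_seq; lia]. }
assert (Lk : forall v, skel (S m) YN [v] -> linked (skel (S m) YN) (Base, 0) v).
{ intros v Hv. apply linked_skel; [auto|lia|]. apply Y_linked; [auto|auto|lia|auto|]. eapply skel_sub; eauto. }
assert (CS := skel_closed (S m) YN).
split; [|split].
- apply (cx_valid vcode2 (Base, 0) L (skel (S m) YN)); auto using vcode2_inj.
 + exists (map (fun v => (v, 0)) (big m)). destruct (big_simplex m) as [Nb Lb]. split; [|split].
  * apply skel_small; [auto|rewrite length_map; lia|]. left. split; rewrite map_map; simpl.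
   -- rewrite map_id. right. apply incl_refl.
   -- apply (sphere_two n ltac:(lia) 0 0); try lia. intros j [<-|Hj]; auto. apply in_map_iff in Hj as (? & <- & _). auto.
  * apply NoDup_map_NoDup_ForallPairs; auto. intros a b _ _ E. congruence.
  * rewrite length_map. auto.
 + intros t (t' & _ & Lt & I). eauto.
- intros Run. replace n with (S (n - 1)) at 1 by lia.
 apply (cx_vanishing vcode2 (Base, 0) L (skel (S m) YN)); auto using vcode2_inj.
 + intros M l Fl. apply skel_flat in Fl; [|auto|lia].
  destruct (Y_trivial XN Base n CX ltac:(lia) M l LX) as [h Hh]; auto.
  { intros l0 Fl0. apply X_trivial; auto. }
  exists h. intros u v H. apply Hh. eapply skel_sub; eauto.
 + replace (S (n - 1)) with n by lia. apply skel_Hv; [auto|lia|]. apply Hv_Y; [auto|auto|lia|].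
  intros [|k] Hk; [lia|]. apply Hv_X_halts; auto.
- intros NH. destruct (X_normal N m NH) as (M & l & Fl & Lu & _ & Inf). destruct (X_loop N m) as (X1 & X2 & X3).
 set (e := fun v => vcode2 (v, 0)).
 apply (sphere_nonvanishing XN Base n CX Xo ltac:(lia) (S m) vcode2 L M l ltac:(lia) vcode2_inj NL HP Fl Lu
  ((([e Base] ++ [e c1]) ++ [e c2]) ++ [e Base])).
 + repeat (eapply level0_step; [|eassumption]). constructor.
 + unfold e. cbn [app wp]. rewrite !(dec_enc vcode2 (Base, 0) vcode2_inj). cbn [fst]. rewrite gone_r.
  intros E. apply (Inf 1%Z); [lia|]. rewrite zpow_1. exact E.
Qed.

(** The core of the tube, position 0 for [l <= 2], is identified with the triangle of the letter
    [T acc]; the remaining vertices are new. *)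
Definition tv (x : nat * nat) : vx :=
 match x with (0, 0) => Base | (0, 1) => c1 | (0, 2) => c2 | (k, l) => Nv k l end.
Definition tpos (v : vx) : nat * nat :=
 match v with Lp _ b => (0, if b then 2 else 1%nat) | Nv k l => (k, l) | _ => (0, 0) end.
Definition trho (v : vx) : vx := match v with Nv k l => tv (0, l) | _ => v end.
Lemma tpos_tv x : tpos (tv x) = x.
Proof. destruct x as [[|k] [|[|[|l]]]]; reflexivity. Qed.
Lemma trho_tv k l : trho (tv (k, l)) = tv (0, l).
Proof. destruct k as [|k], l as [|[|[|l]]]; reflexivity. Qed.

(** The bound 3 on vertices keeps the triangles, which decide triviality of labellings, and leaves
    the tube as the only part of dimension [n]; so the top cohomology is that of the cells of the
    tube. *)
Lemma instance_3 n N : 4 <= n ->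
 solves n n N (cx vcode Base (flat_map (faces 3) (FX Rs d acc n N) ++ flat_map (faces (S n)) (tube_facets n tv))).
Proof.
intros Hn. set (XN := Xc N n). set (X3 := skel 3 XN). set (T := tube_facets n tv).
set (L := flat_map (faces 3) (FX Rs d acc n N) ++ flat_map (faces (S n)) T).
assert (CX0 : closed XN) by apply X_closed. assert (CX : closed X3) by apply skel_closed.
assert (Sm : forall s, length s <= 3 -> (X3 s <-> XN s)) by (intros s; apply skel_small; auto).
assert (Small : forall s, X3 s -> exists t, length t <= 3 /\ incl s t) by (intros s (t & _ & Lt & I); eauto).
assert (Loop : forall l, l <= 2 -> X3 [tv (0, l); tv (shift 0 (S l))]).
{ destruct (X_loop N n) as (X1 & X2 & X4). intros l Hl. apply Sm; [simpl; lia|].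
 destruct l as [|[|[|l]]]; auto; lia. }
assert (Fresh : forall s v, X3 s -> In v s -> trho v = v /\ forall k l, 1 <= k -> v <> tv (k, l)).
{ intros s v Hs Hv. apply skel_sub in Hs; auto. pose proof (X_no_Nv N n s v Hs Hv) as Nn. split.
 - destruct v; auto. destruct (Nn k l); auto.
 - intros [|k] l Hk; [lia|]. apply Nn. }
set (P := Tb n X3 tv).
assert (LT : forall f, In f T -> length f = S n /\ NoDup f).
{ intros f Hf. apply in_map_iff in Hf as (c & <- & Hc). apply in_map_iff in Hc as ([[l j] k] & <- & Hi).
 apply (in_indices n Hn) in Hi. destruct Hi as (Hl & Hj & Hk & Nk). rewrite length_map. split; [apply cell_length; auto|].
 apply NoDup_map_NoDup_ForallPairs; [|apply cell_nodup; auto]. intros a b _ _ E. rewrite <- (tpos_tv a), E, tpos_tv. auto. }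
assert (EX : forall s, s <> [] -> ((exists t, In t (flat_map (faces 3) (FX Rs d acc n N)) /\ forall v, In v s <-> In v t) <-> X3 s)).
{ intros s Ns. rewrite faces_skel by auto. apply skel_ext. intros t. symmetry. apply X_facets. }
assert (HP : forall s, s <> [] -> ((exists t, In t L /\ forall v, In v s <-> In v t) <-> P s)).
{ intros s Ns. unfold P, Tb. fold T. rewrite <- EX by auto.
 assert (ET : (exists t, In t (flat_map (faces (S n)) T) /\ forall v, In v s <-> In v t) <-> fc T s).
 { rewrite faces_skel by auto. split; [intros H; eapply skel_sub; eauto using fc_closed|].
  intros (f & Hf & I). exists f. destruct (LT f Hf). repeat split; auto; [exists f; split; auto using incl_refl|lia]. }
 rewrite <- ET. split.
 - intros (t & Ht & E). apply in_app_or in Ht as [Ht|Ht]; [left|right]; eauto.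
 - intros [(t & Ht & E)|(t & Ht & E)]; exists t; (split; [apply in_or_app|]; auto). }
assert (NL : forall s, In s L -> s <> []) by (intros s Hs; apply in_app_or in Hs as [Hs|Hs]; eapply faces_nonempty; eauto).
assert (CP : closed P) by (apply or_closed; auto using fc_closed).
assert (Po : P [Base]) by (left; apply Sm; [simpl; lia|apply X_Base]).
assert (Lk : forall v, P [v] -> linked P Base v).
{ apply (Tb_linked n Hn X3 tv tpos CX tpos_tv Loop). intros v Hv. apply linked_skel; [auto|lia|].
 apply X_linked; auto. eapply skel_sub; eauto. }
split; [|split].
- apply (cx_valid vcode Base L P); auto using vcode_inj.
 + assert (Hi : In (map tv (cell n 0 0 n)) T).
  { apply in_map. apply (in_map (cellof n) _ (0, 0, n)). apply in_indices; auto. repeat split; lia. }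
  exists (map tv (cell n 0 0 n)). destruct (LT _ Hi). repeat split; auto. right. eexists; split; [exact Hi|apply incl_refl].
 + intros t [H|(f & Hf & I)].
  * destruct (Small t H) as (t' & L' & I). exists t'. split; auto; lia.
  * exists f. split; auto. destruct (LT f Hf). lia.
- intros Run. replace n with (S (n - 1)) at 1 by lia. apply (cx_vanishing vcode Base L P); auto using vcode_inj.
 + intros M l Fl. assert (F3 : flat_lab XN l).
  { apply (skel_flat 3); auto. intros u v w H. apply Fl. left. auto. }
  destruct (X_trivial Rs d acc N n Wf' Hd M l Run F3) as [h Hh].
  apply (Tb_trivial n Hn X3 tv tpos trho CX tpos_tv Loop Fresh M l h Fl).
  intros u v H. apply Hh. eapply skel_sub; eauto.
 + replace (S (n - 1)) with n by lia.
  apply Hv_ext with (P := fc (flat_map (faces 3) (FX Rs d acc n N) ++ T)); [|apply (tube_Hv n Hn tv tpos); [apply tpos_tv|]].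
  * intros s. rewrite fc_app. unfold P, Tb. fold T. destruct s as [|v s].
   -- assert (HN : fc T []).
     { exists (map tv (cell n 0 0 n)). split; [|intros y []]. apply in_map. apply (in_map (cellof n) _ (0, 0, n)).
      apply in_indices; auto. repeat split; lia. }
     tauto.
   -- apply or_iff_compat_r. rewrite <- EX by easy. split.
     ++ intros (t & Ht & I). apply EX; [easy|]. apply (CX t); auto. apply EX; [apply faces_nonempty in Ht; auto|].
      exists t. split; auto. tauto.
     ++ intros (t & Ht & E). exists t. split; auto. intros w Hw. apply E, Hw.
  * intros f Hf. apply in_flat_map in Hf as (g & _ & Hf). apply filter_In in Hf as [_ Hf].
   apply andb_true_iff in Hf as [_ Hf]. apply Nat.leb_le in Hf. lia.
- intros NH. destruct (X_normal N n NH) as (M & l & Fl & Lu & E1 & Inf).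
 apply (tube_nonvanishing n Hn X3 tv tpos trho CX Small tpos_tv Loop Fresh trho_tv vcode L M l); auto using vcode_inj.
 apply skel_flat; auto.
Qed.
End Instances.

(** The order of the quantifiers is essential: the templates [b], [cl], [st] precede the rule
    system, which is made from the code built on them. The rule system enters through [fx] only, and
    [fx] does not depend on [N]. *)
Theorem instances n m : (1 <= n /\ n < m \/ 4 <= n /\ n = m) ->
 exists b cl st, forall Rs d acc, 0 < d -> (forall r, In r Rs -> rule_wf d r /\ r_src r <> acc) -> deterministic Rs ->
  exists fx, forall N, solves Rs acc n m N (assemble b cl st N fx).
Proof.
intros H.
assert (S1 : forall i f, op_sphere n (map (sh i) f) = map (map (sh2 i)) (op_sphere n f)).
{ intros i f. unfold op_sphere. rewrite map_map. apply map_ext. intros g. induction f as [|v f IH]; auto.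
 simpl. rewrite map_app, IH. f_equal. rewrite map_map. auto. }
destruct H as [[H1 H2]|[H1 <-]]; [destruct (Nat.eq_dec n 1) as [->|Nn]|].
- do 3 eexists. intros Rs d acc Hd Wf Det. exists (map (map vcode) (flat_map (faces (S m)) (fixed_facets Rs d acc m))).
 intros N. pose proof (instance_1 Rs d acc Hd Wf Det m N H2) as I. unfold FX in I.
 rewrite (family_op sh sh) in I by (intros; apply faces_map).
 rewrite <- (assemble_cx vcode slope sh) in I by apply vcode_shift. exact I.
- do 3 eexists. intros Rs d acc Hd Wf Det.
 exists (map (map vcode2) (flat_map (faces (S m)) (flat_map (op_sphere n) (fixed_facets Rs d acc m) ++ [fibre n Base]))).
 intros N. pose proof (instance_2 Rs d acc Hd Wf Det n m N ltac:(lia)) as I. unfold FY, FX in I.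
 rewrite (family_op sh sh2 _ _ _ _ _ S1), family_app, (family_op sh2 sh2) in I by (intros; apply faces_map).
 rewrite <- (assemble_cx vcode2 slope2 sh2) in I by apply vcode2_shift. exact I.
- do 3 eexists. intros Rs d acc Hd Wf Det.
 exists (map (map vcode) (flat_map (faces 3) (fixed_facets Rs d acc n) ++ flat_map (faces (S n)) (tube_facets n (tv acc)))).
 intros N. pose proof (instance_3 Rs d acc Hd Wf Det n N H1) as I. unfold FX in I.
 rewrite (family_op sh sh) in I by (intros; apply faces_map). rewrite family_app in I.
 rewrite <- (assemble_cx vcode slope sh) in I by apply vcode_shift. exact I.
Qed.

Theorem mainTheorem18 (n m : nat) :
  ((1 <= n)%nat /\ (n < m)%nat \/ (4 <= n)%nat /\ n = m) ->
  ~ exists e : Code, forall K : list (list nat), valid_input m K ->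
      (linf_vanishes K n -> eval e [code_complex K] 1%nat) /\
      (~ linf_vanishes K n -> eval e [code_complex K] 0%nat).
Proof.
intros Hnm [e He].
destruct (instances n m Hnm) as (b & cl & st & I).
destruct (assemble_code b cl st) as [Phi HPhi].
destruct (affine_system (CComp e [Phi])) as (Rs & d & acc & Hd & Wf & Det & Run & NRun).
destruct (I Rs d acc Hd Wf Det) as [fx S].
set (k := code_complex fx). set (N := 2 ^ k - 1).
destruct (S N) as (Val & Halt & NHalt). specialize (HPhi fx). fold k in HPhi. fold N in HPhi.
set (K := assemble b cl st N fx) in *.
assert (E : forall y, eval e [code_complex K] y -> eval (CComp e [Phi]) [k] y).
{ intros y H. econstructor; [|exact H]. repeat constructor; auto. }
(* The number of stages and the encoding of the input [k] agree, so halting for [N] is the run of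
   the simulated computation on [k]. *)
assert (St : start k = (0, upd (fun _ => 0%Z) 0 (Z.of_nat N))).
{ unfold start, N. rewrite Nat2Z.inj_sub, Nat2Z.inj_pow by (apply Nat.lt_succ_r, Nat.lt_succ_r; simpl; pose proof (Nat.pow_nonzero 2 k); lia).
 reflexivity. }
destruct (He K Val) as [H1 H0].
(* If the cohomology vanishes, [e] answers 1, so the rules do not reach [acc]; but then it does not
   vanish. The converse answer is contradicted in the same way below. *)
assert (V : ~ linf_vanishes K n).
{ intros V. refine (NHalt _ V). unfold halts. rewrite <- St. apply NRun, E, H1, V. }
apply V, Halt. unfold halts. rewrite <- St. apply Run, E, H0, V.
Qed.
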